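(* Let $M_0\in\mathcal G(d,V_{\max},\tau_{\min})$ and let $y_1,\dots,y_N$ be obtained from $N$ i.i.d. noiseless uniform samples from $M_0$ as described in the context. For $\sigma$ sufficiently small and $N$ sufficiently large, the following holds with high probability. (1) $F:=-\log p_N(x)+\log N_f$ is an approximate squared-distance function, i.e. it meets conditions (i)–(iii) of the context. (2) Consider the output set $$\mathcal M_{\mathrm{put}}=\left\{z\in (M_0)_{\min(c_3,c_4)\sigma/\sqrt{2\pi}}\ :\ \Pi_{\mathrm{hi}}(z)\,\partial F(z)=0\right\}$$ in the original coordinate system (i.e. the coordinates not scaled by $1/\sigma$, where $\sigma$ is the bandwidth of the kernel density estimator). Then $\mathcal M_{\mathrm{put}}$ is a manifold whose reach is bounded below by $c\,\sigma$, where $c$ is a constant depending on $C_0,c_1,C_1,k,d$ and $n$. (3) $\mathcal M_{\mathrm{put}}$ converges to $M_0$ in Hausdorff distance for increasing $N$; more specifically, $H(M_0,\mathcal M_{\mathrm{put}})=O(\sigma^{5/4})$.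
   Context: $\mathcal G(d,V_{\max},\tau_{\min})$ is the family of compact boundaryless $C^2$ embedded $d$-dimensional submanifolds of the unit ball of $\mathbb R^n$ with $d$-dimensional volume at most $V_{\max}$ and reach at least $\tau_{\min}$. The reach of a set is the largest number $r$ such that all points within $r$ of it have a unique closest point on it. $H$ is the Hausdorff distance. $(M_0)_r$ is the set of points within distance $r$ of $M_0$. Scaling. Let $\tau,V$ be the reach and volume of $M_0$. For a bandwidth $\sigma>0$ put $\bar\tau:=\sigma^{5/6}$, $M:=M_0/(\sigma\sqrt{2\pi})$, $\hat{\bar\tau}:=\bar\tau/(\sigma\sqrt{2\pi})$, and $\hat V:=\mathrm{Vol}_d(M)$. The $y_i$ are i.i.d. uniform samples from $M_0$ divided by $\sigma\sqrt{2\pi}$, so they are uniform on $M$, and $$p_N(x):=\frac1N\sum_{i=1}^N e^{-\pi\|x-y_i\|^2}$$ (up to a constant factor, the Gaussian kernel density estimator with bandwidth $\sigma$ in rescaled coordinates). For $z$ the projection (nearest point) of $x$ on $M$, let $T_zM$ be the affine tangent space at $z$, $\Pi_z$ the orthogonal projection onto it, $U^z:=\{y:\|y-\Pi_z y\|\le\hat{\bar\tau},\ \|z-\Pi_z y\|\le\hat{\bar\tau}\}$, $\widetilde{\mathcal A}_z:=U^z\cap M$, $\mathcal A_z:=U^z\cap T_zM$, and $$N_f:=\frac{\mathrm{Vol}(\widetilde{\mathcal A}_z)}{\mathrm{Vol}(\mathcal A_z)\,\hat V},$$ which is treated as a constant. Approximate squared-distance function. The conditions on $F$, which is considered in the scaled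 coordinates, locally, on a ball $B$ about the origin of radius $1$ (or of a fixed radius not depending on the sample size, here $1/\sqrt{2\pi}$), with coordinates $(x,y)\in\mathbb R^d\times\mathbb R^{n-d}$ centred at a point of $M$ and $\mathbb R^d$ tangent to $M$ there, are: (i) $F$ is $C^k$-smooth on $B$; (ii) $\partial^\alpha F(x,y)\le C_0$ for $(x,y)\in B$ and $|\alpha|\le k$, where $\partial^\alpha$ denotes successive partial derivatives in $|\alpha|$ directions; (iii) $c_1(|y|^2+\rho^2)\le F(x,y)+\rho^2\le C_1(|y|^2+\rho^2)$ for $(x,y)\in B$, for $0<\rho<c$, where $c$ is an arbitrarily small constant depending only on $C_0,c_1,C_1,k,n$. $\partial F$ and $\partial^2F$ are the gradient and Hessian of $F$, and $\Pi_{\mathrm{hi}}(z)$ is the orthogonal projection of $\mathbb R^n$ onto the span of the eigenvectors of $\partial^2F(z)$ corresponding to its $n-d$ largest eigenvalues. $c_3,c_4$ are constants, depending only on $C_0,c_1,C_1,k,n$, which exist whenever (i)–(iii) hold and are such that, in the scaled local coordinates, $\{w\in B_d(0,c_4)\times B_{n-d}(0,c_3):\Pi_{\mathrm{hi}}(w)\partial F(w)=0\}$ is the graph of a $C^{k-2}$ map $B_d(0,c_4)\to B_{n-d}(0,c_3)$. *)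

(* Defs.v *)
(* The library norm on 'rV[R]_n is the sup norm: it provides the topology and
   the derivatives, but all metric notions below use the Euclidean norm. *)
From HB Require Import structures.
From mathcomp Require Import all_boot all_order all_algebra.
From mathcomp Require Import all_classical all_reals all_analysis.
Set Implicit Arguments.
Unset Strict Implicit.
Unset Printing Implicit Defensive.
Import Order.TTheory GRing.Theory Num.Theory.
Import numFieldNormedType.Exports.
Local Open Scope classical_set_scope.
Local Open Scope ring_scope.

Definition edot (R : realType) n (u v : 'rV[R]_n) : R :=
  \sum_(i < n) u 0 i * v 0 i.

Definition enorm (R : realType) n (u : 'rV[R]_n) : R := Num.sqrt (edot u u).

Definition eball (R : realType) n (r : R) : set 'rV[R]_n :=
  [set x | enorm x < r].

(* +oo when A is empty *)
Definition edist (R : realType) n (x : 'rV[R]_n) (A : set 'rV[R]_n) : \bar R :=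
  ereal_inf [set (enorm (x - a))%:E | a in A].

Definition tube (R : realType) n (A : set 'rV[R]_n) (r : R) : set 'rV[R]_n :=
  [set x | (edist x A <= r%:E)%E].

Definition nearest (R : realType) n (A : set 'rV[R]_n) (x q : 'rV[R]_n) : Prop :=
  A q /\ forall a, A a -> enorm (x - q) <= enorm (x - a).

Definition reach (R : realType) n (A : set 'rV[R]_n) : \bar R :=
  ereal_sup [set r%:E | r in
    [set r : R | 0 <= r /\ forall x, tube A r x -> exists! q, nearest A x q]].

Definition hausdorff_dist (R : realType) n (A B : set 'rV[R]_n) : \bar R :=
  Order.max (ereal_sup [set edist a B | a in A])
            (ereal_sup [set edist b A | b in B]).

(* Volume of the unit ball of R^d. *)
Fixpoint ball_vol (R : realType) (d : nat) : R :=
  match d with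
  | 0 => 1
  | 1 => 2
  | d'.+2 => 2 * pi / d'.+2%:R * ball_vol R d'
  end.

Definition diam (R : realType) n (E : set 'rV[R]_n) : R :=
  sup [set r | exists x y, [/\ E x, E y & r = enorm (x - y)]].

(* The case distinction only matters for d = 0. *)
Definition hausdorff_gauge (R : realType) n (d : nat) (E : set 'rV[R]_n) : R :=
  if E == set0 then 0 else ball_vol R d * (diam E / 2) ^+ d.

Definition hausdorff_content (R : realType) n (d : nat) (delta : R)
    (A : set 'rV[R]_n) : \bar R :=
  ereal_inf [set (\sum_(0 <= i <oo) (hausdorff_gauge d (E i))%:E)%E | E in
    [set E : nat -> set 'rV[R]_n | A `<=` \bigcup_i E i /\
      forall i x y, E i x -> E i y -> enorm (x - y) <= delta]].

(* The d-dimensional volume: the d-dimensional Hausdorff measure, normalized so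
   as to agree with Lebesgue measure on d-dimensional affine subspaces. *)
Definition hvol (R : realType) n (d : nat) (A : set 'rV[R]_n) : \bar R :=
  ereal_sup [set hausdorff_content d delta A | delta in [set delta : R | 0 < delta]].

(* C^k-smoothness on an open set U. *)
Fixpoint Ck (R : realType) p (W : normedModType R) (k : nat)
    (U : set 'rV[R]_p) (f : 'rV[R]_p -> W) : Prop :=
  (forall x, U x -> {for x, continuous f}) /\
  match k with
  | 0 => True
  | k'.+1 => forall v : 'rV[R]_p,
      (forall x, U x -> derivable f x v) /\ Ck k' U ('D_v f)
  end.

Definition iter_derive (R : realType) n (vs : seq 'rV[R]_n)
    (F : 'rV[R]_n -> R) : 'rV[R]_n -> R :=
  foldr (fun v (g : 'rV[R]_n -> R) => 'D_v g) F vs.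

Definition grad (R : realType) n (F : 'rV[R]_n -> R) (z : 'rV[R]_n) : 'rV[R]_n :=
  \row_i 'D_(delta_mx 0 i) F z.

Definition hess (R : realType) n (F : 'rV[R]_n -> R) (z : 'rV[R]_n) : 'M[R]_n :=
  \matrix_(i, j) iter_derive [:: delta_mx 0 i; delta_mx 0 j] F z.

(* A C^k embedded d-dimensional submanifold (without boundary) of R^(d+m):
   around each of its points there is a slice chart Phi, with inverse Psi. *)
Definition submanifold (R : realType) (d m k : nat)
    (M : set 'rV[R]_(d + m)) : Prop :=
  forall p, M p ->
  exists (U W : set 'rV[R]_(d + m)) (Phi Psi : 'rV[R]_(d + m) -> 'rV[R]_(d + m)),
    [/\ open U, open W & U p] /\
    [/\ forall x, U x -> W (Phi x) /\ Psi (Phi x) = x,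
        forall y, W y -> U (Psi y) /\ Phi (Psi y) = y,
        Ck k U Phi,
        Ck k W Psi &
        forall x, U x -> (M x <-> rsubmx (Phi x) = 0)].

Definition manifold_class (R : realType) (d m : nat) (Vmax tau_min : R)
    (M : set 'rV[R]_(d + m)) : Prop :=
  [/\ compact M, submanifold 2 M, (forall x, M x -> enorm x <= 1),
      (hvol d M <= Vmax%:E)%E & (tau_min%:E <= reach M)%E].

(* The linear tangent space: velocities at z of curves in M. *)
Definition tangent (R : realType) n (M : set 'rV[R]_n) (z : 'rV[R]_n) :
    set 'rV[R]_n :=
  [set v | exists gamma : R -> 'rV[R]_n,
    [/\ gamma 0 = z, \forall t \near (0 : R), M (gamma t) &
        is_derive (0 : R) (1 : R) gamma v]].

Definition affine_tangent (R : realType) n (M : set 'rV[R]_n) (z : 'rV[R]_n) :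
    set 'rV[R]_n :=
  [set p | tangent M z (p - z)].

(* p is the orthogonal projection of y on the affine tangent space at z. *)
Definition tangent_proj (R : realType) n (M : set 'rV[R]_n)
    (z y p : 'rV[R]_n) : Prop :=
  affine_tangent M z p /\ forall v, tangent M z v -> edot (y - p) v = 0.

Definition cylinder (R : realType) n (M : set 'rV[R]_n) (z : 'rV[R]_n)
    (t : R) : set 'rV[R]_n :=
  [set y | exists p,
    [/\ tangent_proj M z y p, enorm (y - p) <= t & enorm (z - p) <= t]].

Definition normalization (R : realType) n (d : nat) (M : set 'rV[R]_n) (t : R)
    (z : 'rV[R]_n) : R :=
  fine (hvol d (cylinder M z t `&` M)) /
  (fine (hvol d (cylinder M z t `&` affine_tangent M z)) * fine (hvol d M)).

Definition kde (R : realType) n (N : nat) (y : 'I_N -> 'rV[R]_n)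
    (x : 'rV[R]_n) : R :=
  N%:R^-1 * \sum_(i < N) expR (- pi * enorm (x - y i) ^+ 2).

Definition scale (R : realType) (sigma : R) : R := sigma * Num.sqrt (2 * pi).

Definition rescale_set (R : realType) n (sigma : R) (A : set 'rV[R]_n) :
    set 'rV[R]_n :=
  [set (scale sigma)^-1 *: a | a in A].

(* The function F in rescaled coordinates, for the samples X of M0.  The
   normalization is treated as a constant: it is frozen at a point z of the
   rescaled manifold. *)
Definition kde_asdf (R : realType) n (d : nat) (sigma : R) (M0 : set 'rV[R]_n)
    (N : nat) (X : 'I_N -> 'rV[R]_n) (z x : 'rV[R]_n) : R :=
  - ln (kde (fun i => (scale sigma)^-1 *: X i) x) +
  ln (normalization d (rescale_set sigma M0)
        (sigma `^ (5 / 6) / scale sigma) z).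

Definition local_radius (R : realType) : R := (Num.sqrt (2 * pi))^-1.

(* lsubmx w and rsubmx w are the tangential and normal coordinates of w.  The
   derivatives are along arbitrary unit directions; reversing one of them shows
   that the upper bound C0 also bounds their absolute value. *)
Definition asdf (R : realType) (d m k : nat) (C0 c1 C1 rho : R)
    (F : 'rV[R]_(d + m) -> R) : Prop :=
  [/\ Ck k (eball (local_radius R)) F,
      (forall (vs : seq 'rV[R]_(d + m)) w, (size vs <= k)%N ->
         (forall v, v \in vs -> enorm v = 1) ->
         eball (local_radius R) w -> iter_derive vs F w <= C0) &
      forall w, eball (local_radius R) w ->
        c1 * (enorm (rsubmx w) ^+ 2 + rho ^+ 2) <= F w + rho ^+ 2 /\
        F w + rho ^+ 2 <= C1 * (enorm (rsubmx w) ^+ 2 + rho ^+ 2)].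

(* The rows of Q are an orthonormal basis of eigenvectors of H, sorted by
   decreasing eigenvalue, and P is the orthogonal projection (acting on row
   vectors) onto the span of the first m of them. *)
Definition is_Pi_hi (R : realType) n (m : nat) (H P : 'M[R]_n) : Prop :=
  exists (Q : 'M[R]_n) (l : 'rV[R]_n),
    [/\ Q *m Q^T = 1%:M, Q *m H = diag_mx l *m Q,
        (forall i j : 'I_n, (i <= j)%N -> l 0 j <= l 0 i) &
        P = \sum_(i < n | (i < m)%N) (row i Q)^T *m row i Q].

(* Unique, hence independent of the choice, as soon as the m-th largest
   eigenvalue is greater than the next one. *)
Definition Pi_hi (R : realType) n (m : nat) (H : 'M[R]_n) : 'M[R]_n :=
  xget 0 [set P | is_Pi_hi m H P].

Definition hi_critical (R : realType) n (m : nat) (F : 'rV[R]_n -> R)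
    (z : 'rV[R]_n) : Prop :=
  grad F z *m Pi_hi m (hess F z) = 0.

(* The product B_d(0, c4) x B_m(0, c3) lies in the ball where F is controlled
   and, whatever the approximate squared-distance function F, the critical set
   of F in this product is the graph of a C^(k-2) map psi. *)
Definition graph_constants (R : realType) (d m k : nat)
    (C0 c1 C1 c c3 c4 : R) : Prop :=
  [/\ 0 < c, 0 < c3, 0 < c4,
      (forall (x : 'rV[R]_d) (y : 'rV[R]_m), eball c4 x -> eball c3 y ->
         eball (local_radius R) (row_mx x y)) &
      forall (rho : R) (F : 'rV[R]_(d + m) -> R),
        0 < rho < c -> asdf k C0 c1 C1 rho F ->
        exists psi : 'rV[R]_d -> 'rV[R]_m,
          [/\ Ck (k - 2) (eball c4) psi,
              (forall x, eball c4 x -> eball c3 (psi x)) &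
              forall x y, eball c4 x -> eball c3 y ->
                (hi_critical m F (row_mx x y) <-> y = psi x)]].

(* The rows of Q are an orthonormal basis of R^(d+m), the first d of which span
   the tangent space of M at q; w |-> q + w *m Q is then the passage from local
   coordinates centred at q to ambient ones. *)
Definition tangent_frame (R : realType) (d m : nat) (M : set 'rV[R]_(d + m))
    (q : 'rV[R]_(d + m)) (Q : 'M[R]_(d + m)) : Prop :=
  Q *m Q^T = 1%:M /\
  tangent M q = [set row_mx u 0 *m Q | u in [set: 'rV[R]_d]].

(* The normalization may be frozen at the projection z of any point x of the
   local ball around q. *)
Definition kde_is_asdf (R : realType) (d m k : nat) (C0 c1 C1 rho sigma : R)
    (M0 : set 'rV[R]_(d + m)) (N : nat) (X : 'I_N -> 'rV[R]_(d + m)) : Prop :=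
  forall q Q x z,
    rescale_set sigma M0 q -> tangent_frame (rescale_set sigma M0) q Q ->
    eball (local_radius R) (x - q) -> nearest (rescale_set sigma M0) x z ->
    asdf k C0 c1 C1 rho (fun w => kde_asdf d sigma M0 X z (q + w *m Q)).

(* The output set, with F transported to the original coordinates and its
   normalization frozen at the projection q of the rescaled point. *)
Definition M_put (R : realType) (d m : nat) (c3 c4 sigma : R)
    (M0 : set 'rV[R]_(d + m)) (N : nat) (X : 'I_N -> 'rV[R]_(d + m)) :
    set 'rV[R]_(d + m) :=
  [set z | tube M0 (Num.min c3 c4 * sigma / Num.sqrt (2 * pi)) z /\
    exists q, nearest (rescale_set sigma M0) ((scale sigma)^-1 *: z) q /\
      hi_critical m
        (fun x => kde_asdf d sigma M0 X q ((scale sigma)^-1 *: x)) z].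

Definition borel (R : realType) n : set (set 'rV[R]_n) :=
  <<s [set U : set 'rV[R]_n | open U] >>.

(* X_1, ..., X_N are independent and uniform on M0 with respect to the
   d-dimensional volume.  Taking some of the A i equal to setT gives the product
   rule for subfamilies. *)
Definition iid_uniform (R : realType) n (d : nat) (M0 : set 'rV[R]_n)
    (disp : measure_display) (T : measurableType disp) (P : probability T R)
    (N : nat) (X : 'I_N -> T -> 'rV[R]_n) : Prop :=
  [/\ forall i A, borel A -> measurable (X i @^-1` A),
      (forall i A, borel A ->
         P (X i @^-1` A) = (fine (hvol d (A `&` M0)) / fine (hvol d M0))%:E) &
      forall A : 'I_N -> set 'rV[R]_n, (forall i, borel (A i)) ->
        P [set w | forall i, A i (X i w)] =
        (\prod_(i < N) P (X i @^-1` A i))%E].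

(* Main.v *)
(* Write sigma = b ^ 6 and rescale by sigma * sqrt (2 pi): the reach of M is then
   of order b ^- 6.  A point of M within r << reach of a given one sees M as a
   graph over its tangent space, so balls of radius r have d-volume
   ball_vol d * r ^ d up to a small relative error.  With high probability the
   empirical measures of all balls centred on a fine net are close to their
   probabilities; comparing superlevel sets of the Gaussian with those of a
   Gaussian sum over Z^d gives |p_N / N_f - exp (- pi dist (., M) ^ 2)| <= b ^ 3
   near M.  Exponential moments bound the derivatives of F of every order by
   constants depending only on d, m and k, and interpolation turns the C^0
   estimate into closeness of the gradient and Hessian of F, in tangent
   coordinates (x, y), to those of pi |y| ^ 2.  This proves (i)-(iii).

   A critical point is then within O(b ^ (3/2)) of M, and one lies over each point
   of M, which bounds the Hausdorff distance, as sigma ^ (5/4) = sigma * b ^ (3/2).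
   For the reach, let z1 and z2 be critical points at distance e.  The spectral
   projection depends on the Hessian smoothly enough for the midpoint of z1 and z2
   to be critical up to an error O(e ^ 2), so that the critical point in the same
   normal fibre of M is within K e ^ 2 of the midpoint.  A closed set with this
   property has reach at least of order 1 / K, by the parallelogram identity. *)
Require Import Defs.
From HB Require Import structures.
From mathcomp Require Import all_boot all_order all_algebra.
From mathcomp Require Import all_classical all_reals all_analysis.
From mathcomp Require Import measurable_realfun.
From mathcomp Require Import zify ring lra.
Set Implicit Arguments.
Unset Strict Implicit.
Unset Printing Implicit Defensive.
Import Order.TTheory GRing.Theory Num.Theory.
Import numFieldNormedType.Exports.
Local Open Scope classical_set_scope.
Local Open Scope ring_scope.

(** The exponent 3 in [b ^ 3] is dictated by claim (3): interpolation halves it, and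
    [sigma * b ^ (3/2)] is exactly [sigma ^ (5/4)]. The errors themselves are smaller. With balls of
    radius of order 1/b and a reach of order b^-6, curvature and normalization cost O(b^5) and the
    lattice sums O(b^4); the spare powers of b absorb all constants.

    The graph map of [graph_constants] is only of class C^(k-2), hence merely continuous when k = 2,
    and comes with no modulus. It provides charts and one critical point in each normal fibre, but
    never a curvature bound. The bound on the reach rests on four derivatives of F whatever k is,
    and this is why it goes through midpoints rather than through derivatives of the graph map.

    The volume is a Hausdorff measure, defined by covers with arbitrary sets, so its value on a
    Euclidean ball amounts to the isodiametric inequality. That inequality is proved by counting
    points of fine lattices, and the same counts evaluate the Gaussian integral; nothing is
    integrated over R^d or over M. *)

Ltac vec := by apply/rowP => ?; rewrite ?mxE; ring.

Ltac nneg := repeat first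
  [ done | assumption | exact: ler0n | exact: ltW | exact: ler01
  | apply: addr_ge0 | apply: mulr_ge0 | apply: exprn_ge0 | exact: sqr_ge0
  | exact: sqrtr_ge0 | exact: normr_ge0 | exact: expR_ge0 | exact: pi_ge0
  | rewrite invr_ge0 ].

(** * Euclidean inner product, norm and topology of row vectors *)

Section Euclid.
Context {R : realType}.

Section Basics.
Context {n : nat}.
Implicit Types u v w : 'rV[R]_n.

Lemma edotE u v : edot u v = (u *m v^T) 0 0.
Proof. by rewrite /edot mxE; apply: eq_bigr => i _; rewrite mxE. Qed.

Lemma edotC u v : edot u v = edot v u.
Proof. by apply: eq_bigr => i _; rewrite mulrC. Qed.

Lemma edotDl u v w : edot (u + v) w = edot u w + edot v w.
Proof. by rewrite !edotE mulmxDl mxE. Qed.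

Lemma edotDr u v w : edot u (v + w) = edot u v + edot u w.
Proof. by rewrite edotC edotDl !(edotC u). Qed.

Lemma edotZl a u v : edot (a *: u) v = a * edot u v.
Proof. by rewrite !edotE -scalemxAl mxE. Qed.

Lemma edotZr a u v : edot u (a *: v) = a * edot u v.
Proof. by rewrite edotC edotZl edotC. Qed.

Lemma edotNl u v : edot (- u) v = - edot u v.
Proof. by rewrite -scaleN1r edotZl mulN1r. Qed.

Lemma edotNr u v : edot u (- v) = - edot u v.
Proof. by rewrite edotC edotNl edotC. Qed.

Lemma edotBl u v w : edot (u - v) w = edot u w - edot v w.
Proof. by rewrite edotDl edotNl. Qed.

Lemma edotBr u v w : edot u (v - w) = edot u v - edot u w.
Proof. by rewrite edotDr edotNr. Qed.

Lemma edot0l u : edot 0 u = 0.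
Proof. by rewrite -(scale0r u) edotZl mul0r. Qed.

Lemma edot0r u : edot u 0 = 0.
Proof. by rewrite edotC edot0l. Qed.

Lemma edot_ge0 u : 0 <= edot u u.
Proof. by apply: sumr_ge0 => i _; rewrite -expr2 sqr_ge0. Qed.

Lemma edot_eq0 u : edot u u = 0 -> u = 0.
Proof.
move/eqP; rewrite psumr_eq0 => [/allP u0|i _]; last by rewrite -expr2 sqr_ge0.
apply/rowP => i; rewrite mxE; apply/eqP; rewrite -sqrf_eq0 expr2.
exact: u0 (mem_index_enum i).
Qed.

Lemma enorm_ge0 u : 0 <= enorm u.
Proof. exact: sqrtr_ge0. Qed.

Lemma enorm_sqr u : enorm u ^+ 2 = edot u u.
Proof. by rewrite sqr_sqrtr ?edot_ge0. Qed.

Lemma enorm0 : enorm (0 : 'rV[R]_n) = 0.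
Proof. by rewrite /enorm edot0l sqrtr0. Qed.

Lemma enorm_eq0 u : enorm u = 0 -> u = 0.
Proof. by move=> u0; apply: edot_eq0; rewrite -enorm_sqr u0 expr0n. Qed.

Lemma enorm_gt0 u : u != 0 -> 0 < enorm u.
Proof.
by move=> u0; rewrite lt_def enorm_ge0 andbT; apply: contra u0 => /eqP/enorm_eq0->.
Qed.

Lemma enormZ a u : enorm (a *: u) = `|a| * enorm u.
Proof.
by rewrite /enorm edotZl edotZr mulrA -expr2 sqrtrM ?sqr_ge0 // sqrtr_sqr.
Qed.

Lemma enormN u : enorm (- u) = enorm u.
Proof. by rewrite -scaleN1r enormZ normrN1 mul1r. Qed.

Lemma enormBC u v : enorm (u - v) = enorm (v - u).
Proof. by rewrite -enormN opprB. Qed.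

Lemma enormD_sqr u v :
  enorm (u + v) ^+ 2 = enorm u ^+ 2 + 2 * edot u v + enorm v ^+ 2.
Proof. by rewrite !enorm_sqr edotDl !edotDr (edotC v u); ring. Qed.

Lemma enormB_sqr u v :
  enorm (u - v) ^+ 2 = enorm u ^+ 2 - 2 * edot u v + enorm v ^+ 2.
Proof. by rewrite enormD_sqr edotNr enormN mulrN. Qed.

Lemma edot_le u v : edot u v <= enorm u * enorm v.
Proof.
have [->|v0] := eqVneq v 0; first by rewrite edot0r enorm0 mulr0.
have vp := enorm_gt0 v0.
have := edot_ge0 (enorm v *: u - (edot u v / enorm v) *: v).
rewrite -enorm_sqr enormB_sqr !enormZ edotZl edotZr !exprMn !real_normK ?num_real //.
have -> : enorm v ^+ 2 * enorm u ^+ 2 - 2 * (enorm v * (edot u v / enorm v * edot u v))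
  + (edot u v / enorm v) ^+ 2 * enorm v ^+ 2 =
  (enorm u * enorm v) ^+ 2 - edot u v ^+ 2 by field; rewrite gt_eqF.
rewrite subr_ge0 => le2; rewrite (le_trans (ler_norm _)) //.
by rewrite -(@ler_sqr _ `|_|) ?nnegrE ?mulr_ge0 ?enorm_ge0 // real_normK ?num_real.
Qed.

Lemma edot_norm_le u v : `|edot u v| <= enorm u * enorm v.
Proof.
by rewrite ler_norml edot_le andbT lerNl -edotNl -(enormN u) edot_le.
Qed.

Lemma enormD_le u v : enorm (u + v) <= enorm u + enorm v.
Proof.
rewrite -ler_sqr ?nnegrE ?addr_ge0 ?enorm_ge0 // enormD_sqr.
have := edot_le u v; nra.
Qed.

Lemma enormB_le u v : enorm (u - v) <= enorm u + enorm v.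
Proof. by rewrite (le_trans (enormD_le _ _)) // enormN. Qed.

Lemma enorm_triangle w u v : enorm (u - v) <= enorm (u - w) + enorm (w - v).
Proof. by rewrite (le_trans _ (enormD_le _ _)) // addrA subrK. Qed.

Lemma enorm_dist_le u v : `|enorm u - enorm v| <= enorm (u - v).
Proof.
rewrite ler_norml; apply/andP; split.
  by rewrite lerNl opprB lerBlDr enormBC (le_trans _ (enormD_le _ _)) // subrK.
by rewrite lerBlDr (le_trans _ (enormD_le _ _)) // subrK.
Qed.

Lemma coord_le_enorm u i : `|u 0 i| <= enorm u.
Proof.
rewrite -ler_sqr ?nnegrE ?enorm_ge0 // enorm_sqr real_normK ?num_real //.
by rewrite /edot (bigD1 i) //= -expr2 lerDl sumr_ge0 // => j _; rewrite -expr2 sqr_ge0.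
Qed.

Lemma norm_le_enorm u : `|u| <= enorm u.
Proof.
rewrite /Num.norm /= mx_normrE.
by apply: bigmax_le => [|[i j] _]; rewrite ?enorm_ge0 // ord1 coord_le_enorm.
Qed.

Lemma enorm_sum_le I (r : seq I) (P : pred I) (F : I -> 'rV[R]_n) :
  enorm (\sum_(i <- r | P i) F i) <= \sum_(i <- r | P i) enorm (F i).
Proof.
elim/big_ind2: _ => [|x y z t h1 h2|//]; first by rewrite enorm0.
exact: le_trans (enormD_le _ _) (lerD h1 h2).
Qed.

Lemma enorm_delta (i : 'I_n) : enorm (delta_mx 0 i : 'rV[R]_n) = 1.
Proof.
rewrite /enorm /edot (bigD1 i) //= !mxE !eqxx mulr1 big1 ?addr0 ?sqrtr1 //.
by move=> j /negPf ji; rewrite !mxE ji andbF mulr0.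
Qed.

Lemma edot_delta u (i : 'I_n) : edot u (delta_mx 0 i) = u 0 i.
Proof.
rewrite /edot (bigD1 i) //= mxE !eqxx mulr1 big1 ?addr0 // => j /negPf ji.
by rewrite !mxE ji andbF mulr0.
Qed.

Lemma enorm_le_norm u : enorm u <= n%:R * `|u|.
Proof.
rewrite [u in enorm u]row_sum_delta (le_trans (enorm_sum_le _ _ _)) //.
rewrite -[n in n%:R]card_ord -sum1_card natr_sum mulr_suml ler_sum // => i _.
rewrite enormZ enorm_delta mulr1 mul1r.
rewrite /Num.norm /= mx_normrE.
exact: (le_bigmax_cond _ (fun ij : 'I_1 * 'I_n => `|u ij.1 ij.2|) (isT : xpredT (0, i))).
Qed.

Lemma edot_orth u : (forall v, edot u v = 0) -> u = 0.
Proof. by move=> h; apply: edot_eq0. Qed.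

End Basics.

Lemma enorm_row_mx n1 n2 (a : 'rV[R]_n1) (b : 'rV[R]_n2) :
  enorm (row_mx a b) ^+ 2 = enorm a ^+ 2 + enorm b ^+ 2.
Proof. by rewrite !enorm_sqr !edotE tr_row_mx mul_row_col mxE. Qed.

Lemma edot_row_mx n1 n2 (a a' : 'rV[R]_n1) (b b' : 'rV[R]_n2) :
  edot (row_mx a b) (row_mx a' b') = edot a a' + edot b b'.
Proof. by rewrite !edotE tr_row_mx mul_row_col mxE. Qed.

Lemma enorm_lsubmx n1 n2 (v : 'rV[R]_(n1 + n2)) : enorm (lsubmx v) <= enorm v.
Proof.
rewrite -{2}(hsubmxK v) -ler_sqr ?nnegrE ?enorm_ge0 // enorm_row_mx.
by rewrite lerDl sqr_ge0.
Qed.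

Lemma enorm_rsubmx n1 n2 (v : 'rV[R]_(n1 + n2)) : enorm (rsubmx v) <= enorm v.
Proof.
rewrite -{2}(hsubmxK v) -ler_sqr ?nnegrE ?enorm_ge0 // enorm_row_mx.
by rewrite lerDr sqr_ge0.
Qed.

Lemma enorm_row_mx0 n1 n2 (a : 'rV[R]_n1) : enorm (row_mx a (0 : 'rV[R]_n2)) = enorm a.
Proof.
by apply: (pexpIrn (isT : (0 < 2)%N)); rewrite ?nnegrE ?enorm_ge0 // enorm_row_mx enorm0 expr0n addr0.
Qed.

Lemma enorm_row_0mx n1 n2 (b : 'rV[R]_n2) : enorm (row_mx (0 : 'rV[R]_n1) b) = enorm b.
Proof.
by apply: (pexpIrn (isT : (0 < 2)%N)); rewrite ?nnegrE ?enorm_ge0 // enorm_row_mx enorm0 expr0n add0r.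
Qed.

Lemma edot_mulmx p q (u : 'rV[R]_p) (A : 'M[R]_(p, q)) (v : 'rV[R]_q) :
  edot (u *m A) v = edot u (v *m A^T).
Proof. by rewrite !edotE trmx_mul trmxK mulmxA. Qed.

Section Orthogonal.
Context {n : nat} {Q : 'M[R]_n}.
Hypothesis QQ : Q *m Q^T = 1%:M.

Lemma orth_tr : Q^T *m Q = 1%:M. Proof. exact: mulmx1C. Qed.

Lemma mulmx_orthK (u : 'rV[R]_n) : u *m Q *m Q^T = u.
Proof. by rewrite -mulmxA QQ mulmx1. Qed.

Lemma mulmx_orthVK (u : 'rV[R]_n) : u *m Q^T *m Q = u.
Proof. by rewrite -mulmxA orth_tr mulmx1. Qed.

Lemma edot_orthmx (u v : 'rV[R]_n) : edot (u *m Q) (v *m Q) = edot u v.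
Proof. by rewrite edot_mulmx mulmx_orthK. Qed.

Lemma edot_orthmxV (u v : 'rV[R]_n) : edot (u *m Q^T) (v *m Q^T) = edot u v.
Proof. by rewrite edot_mulmx trmxK mulmx_orthVK. Qed.

Lemma enorm_orthmx (u : 'rV[R]_n) : enorm (u *m Q) = enorm u.
Proof. by rewrite /enorm edot_orthmx. Qed.

Lemma enorm_orthmxV (u : 'rV[R]_n) : enorm (u *m Q^T) = enorm u.
Proof. by rewrite /enorm edot_orthmxV. Qed.
End Orthogonal.

Lemma continuous_sumr (T : topologicalType) I (r : seq I) (f : I -> T -> R) (x : T) :
  (forall i, {for x, continuous (f i)}) ->
  {for x, continuous (fun t => \sum_(i <- r) f i t)}.
Proof.
move=> fc; elim: r => [|i r IH].
  have -> : (fun t => \sum_(i <- [::]) f i t) = fun=> 0.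
    by apply/funext => y; rewrite big_nil.
  exact: cst_continuous.
have -> : (fun t => \sum_(j <- i :: r) f j t) = (fun t => f i t + \sum_(j <- r) f j t).
  by apply/funext => y; rewrite big_cons.
exact: continuousD.
Qed.

Section Topology.
Context {n : nat}.
Implicit Types u v x : 'rV[R]_n.

Lemma coord_continuous_row (i : 'I_n) : continuous (fun u : 'rV[R]_n => u 0 i).
Proof. exact: coord_continuous. Qed.

Lemma continuous_edot (f g : 'rV[R]_n -> 'rV[R]_n) x :
  {for x, continuous f} -> {for x, continuous g} ->
  {for x, continuous (fun y => edot (f y) (g y))}.
Proof.
move=> fc gc; apply: continuous_sumr => i; apply: continuousM.
  exact: (continuous_comp fc (@coord_continuous_row i (f x))).
exact: (continuous_comp gc (@coord_continuous_row i (g x))).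
Qed.

Lemma continuous_enorm : continuous (@enorm R n).
Proof.
move=> x; apply: continuous_comp; last exact: sqrt_continuous.
exact: (@continuous_edot id id).
Qed.

Lemma continuous_enormB (a : 'rV[R]_n) : continuous (fun x : 'rV[R]_n => enorm (x - a)).
Proof.
move=> x; have h : {for x, continuous (fun y : 'rV[R]_n => y - a)}.
  by apply: continuousB; [move=> P|exact: cst_continuous].
exact: (continuous_comp h (@continuous_enorm (x - a))).
Qed.

Lemma open_eball a r : open [set x : 'rV[R]_n | enorm (x - a) < r].
Proof.
apply: (open_comp (f := fun x => enorm (x - a)) (D := [set t | t < r])).
  by move=> x _; exact: continuous_enormB.
exact: open_lt.
Qed.

Lemma closed_eball a r : closed [set x : 'rV[R]_n | enorm (x - a) <= r].
Proof.
apply: (closed_comp (f := fun x => enorm (x - a)) (D := [set t | t <= r])).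
  by move=> x _; exact: continuous_enormB.
exact: closed_le.
Qed.

Lemma compact_eball a r : compact [set x : 'rV[R]_n | enorm (x - a) <= r].
Proof.
apply: bounded_closed_compact; last exact: closed_eball.
exists (`|a| + r); split; first exact: num_real.
move=> M ltM x /= xr; rewrite -(subrK a x) (le_trans (ler_normD _ _)) // ltW //.
by rewrite (le_lt_trans _ ltM) // addrC lerD2l (le_trans (norm_le_enorm _)).
Qed.

Lemma nbhs_eball x (A : set 'rV[R]_n) :
  nbhs x A -> exists2 e, 0 < e & forall y, enorm (y - x) < e -> A y.
Proof.
move=> /nbhs_ballP[e /= e0 eA]; exists e => // y yx; apply: eA.
rewrite -ball_normE /= -normrN opprB; exact: le_lt_trans (norm_le_enorm _) yx.
Qed.

Lemma eball_nbhs x e (A : set 'rV[R]_n) : 0 < e ->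
  (forall y, enorm (y - x) < e -> A y) -> nbhs x A.
Proof.
move=> e0 h; apply: (@filterS _ _ _ [set y | enorm (y - x) < e]) => //.
by apply: open_nbhs_nbhs; split; [exact: open_eball|rewrite /= subrr enorm0].
Qed.

Lemma compact_closed_row (A : set 'rV[R]_n) : compact A -> closed A.
Proof. by apply: compact_closed; exact: norm_hausdorff. Qed.

Lemma nearest_exists (A : set 'rV[R]_n) x : closed A -> A !=set0 ->
  exists q, nearest A x q.
Proof.
move=> cA [a Aa].
pose B := A `&` [set y | enorm (y - x) <= enorm (a - x)].
have cB : compact B.
  rewrite /B setIC; apply: compact_closedI => //; exact: compact_eball.
have [q Bq qmin] : exists2 q, B q & forall y, B y -> enorm (q - x) <= enorm (y - x).
  have [||q /set_mem Bq h] := @EVT_min_rV R n (fun y => enorm (y - x)) B _ cB.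
  - by exists a; split=> //=.
  - by apply: continuous_subspaceT; exact: continuous_enormB.
  by exists q => // y By; apply: h; rewrite inE.
exists q; split; first exact: Bq.1.
move=> y Ay; rewrite enormBC (enormBC x).
case: (leP (enorm (y - x)) (enorm (a - x))) => [h|/ltW h]; first exact: qmin.
by apply: le_trans h; exact: Bq.2.
Qed.

End Topology.
End Euclid.

(** * Counting lattice points: a discrete Brunn-Minkowski inequality *)

Section Box.

Definition zrange (J : nat) : seq int := [seq k%:Z - J%:Z | k <- iota 0 (2 * J).+1].

Lemma mem_zrange J (i : int) : (i \in zrange J) = (`|i| <= J)%N.
Proof.
apply/mapP/idP => [[k]|iJ]; first by rewrite mem_iota => kJ ->; lia.
by exists `|(i + J%:Z)%R|%N; [rewrite mem_iota; lia|lia].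
Qed.

Lemma uniq_zrange J : uniq (zrange J).
Proof. by rewrite map_inj_uniq ?iota_uniq // => a b; lia. Qed.

Lemma seq_int_max (s : seq int) : s != [::] ->
  exists2 m : int, m \in s & forall i : int, i \in s -> i <= m.
Proof.
elim: s => // a [|b s] IH _.
  by exists a => [|i]; rewrite inE // => /eqP->.
have [//|m ms mmax] := IH; exists (Num.max a m).
  by rewrite inE; case: leP => _; rewrite ?eqxx ?ms ?orbT.
by move=> i; rewrite inE => /orP[/eqP->|/mmax im]; rewrite le_max ?lexx // im orbT.
Qed.

(** The translates [S - max T] and [max S + 1 - T] both lie in [D]. They are disjoint: elements of
    the first are at most [max S - max T], those of the second are larger. The step 1 plays the part
    of a unit cell; without it the two sets would share the point [max S - max T]. *)
Lemma size_diff_step (S T D : seq int) : uniq S -> uniq T -> S != [::] -> T != [::] ->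
  (forall i j : int, i \in S -> j \in T -> (i - j \in D) && (i - j + 1 \in D)) ->
  (size S + size T <= size D)%N.
Proof.
move=> uS uT S0 T0 h.
have [a aS amax] := seq_int_max S0; have [b bT bmax] := seq_int_max T0.
have -> : (size S + size T)%N = size ([seq (i : int) - b | i <- S] ++ [seq a - (j : int) + 1 | j <- T]).
  by rewrite size_cat !size_map.
apply: uniq_leq_size => [|k]; last first.
  rewrite mem_cat => /orP[/mapP[i iS ->]|/mapP[j jT ->]].
    by case/andP: (h _ _ iS bT).
  by case/andP: (h _ _ aS jT).
rewrite cat_uniq !map_inj_uniq ?uS ?uT /= ?andbT; try by move=> ? ?; lia.
apply/hasPn => k /mapP[j jT ->]; apply/negP => /mapP[i iS].
by have := amax _ iS; have := bmax _ jT; lia.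
Qed.

Lemma sum_level (M x : nat) : (x <= M)%N -> (\sum_(s < M) (s < x) = x)%N.
Proof.
move=> xM; rewrite -(big_mkord xpredT (fun s => nat_of_bool (s < x)%N)).
rewrite (big_cat_nat (n := x)) //= [X in (_ + X)%N]big_nat_cond [X in (_ + X)%N]big1.
  rewrite big_nat_cond (eq_bigr (fun=> 1%N)) => [|i]; last by rewrite andbT => /andP[_ ->].
  by rewrite -big_nat_cond sum_nat_const_nat subn0 muln1 addn0.
by move=> i; rewrite andbT => /andP[xi _]; rewrite ltnNge xi.
Qed.

(** The levels that satisfy the condition are the first ones, so if there are [n > 0] of them then
    level [n - 1] is among them, which is [c * n ^ 2 <= X]. This recovers a function from its
    superlevel sets without extracting roots. *)
Lemma level_count (M c X : nat) :
  (c * (\sum_(s < M) (c * s.+1 ^ 2 <= X)) ^ 2 <= X)%N /\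
  (\sum_(s < M) (c * s.+1 ^ 2 <= X) <= M)%N.
Proof.
elim: M => [|M [IH1 IH2]]; first by rewrite big_ord0 exp0n // muln0.
split; last by rewrite big_ord_recr /= -[M.+1]addn1 leq_add // leq_b1.
rewrite big_ord_recr /=; case: (leqP (c * M.+1 ^ 2) X) => [h|_]; last by rewrite addn0.
by apply: leq_trans h; rewrite leq_mul2l leq_sqr addn1 ltnS IH2 orbT.
Qed.

Lemma sum_mem_size (T : Type) (s : seq T) (P : pred T) :
  (\sum_(i <- s) nat_of_bool (P i) = size [seq i <- s | P i])%N.
Proof. by rewrite size_filter -sum1_count [RHS]big_mkcond. Qed.

Lemma bigmax_attained (T : eqType) (s : seq T) (f : T -> nat) :
  (0 < \sum_(i <- s) f i)%N ->
  exists2 i, i \in s & forall j, j \in s -> (f j <= f i)%N.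
Proof.
elim: s => [|a [|b s] IH]; first by rewrite big_nil.
  by exists a => [|j]; rewrite inE // => /eqP->.
rewrite big_cons; case: (posnP (\sum_(i <- b :: s) f i)) => [s0 _|sp _].
  exists a; first by rewrite inE eqxx.
  move=> j; rewrite inE => /orP[/eqP->//|js].
  have : (f j <= \sum_(i <- b :: s) f i)%N by rewrite (big_rem j) //= leq_addr.
  by rewrite s0 leqn0 => /eqP->.
have [i is_ imax] := IH sp; case: (leqP (f a) (f i)) => fai.
  exists i; first by rewrite inE is_ orbT.
  by move=> j; rewrite inE => /orP[/eqP->//|]; exact: imax.
exists a; first by rewrite inE eqxx.
by move=> j; rewrite inE => /orP[/eqP->//|/imax fji]; rewrite (leq_trans fji) // ltnW.
Qed.

(* Discrete Prekopa-Leindler inequality on the line: after rescaling f and g to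
   have the same maximum, compare the superlevel sets. *)
Lemma line_diff_sum (J c : nat) (f g h : int -> nat) :
  (forall i j e : int, i \in zrange J -> j \in zrange J -> (e == 0) || (e == 1) ->
     (c * (f i * g j) <= h (i - j + e)%R ^ 2)%N) ->
  (4 * c * ((\sum_(i <- zrange J) f i) * (\sum_(i <- zrange J) g i)) <=
   (\sum_(i <- zrange (2 * J).+1) h i) ^ 2)%N.
Proof.
move=> fgh; set A := (\sum_(i <- _) f i)%N; set B := (\sum_(i <- _) g i)%N.
set H := (\sum_(i <- _) h i)%N.
case: (posnP A) => [->|A0]; first by rewrite mul0n muln0.
case: (posnP B) => [->|B0]; first by rewrite !muln0.
have [i0 i0J fmax] := bigmax_attained A0; have [j0 j0J gmax] := bigmax_attained B0.
pose F := f i0; pose G := g j0.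
have F0 : (0 < F)%N.
  rewrite lt0n; apply/eqP => F0; move: A0; rewrite /A big_seq big1 // => i /fmax.
  by rewrite -/F F0 leqn0 => /eqP.
have G0 : (0 < G)%N.
  rewrite lt0n; apply/eqP => G0; move: B0; rewrite /B big_seq big1 // => i /gmax.
  by rewrite -/G G0 leqn0 => /eqP.
(* Superlevel sets of [h] in squared form: [sqrt c * (s + 1) <= h k * sqrt (F * G)]. Everything
   stays in the natural numbers. *)
pose n k := (\sum_(s < F * G) (c * s.+1 ^ 2 <= h k ^ 2 * (F * G)))%N.
have nk k : (c * n k ^ 2 <= h k ^ 2 * (F * G))%N by case: (level_count (F * G) c (h k ^ 2 * (F * G))).
pose N := (\sum_(k <- zrange (2 * J).+1) n k)%N.
have NAB : (A * G + B * F <= N)%N.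
  have -> : (A * G = \sum_(s < F * G) \sum_(i <- zrange J) (s < f i * G))%N.
    rewrite exchange_big /= /A big_distrl /= big_seq [RHS]big_seq; apply: eq_bigr => i iJ.
    by rewrite sum_level // leq_mul2r fmax // orbT.
  have -> : (B * F = \sum_(s < F * G) \sum_(i <- zrange J) (s < g i * F))%N.
    rewrite exchange_big /= /B big_distrl /= big_seq [RHS]big_seq; apply: eq_bigr => i iJ.
    by rewrite sum_level // mulnC leq_mul2l gmax // orbT.
  rewrite -big_split /= /N /n exchange_big /=; apply: leq_sum => s _.
  rewrite !sum_mem_size; apply: size_diff_step.
  - by rewrite filter_uniq // uniq_zrange.
  - by rewrite filter_uniq // uniq_zrange.
  - apply/eqP => /(congr1 (fun l => i0 \in l)).
    by rewrite mem_filter i0J in_nil andbT /= -/F ltn_ord.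
  - apply/eqP => /(congr1 (fun l => j0 \in l)).
    by rewrite mem_filter j0J in_nil andbT /= -/G (mulnC G) ltn_ord.
  move=> i j; rewrite !mem_filter !mem_zrange => /andP[fi iJ] /andP[gj jJ].
  have key e : (e == 0) || (e == 1) -> (c * s.+1 ^ 2 <= h (i - j + e)%R ^ 2 * (F * G))%N.
    move=> e01; apply: (@leq_trans (c * (f i * g j) * (F * G))).
      rewrite -mulnA leq_mul2l -mulnn; apply/orP; right.
      by apply: leq_trans (leq_mul fi gj) _; rewrite mulnACA (mulnC G).
    by rewrite leq_mul2r fgh ?orbT ?mem_zrange.
  have k0 := key 0; rewrite addr0 eqxx in k0.
  have k1 := key 1; rewrite eqxx orbT in k1.
  by rewrite k0 // k1 //=; apply/andP; split; lia.
have cN : (c * N ^ 2 <= H ^ 2 * (F * G))%N.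
  rewrite -!mulnn /N /H !big_distrlr /= big_distrr big_distrl /=.
  apply: leq_sum => k _; rewrite big_distrr big_distrl /=; apply: leq_sum => l _.
  rewrite -leq_sqr; have := leq_mul (nk k) (nk l).
  by rewrite -!mulnn; congr (_ <= _)%N; ring.
rewrite -(leq_pmul2r (m := F * G)) ?muln_gt0 ?F0 ?G0 //.
apply: leq_trans cN; apply: (@leq_trans (c * (A * G + B * F) ^ 2)); last first.
  by rewrite leq_mul2l leq_sqr NAB orbT.
have -> : (4 * c * (A * B) * (F * G) = c * (4 * (A * G * (B * F))))%N by ring.
by rewrite leq_mul2l (nat_AGM2 _ _) orbT.
Qed.

Fixpoint box (d J : nat) : seq 'rV[int]_d :=
  if d is d'.+1 then [seq row_mx (const_mx i : 'rV_1) u | i <- zrange J, u <- box d' J]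
  else [:: 0].

Definition unit_step d (e : 'rV[int]_d) := forall i, (e 0 i == 0) || (e 0 i == 1).

Lemma row_consE d (u : 'rV[int]_(1 + d)) :
  u = row_mx (const_mx (u ord0 (lshift d (ord0 : 'I_1)))) (rsubmx u).
Proof.
rewrite -{1}(hsubmxK u); congr row_mx; apply/rowP => i.
by rewrite !mxE; congr (u _ _); apply: val_inj; rewrite /= ord1.
Qed.

Lemma row_cons_inj d i j (u v : 'rV[int]_d) :
  row_mx (const_mx i : 'rV_1) u = row_mx (const_mx j) v -> i = j /\ u = v.
Proof. by move=> /eq_row_mx[/rowP/(_ 0)]; rewrite !mxE. Qed.

Lemma mem_box d J (u : 'rV[int]_d) : (u \in box d J) = [forall i, (`|u ord0 i| <= J)%N].
Proof.
elim: d u => [|d IH] u.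
  by rewrite /= thinmx0 inE eqxx; apply/esym/forallP; case.
apply/allpairsP/forallP => [[[i v] /= [iJ vJ ->]] k|h].
  rewrite mem_zrange in iJ; rewrite IH in vJ.
  by rewrite mxE; case: splitP => l _; rewrite ?mxE //; exact: (forallP vJ).
exists (u ord0 (lshift d (ord0 : 'I_1)), rsubmx (u : 'rV_(1 + d))); split=> /=.
- by rewrite mem_zrange h.
- by rewrite IH; apply/forallP => i; rewrite mxE h.
- exact: row_consE.
Qed.

Lemma uniq_box d J : uniq (box d J).
Proof.
elim: d => //= d IH.
have -> // : uniq ([seq row_mx (const_mx i : 'rV_1) u | i <- zrange J, u <- box d J] : seq 'rV[int]_(1 + d)).
apply: allpairs_uniq; rewrite ?uniq_zrange //.
by move=> [i u] [j v] _ _ /= /row_cons_inj[-> ->].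
Qed.

Lemma big_box_cons d J (F : 'rV[int]_d.+1 -> nat) :
  (\sum_(u <- box d.+1 J) F u =
   \sum_(i <- zrange J) \sum_(u <- box d J) F (row_mx (const_mx i : 'rV_1) u))%N.
Proof. exact: (big_allpairs_dep (op := addn)). Qed.

(** Induction on the dimension. For fixed first coordinates the induction hypothesis says that the
    sums over the fibres satisfy the hypothesis of [line_diff_sum] with [4 ^ d * c] in place of [c];
    this is why [c] is a parameter. *)
Lemma box_diff_sum d (J c : nat) (f g h : 'rV[int]_d -> nat) :
  (forall u v e, u \in box d J -> v \in box d J -> unit_step e ->
     (c * (f u * g v) <= h (u - v + e)%R ^ 2)%N) ->
  (4 ^ d * c * ((\sum_(u <- box d J) f u) * (\sum_(u <- box d J) g u)) <=
   (\sum_(u <- box d (2 * J).+1) h u) ^ 2)%N.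
Proof.
elim: d c f g h => [|d IH] c f g h fgh.
  rewrite /= !big_seq1 expn0 mul1n.
  by have := fgh 0 0 0; rewrite subr0 addr0; apply; rewrite ?inE // => -[].
rewrite !big_box_cons expnS -(mulnA 4); apply: line_diff_sum => i j e iJ jJ e01.
apply: IH => u v w uJ vJ w01.
have -> : row_mx (const_mx (i - j + e)) (u - v + w) = row_mx (const_mx i : 'rV_1) u -
    row_mx (const_mx j) v + row_mx (const_mx e) w :> 'rV[int]_(1 + d).
  rewrite opp_row_mx !add_row_mx; congr row_mx.
  by apply/rowP => k; rewrite !mxE.
apply: fgh.
- by apply/allpairsP; exists (i, u).
- by apply/allpairsP; exists (j, v).
- by move=> k; rewrite mxE; case: splitP => l _; rewrite ?mxE.
Qed.

(** Brunn-Minkowski for [A - A] thickened by the vertices of a unit cube, from [box_diff_sum] for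
    indicator functions. For the lattice points of a set of given diameter it bounds their number by
    that of a ball of the same diameter: the isodiametric inequality. *)
Lemma card_diff_cube d J (A D : pred 'rV[int]_d) :
  (forall u v e, A u -> A v -> unit_step e -> D (u - v + e)) ->
  (2 ^ d * count A (box d J) <= count D (box d (2 * J).+1))%N.
Proof.
move=> AD; rewrite -leq_sqr expnMn -expnM (mulnC d) expnM.
have := @box_diff_sum d J 1 A A D; rewrite muln1 !sum_mem_size !size_filter mulnn.
apply => u v e _ _ e01.
by case Au : (A u); case Av : (A v); rewrite ?muln0 // AD.
Qed.

Definition sqn d (u : 'rV[int]_d) : nat := (\sum_i `|u ord0 i| ^ 2)%N.

Lemma sqn_cons d i (u : 'rV[int]_d) :
  sqn (row_mx (const_mx i : 'rV_1) u) = (`|i| ^ 2 + sqn u)%N.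
Proof.
rewrite /sqn big_split_ord /= big_ord1 row_mxEl mxE; congr addn.
by apply: eq_bigr => k _; rewrite row_mxEr.
Qed.

Lemma coord_sqn d (u : 'rV[int]_d) i : (`|u ord0 i| ^ 2 <= sqn u)%N.
Proof. by rewrite /sqn (bigD1 i) //= leq_addr. Qed.

(** Every box that contains the ball of squared radius [T] gives the same count ([lat_box]), and
    [box d T] does so because a coordinate with [i ^ 2 <= T] has [|i| <= T]. *)
Definition lat d T := count (fun u => sqn u <= T)%N (box d T).

Lemma lat_box d T J : (T < J.+1 ^ 2)%N ->
  count (fun u => sqn u <= T)%N (box d J) = lat d T.
Proof.
move=> TJ; rewrite /lat -!size_filter; apply: perm_size.
apply: uniq_perm; rewrite ?filter_uniq ?uniq_box // => u.
rewrite !mem_filter; case: leqP => //= uT; rewrite !mem_box.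
by apply/forallP/forallP => _ i; have := coord_sqn u i; nia.
Qed.

Lemma lat_mono d T T' : (T <= T')%N -> (lat d T <= lat d T')%N.
Proof.
move=> TT; rewrite -(@lat_box d T T') ?(leq_ltn_trans TT) //; last first.
  by rewrite -mulnn; nia.
by apply: sub_count => u /leq_trans; apply.
Qed.

Lemma lat0 T : lat 0 T = 1%N.
Proof. by rewrite /lat /= /sqn big_ord0. Qed.

Lemma lat_cons d T J : (T < J.+1 ^ 2)%N ->
  lat d.+1 T = (\sum_(i <- zrange J | `|i| ^ 2 <= T) lat d (T - `|i| ^ 2))%N.
Proof.
move=> TJ; rewrite -(lat_box _ TJ) -size_filter -sum_mem_size big_box_cons.
rewrite [RHS]big_mkcond; apply: eq_bigr => i _.
rewrite sum_mem_size size_filter; case: leqP => iT.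
  rewrite -(@lat_box _ _ J); last by lia.
  by apply: eq_count => u; rewrite sqn_cons; lia.
rewrite -[RHS](count_pred0 (box d J)); apply: eq_count => u; rewrite sqn_cons /=; lia.
Qed.

Lemma lat1_bounds T : exists2 r, (r ^ 2 <= T < r.+1 ^ 2)%N & lat 1 T = (2 * r).+1.
Proof.
have [r rT] : exists r, (r ^ 2 <= T < r.+1 ^ 2)%N.
  have ex : exists r, (r ^ 2 <= T)%N by exists 0%N.
  have bd r : (r ^ 2 <= T)%N -> (r <= T)%N by nia.
  have [r rT rmax] := ex_maxnP ex bd; exists r; rewrite rT /= ltnNge.
  by apply/negP => /rmax; rewrite ltnn.
exists r => //; rewrite (@lat_cons 0 T r); last by case/andP: rT.
rewrite (eq_bigr (fun=> 1%N)) => [|i _]; last by rewrite lat0.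
rewrite big_seq_cond (eq_bigl (fun i => i \in zrange r)) => [|i].
  by rewrite -big_seq sum1_size size_map size_iota.
rewrite mem_zrange; case: leqP => //= ir; case/andP: rT => rT _.
by apply: leq_trans rT; rewrite leq_sqr.
Qed.

End Box.

(** * Asymptotics of the number of lattice points in a ball *)

Section LatticeCount.
Context {R : realType}.
Implicit Types (x s t eta : R) (d T n : nat).

(** For [0 <= x <= pi / 2], the area under the unit circle over [[0, sin x]]: the substitution
    [u = sin x] turns the integral of [sqrt (1 - u ^ 2)] into that of [cos ^ 2]. *)
Definition half_area x : R := 2^-1 * (x + sin x * cos x).

Lemma is_derive_half_area x : is_derive x 1 half_area (cos x ^+ 2).
Proof.
rewrite /half_area.
have h := cos2Dsin2 x; apply: is_derive_eq.
rewrite /GRing.scale /=; move: h; set c := cos x; set t := sin x => h.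
have -> : c ^+ 2 = 2^-1 * (c ^+ 2 + t ^+ 2) + 2^-1 * (c ^+ 2 - t ^+ 2) by field.
by rewrite h; ring.
Qed.

(** The area over [[sin s, sin t]] lies between an inscribed and a circumscribed rectangle. Up to
    sign, either inequality is the monotonicity of [b * sin u - half_area u], whose derivative is
    [cos u * (b - cos u)], for [b = cos t] and for [b = cos s]. *)
Lemma half_area_bounds s t : 0 <= s -> s <= t -> t <= pi / 2 ->
  cos t * (sin t - sin s) <= half_area t - half_area s <= cos s * (sin t - sin s).
Proof.
move=> s0 st tpi.
have cosd u v : s <= u -> u <= v -> v <= t -> cos v <= cos u.
  move=> su uv vt; rewrite leNgt ltr_cos -?leNgt //.
  - by rewrite in_itv /=; have := pi_gt0 R; lra.
  - by rewrite in_itv /=; have := pi_gt0 R; lra.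
have cos0 u : s <= u -> u <= t -> 0 <= cos u.
  by move=> su ut; apply: cos_ge0_pihalf; have := pi_gt0 R; lra.
have dd (a b c u : R) : is_derive u (1 : R) (fun x => a * (b * sin x - half_area x) + c)
    (a * (b * cos u - cos u ^+ 2)).
  have h := is_derive_half_area u.
  by apply: (is_derive_eq (f := fun x => a * (b * sin x - half_area x) + c));
    rewrite /GRing.scale /=; ring.
have mono (a b : R) : (forall u, u \in `]s, t[ -> 0 <= a * (b * cos u - cos u ^+ 2)) ->
    a * (b * sin s - half_area s) <= a * (b * sin t - half_area t).
  move=> h; pose f x := a * (b * sin x - half_area x) + 0.
  suff : f s <= f t by rewrite /f !addr0.
  apply: (@ger0_derive1_ndecr _ f s t) => //.
  - by move=> u /h; rewrite derive1E (@derive_val _ _ _ _ _ _ _ (dd a b 0 u)).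
  - apply: continuous_subspaceT => u; apply: differentiable_continuous.
    by apply/derivable1_diffP; have := dd a b 0 u; case.
apply/andP; split.
- have := mono (-1) (cos t) => h; suff : -1 * (cos t * sin s - half_area s) <= -1 * (cos t * sin t - half_area t) by lra.
  apply: h => u; rewrite in_itv /= => /andP[su ut].
  have := cosd u t (ltW su) (ltW ut) (lexx _); have := cos0 u (ltW su) (ltW ut); nra.
- have := mono 1 (cos s) => h; suff : 1 * (cos s * sin s - half_area s) <= 1 * (cos s * sin t - half_area t) by lra.
  apply: h => u; rewrite in_itv /= => /andP[su ut].
  have := cosd s u (lexx _) (ltW su) (ltW ut); have := cos0 u (ltW su) (ltW ut); nra.
Qed.

Lemma quarter_disc_sum x n : 0 < x -> n%:R <= x -> x < n.+1%:R ->
  \sum_(1 <= j < n.+1) Num.sqrt (x ^+ 2 - j%:R ^+ 2) <= pi / 4 * x ^+ 2 <=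
  x + \sum_(1 <= j < n.+1) Num.sqrt (x ^+ 2 - j%:R ^+ 2).
Proof.
move=> x0 nx xn.
pose s j : R := Num.min (j%:R / x) 1; pose th j := asin (s j).
have s01 j : 0 <= s j <= 1.
  by rewrite /s le_min ler01 andbT divr_ge0 ?ler0n ?(ltW x0) //= ge_min lexx orbT.
have sth j : sin (th j) = s j.
  by rewrite /th asinK // in_itv /=; have := s01 j; lra.
have sE j : (j <= n)%N -> s j = j%:R / x.
  move=> jn; rewrite /s; apply/min_idPl; rewrite ler_pdivrMr // mul1r.
  by rewrite (le_trans _ nx) // ler_nat.
have cth j : (j <= n)%N -> cos (th j) = Num.sqrt (x ^+ 2 - j%:R ^+ 2) / x.
  move=> jn; rewrite /th cos_asin; last by have := s01 j; lra.
  rewrite sE // (_ : 1 - _ = (x ^+ 2 - j%:R ^+ 2) / x ^+ 2).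
    have xj : 0 <= x ^+ 2 - j%:R ^+ 2.
      rewrite subr_ge0 ler_sqr ?nnegrE ?ler0n ?(ltW x0) //.
      by rewrite (le_trans _ nx) // ler_nat.
    by rewrite sqrtrM // sqrtrV ?sqrtr_sqr ?gtr0_norm // sqr_ge0.
  by field; rewrite gt_eqF.
have th_pi j : 0 <= th j <= pi / 2.
  have h := s01 j; rewrite /th asin_lepi2 ?andbT; last by lra.
  rewrite leNgt; apply/negP => tn; have : sin (asin (s j)) < 0.
    rewrite -(opprK (asin _)) sinN oppr_lt0; apply: sin_gt0_pi.
    rewrite oppr_gt0 tn /= ltrNl.
    have := @asin_geNpi2 _ (s j); have := pi_gt0 R; lra.
  by rewrite -/(th j) sth; lra.
have thm j : th j <= th j.+1.
  rewrite leNgt; apply/negP => h.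
  have : sin (th j.+1) < sin (th j).
    by rewrite ltr_sin // in_itv /=; have := th_pi j; have := th_pi j.+1; have := pi_gt0 R; lra.
  rewrite !sth ltNge /s; case/negP; rewrite le_min2 // ler_pM2r ?invr_gt0 //.
  by rewrite ler_nat.
have th0 : th 0%N = 0.
  rewrite /th sE // mul0r -[X in asin X](sin0 R) sinK // in_itv /=; have := pi_gt0 R; lra.
have thn : th n.+1 = pi / 2.
  have -> : th n.+1 = asin (sin (pi / 2)).
    rewrite sin_pihalf /th /s; congr asin; apply/min_idPr.
    by rewrite ler_pdivlMr // mul1r ltW.
  by rewrite sinK // in_itv /=; have := pi_gt0 R; lra.
have stp j := half_area_bounds (proj1 (andP (th_pi j))) (thm j) (proj2 (andP (th_pi j.+1))).
have A0 : half_area 0 = 0 by rewrite /half_area sin0 mul0r addr0 mulr0.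
have A1 : half_area (pi / 2) = pi / 4 by rewrite /half_area cos_pihalf mulr0 addr0; field.
have x2 : 0 < x ^+ 2 by rewrite exprn_gt0.
apply/andP; split.
- rewrite -ler_pdivrMr //.
  have -> : (\sum_(1 <= j < n.+1) Num.sqrt (x ^+ 2 - j%:R ^+ 2)) / x ^+ 2 =
      \sum_(0 <= j < n) cos (th j.+1) * (s j.+1 - s j).
    rewrite big_add1 /= mulr_suml; apply: eq_big_nat => j /andP[_ jn].
    rewrite (cth j.+1 jn) (sE j.+1 jn) (sE j (ltnW jn)).
    have -> : j.+1%:R / x - j%:R / x = x^-1 by rewrite -mulrBl -natrB // subSnn mul1r.
    by field; rewrite gt_eqF.
  apply: (@le_trans _ _ (half_area (th n) - half_area (th 0%N))).
    rewrite -(telescope_sumr (fun j => half_area (th j))) // ler_sum // => j _.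
    by rewrite -!sth; case/andP: (stp j).
  rewrite th0 A0 subr0 -A1 -thn.
  have := stp n; rewrite !sth => /andP[h _].
  rewrite -subr_ge0 (le_trans _ h) // mulr_ge0 //.
    by rewrite thn cos_pihalf.
  by rewrite subr_ge0 /s le_min2 // ler_pM2r ?invr_gt0 // ler_nat.
- rewrite -ler_pdivlMr // -A1.
  have -> : half_area (pi / 2) = half_area (th n.+1) - half_area (th 0%N).
    by rewrite thn th0 A0 subr0.
  rewrite -(telescope_sumr (fun j => half_area (th j))) //.
  have -> : (x + \sum_(1 <= j < n.+1) Num.sqrt (x ^+ 2 - j%:R ^+ 2)) / x ^+ 2 =
      \sum_(0 <= j < n.+1) cos (th j) / x.
    rewrite [RHS]big_nat_recl // (cth 0%N) // expr0n subr0 sqrtr_sqr gtr0_norm //.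
    rewrite mulrDl; congr (_ + _); first by field; rewrite gt_eqF.
    rewrite big_add1 /= mulr_suml; apply: eq_big_nat => j /andP[_ jn].
    by rewrite cth //; field; rewrite gt_eqF.
  rewrite big_nat [leRHS]big_nat ler_sum // => j /andP[_ jn].
  have /andP[_ h] := stp j; apply: le_trans h _; rewrite !sth ler_wpM2l //.
    by rewrite cth // divr_ge0 ?sqrtr_ge0 ?ltW.
  rewrite (sE j) // lerBlDr /s ge_min; apply/orP; left.
  by rewrite -natr1 mulrDl mul1r addrC.
Qed.

Lemma sum_zrange_even (f : nat -> R) n :
  \sum_(i <- zrange n) f `|i|%N = f 0%N + 2 * \sum_(1 <= j < n.+1) f j.
Proof.
elim: n => [|n IH]; first by rewrite /zrange /= big_seq1 subrr big_geq // mulr0 addr0.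
rewrite (perm_big [:: n.+1%:Z, - n.+1%:Z & zrange n]); last first.
  apply: uniq_perm; first by rewrite uniq_zrange.
    have := mem_zrange n; move: (zrange n) (uniq_zrange n) => z uz mz.
    rewrite !cons_uniq uz andbT !inE !mz; lia.
  move=> i; have := mem_zrange n i; move: (zrange n) => z mz.
  rewrite [LHS]mem_zrange !in_cons mz; lia.
rewrite 2!big_cons IH abszN absz_nat [in RHS]big_nat_recr //=; ring.
Qed.

Lemma sqrt_nat_sqr T : Num.sqrt (T%:R : R) ^+ 2 = T%:R.
Proof. by rewrite sqr_sqrtr. Qed.

Lemma lat1_bound T : `|(lat 1 T)%:R - 2 * Num.sqrt T%:R| <= 1 :> R.
Proof.
have [r /andP[rT Tr] ->] := lat1_bounds T.
have h1 : r%:R <= Num.sqrt T%:R :> R.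
  rewrite -ler_sqr ?nnegrE ?sqrtr_ge0 // sqrt_nat_sqr -natrX ler_nat //.
have h2 : Num.sqrt T%:R <= r.+1%:R :> R.
  rewrite -ler_sqr ?nnegrE ?sqrtr_ge0 // sqrt_nat_sqr -natrX ler_nat ltnW //.
rewrite -natr1 natrM ler_norml; rewrite -natr1 in h2; lra.
Qed.

(** The disc is cut by vertical lines through the integers. Each line carries [2 * sqrt (T - i ^ 2)]
    points up to 1, there are at most [2 * sqrt T + 1] lines, and [quarter_disc_sum] sums the chords
    up to another [2 * sqrt T]. *)
Lemma lat2_bound T : `|(lat 2 T)%:R - pi * T%:R| <= 4 * Num.sqrt T%:R + 1 :> R.
Proof.
case: (posnP T) => [->|T0].
  rewrite /lat mulr0 subr0 sqrtr0 mulr0 add0r /=.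
  rewrite ger0_norm ?ler0n // -[leRHS]/(1%:R) ler_nat addn0.
  exact: leq_b1.
have [r /andP[rT Tr] _] := lat1_bounds T.
set x := Num.sqrt (T%:R : R).
have x0 : 0 < x by rewrite sqrtr_gt0 ltr0n.
have x2 : x ^+ 2 = T%:R by rewrite sqrt_nat_sqr.
have h1 : r%:R <= x.
  by rewrite -ler_sqr ?nnegrE ?sqrtr_ge0 // sqrt_nat_sqr -natrX ler_nat.
have h2 : x < r.+1%:R.
  by rewrite -ltr_sqr ?nnegrE ?sqrtr_ge0 // sqrt_nat_sqr -natrX ltr_nat.
have /andP[q1 q2] := quarter_disc_sum x0 h1 h2.
rewrite (lat_cons _ Tr) natr_sum.
pose f j : R := 2 * Num.sqrt (x ^+ 2 - j%:R ^+ 2).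
have sf : \sum_(i <- zrange r) f `|i|%N = 2 * x + 4 * \sum_(1 <= j < r.+1) Num.sqrt (x ^+ 2 - j%:R ^+ 2).
  rewrite sum_zrange_even /f -mulr_sumr expr0n subr0 sqrtr_sqr gtr0_norm //; ring.
have b : `|\sum_(i <- zrange r | (`|i| ^ 2 <= T)%N) (lat 1 (T - `|i| ^ 2))%:R -
    \sum_(i <- zrange r) f `|i|%N| <= (2 * r).+1%:R.
  have -> : \sum_(i <- zrange r | (`|i| ^ 2 <= T)%N) ((lat 1 (T - `|i| ^ 2))%:R : R) =
      \sum_(i <- zrange r) (lat 1 (T - `|i| ^ 2))%:R.
    rewrite big_seq_cond [RHS]big_seq_cond; apply: eq_bigl => i.
    by rewrite andbT mem_zrange; case: leqP => //= ir; rewrite (leq_trans _ rT) // leq_sqr.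
  rewrite -sumrB (le_trans (ler_norm_sum _ _ _)) //.
  have -> : (2 * r).+1%:R = \sum_(i <- zrange r) (1 : R).
    by rewrite big_const_seq count_predT size_map size_iota iter_addr_0.
  rewrite big_seq [leRHS]big_seq; apply: ler_sum => i; rewrite mem_zrange => ir.
  rewrite /f x2 -natrX -natrB ?lat1_bound //.
  by rewrite (leq_trans _ rT) // leq_sqr.
have br : (2 * r).+1%:R = 2 * r%:R + 1 :> R by rewrite -natr1 natrM.
rewrite sf br in b.
move: b; rewrite !ler_norml x2 => /andP[b1 b2]; rewrite x2 in q1 q2.
by apply/andP; split; lra.
Qed.

(** Summation over shells: the difference counts the points with [sqn u = V]. The case [V = 0] is
    singled out because [0.-1] is again 0. *)
Lemma lat_delta d U M : (U <= M)%N ->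
  (lat d U = \sum_(V < M.+1) (lat d V - (if V == 0 :> nat then 0 else lat d V.-1)) * (V <= U))%N.
Proof.
move=> UM; rewrite -(big_mkord xpredT (fun V => (lat d V - (if V == 0%N then 0 else lat d V.-1)) * (V <= U))%N).
rewrite (big_cat_nat (n := U.+1)) //= [X in (_ + X)%N]big_nat_cond [X in (_ + X)%N]big1.
  rewrite addn0; elim: U {UM} => [|U IH]; first by rewrite big_nat1 subn0 muln1.
  rewrite big_nat_recr //= leqnn muln1 -[LHS](subnKC (lat_mono d (leqnSn U))).
  congr addn; rewrite {1}IH big_nat [RHS]big_nat; apply: eq_bigr => V /andP[_ VU].
  by move: VU; rewrite ltnS => VU; rewrite VU (leq_trans VU).
by move=> V /andP[/andP[UV _] _]; rewrite leqNgt UV muln0.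
Qed.

Lemma lat_conv d T : lat d.+2 T =
  (\sum_(V < T.+1) (lat d V - (if V == 0 :> nat then 0 else lat d V.-1)) * lat 2 (T - V))%N.
Proof.
have TT : (T < T.+1 ^ 2)%N by rewrite -mulnn; nia.
have e2 (e U : nat) : (U <= T)%N -> lat e.+2 U = (\sum_(i <- zrange T) \sum_(j <- zrange T)
    if (`|i| ^ 2 + `|j| ^ 2 <= U)%N then lat e (U - (`|i| ^ 2 + `|j| ^ 2)) else 0)%N.
  move=> UT; rewrite (@lat_cons _ _ T); last by lia.
  rewrite big_mkcond /=; apply: eq_bigr => i _; case: leqP => iU.
    rewrite (@lat_cons _ _ T); last by lia.
    rewrite big_mkcond /=; apply: eq_bigr => j _.
    by rewrite leq_subRL // subnDA.
  by rewrite big1 // => j _; rewrite leqNgt (leq_trans iU) // leq_addr.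
rewrite e2 //.
under [RHS]eq_bigr => V _ do rewrite (e2 0%N (T - V)%N (leq_subr _ _)) big_distrr /=.
rewrite [RHS]exchange_big; apply: eq_bigr => i _.
under [RHS]eq_bigr => V _ do rewrite big_distrr /=.
rewrite [RHS]exchange_big; apply: eq_bigr => j _.
case: leqP => ijT.
  rewrite (lat_delta d (leq_subr (`|i| ^ 2 + `|j| ^ 2) T)); apply: eq_bigr => V _.
  rewrite !lat0; congr muln; have := ltn_ord V.
  set q := (_ + _)%N in ijT *; move: (V : nat) => v vT.
  by case: (leqP v (T - q)); case: (leqP q (T - v)); lia.
rewrite big1 // => V _; have -> : (`|i| ^ 2 + `|j| ^ 2 <= T - V)%N = false by lia.
by rewrite muln0.
Qed.

(** In [lat_conv], which sums over Z^2 times the shells of Z^d, replace [lat 2 (T - V)] by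
    [pi * (T - V)] and sum by parts. This is the recursion that makes [ball_vol] proceed by steps of
    2. *)
Lemma lat_step d T :
  `|(lat d.+2 T)%:R - pi * \sum_(U < T) (lat d U)%:R| <=
  (4 * Num.sqrt T%:R + 1) * (lat d T)%:R :> R.
Proof.
pose de V := (lat d V - (if V == 0 then 0 else lat d V.-1))%N.
have -> : \sum_(U < T) (lat d U)%:R = \sum_(V < T.+1) (de V)%:R * (T - V)%:R :> R.
  rewrite (eq_bigr (fun U : 'I_T => \sum_(V < T.+1) (de V)%:R * ((V <= U)%N)%:R)); last first.
    by move=> U _; rewrite (lat_delta d (ltnW (ltn_ord U))) natr_sum; under eq_bigr do rewrite natrM.
  rewrite exchange_big; apply: eq_bigr => V _; rewrite -mulr_sumr; congr (_ * _).
  rewrite -natr_sum; congr (_%:R); rewrite -(big_mkord xpredT (fun U => nat_of_bool (V <= U)%N)).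
  rewrite (big_cat_nat (n := V)) //=; last by rewrite -ltnS.
  rewrite big_nat_cond big1 ?add0n; last first.
    by move=> i; rewrite andbT => /andP[_ iV]; rewrite leqNgt iV.
  rewrite big_nat_cond (eq_bigr (fun=> 1%N)) => [|i]; last by rewrite andbT => /andP[-> _].
  by rewrite -big_nat_cond sum_nat_const_nat muln1.
rewrite lat_conv natr_sum mulr_sumr -sumrB (le_trans (ler_norm_sum _ _ _)) //.
have -> : (lat d T)%:R = \sum_(V < T.+1) (de V)%:R :> R.
  rewrite (lat_delta d (leqnn T)) natr_sum; apply: eq_bigr => V _.
  by rewrite -ltnS ltn_ord muln1.
rewrite mulr_sumr ler_sum // => V _.
rewrite natrM -/(de V) (_ : _ - _ = (de V)%:R * ((lat 2 (T - V))%:R - pi * (T - V)%:R)); last by ring.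
rewrite normrM ger0_norm ?ler0n // mulrC ler_wpM2r ?ler0n //.
rewrite (le_trans (lat2_bound _)) // lerD2r ler_pM2l ?ltr0n // ler_wsqrtr //.
by rewrite ler_nat leq_subr.
Qed.

(** Mean value inequality for the power [p / 2 + 1] in the variable [x ^ 2]. The induction goes by
    steps of 2, so that only integral powers of [x] and [y] occur. *)
Lemma pow_diff_bounds (x y : R) p : 0 <= x -> x <= y ->
  p.+2%:R / 2 * x ^+ p * (y ^+ 2 - x ^+ 2) <= y ^+ p.+2 - x ^+ p.+2 <=
  p.+2%:R / 2 * y ^+ p * (y ^+ 2 - x ^+ 2).
Proof.
move=> x0 xy; have y0 : 0 <= y by exact: le_trans xy.
have xy2 : 0 <= y ^+ 2 - x ^+ 2 by nra.
have step q : q.+2%:R / 2 * x ^+ q * (y ^+ 2 - x ^+ 2) <= y ^+ q.+2 - x ^+ q.+2 <=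
    q.+2%:R / 2 * y ^+ q * (y ^+ 2 - x ^+ 2) ->
    q.+4%:R / 2 * x ^+ q.+2 * (y ^+ 2 - x ^+ 2) <= y ^+ q.+4 - x ^+ q.+4 <=
    q.+4%:R / 2 * y ^+ q.+2 * (y ^+ 2 - x ^+ 2).
  set X := x ^+ q; set Y := y ^+ q.
  have -> : x ^+ q.+4 = X * x ^+ 2 * x ^+ 2 by rewrite /X -!exprD addn2 addn2.
  have -> : y ^+ q.+4 = Y * y ^+ 2 * y ^+ 2 by rewrite /Y -!exprD addn2 addn2.
  have -> : x ^+ q.+2 = X * x ^+ 2 by rewrite /X -!exprD addn2.
  have -> : y ^+ q.+2 = Y * y ^+ 2 by rewrite /Y -!exprD addn2.
  have -> : q.+4%:R = q.+2%:R + 2 :> R by rewrite -natrD addn2.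
  have X0 : 0 <= X by rewrite exprn_ge0.
  have Y0 : 0 <= Y by rewrite exprn_ge0.
  have XY : X <= Y by rewrite lerXn2r.
  set c : R := q.+2%:R; have c0 : 0 <= c by rewrite ler0n.
  move: xy2; set u := y ^+ 2; set v := x ^+ 2 => uv /andP[h1 h2].
  have u0 : 0 <= u by rewrite sqr_ge0.
  have v0 : 0 <= v by rewrite sqr_ge0.
  have XvYu : X * v <= Y * u by rewrite ler_pM //; lra.
  apply/andP; split.
  - have t1 : u * (c / 2 * X * (u - v)) <= u * (Y * u - X * v) by rewrite ler_wpM2l.
    have t2 : 0 <= c / 2 * X * (u - v) * (u - v) by rewrite !mulr_ge0.
    nra.
  - have t1 : u * (Y * u - X * v) <= u * (c / 2 * Y * (u - v)) by rewrite ler_wpM2l.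
    have t2 : X * v * (u - v) <= Y * u * (u - v) by rewrite ler_wpM2r.
    nra.
elim/ltn_ind: p => -[_|[_|p IH]].
- by rewrite !expr0 !mulr1 divff // !mul1r lexx.
- rewrite !expr1; apply/andP; split.
    have : 0 <= (y - x) ^+ 2 * (y + x / 2) by rewrite mulr_ge0 ?sqr_ge0 //; nra.
    nra.
  have : 0 <= (y - x) ^+ 2 * (y / 2 + x) by rewrite mulr_ge0 ?sqr_ge0 //; nra.
  nra.
by apply: step; apply: IH; rewrite ltnW.
Qed.

Lemma sum_sqrt_pow d T :
  Num.sqrt (T%:R : R) ^+ d.+2 - d.+2%:R / 2 * Num.sqrt T%:R ^+ d <=
  d.+2%:R / 2 * \sum_(U < T) Num.sqrt U%:R ^+ d <= Num.sqrt (T%:R : R) ^+ d.+2.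
Proof.
have st U : Num.sqrt U%:R <= Num.sqrt U.+1%:R :> R by rewrite ler_wsqrtr // ler_nat.
have pd U : d.+2%:R / 2 * Num.sqrt (U%:R : R) ^+ d <= Num.sqrt U.+1%:R ^+ d.+2 - Num.sqrt U%:R ^+ d.+2 <=
    d.+2%:R / 2 * Num.sqrt (U.+1%:R : R) ^+ d.
  have := pow_diff_bounds d (sqrtr_ge0 (U%:R : R)) (st U).
  by rewrite !sqrt_nat_sqr -natrB // subSnn !mulr1.
have c0 : 0 <= d.+2%:R / 2 :> R by rewrite divr_ge0 ?ler0n.
elim: T => [|T /andP[IH1 IH2]].
  by rewrite big_ord0 mulr0 sqrtr0 expr0n subr_le0 mulr_ge0 ?exprn_ge0 ?lexx.
by rewrite big_ord_recr /= mulrDr; have /andP[h1 h2] := pd T; apply/andP; split; lra.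
Qed.

Lemma pow_small q eta : 0 < eta ->
  exists2 C, 0 <= C & forall p x, (p < q)%N -> 0 <= x -> x ^+ p <= eta * x ^+ q + C.
Proof.
move=> eta0; pose m := Num.max 1 eta^-1; have m1 : 1 <= m by rewrite /m le_max lexx.
exists (m ^+ q) => [|p x pq x0]; first by rewrite exprn_ge0 // (le_trans ler01).
have [xm|mx] := leP x m.
  rewrite ler_wpDl ?mulr_ge0 ?exprn_ge0 ?(ltW eta0) //.
  apply: (@le_trans _ _ (m ^+ p)); first by rewrite lerXn2r ?nnegrE // (le_trans ler01).
  by rewrite ler_weXn2l // ltnW.
have [x1 xe] : 1 < x /\ eta^-1 < x by apply/andP; rewrite -gt_max.
rewrite ler_wpDr ?exprn_ge0 //; first by rewrite (le_trans ler01).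
have -> : q = (p + 1 + (q - p.+1))%N by lia.
rewrite !exprD expr1 -mulrA mulrCA -[leLHS]mulr1 ler_wpM2l ?exprn_ge0 //.
rewrite mulrA (@le_trans _ _ (eta * x)) //.
  by rewrite mulrC -ler_pdivrMr // mul1r ltW.
by rewrite ler_peMr ?mulr_ge0 ?(ltW eta0) // exprn_ege1 // ltW.
Qed.

Lemma ball_vol_ge0 d : 0 <= ball_vol R d.
Proof.
elim/ltn_ind: d => -[|[|d]] IH //=.
by rewrite mulr_ge0 ?IH // divr_ge0 ?mulr_ge0 ?pi_ge0.
Qed.

Lemma ball_vol_gt0 d : 0 < ball_vol R d.
Proof.
elim/ltn_ind: d => -[|[|d]] IH //=.
by rewrite mulr_gt0 ?IH // divr_gt0 ?mulr_gt0 ?pi_gt0.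
Qed.

(** Induction by steps of 2 from dimensions 1 and 2, through [lat_step] and [sum_sqrt_pow]. Only an
    arbitrarily small relative error is kept, not a rate: [pow_small] swallows every lower power of
    [sqrt T]. *)
Lemma lat_asymp d eta : 0 < eta -> exists2 C, 0 <= C & forall T,
  `|(lat d T)%:R - ball_vol R d * Num.sqrt T%:R ^+ d| <= eta * Num.sqrt T%:R ^+ d + C.
Proof.
case: d => [|d] in eta *.
  by move=> e0; exists 0 => // T; rewrite lat0 mulr1 subrr normr0 addr0 mulr1 ltW.
elim/ltn_ind: d eta => -[_|[_|d IH]] eta eta0.
- exists 1 => // T; rewrite expr1 (le_trans (lat1_bound T)) // lerDr.
  by rewrite mulr_ge0 ?sqrtr_ge0 ?ltW.
- have [C C0 hC] := pow_small 2 (divr_gt0 eta0 (ltr0n _ 4)).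
  exists (4 * C + 1) => [|T]; first by rewrite addr_ge0 ?mulr_ge0.
  have -> : ball_vol R 2 = pi by rewrite /=; field.
  rewrite {1}sqrt_nat_sqr (le_trans (lat2_bound T)) //.
  have := hC 1%N _ isT (sqrtr_ge0 (T%:R : R)); rewrite expr1; lra.
set D := d.+1.
pose w := ball_vol R D; have w0 : 0 <= w := ball_vol_ge0 D.
have pi0 := pi_gt0 R.
pose e1 := eta / (2 * pi); have e10 : 0 < e1 by rewrite divr_gt0 ?mulr_gt0.
have [C C0 hC] := IH d (leqnSn _) _ e10.
(* Sum of the coefficients of the powers of [x] below [x ^+ D.+2] in [h9]. Applying [pow_small] with
   [eta / (2 * (K + 1))] makes all of them together cost at most half of [eta]. *)
pose K := pi * C + 4 * (w + e1) + (w + e1) + 4 * C + pi * w.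
have we : 0 <= w + e1 by rewrite addr_ge0 // ltW.
have K0 : 0 <= K by rewrite /K; nneg.
have [B B0 hB] := pow_small D.+2 (divr_gt0 eta0 (mulr_gt0 (ltr0n _ 2) (ltr_wpDl K0 ltr01))).
exists (K * B + C) => [|T]; first by rewrite addr_ge0 ?mulr_ge0.
have h1 := lat_step D T; have h2 := hC T; have /andP[h3 h4] := sum_sqrt_pow D T.
have h5 : `|\sum_(U < T) (lat D U)%:R - w * \sum_(U < T) Num.sqrt U%:R ^+ D| <=
    e1 * (\sum_(U < T) Num.sqrt U%:R ^+ D) + C * T%:R.
  rewrite mulr_sumr -sumrB (le_trans (ler_norm_sum _ _ _)) //.
  have -> : C * T%:R = \sum_(U < T) C by rewrite sumr_const card_ord mulr_natr.
  by rewrite mulr_sumr -big_split /= ler_sum.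
have S0 : 0 <= \sum_(U < T) Num.sqrt U%:R ^+ D :> R by rewrite sumr_ge0 // => U _; rewrite exprn_ge0.
rewrite -(sqrt_nat_sqr T) in h5.
move: h1 h2 h3 h4 h5 S0; rewrite -/w.
set L := \sum_(U < T) _; set S := \sum_(U < T) _; set x := Num.sqrt _.
set l := (lat D T)%:R; set l2 := (lat D.+2 T)%:R.
have x0 : 0 <= x := sqrtr_ge0 _.
have b2 := hB 2%N x isT x0; have b1 := hB 1%N x isT x0.
have bD := hB D x (leqnSn _) x0; have bD1 := hB D.+1 x (leqnn _) x0; rewrite expr1 in b1.
have -> : ball_vol R D.+2 = 2 * pi / D.+2%:R * w by [].
have k1 : 1 <= D.+2%:R / 2 :> R by rewrite ler_pdivlMr // mul1r ler_nat.
have kN : D.+2%:R != 0 :> R by rewrite pnatr_eq0.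
move: k1; set k := D.+2%:R / 2; rewrite (_ : 2 * pi / D.+2%:R * w = pi * w / k); last first.
  by rewrite /k; move: kN; set kk : R := D.+2%:R => kN; field.
have xD : x ^+ D.+1 = x * x ^+ D by rewrite exprS.
move: b2 b1 bD bD1; rewrite xD; set X := x ^+ D.+2; set Y := x ^+ D.
have X0 : 0 <= X by rewrite exprn_ge0.
have Y0 : 0 <= Y by rewrite exprn_ge0.
set z := eta / _; have zK : K * z <= eta / 2.
  rewrite /z invfM mulrA mulrA ler_pdivrMr ?ltr_wpDl //; lra.
move=> b2 b1 bD bD1 k1 h1 h2 h3 h4 h5 S0.
have k0 : 0 < k by exact: lt_le_trans k1.
have SX : S <= X by apply: le_trans h4; rewrite ler_peMl.
have h6 : `|pi * w * S - pi * w / k * X| <= pi * w * Y.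
  rewrite (_ : _ - _ = pi * w * (S - X / k)); last by ring.
  rewrite normrM (ger0_norm (mulr_ge0 (ltW pi0) w0)).
  apply: ler_wpM2l; first by nneg.
  have -> : S - X / k = (k * S - X) / k by field; rewrite gt_eqF.
  rewrite normrM (gtr0_norm (x := k^-1)) ?invr_gt0 // ler_pdivrMr // ler_norml; nra.
have h7 : `|pi * L - pi * w * S| <= pi * (e1 * X + C * x ^+ 2).
  rewrite (_ : _ - _ = pi * (L - w * S)); last by ring.
  rewrite normrM gtr0_norm // ler_wpM2l ?(ltW pi0) // (le_trans h5) // lerD2r.
  by apply: ler_wpM2l => //; nneg.
have h8 : (4 * x + 1) * l <= (4 * x + 1) * ((w + e1) * Y + C).
  rewrite ler_wpM2l ?addr_ge0 ?mulr_ge0 //; move: h2; rewrite ler_norml; lra.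
have pe : pi * e1 = eta / 2 by rewrite /e1 invfM (mulrA eta) mulrCA divff ?mulr1 // lt0r_neq0.
have h9 : `|l2 - pi * w / k * X| <= eta / 2 * X +
    (pi * C * x ^+ 2 + 4 * (w + e1) * (x * Y) + (w + e1) * Y + 4 * C * x + pi * w * Y) + C.
  have -> : l2 - pi * w / k * X = (l2 - pi * L) + (pi * L - pi * w * S) + (pi * w * S - pi * w / k * X).
    by ring.
  rewrite (le_trans (ler_normD _ _)) // (le_trans (lerD (ler_normD _ _) (lexx _))) //.
  have h12 := le_trans h1 h8.
  have pX : pi * (e1 * X + C * x ^+ 2) = eta / 2 * X + pi * C * x ^+ 2 by rewrite -pe; ring.
  rewrite pX in h7; clear -h6 h7 h12; lra.
rewrite (le_trans h9) //.
have h10 : pi * C * x ^+ 2 + 4 * (w + e1) * (x * Y) + (w + e1) * Y + 4 * C * x + pi * w * Y <=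
    K * (z * X + B).
  set Z := z * X + B in b2 b1 bD bD1 *.
  have t1 : pi * C * x ^+ 2 <= pi * C * Z by apply: ler_wpM2l => //; nneg.
  have t2 : 4 * (w + e1) * (x * Y) <= 4 * (w + e1) * Z by rewrite ler_wpM2l // mulr_ge0.
  have t3 : (w + e1) * Y <= (w + e1) * Z by rewrite ler_wpM2l.
  have t4 : 4 * C * x <= 4 * C * Z by rewrite ler_wpM2l // mulr_ge0.
  have t5 : pi * w * Y <= pi * w * Z by apply: ler_wpM2l => //; nneg.
  rewrite /K; clear -t1 t2 t3 t4 t5; lra.
have h11 : K * z * X <= eta / 2 * X by rewrite ler_wpM2r.
clear -h10 h11; lra.
Qed.

End LatticeCount.

(** * Hausdorff content and measure *)

Section HausdorffMeasure.
Context {R : realType}.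
Local Open Scope ereal_scope.

Section Content.
Context {n d : nat}.
Implicit Types (A B : set 'rV[R]_n) (delta : R).

Definition small delta (E : set 'rV[R]_n) := forall x y, E x -> E y -> (enorm (x - y) <= delta)%R.

Lemma diam_small delta (E : set 'rV[R]_n) x y : small delta E -> E x -> E y -> (enorm (x - y) <= diam E)%R.
Proof.
move=> sE Ex Ey; apply: ub_le_sup; last by exists x, y.
by exists delta => r [a [b [Ea Eb ->]]]; exact: sE.
Qed.

Lemma diam_le delta (E : set 'rV[R]_n) : (0 <= delta)%R -> small delta E -> (diam E <= delta)%R.
Proof.
move=> d0 sE; have [[x Ex]|/nonemptyPn ->] := pselect (E !=set0); last first.
  by rewrite /diam (_ : [set _ | _] = set0) ?sup0 // -subset0 => r [x [y []]].
apply: ge_sup; first by exists (enorm (x - x)), x, x.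
by move=> r [a [b [Ea Eb ->]]]; exact: sE.
Qed.

Lemma diam_ge0 (E : set 'rV[R]_n) : (0 <= diam E)%R.
Proof.
have [[x Ex]|/nonemptyPn ->] := pselect (E !=set0); last first.
  by rewrite /diam (_ : [set _ | _] = set0) ?sup0 // -subset0 => r [x [y []]].
have [ub|nub] := pselect (has_ubound [set r | exists x y, [/\ E x, E y & r = enorm (x - y)]]).
  by apply: ub_le_sup => //; exists x, x; rewrite subrr enorm0.
(* An unbounded set has diameter 0, the default value of [sup]; the sets of a [cover] are [small],
   hence bounded. *)
by rewrite /diam sup_out // => -[].
Qed.

Lemma gauge_ge0 (E : set 'rV[R]_n) : (0 <= hausdorff_gauge d E)%R.
Proof.
rewrite /hausdorff_gauge; case: ifP => // _.
by apply: mulr_ge0; [exact: ball_vol_ge0|rewrite exprn_ge0 ?divr_ge0 ?diam_ge0].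
Qed.

Lemma gauge0 : hausdorff_gauge d (set0 : set 'rV[R]_n) = 0%R.
Proof. by rewrite /hausdorff_gauge eqxx. Qed.

Lemma gauge_le delta (E : set 'rV[R]_n) : (0 <= delta)%R -> small delta E ->
  (hausdorff_gauge d E <= ball_vol R d * (delta / 2) ^+ d)%R.
Proof.
move=> d0 sE; rewrite /hausdorff_gauge; case: ifP => _.
  by apply: mulr_ge0; [exact: ball_vol_ge0|rewrite exprn_ge0 ?divr_ge0].
by rewrite ler_wpM2l ?ball_vol_ge0 // lerXn2r ?nnegrE ?divr_ge0 ?diam_ge0 // ler_pM2r ?invr_gt0 // diam_le.
Qed.

Definition cover delta A (E : nat -> set 'rV[R]_n) :=
  A `<=` \bigcup_i E i /\ forall i, small delta (E i).

Lemma content_le delta A E : cover delta A E ->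
  hausdorff_content d delta A <= \sum_(0 <= i <oo) (hausdorff_gauge d (E i))%:E.
Proof. by move=> [AE sE]; apply: ereal_inf_lbound; exists E. Qed.

Lemma content_ge delta A (c : \bar R) :
  (forall E, cover delta A E -> c <= \sum_(0 <= i <oo) (hausdorff_gauge d (E i))%:E) ->
  c <= hausdorff_content d delta A.
Proof. by move=> h; apply: le_ereal_inf_tmp => _ [E cE <-]; exact: h. Qed.

Lemma content_ge0 delta A : 0 <= hausdorff_content d delta A.
Proof.
by apply: content_ge => E _; apply: nneseries_ge0 => i _ _; rewrite lee_fin gauge_ge0.
Qed.

Lemma content_hvol delta A : (0 < delta)%R -> hausdorff_content d delta A <= hvol d A.
Proof. by move=> d0; apply: ereal_sup_ubound; exists delta. Qed.

Lemma hvol_le A (c : \bar R) :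
  (forall delta, (0 < delta)%R -> hausdorff_content d delta A <= c) -> hvol d A <= c.
Proof. by move=> h; apply: ge_ereal_sup => _ [delta d0 <-]; exact: h. Qed.

Lemma hvol_ge0 A : 0 <= hvol d A.
Proof. exact: le_trans (content_ge0 1 A) (content_hvol _ _). Qed.

Lemma content_mono delta A B : A `<=` B ->
  hausdorff_content d delta A <= hausdorff_content d delta B.
Proof.
move=> AB; apply: content_ge => E [BE sE]; apply: content_le; split => //.
exact: subset_trans BE.
Qed.

Lemma hvol_mono A B : A `<=` B -> hvol d A <= hvol d B.
Proof.
move=> AB; apply: hvol_le => delta d0.
exact: le_trans (content_mono delta AB) (content_hvol _ d0).
Qed.

Lemma sum_gauge_le (E : nat -> set 'rV[R]_n) (c : \bar R) :
  (forall N, \sum_(0 <= i < N) (hausdorff_gauge d (E i))%:E <= c) ->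
  \sum_(0 <= i <oo) (hausdorff_gauge d (E i))%:E <= c.
Proof.
move=> h; apply: lime_le; last by apply: nearW.
by apply: is_cvg_nneseries => i _ _; rewrite lee_fin gauge_ge0.
Qed.

Lemma sum_gauge_ge (E : nat -> set 'rV[R]_n) N :
  \sum_(0 <= i < N) (hausdorff_gauge d (E i))%:E <=
  \sum_(0 <= i <oo) (hausdorff_gauge d (E i))%:E.
Proof. by apply: nneseries_lim_ge => i _; rewrite lee_fin gauge_ge0. Qed.

Lemma content_small delta A (E : set 'rV[R]_n) : A `<=` E -> small delta E ->
  hausdorff_content d delta A <= (hausdorff_gauge d E)%:E.
Proof.
move=> AE sE; pose F i := if i == 0%N then E else set0.
apply: le_trans (content_le (E := F) _) _.
  by split=> [x /AE Ex|[|i]] //; exists 0%N.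
apply: sum_gauge_le => -[|N]; first by rewrite big_geq // lee_fin gauge_ge0.
rewrite big_nat_recl // big1 ?adde0 // => i _.
by rewrite /F /= gauge0.
Qed.

Lemma content0 delta : hausdorff_content d delta (set0 : set 'rV[R]_n) = 0.
Proof.
apply/eqP; rewrite eq_le content_ge0 andbT (le_trans (content_small (@subset_refl _ set0) _)) ?gauge0 //.
Qed.

Lemma contentU delta A B : hausdorff_content d delta (A `|` B) <=
  hausdorff_content d delta A + hausdorff_content d delta B.
Proof.
have [->|finB] := eqVneq (hausdorff_content d delta B) +oo.
  by rewrite addey ?leey // gt_eqF // (lt_le_trans _ (content_ge0 _ _)) // ltNyr.
have [->|finA] := eqVneq (hausdorff_content d delta A) +oo.
  by rewrite addye ?leey // gt_eqF // (lt_le_trans _ (content_ge0 _ _)) // ltNyr.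
have fA : hausdorff_content d delta A \is a fin_num by rewrite ge0_fin_numE ?content_ge0 // ltey.
have fB : hausdorff_content d delta B \is a fin_num by rewrite ge0_fin_numE ?content_ge0 // ltey.
apply/lee_addgt0Pr => e e0.
have e20 : (0 < e / 2)%R by rewrite divr_gt0.
have [_ [E [AE sE] <-] hE] := lb_ereal_inf_adherent e20 fA.
have [_ [F [BF sF] <-] hF] := lb_ereal_inf_adherent e20 fB.
pose G i := if odd i then F i./2 else E i./2.
apply: le_trans (content_le (E := G) _) _.
  split=> [x [/AE[i _ Ei]|/BF[i _ Fi]]|i].
  - by exists i.*2 => //; rewrite /G odd_double doubleK.
  - by exists i.*2.+1 => //; rewrite /G /= odd_double /= uphalf_double.
  - by rewrite /G; case: ifP => _; [exact: sF|exact: sE].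
apply: sum_gauge_le => N.
have step M : \sum_(0 <= i < M.*2) (hausdorff_gauge d (G i))%:E =
    \sum_(0 <= i < M) (hausdorff_gauge d (E i))%:E + \sum_(0 <= i < M) (hausdorff_gauge d (F i))%:E.
  elim: M => [|M IH]; first by rewrite !big_geq // adde0.
  rewrite doubleS !big_nat_recr //= IH /G /= odd_double /= doubleK uphalf_double.
  by rewrite -!addeA; congr (_ + _); rewrite addeCA.
have NN : \sum_(0 <= i < N) (hausdorff_gauge d (G i))%:E <= \sum_(0 <= i < N.*2) (hausdorff_gauge d (G i))%:E.
  rewrite (big_cat_nat (n := N) (p := N.*2)) //=; last by rewrite -addnn leq_addr.
  by rewrite leeDl // sume_ge0 // => i _; rewrite lee_fin gauge_ge0.
rewrite (le_trans NN) // step (le_trans (leeD (sum_gauge_ge E N) (sum_gauge_ge F N))) //.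
rewrite [e in leRHS]splitr EFinD addeACA; apply: leeD; exact: ltW.
Qed.

Lemma content_bigU delta (T : eqType) (s : seq T) (F : T -> set 'rV[R]_n) A :
  (forall x, A x -> exists2 i, i \in s & F i x) ->
  hausdorff_content d delta A <= \sum_(i <- s) hausdorff_content d delta (F i).
Proof.
elim: s A => [|i s IH] A AF.
  rewrite big_nil (_ : A = set0) ?content0 // -subset0 => x /AF[i].
  by rewrite in_nil.
rewrite big_cons; apply: le_trans (content_mono delta (B := F i `|` (A `\` F i)) _) _.
  by move=> x Ax; have [Fx|nFx] := pselect (F i x); [left|right].
apply: le_trans (contentU _ _ _) _; rewrite leeD2l //; apply: IH => x [/AF[j]].
by rewrite inE => /orP[/eqP->|js Fjx _] //; exists j.
Qed.

Lemma hvol_bigU (T : eqType) (s : seq T) (F : T -> set 'rV[R]_n) A :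
  (forall x, A x -> exists2 i, i \in s & F i x) ->
  hvol d A <= \sum_(i <- s) hvol d (F i).
Proof.
move=> AF; apply: hvol_le => delta d0; apply: le_trans (content_bigU delta AF) _.
by apply: lee_sum => i _; exact: content_hvol.
Qed.

End Content.

(** The image of a cover by sets of diameter at most [delta / K] is a cover by sets of diameter at
    most [delta], and gauges grow by at most [K ^+ d]. Every comparison between a manifold and its
    tangent spaces goes through this. *)
Lemma hvol_lip n p d (f : 'rV[R]_n -> 'rV[R]_p) (K : R) (A : set 'rV[R]_n) :
  (0 < K)%R -> (forall x y, A x -> A y -> (enorm (f x - f y) <= K * enorm (x - y))%R) ->
  hvol d (f @` A) <= (K ^+ d)%:E * hvol d A.
Proof.
move=> K0 lip; have Kd : (0 < K ^+ d)%R by rewrite exprn_gt0.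
apply: hvol_le => delta d0.
have dK : (0 < delta / K)%R by rewrite divr_gt0.
apply: (@le_trans _ _ ((K ^+ d)%:E * hausdorff_content d (delta / K) A)); last first.
  by rewrite lee_pmul2l // content_hvol.
rewrite -lee_pdivrMl //; apply: content_ge => E [AE sE]; rewrite lee_pdivrMl //.
pose F i := f @` (E i `&` A).
apply: le_trans (content_le (E := F) _) _.
  split=> [_ [x Ax <-]|i _ _ [x [Ex Ax] <-] [y [Ey Ay] <-]].
    by have [i _ Ei] := AE _ Ax; exists i => //; exists x.
  apply: le_trans (lip _ _ Ax Ay) _.
  by have := sE i _ _ Ex Ey; rewrite ler_pdivlMr // mulrC.
have g i : (hausdorff_gauge d (F i) <= K ^+ d * hausdorff_gauge d (E i))%R.
  have [E0|/set0P[x Ex]] := eqVneq (E i) set0.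
    by rewrite /F E0 set0I image_set0 gauge0 mulr_ge0 ?gauge_ge0 // ltW.
  rewrite [X in (_ <= _ * X)%R]/hausdorff_gauge ifF; last first.
    by apply/negbTE/set0P; exists x.
  apply: (@le_trans _ _ (ball_vol R d * (K * diam (E i) / 2) ^+ d)%R).
    apply: gauge_le; first by rewrite mulr_ge0 ?diam_ge0 // ltW.
    move=> _ _ [y [Ey Ay] <-] [z [Ez Az] <-]; apply: le_trans (lip _ _ Ay Az) _.
    by rewrite ler_pM2l //; apply: diam_small (sE i) Ey Ez.
  by rewrite -mulrA exprMn mulrCA.
apply: sum_gauge_le => N; apply: (@le_trans _ _ ((K ^+ d)%:E * \sum_(0 <= i < N) (hausdorff_gauge d (E i))%:E)).
  rewrite ge0_sume_distrr; last by move=> i _; rewrite lee_fin gauge_ge0.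
  by apply: lee_sum => i _; rewrite -EFinM lee_fin.
by rewrite lee_pmul2l // sum_gauge_ge.
Qed.

End HausdorffMeasure.

(** * Hausdorff measure of Euclidean balls *)

Section BallVolume.
Context {R : realType}.

Definition vR d (v : 'rV[int]_d) : 'rV[R]_d := \row_i (v ord0 i)%:~R.

Lemma enorm_vR d (v : 'rV[int]_d) : enorm (vR v) ^+ 2 = (sqn v)%:R.
Proof.
rewrite enorm_sqr /sqn natr_sum; apply: eq_bigr => i _.
by rewrite !mxE -expr2 natrX natr_absz intr_norm real_normK ?num_real.
Qed.

Lemma vRD d (u v : 'rV[int]_d) : vR (u + v) = vR u + vR v.
Proof. by apply/rowP => i; rewrite !mxE intrD. Qed.

Lemma vRB d (u v : 'rV[int]_d) : vR (u - v) = vR u - vR v.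
Proof. by apply/rowP => i; rewrite !mxE intrB. Qed.

Lemma enorm_le_sup d (x : 'rV[R]_d) c : 0 <= c -> (forall i, `|x ord0 i| <= c) ->
  enorm x <= d%:R * c.
Proof.
move=> c0 xc; rewrite (le_trans (enorm_le_norm x)) // ler_wpM2l ?ler0n //.
rewrite /Num.norm /= mx_normrE; apply: bigmax_le => // -[i j] _ /=.
by rewrite ord1.
Qed.

Lemma enorm_unit_step d (e : 'rV[int]_d) : unit_step e -> enorm (vR e) <= d%:R.
Proof.
move=> he; rewrite -[d%:R]mulr1; apply: enorm_le_sup => // i.
by rewrite mxE; case/orP: (he i) => /eqP->; rewrite ?normr0 ?normr1.
Qed.

Lemma size_box d J : size (box d J) = ((2 * J).+1 ^ d)%N.
Proof.
elim: d => // d IH.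
have -> : size (box d.+1 J) = (size (zrange J) * size (box d J))%N by exact: size_allpairs.
by rewrite IH size_map size_iota expnS.
Qed.

Lemma count_lat d K T : (count (fun v => sqn v <= T)%N (box d K) <= lat d T)%N.
Proof.
rewrite /lat -!size_filter; apply: uniq_leq_size; first by rewrite filter_uniq ?uniq_box.
move=> u; rewrite !mem_filter => /andP[uT _]; rewrite uT /= mem_box.
by apply/forallP => i; have := coord_sqn u i; nia.
Qed.

Lemma continuous_exprn (f : R -> R) x n : {for x, continuous f} ->
  {for x, continuous (fun y => f y ^+ n)}.
Proof.
move=> fc; exact: (continuous_comp fc (@exprn_continuous R n (f x))).
Qed.

Lemma poly_near0 (f : R -> R) c : {for 0, continuous f} -> f 0 < c ->
  exists k0 : nat, forall k, (k0 <= k)%N -> (0 < k)%N -> f k%:R^-1 <= c.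
Proof.
move=> fc f0; have : nbhs (f 0) [set y | y < c].
  by apply: open_nbhs_nbhs; split=> //; exact: open_lt.
move=> /fc /nbhs_ballP[e /= e0 he].
exists (Num.truncn e^-1).+1 => k ke k0; apply: ltW; apply: he.
rewrite /ball /= sub0r normrN gtr0_norm ?invr_gt0 ?ltr0n //.
rewrite invf_plt ?posrE ?ltr0n // (lt_le_trans _ (_ : (Num.truncn e^-1).+1%:R <= _)) ?ler_nat //.
have ei : 0 <= e^-1 by rewrite invr_ge0 ltW.
by case/andP: (truncn_itv ei).
Qed.

(** These are points of the lattice k^-1 Z^d in a ball of radius [t], after scaling by [k]. The
    summand [d%:R], left over from a [unit_step], becomes negligible against [k]. *)
Lemma count_upper d (t eta : R) : 0 <= t -> 0 < eta ->
  exists k0 : nat, forall k K, (k0 <= k)%N -> (0 < k)%N ->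
  (count (fun v => (sqn v)%:R <= (k%:R * t + d%:R) ^+ 2) (box d K))%:R <=
  (ball_vol R d * t ^+ d + eta) * k%:R ^+ d.
Proof.
move=> t0 eta0; case: d => [|d].
  exists 0%N => k K _ _; rewrite !expr0 !mulr1.
  apply: (@le_trans _ _ 1%:R); last by rewrite /=; lra.
  by rewrite ler_nat (leq_trans (count_size _ _)).
set D := d.+1; have w0 : 0 <= ball_vol R D := ball_vol_ge0 D; set w := ball_vol R D.
pose e1 := eta / (2 * (t ^+ D + 1)); have tD : 0 <= t ^+ D by rewrite exprn_ge0.
have e10 : 0 < e1 by rewrite divr_gt0 // mulr_gt0 // ltr_wpDl.
have [C C0 hC] := lat_asymp D e10.
pose f s := (w + e1) * (t + D%:R * s) ^+ D + C * s ^+ D.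
have [k0 hk0] : exists k0 : nat, forall k, (k0 <= k)%N -> (0 < k)%N -> f k%:R^-1 <= w * t ^+ D + eta.
  apply: poly_near0.
    have cX : {for 0, continuous (fun s : R => s)} by [].
    apply: continuousD; apply: continuousM; try exact: cst_continuous.
      apply: continuous_exprn; apply: continuousD; first exact: cst_continuous.
      by apply: continuousM; [exact: cst_continuous|].
    exact: (@continuous_exprn id).
  rewrite /f mulr0 addr0 expr0n /= mulr0 addr0 mulrDl ltrD2l /e1.
  rewrite mulrAC ltr_pdivrMr ?mulr_gt0 ?ltr_wpDl // ltr_pM2l //; lra.
exists k0 => k K kk k1; have kR : 0 < k%:R :> R by rewrite ltr0n.
set r := k%:R * t + D%:R; have r0 : 0 <= r by rewrite addr_ge0 ?mulr_ge0 ?ler0n.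
have /andP[T1 T2] := truncn_itv (sqr_ge0 r); set T := Num.truncn (r ^+ 2) in T1 T2.
have hc : (count (fun v => (sqn v)%:R <= r ^+ 2 :> R)%R (box D K) <= lat D T)%N.
  apply: leq_trans (count_lat D K T); apply: sub_count => v /= vr.
  by rewrite -ltnS -(ltr_nat R) (le_lt_trans vr).
rewrite (le_trans (_ : _ <= (lat D T)%:R)) ?ler_nat //.
have sT : Num.sqrt T%:R <= r.
  by rewrite -ler_sqr ?nnegrE ?sqrtr_ge0 // sqr_sqrtr ?ler0n.
have h1 : (lat D T)%:R <= (w + e1) * Num.sqrt T%:R ^+ D + C.
  by move: (hC T); rewrite ler_norml -/w; lra.
rewrite (le_trans h1) // (le_trans (_ : _ <= (w + e1) * r ^+ D + C)) //.
  by rewrite lerD2r ler_wpM2l ?addr_ge0 ?(ltW e10) // lerXn2r ?nnegrE ?sqrtr_ge0.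
have -> : (w + e1) * r ^+ D + C = f k%:R^-1 * k%:R ^+ D.
  have kk0 : k%:R != 0 :> R by rewrite gt_eqF.
  have h2 : (t + D%:R / k%:R) ^+ D * k%:R ^+ D = r ^+ D.
    by rewrite -exprMn /r; congr (_ ^+ _); field.
  have h3 : k%:R^-1 ^+ D * k%:R ^+ D = 1 :> R by rewrite -exprMn mulVf // expr1n.
  rewrite /f -h2; transitivity ((w + e1) * ((t + D%:R / k%:R) ^+ D * k%:R ^+ D) +
    C * (k%:R^-1 ^+ D * k%:R ^+ D)); first by rewrite h3 mulr1.
  by ring.
by rewrite ler_wpM2r ?exprn_ge0 ?hk0 // ler0n.
Qed.

(** The radius is reduced by [d] with [hvol_cube_minus_ball] in view, where the whole cell around a
    counted point has to lie in the ball. The subtraction is a genuine one for large [k]. *)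
Lemma lat_lower d (eta : R) : 0 < eta ->
  exists k0 : nat, forall k, (k0 <= k)%N -> (0 < k)%N ->
  (ball_vol R d - eta) * k%:R ^+ d <= (lat d ((k - d) ^ 2))%:R.
Proof.
move=> eta0; case: d => [|d].
  by exists 0%N => k _ _; rewrite lat0 mulr1 /= lerBlDr lerDl ltW.
set D := d.+1; have w0 : 0 <= ball_vol R D := ball_vol_ge0 D; set w := ball_vol R D.
have e10 : 0 < eta / 2 by rewrite divr_gt0.
have [C C0 hC] := lat_asymp D e10.
pose f s := C * s ^+ D - (w - eta / 2) * (1 - D%:R * s) ^+ D.
have [k0 hk0] : exists k0 : nat, forall k, (k0 <= k)%N -> (0 < k)%N -> f k%:R^-1 <= - (w - eta).
  apply: poly_near0.
    have cX : {for 0, continuous (fun s : R => s)} by [].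
    apply: continuousB; apply: continuousM; try exact: cst_continuous.
      exact: (@continuous_exprn id).
    apply: continuous_exprn; apply: continuousB; first exact: cst_continuous.
    by apply: continuousM; [exact: cst_continuous|].
  rewrite /f mulr0 subr0 expr0n expr1n /= mulr0; lra.
exists (maxn k0 D) => k; rewrite geq_max => /andP[kk kD] k1.
have kR : 0 < k%:R :> R by rewrite ltr0n.
have h := hC ((k - D) ^ 2)%N; rewrite natrX sqrtr_sqr normr_nat natrB // -/w in h.
have {}h : (w - eta / 2) * (k%:R - D%:R) ^+ D - C <= (lat D ((k - D) ^ 2))%:R.
  by move: h; rewrite ler_norml; lra.
apply: le_trans h.
have -> : (w - eta / 2) * (k%:R - D%:R) ^+ D - C = - f k%:R^-1 * k%:R ^+ D.
  have kk0 : k%:R != 0 :> R by rewrite gt_eqF.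
  have h2 : (1 - D%:R / k%:R) ^+ D * k%:R ^+ D = (k%:R - D%:R) ^+ D :> R.
    by rewrite -exprMn; congr (_ ^+ _); field.
  have h3 : k%:R^-1 ^+ D * k%:R ^+ D = 1 :> R by rewrite -exprMn mulVf // expr1n.
  rewrite /f -h2; transitivity ((w - eta / 2) * ((1 - D%:R / k%:R) ^+ D * k%:R ^+ D) -
    C * (k%:R^-1 ^+ D * k%:R ^+ D)); first by rewrite h3 mulr1.
  by ring.
by rewrite ler_wpM2r ?exprn_ge0 ?ler0n // lerNr hk0.
Qed.

(** A difference of two points of [A] plus a unit step lies in the ball of radius [k * t + d], so
    [card_diff_cube] applies. *)
Lemma count_separated d (A : pred 'rV[int]_d) k (t : R) :
  (forall u v, A u -> A v -> enorm (vR (u - v)) <= k%:R * t) -> 0 <= t ->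
  (2 ^ d * count A (box d k) <=
   count (fun v => (sqn v)%:R <= (k%:R * t + d%:R) ^+ 2 :> R)%R (box d (2 * k).+1))%N.
Proof.
move=> At t0; apply: card_diff_cube => u v e Au Av e1.
rewrite -enorm_vR ler_sqr ?nnegrE ?enorm_ge0 ?addr_ge0 ?mulr_ge0 ?ler0n //.
rewrite vRD (le_trans (enormD_le _ _)) // lerD //; first exact: At.
exact: enorm_unit_step.
Qed.

Lemma sum_half_pow N : \sum_(0 <= i < N) (2^-1 : R) ^+ i.+1 <= 1.
Proof.
suff -> : \sum_(0 <= i < N) (2^-1 : R) ^+ i.+1 = 1 - 2^-1 ^+ N.
  by rewrite lerBlDr lerDl exprn_ge0 // invr_ge0.
elim: N => [|N IH]; first by rewrite big_geq // expr0 subrr.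
by rewrite big_nat_recr //= IH exprS; field.
Qed.

Definition unit_eball d : set 'rV[R]_d := [set x | enorm x <= 1].

Lemma compact_unit_eball d : compact (@unit_eball d).
Proof.
have -> : @unit_eball d = [set x | enorm (x - 0) <= 1].
  by apply/seteqP; split=> x /=; rewrite subr0.
exact: compact_eball.
Qed.

(** The isodiametric inequality summed over a finite cover. The unit ball contains about
    [ball_vol R d * k ^ d] points of k^-1 Z^d, and a set of diameter [t i] at most about
    [ball_vol R d * (k * t i / 2) ^ d]; now let [k] grow. *)
Lemma finite_cover_lower d (N : nat) (U : nat -> set 'rV[R]_d) (t : nat -> R) :
  (forall i, 0 <= t i) -> (forall i, small (t i) (U i)) ->
  (forall x, unit_eball x -> exists2 i, (i < N)%N & U i x) ->
  ball_vol R d <= \sum_(0 <= i < N) ball_vol R d * (t i / 2) ^+ d.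
Proof.
move=> t0 Ut cov; set w := ball_vol R d.
have w0 : 0 <= w := ball_vol_ge0 d.
apply/ler_addgt0Pr => e e0.
(* One share of the error for each of the [N] covering sets and one for the ball. *)
pose eta := e / N.+1%:R; have eta0 : 0 < eta by rewrite divr_gt0 ?ltr0n.
have [k1 hk1] := lat_lower d eta0.
have [k2 hk2] : exists k2 : nat, forall i, (i < N)%N -> forall k K, (k2 <= k)%N -> (0 < k)%N ->
    (count (fun v => (sqn v)%:R <= (k%:R * t i + d%:R) ^+ 2) (box d K))%:R <=
    (w * t i ^+ d + eta) * k%:R ^+ d.
  elim: N {eta cov hk1 e0} (eta) eta0 => [|N IH] eta eta0; first by exists 0%N.
  have [k2 h2] := IH eta eta0; have [k3 h3] := count_upper d (t0 N) eta0.
  exists (maxn k2 k3) => i; rewrite ltnS leq_eqVlt => iN k K; rewrite geq_max => /andP[kk2 kk3] k0.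
  by case/orP: iN => [/eqP->|iN]; [exact: h3|exact: h2].
pose k := (maxn k1 k2).+1.
have kR : 0 < k%:R ^+ d :> R by rewrite exprn_gt0 // ltr0n.
have h1 := hk1 k (leqW (leq_maxl _ _)) isT.
pose A i := fun v : 'rV[int]_d => `[< U i (k%:R^-1 *: vR v) >].
have kN : k%:R != 0 :> R by rewrite pnatr_eq0.
have hA i : (i < N)%N -> (count (A i) (box d k))%:R <= (w * (t i / 2) ^+ d + eta) * k%:R ^+ d.
  move=> iN; have := @count_separated d (A i) k (t i) _ (t0 i).
  have sep u v : A i u -> A i v -> enorm (vR (u - v)) <= k%:R * t i.
    move=> /asboolP Au /asboolP Av; have := Ut i _ _ Au Av.
    by rewrite -scalerBr -vRB enormZ ger0_norm ?invr_ge0 ?ler0n // ler_pdivrMl ?ltr0n.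
  move=> /(_ sep) h; have := hk2 i iN k (2 * k).+1 (leqW (leq_maxr _ _)) isT.
  move=> /(le_trans (_ : (2 ^ d * count (A i) (box d k))%:R <= _)); rewrite ler_nat => /(_ h).
  rewrite natrM natrX expr_div_n => h3.
  have p2 : 1 <= 2 ^+ d :> R by rewrite exprn_ege1 // ler1n.
  have p20 : 0 < 2 ^+ d :> R by exact: lt_le_trans p2.
  rewrite -(ler_pM2l p20) (le_trans h3) // mulrA ler_wpM2r ?(ltW kR) //.
  have -> : 2 ^+ d * (w * (t i ^+ d / 2 ^+ d) + eta) = w * t i ^+ d + 2 ^+ d * eta.
    by field; rewrite gt_eqF.
  rewrite lerD2l.
  by rewrite ler_peMl // ltW.
have cnt : ((lat d ((k - d) ^ 2)) <= \sum_(0 <= i < N) count (A i) (box d k))%N.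
  apply: (@leq_trans (count (fun v => sqn v <= k ^ 2)%N (box d k))).
    rewrite (@lat_box d (k ^ 2)) ?lat_mono ?leq_sqr ?leq_subr //.
    by rewrite ltn_sqr.
  have cov2 v : (sqn v <= k ^ 2)%N -> exists2 i, (i < N)%N & A i v.
    move=> vk; have [|i iN Ui] := cov (k%:R^-1 *: vR v); last by exists i => //; apply/asboolP.
    rewrite /unit_eball /= enormZ ger0_norm ?invr_ge0 ?ler0n // ler_pdivrMl ?ltr0n // mulr1.
    by rewrite -ler_sqr ?nnegrE ?enorm_ge0 ?ler0n // enorm_vR -natrX ler_nat.
  elim: (box d k) => [|v s IH]; first by rewrite /= big1.
  rewrite /= big_split /= leq_add //.
  case: (leqP (sqn v) (k ^ 2)) => [vk|] //; have [i iN Aiv] := cov2 _ vk.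
  by rewrite (bigD1_seq i) ?mem_iota ?iota_uniq ?Aiv //= ?leq_addr // subn0 add0n iN.
have cntR : (lat d ((k - d) ^ 2))%:R <= \sum_(0 <= i < N) (w * (t i / 2) ^+ d + eta) * k%:R ^+ d.
  apply: le_trans (_ : (\sum_(0 <= i < N) count (A i) (box d k))%:R <= _); first by rewrite ler_nat.
  by rewrite natr_sum big_nat [leRHS]big_nat; apply: ler_sum => i /andP[_ iN]; exact: hA.
have := le_trans h1 cntR; rewrite -mulr_suml ler_pM2r // big_split /= sumr_const_nat subn0.
rewrite -/w => h; rewrite -lerBlDl -subr_ge0.
have eN : eta *+ N + eta = e by rewrite -mulrSr -mulr_natr divfK // pnatr_eq0.
by move: h; rewrite -eN; lra.
Qed.

End BallVolume.
Section BallVolume2.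
Context {R : realType}.

(** A covering set is replaced by an open neighbourhood whose gauge is larger by at most
    [e * 2^-1 ^+ i.+1]; compactness then leaves finitely many. In positive dimension an empty set
    contributes [0 ^+ d = 0]; this fails for [d = 0], which is treated apart. *)
Lemma content_ball_ge d delta : ((ball_vol R d)%:E <= hausdorff_content d delta (@unit_eball R d))%E.
Proof.
apply: content_ge => E [BE sE].
have [d0|dp] := posnP d.
  subst d; have [|i _ Ei] := BE 0; first by rewrite /unit_eball /= enorm0.
  apply: le_trans (sum_gauge_ge E i.+1); rewrite big_nat_recr //= -[leLHS]add0e.
  apply: leeD; first by apply: sume_ge0 => j _; rewrite lee_fin gauge_ge0.
  rewrite lee_fin /hausdorff_gauge ifF ?mulr1 //; apply/negbTE/set0P.
  by exists 0.
have gnn (i : nat) : (0 <= (hausdorff_gauge d (E i))%:E)%E by rewrite lee_fin gauge_ge0.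
apply/lee_addgt0Pr => e e0.
have w0 : 0 <= ball_vol R d := ball_vol_ge0 d.
have [ep hep] : exists ep : nat -> R, forall i, 0 < ep i /\
    ball_vol R d * ((diam (E i) + 2 * ep i) / 2) ^+ d <=
    ball_vol R d * (diam (E i) / 2) ^+ d + e * 2^-1 ^+ i.+1.
  have h (i : nat) : exists ep, 0 < ep /\ ball_vol R d * ((diam (E i) + 2 * ep) / 2) ^+ d <=
      ball_vol R d * (diam (E i) / 2) ^+ d + e * 2^-1 ^+ i.+1.
    pose f s := ball_vol R d * ((diam (E i) + 2 * s) / 2) ^+ d.
    have [||k0 hk] := @poly_near0 R f (f 0 + e * 2^-1 ^+ i.+1).
    - apply: continuousM; first exact: cst_continuous.
      apply: continuous_exprn; apply: continuousM; last exact: cst_continuous.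
      apply: continuousD; first exact: cst_continuous.
      by apply: continuousM; [exact: cst_continuous|move=> P].
    - by rewrite ltrDl mulr_gt0 // exprn_gt0 // invr_gt0.
    exists k0.+1%:R^-1; split; first by rewrite invr_gt0 ltr0n.
    have := hk k0.+1 (leqnSn _) isT.
    by rewrite /f mulr0 addr0.
  by exists (fun i => projT1 (cid (h i))) => i; exact: (projT2 (cid (h i))).
pose U i := \bigcup_(y in E i) [set x : 'rV[R]_d | enorm (x - y) < ep i].
have Uo i : open (U i) by apply: bigcup_open => y _; exact: open_eball.
have EU i x : E i x -> U i x.
  by move=> Ex; exists x => //=; rewrite subrr enorm0; case: (hep i).
have := @compact_unit_eball R d; rewrite compact_cover => cc.
have [//|x /BE[i _ Ei]|D' _ cov] := cc nat setT U.
  by exists i => //; exact: EU.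
have [N ND] : exists N : nat, forall i, i \in finmap.enum_fset D' -> (i < N)%N.
  exists (\max_(i <- finmap.enum_fset D') i).+1 => i iD; rewrite ltnS.
  exact: (@leq_bigmax_seq _ (finmap.enum_fset D') xpredT id).
pose t i := if pselect (E i !=set0) then diam (E i) + 2 * ep i else 0.
have t0 i : 0 <= t i.
  rewrite /t; case: pselect => [?|?] //=; rewrite addr_ge0 ?diam_ge0 // mulr_ge0 // ltW //.
  by case: (hep i).
have Ut i : small (t i) (U i).
  move=> x y [a Ea /= xa] [b Eb /= yb]; rewrite /t; case: pselect => [ne|]; last by case; exists a.
  rewrite (le_trans (enorm_triangle a _ _)) // (le_trans (lerD (lexx _) (enorm_triangle b _ _))) //.
  have := diam_small (sE i) Ea Eb; rewrite (enormBC b); lra.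
have := finite_cover_lower (N := N) t0 Ut.
have covN x : unit_eball x -> exists2 i, (i < N)%N & U i x.
  by move=> /cov[i /= iD Ui]; exists i => //; exact: ND.
move=> /(_ covN) h; rewrite (@le_trans _ _ (\sum_(0 <= i < N) (ball_vol R d * (t i / 2) ^+ d))%:E) ?lee_fin //.
apply: (@le_trans _ _ ((\sum_(0 <= i < N) (hausdorff_gauge d (E i))%:E) +
    (\sum_(0 <= i < N) (e * 2^-1 ^+ i.+1))%:E)%E); last first.
  apply: leeD; first exact: sum_gauge_ge.
  by rewrite lee_fin -mulr_sumr ler_piMr ?(ltW e0) // sum_half_pow.
rewrite sumEFin -EFinD lee_fin -big_split /=; apply: ler_sum => i _.
have e1 : 0 <= e * 2^-1 ^+ i.+1 by rewrite mulr_ge0 ?(ltW e0) // exprn_ge0 // invr_ge0.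
rewrite /t; case: pselect => [ne|nne]; last first.
  by rewrite mul0r expr0n gtn_eqF // mulr0 addr_ge0 ?gauge_ge0.
rewrite /hausdorff_gauge ifF; last by apply/negbTE/set0P.
by case: (hep i).
Qed.

Lemma sum_const_EFin T (s : seq T) (c : R) :
  (\sum_(i <- s) c%:E = ((size s)%:R * c)%:E)%E.
Proof. by rewrite sumEFin big_const_seq count_predT iter_addr_0 mulr_natl. Qed.

Definition cube d (a : 'rV[R]_d) (h : R) : set 'rV[R]_d :=
  [set x | forall i, `|(x - a) ord0 i| <= h].

Lemma round_exists (k : nat) (z : R) : `|z| <= (2 * k).+1%:R ->
  exists2 v : int, (`|v| <= k)%N & `|z - 2 * v%:~R| <= 1.
Proof.
have kE : (2 * k).+1%:R = 2 * k%:R + 1 :> R by rewrite -natr1 natrM.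
rewrite ler_norml kE => /andP[z1 z2].
have /andP[f1 f2] := floor_itv ((z + 1) / 2); set v := Num.floor _ in f1 f2.
rewrite intrD in f2.
have [vk|vk] := leP v k%:Z; last first.
  have kv : (k%:Z + 1)%:~R <= v%:~R :> R by rewrite ler_int lezD1.
  rewrite intrD in kv.
  have kk : (k%:Z)%:~R = k%:R :> R by [].
  exists k%:Z; first by rewrite absz_nat.
  by rewrite ler_norml kk; rewrite kk in kv; apply/andP; split; lra.
exists v; last by rewrite ler_norml; apply/andP; split; lra.
suff : - k%:Z <= v by move: vk; lia.
rewrite -ltzD1 -(ltr_int R) intrD mulrNz; have kk : (k%:Z)%:~R = k%:R :> R by [].
rewrite kk; lra.
Qed.

Lemma rounds_exist d (k : nat) (z : 'rV[R]_d) : (forall i, `|z ord0 i| <= (2 * k).+1%:R) ->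
  exists2 v : 'rV[int]_d, v \in box d k & forall i, `|(z - 2 *: vR v) ord0 i| <= 1.
Proof.
move=> zk; have h i := cid2 (round_exists (zk i)).
exists (\row_i s2val (h i)).
  by rewrite mem_box; apply/forallP => i; rewrite mxE; exact: (s2valP (h i)).
by move=> i; rewrite !mxE; exact: (s2valP' (h i)).
Qed.

(** Maps [cube 0 1] onto one cell of its division into [(2 * k).+1 ^ d] equal cells. An odd number
    of cells on each side puts their centres at multiples of the integer points of [box d k]. *)
Definition subcube_map d k (v : 'rV[int]_d) (x : 'rV[R]_d) : 'rV[R]_d :=
  (2 * k).+1%:R^-1 *: (2 *: vR v + x).

Lemma subcube_map_lip d k (v : 'rV[int]_d) x y :
  enorm (subcube_map k v x - subcube_map k v y) = (2 * k).+1%:R^-1 * enorm (x - y).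
Proof.
rewrite /subcube_map -scalerBr enormZ ger0_norm ?invr_ge0 ?ler0n //.
by congr (_ * enorm _); rewrite opprD addrACA subrr add0r.
Qed.

Lemma hvol_subcube d k (v : 'rV[int]_d) (A : set 'rV[R]_d) :
  (hvol d (subcube_map k v @` A) <= ((2 * k).+1%:R^-1 ^+ d)%:E * hvol d A)%E.
Proof.
apply: hvol_lip; first by rewrite invr_gt0 ltr0n.
by move=> x y _ _; rewrite subcube_map_lip.
Qed.

Lemma subcube_cover d k (x : 'rV[R]_d) : cube 0 1 x ->
  exists2 v, v \in box d k & (subcube_map k v @` cube 0 1) x.
Proof.
move=> xQ; have k0 : (2 * k).+1%:R != 0 :> R by rewrite pnatr_eq0.
have [|v vk hv] := @rounds_exist d k ((2 * k).+1%:R *: x).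
  move=> i; rewrite mxE normrM normr_nat ler_piMr ?ler0n //.
  by have := xQ i; rewrite subr0.
exists v => //; exists ((2 * k).+1%:R *: x - 2 *: vR v).
  by move=> i; rewrite subr0.
by rewrite /subcube_map addrC subrK scalerA mulVf // scale1r.
Qed.

Lemma cube_enorm d (x : 'rV[R]_d) : cube 0 1 x -> enorm x <= d%:R.
Proof.
move=> xQ; rewrite -[d%:R]mulr1; apply: enorm_le_sup => // i.
by have := xQ i; rewrite subr0.
Qed.

(** Self-similarity in place of a Vitali covering. Cut the cube into small cells: in each of them
    the inscribed ball is a single covering set, and what remains is a scaled copy of the cube minus
    the ball. By [hvol_cube_minus_ball] the remainder is a fraction of at most about [1 - w / 2 ^ d]
    of the cube, where [w = ball_vol R d]. The volume [x] of the cube therefore satisfies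
    [x <= w + (1 - w / 2 ^ d) * x], that is, [x <= 2 ^ d]. *)
Lemma hvol_cube_ball_le d :
  (hvol d (@cube d 0 1) <= (ball_vol R d)%:E + hvol d (@cube d 0 1 `\` @unit_eball R d))%E.
Proof.
apply: hvol_le => delta d0.
pose k := Num.truncn (2 * (d%:R + 1) / delta : R).
have kd : 2 * (d%:R + 1) * (2 * k).+1%:R^-1 <= delta :> R.
  have /truncn_itv/andP[_ h] : 0 <= 2 * (d%:R + 1) / delta by rewrite divr_ge0 ?mulr_ge0 ?addr_ge0 // ltW.
  rewrite ltr_pdivrMr // in h; rewrite ler_pdivrMr ?ltr0n // (le_trans (ltW h)) //.
  by rewrite mulrC ler_pM2l // ler_nat ltnS leq_pmull.
have c0 : 0 < (2 * k).+1%:R^-1 :> R by rewrite invr_gt0 ltr0n.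
apply: (le_trans (content_bigU (F := fun v => subcube_map k v @` cube 0 1) (s := box d k) delta (@subcube_cover d k))).
set Y := hvol d (_ `\` _).
apply: (@le_trans _ _ (\sum_(v <- box d k) ((2 * k).+1%:R^-1 ^+ d)%:E * ((ball_vol R d)%:E + Y))%E); last first.
  have Y0 : (0 <= (ball_vol R d)%:E + Y)%E by rewrite adde_ge0 ?hvol_ge0 // lee_fin ball_vol_ge0.
  rewrite -ge0_sume_distrl; last by move=> i _; rewrite lee_fin exprn_ge0 // ltW.
  rewrite sum_const_EFin size_box natrX -exprMn.
  by rewrite divff ?expr1n ?mul1e // pnatr_eq0.
apply: lee_sum => v _.
apply: (le_trans (content_mono delta (B := subcube_map k v @` (@unit_eball R d) `|` subcube_map k v @` (cube 0 1 `\` @unit_eball R d)) _)).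
  move=> _ [x Qx <-]; have [Bx|Bx] := pselect (unit_eball x); [left|right]; by exists x.
apply: (le_trans (contentU _ _ _)); rewrite ge0_muleDr ?hvol_ge0 ?lee_fin ?ball_vol_ge0 //.
apply: leeD; last exact: le_trans (content_hvol _ d0) (hvol_subcube _ _ _).
have sB : small (2 * (2 * k).+1%:R^-1) (subcube_map k v @` @unit_eball R d).
  move=> _ _ [x Bx <-] [y By <-]; rewrite subcube_map_lip mulrC ler_pM2r //.
  by rewrite (le_trans (enormB_le _ _)) // -[2]/(1 + 1) lerD.
have s0 : 0 <= 2 * (2 * k).+1%:R^-1 :> R by rewrite mulr_ge0 // ltW.
apply: (le_trans (content_small (E := subcube_map k v @` @unit_eball R d) _ _)) => //.
  move=> x y Ex Ey; apply: le_trans (sB _ _ Ex Ey) _; apply: le_trans kd.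
  by rewrite ler_pM2r // mulrDr mulr1 lerDr mulr_ge0.
rewrite -EFinM lee_fin (le_trans (gauge_le (d := d) s0 sB)) //.
by rewrite mulrAC divff // mul1r mulrC.
Qed.

(** Cells whose index has norm at most [k - d] lie inside the unit ball, since a cell reaches at
    most [d] beyond its centre at this scale; [lat] counts them. *)
Lemma hvol_cube_minus_ball d k : (d <= k)%N ->
  (hvol d (@cube d 0 1 `\` @unit_eball R d) <=
   (((2 * k).+1 ^ d - lat d ((k - d) ^ 2))%:R * (2 * k).+1%:R^-1 ^+ d)%:E * hvol d (@cube d 0 1))%E.
Proof.
move=> dk; pose P := fun v : 'rV[int]_d => (sqn v <= (k - d) ^ 2)%N.
have c0 : 0 < (2 * k).+1%:R^-1 :> R by rewrite invr_gt0 ltr0n.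
apply: (@le_trans _ _ (\sum_(v <- [seq v <- box d k | ~~ P v]) ((2 * k).+1%:R^-1 ^+ d)%:E * hvol d (@cube d 0 1))%E).
  apply: le_trans (lee_sum _ (fun v _ => hvol_subcube k v (@cube d 0 1))).
  apply: hvol_bigU => x [/(@subcube_cover d k)[v vk [y Qy yx]] nB].
  exists v; last by exists y.
  rewrite mem_filter vk andbT; apply/negP => Pv; apply: nB; rewrite -yx /unit_eball /=.
  rewrite /subcube_map enormZ gtr0_norm // ler_pdivrMl ?ltr0n // mulr1.
  rewrite (le_trans (enormD_le _ _)) // enormZ ger0_norm //.
  have v1 : enorm (vR v) <= k%:R - d%:R :> R.
    rewrite -natrB // -ler_sqr ?nnegrE ?enorm_ge0 ?ler0n // enorm_vR -natrX ler_nat.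
    exact: Pv.
  have y1 := cube_enorm Qy; have dR : d%:R <= k%:R :> R by rewrite ler_nat.
  have d0 : 0 <= d%:R :> R by rewrite ler0n.
  have kE : (2 * k).+1%:R = 2 * k%:R + 1 :> R by rewrite -natr1 natrM.
  by rewrite kE; lra.
rewrite -ge0_sume_distrl; last by move=> i _; rewrite lee_fin exprn_ge0 // ltW.
rewrite sum_const_EFin size_filter.
rewrite lee_wpmul2r ?hvol_ge0 // lee_fin ler_wpM2r ?exprn_ge0 // ?(ltW c0) // ler_nat.
have := count_predC P (box d k); rewrite size_box.
rewrite (@lat_box d ((k - d) ^ 2)) => [|]; last by rewrite ltn_sqr; lia.
by move=> <-; rewrite addKn; apply: eq_leq; apply: eq_count.
Qed.

(** Finiteness is what allows the volume of the cube to be subtracted from both sides of the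
    self-similar inequality. *)
Lemma hvol_cube_fin d : (hvol d (@cube d 0 1) < +oo)%E.
Proof.
apply: (@le_lt_trans _ _ (ball_vol R d * d%:R ^+ d)%:E); last by rewrite ltry.
apply: hvol_le => delta d0.
pose k := Num.truncn (2 * (d%:R + 1) / delta : R).
have kd : 2 * (d%:R + 1) * (2 * k).+1%:R^-1 <= delta :> R.
  have /truncn_itv/andP[_ h] : 0 <= 2 * (d%:R + 1) / delta by rewrite divr_ge0 ?mulr_ge0 ?addr_ge0 // ltW.
  rewrite ltr_pdivrMr // in h; rewrite ler_pdivrMr ?ltr0n // (le_trans (ltW h)) //.
  by rewrite mulrC ler_pM2l // ler_nat ltnS leq_pmull.
have c0 : 0 < (2 * k).+1%:R^-1 :> R by rewrite invr_gt0 ltr0n.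
apply: (le_trans (content_bigU (F := fun v => subcube_map k v @` cube 0 1) (s := box d k) delta (@subcube_cover d k))).
apply: (@le_trans _ _ (\sum_(v <- box d k) ((2 * k).+1%:R^-1 ^+ d * (ball_vol R d * d%:R ^+ d))%:E)%E); last first.
  rewrite sum_const_EFin size_box natrX mulrA -exprMn.
  by rewrite divff ?expr1n ?mul1r // pnatr_eq0.
apply: lee_sum => v _.
have sB : small (2 * (d%:R * (2 * k).+1%:R^-1)) (subcube_map k v @` @cube d 0 1).
  move=> _ _ [x Bx <-] [y By <-]; rewrite subcube_map_lip mulrC mulrA ler_pM2r //.
  by rewrite (le_trans (enormB_le _ _)) // mulr2n mulrDl !mul1r lerD // cube_enorm.
have s0 : 0 <= 2 * (d%:R * (2 * k).+1%:R^-1) :> R by rewrite !mulr_ge0 // ltW.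
apply: (le_trans (content_small (E := subcube_map k v @` @cube d 0 1) _ _)) => //.
  move=> x y Ex Ey; apply: le_trans (sB _ _ Ex Ey) _; apply: le_trans kd.
  by rewrite mulrA ler_pM2r // mulrDr mulr1 lerDl.
rewrite lee_fin (le_trans (gauge_le (d := d) s0 sB)) //.
by rewrite mulrAC divff // mul1r exprMn mulrC -mulrA mulrC mulrA (mulrC (_ ^-1 ^+ _)).
Qed.

Lemma hvol_cube_le d : (hvol d (@cube d 0 1) <= (2 ^+ d)%:E)%E.
Proof.
have fin : hvol d (@cube d 0 1) \is a fin_num by rewrite ge0_fin_numE ?hvol_ge0 ?hvol_cube_fin.
have finY : hvol d (@cube d 0 1 `\` @unit_eball R d) \is a fin_num.
  rewrite ge0_fin_numE ?hvol_ge0 // (le_lt_trans _ (hvol_cube_fin d)) //.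
  by apply: hvol_mono => x [].
have h1 := hvol_cube_ball_le d; have h2 := @hvol_cube_minus_ball d.
rewrite -(fineK fin) -(fineK finY) -EFinD lee_fin in h1.
rewrite -(fineK fin) lee_fin.
set x := fine (hvol d (@cube d 0 1)) in h1 *; set y := fine _ in h1.
have x0 : 0 <= x by rewrite fine_ge0 ?hvol_ge0.
set w := ball_vol R d in h1.
have w0 : 0 < w by exact: ball_vol_gt0.
have key eta : 0 < eta -> (w - eta) * x <= w * (2 ^+ d + eta).
  move=> eta0; have [k0 hk0] := lat_lower d eta0.
  pose f s : R := (2 + s) ^+ d.
  have [||k1 hk1] := @poly_near0 R f (2 ^+ d + eta).
  - apply: continuous_exprn; apply: continuousD; first exact: cst_continuous.
    by move=> P.
  - by rewrite /f addr0 ltrDl.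
  have [k [kk0 kk1 kd]] : exists k, [/\ (k0 <= k)%N, (k1 <= k)%N & (d < k)%N].
    by exists (k0 + k1 + d).+1; split; lia.
  have k00 : (0 < k)%N by exact: leq_ltn_trans kd.
  have kR : 0 < k%:R :> R by rewrite ltr0n.
  have /h2 : (d <= k)%N by exact: ltnW.
  rewrite -(fineK fin) -(fineK finY) -EFinM lee_fin -/x -/y => h3.
  have h4 : (w - eta) * k%:R ^+ d <= (lat d ((k - d) ^ 2))%:R by exact: hk0.
  have h5 : f k%:R^-1 <= 2 ^+ d + eta by exact: hk1.
  have h6 : (2 * k).+1%:R ^+ d <= (2 ^+ d + eta) * k%:R ^+ d.
    apply: le_trans (ler_wpM2r (exprn_ge0 d (ltW kR)) h5).
    by rewrite /f -exprMn mulrDl mulVf ?gt_eqF // -natrM natr1 mulnC.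
  set K := (2 * k).+1%:R ^+ d in h6 *.
  have K0 : 0 < K by rewrite exprn_gt0 // ltr0n.
  have latK : (lat d ((k - d) ^ 2) <= (2 * k).+1 ^ d)%N.
    rewrite -(@lat_box d _ k) ?(leq_trans (count_size _ _)) ?size_box //.
    by rewrite ltn_sqr ltnS leq_subr.
  rewrite natrB // natrX -/K exprVn -/K in h3.
  set l := (lat d _)%:R in h4 h3.
  have h7 : l * x <= w * K.
    have h8 : K * y <= (K - l) * x.
      by move: h3; rewrite mulrAC ler_pdivlMr // mulrC.
    have h9 : K * x <= K * (w + y) by rewrite ler_pM2l.
    lra.
  have kd0 : 0 < k%:R ^+ d :> R by rewrite exprn_gt0.
  rewrite -(ler_pM2r kd0) (le_trans (_ : _ <= l * x)) //.
    by rewrite mulrAC ler_wpM2r.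
  by rewrite (le_trans h7) // -mulrA ler_pM2l.
suff : w * x <= w * 2 ^+ d by rewrite ler_pM2l.
apply/ler_addgt0Pr => e e0.
have wx : 0 < w + x by rewrite ltr_wpDr.
have := key (e / (w + x)) (divr_gt0 e0 wx).
set t := e / (w + x); have tE : t * (w + x) = e by rewrite /t divfK ?gt_eqF.
by rewrite -tE; lra.
Qed.

Lemma hvol_cube_scale d (a : 'rV[R]_d) (h : R) : 0 < h -> (hvol d (cube a h) <= ((2 * h) ^+ d)%:E)%E.
Proof.
move=> h0; have -> : cube a h = (fun x => a + h *: x) @` @cube d 0 1.
  apply/seteqP; split=> [x hx|_ [x hx <-]].
    exists (h^-1 *: (x - a)); last by rewrite scalerA divff ?gt_eqF // scale1r addrC subrK.
    move=> i; have hi := hx i; rewrite subr0 mxE normrM gtr0_norm ?invr_gt0 //.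
    by rewrite ler_pdivrMl // mulr1.
  move=> i; have hi := hx i; rewrite subr0 in hi; rewrite addrC addKr mxE normrM gtr0_norm //.
  by rewrite ler_piMr // ltW.
apply: le_trans (@hvol_lip R d d d (fun x => a + h *: x) h (cube 0 1) h0 _) _.
  by move=> x y _ _; rewrite opprD addrACA subrr add0r -scalerBr enormZ gtr0_norm.
rewrite exprMn mulrC EFinM; apply: lee_pmul; rewrite ?hvol_ge0 ?lee_fin ?exprn_ge0 ?(ltW h0) //.
exact: hvol_cube_le.
Qed.

(** The lower bound is the isodiametric inequality. For the upper bound the ball is covered by cubes
    of side 1/k, about [ball_vol R d * k ^ d] of them, each of volume at most that of Lebesgue
    measure. *)
Lemma hvol_unit_eball d : hvol d (@unit_eball R d) = (ball_vol R d)%:E.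
Proof.
apply/eqP; rewrite eq_le; apply/andP; split; last first.
  exact: le_trans (content_ball_ge d 1) (content_hvol _ _).
apply/lee_addgt0Pr => e e0.
have [k0 hk] := count_upper d (@ler01 R) e0.
pose k := k0.+1; pose K := (k + d)%N.
pose P := fun v : 'rV[int]_d => (sqn v)%:R <= (k%:R * 1 + d%:R) ^+ 2 :> R.
have kR : 0 < k%:R :> R by rewrite ltr0n.
have h0 : 0 < (2 * k%:R)^-1 :> R by rewrite invr_gt0 mulr_gt0.
apply: (@le_trans _ _ (\sum_(v <- [seq v <- box d K | P v]) (k%:R^-1 ^+ d : R)%:E)%E); last first.
  rewrite sum_const_EFin size_filter -EFinD lee_fin.
  have := hk k K (leqnSn _) isT; rewrite expr1n mulr1 => h.
  by rewrite exprVn ler_pdivrMr ?exprn_gt0.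
apply: (@le_trans _ _ (\sum_(v <- [seq v <- box d K | P v]) hvol d (cube (k%:R^-1 *: vR v) (2 * k%:R)^-1))%E); last first.
  apply: lee_sum => v _; apply: le_trans (hvol_cube_scale _ h0) _.
  by rewrite invfM mulrA divff // mul1r.
apply: hvol_bigU => x Bx.
have [|v vK hv] := @rounds_exist d K ((2 * k%:R) *: x).
  move=> i; rewrite mxE normrM ger0_norm ?mulr_ge0 ?ler0n //.
  have := le_trans (coord_le_enorm x i) Bx => xi.
  rewrite (le_trans (ler_wpM2l _ xi)) ?mulr_ge0 // mulr1 -natrM ler_nat /K; lia.
have vx : enorm (2 *: vR v - (2 * k%:R) *: x) <= d%:R.
  rewrite enormBC -[d%:R]mulr1; apply: enorm_le_sup => //.
exists v; last first.
  move=> i; have -> : x - k%:R^-1 *: vR v = (2 * k%:R)^-1 *: ((2 * k%:R) *: x - 2 *: vR v).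
    rewrite scalerBr !scalerA mulVf ?mulf_neq0 ?gt_eqF // scale1r; congr (_ - _ *: _).
    by field; rewrite gt_eqF.
  by rewrite mxE normrM gtr0_norm // ler_piMr ?(ltW h0).
rewrite mem_filter vK andbT /P -enorm_vR ler_sqr ?nnegrE ?enorm_ge0 ?addr_ge0 ?mulr_ge0 ?ler0n //.
have := enormD_le (2 *: vR v - (2 * k%:R) *: x) ((2 * k%:R) *: x).
rewrite subrK !enormZ !ger0_norm ?mulr_ge0 ?ler0n // => h.
have kx : k%:R * enorm x <= k%:R by rewrite ler_piMr // ler0n.
have d0 : 0 <= d%:R :> R by rewrite ler0n.
by rewrite mulr1; lra.
Qed.

Lemma hvol_eball d (a : 'rV[R]_d) (r : R) : 0 < r ->
  hvol d [set x | enorm (x - a) <= r] = (ball_vol R d * r ^+ d)%:E.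
Proof.
move=> r0; have rd : 0 < r ^+ d by rewrite exprn_gt0.
have E1 : [set x | enorm (x - a) <= r] = (fun x => a + r *: x) @` @unit_eball R d.
  apply/seteqP; split=> [x hx|_ [x hx <-]] /=.
    exists (r^-1 *: (x - a)); last by rewrite scalerA divff ?gt_eqF // scale1r addrC subrK.
    by rewrite /unit_eball /= enormZ gtr0_norm ?invr_gt0 // ler_pdivrMl // mulr1.
  by rewrite addrC addKr enormZ gtr0_norm // ler_piMr // ltW.
have E2 : @unit_eball R d = (fun x => r^-1 *: (x - a)) @` [set x | enorm (x - a) <= r].
  apply/seteqP; split=> [x hx|_ [x /= hx <-]].
    exists (a + r *: x); last by rewrite addrC addKr scalerA mulVf ?gt_eqF // scale1r.
    by rewrite /= addrC addKr enormZ gtr0_norm // ler_piMr // ltW.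
  by rewrite /unit_eball /= enormZ gtr0_norm ?invr_gt0 // ler_pdivrMl // mulr1.
apply/eqP; rewrite eq_le; apply/andP; split.
  rewrite E1; apply: le_trans (@hvol_lip R d d d (fun x => a + r *: x) r (@unit_eball R d) r0 _) _.
    by move=> x y _ _; rewrite opprD addrACA subrr add0r -scalerBr enormZ gtr0_norm.
  by rewrite hvol_unit_eball -EFinM mulrC.
have : ((ball_vol R d)%:E <= (r^-1 ^+ d)%:E * hvol d [set x | (enorm (x - a) <= r)%R])%E.
  rewrite -hvol_unit_eball {1}E2; apply: hvol_lip; first by rewrite invr_gt0.
  move=> x y _ _; rewrite -scalerBr enormZ gtr0_norm ?invr_gt0 //.
  by rewrite opprB addrA subrK.
by rewrite exprVn -lee_pdivrMl ?invr_gt0 // invrK -EFinM mulrC.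
Qed.

End BallVolume2.

(** * Directional derivatives and differentiability *)

Section Differentials.
Context {R : realType}.

Lemma line_quotient (W : normedModType R) n (f : 'rV[R]_n -> W) x v t :
  (fun h => h^-1 *: (((fun s : R => f (x + s *: v)) \o shift t) (h *: (1 : R)) - f (x + t *: v))) =
  (fun h => h^-1 *: ((f \o shift (x + t *: v)) (h *: v) - f (x + t *: v))).
Proof.
apply/funext => h /=; congr (_ *: (f _ - _)).
by rewrite scalerDl [h *: 1]mulr1 addrCA.
Qed.

Lemma is_derive_line (W : normedModType R) n (f : 'rV[R]_n -> W) x v t :
  derivable f (x + t *: v) v ->
  is_derive t (1 : R) (fun s : R => f (x + s *: v)) ('D_v f (x + t *: v)).
Proof.
by move=> df; split; rewrite /derivable /derive line_quotient.
Qed.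

Lemma mvt_dir n (f : 'rV[R]_n -> R) x v h :
  (forall c, `|c| <= `|h| -> derivable f (x + c *: v) v) ->
  exists2 c, `|c| <= `|h| & f (x + h *: v) - f x = h * 'D_v f (x + c *: v).
Proof.
move=> df; pose g (s : R) := f (x + s *: v).
have dg (c : R) : `|c| <= `|h| -> is_derive c (1 : R) g ('D_v f (x + c *: v)).
  by move=> ch; apply: is_derive_line; exact: df.
have g0 : f x = g 0 by rewrite /g scale0r addr0.
have key (a b : R) : a < b -> (forall c, a <= c <= b -> `|c| <= `|h|) ->
    exists2 c, `|c| <= `|h| & g b - g a = 'D_v f (x + c *: v) * (b - a).
  move=> ab hc; have [||c /[!in_itv]/= /andP[ac cb] e] := MVT_segment (ltW ab) (f := g) (df := fun c => 'D_v f (x + c *: v)).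
  - by move=> c /[!in_itv]/= /andP[ac cb]; apply: dg; apply: hc; rewrite !ltW.
  - have din : {in `[a, b], forall c, derivable g c 1}.
      by move=> c /[!in_itv]/= cab; have := dg c (hc c cab); case.
    exact: derivable_within_continuous din.
  by exists c => //; apply: hc; rewrite ac.
rewrite g0; have [h0|h0|->] := ltgtP h 0.
- have [c /andP[hc c0]|c ch e] := key _ _ h0.
    by rewrite !ler0_norm // ?lerN2 // ltW.
  by exists c => //; apply: oppr_inj; rewrite opprB e sub0r mulrN mulrC.
- have [c /andP[c0 hc]|c ch e] := key _ _ h0.
    by rewrite !ger0_norm // ltW.
  by exists c => //; rewrite e subr0 mulrC.
- by exists 0; rewrite ?lexx // subrr mul0r.
Qed.

Lemma coord_enorm_sum n (h : 'rV[R]_n) (x : 'rV[R]_n) (i : 'I_n) :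
  enorm (\sum_(j < n | (j < i)%N) h 0 j *: (delta_mx 0 j : 'rV[R]_n)) <= n%:R * enorm h.
Proof.
rewrite (le_trans (enorm_sum_le _ _ _)) //.
rewrite -[n in n%:R]card_ord -sum1_card natr_sum mulr_suml [leLHS]big_mkcond /=.
apply: ler_sum => j _; rewrite mul1r; case: ifP => _; last exact: enorm_ge0.
by rewrite enormZ enorm_delta mulr1 coord_le_enorm.
Qed.

Lemma mulmx_bound n p (A : 'M[R]_(n, p)) :
  exists2 C, 0 < C & forall v : 'rV[R]_n, enorm (v *m A) <= C * enorm v.
Proof.
exists (\sum_i enorm (row i A) + 1).
  by rewrite ltr_wpDl // sumr_ge0 // => i _; exact: enorm_ge0.
move=> v; rewrite mulmx_sum_row (le_trans (enorm_sum_le _ _ _)) //.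
rewrite mulrDl mul1r ler_wpDr ?enorm_ge0 // mulr_suml ler_sum // => i _.
by rewrite enormZ mulrC ler_wpM2l ?enorm_ge0 ?coord_le_enorm.
Qed.

Lemma continuous_mulmxr n p (A : 'M[R]_(n, p)) : continuous (fun v : 'rV[R]_n => v *m A).
Proof.
move=> x; have [C C0 hC] := mulmx_bound A; move=> B /nbhs_eball[e e0 he].
apply: (@eball_nbhs _ _ _ (e / C)); first by rewrite divr_gt0.
move=> y; rewrite ltr_pdivlMr // mulrC => yx; apply: he.
by rewrite -mulmxBl (le_lt_trans (hC _)).
Qed.

(* Telescope the increment along the coordinates and apply the mean value
   theorem to each of them. *)
Lemma C1_scalar_expansion n (U : set 'rV[R]_n) (f : 'rV[R]_n -> R) x : open U -> U x ->
  (forall i y, U y -> derivable f y (delta_mx 0 i)) ->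
  (forall i, {for x, continuous ('D_(delta_mx 0 i) f)}) ->
  forall e, 0 < e -> exists2 d, 0 < d & forall h : 'rV[R]_n, enorm h < d ->
    `|f (x + h) - f x - \sum_i h 0 i * 'D_(delta_mx 0 i) f x| <= e * enorm h.
Proof.
move=> oU Ux df cf e e0.
have [r r0 rU] := nbhs_eball (open_nbhs_nbhs (conj oU Ux)).
pose e1 := e / n.+1%:R; have e10 : 0 < e1 by rewrite divr_gt0 // ltr0n.
have [s s0 hs] : exists2 s, 0 < s & forall i y, enorm (y - x) < s ->
    `|'D_(delta_mx 0 i) f y - 'D_(delta_mx 0 i) f x| <= e1.
  have h i : exists2 s, 0 < s & forall y, enorm (y - x) < s ->
      `|'D_(delta_mx 0 i) f y - 'D_(delta_mx 0 i) f x| <= e1.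
    have [s s0 hs] := nbhs_eball (cf i _ (nbhsx_ballx ('D_(delta_mx 0 i) f x) e1 e10)).
    exists s => // y /hs; rewrite /= -ball_normE /= distrC => h; exact: ltW.
  exists (\big[Num.min/1]_i s2val (cid2 (h i))).
    by apply: lt_bigmin => // i _; exact: (s2valP (cid2 (h i))).
  move=> i y ys; apply: (s2valP' (cid2 (h i))); apply: lt_le_trans ys _.
  exact: bigmin_le_cond.
pose d := Num.min r s / n.+1%:R.
have rs0 : 0 < Num.min r s by rewrite lt_min r0.
have d0 : 0 < d by rewrite divr_gt0 ?ltr0n.
exists d => // h hd.
pose p (i : nat) := \sum_(j < n | (j < i)%N) h 0 j *: (delta_mx 0 j : 'rV[R]_n).
have nh : n%:R * enorm h + enorm h < Num.min r s.
  have -> : n%:R * enorm h + enorm h = n.+1%:R * enorm h by rewrite -natr1; ring.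
  by rewrite mulrC -ltr_pdivlMr ?ltr0n.
have psmall (i : 'I_n) c : `|c| <= `|h 0 i| ->
    enorm (x + p i + c *: delta_mx 0 i - x) < Num.min r s.
  move=> ch; rewrite addrAC [x + _]addrC addrK (le_lt_trans _ nh) //.
  rewrite (le_trans (enormD_le _ _)) // lerD //; first exact: coord_enorm_sum.
  by rewrite enormZ enorm_delta mulr1 (le_trans ch) // coord_le_enorm.
have stp (i : 'I_n) : `|f (x + p i.+1) - f (x + p i) - h 0 i * 'D_(delta_mx 0 i) f x| <= e1 * enorm h.
  have [c ci|c ci e2] := @mvt_dir n f (x + p i) (delta_mx 0 i) (h 0 i).
    apply: df; apply: rU; have := psmall _ _ ci; rewrite lt_min => /andP[h1 _]; exact: h1.
  have -> : p i.+1 = p i + h 0 i *: delta_mx 0 i.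
    rewrite /p (bigD1 i) //= addrC; congr (_ + _); apply: eq_bigl => j.
    by rewrite ltnS ltn_neqAle andbC.
  rewrite addrA e2 -mulrBr normrM mulrC ler_pM ?normr_ge0 ?coord_le_enorm //.
  by apply: hs; have := psmall _ _ ci; rewrite lt_min => /andP[_ h1]; exact: h1.
have tel : f (x + h) - f x = \sum_(i < n) (f (x + p i.+1) - f (x + p i)).
  rewrite -(big_mkord xpredT (fun i => f (x + p i.+1) - f (x + p i))) telescope_sumr //.
  have -> : p 0%N = 0 by rewrite /p big1.
  have -> : p n = h.
    by rewrite [RHS]row_sum_delta /p; apply: eq_bigl => j; rewrite ltn_ord.
  by rewrite addr0.
rewrite tel -sumrB (le_trans (ler_norm_sum _ _ _)) //.
apply: (@le_trans _ _ (\sum_(i < n) e1 * enorm h)); first by apply: ler_sum => i _; exact: stp.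
rewrite sumr_const card_ord -mulr_natl mulrA ler_wpM2r ?enorm_ge0 //.
rewrite /e1 mulrCA ler_piMr ?(ltW e0) // ler_pdivrMr ?ltr0n // mul1r ler_nat //.
Qed.

Definition partials n p (f : 'rV[R]_n -> 'rV[R]_p) x : 'M[R]_(n, p) :=
  \matrix_(i, j) 'D_(delta_mx 0 i) (fun y => f y 0 j) x.

Lemma C1_expansion n p (U : set 'rV[R]_n) (f : 'rV[R]_n -> 'rV[R]_p) x : open U -> U x ->
  (forall i y, U y -> derivable f y (delta_mx 0 i)) ->
  (forall i, {for x, continuous ('D_(delta_mx 0 i) f)}) ->
  forall e, 0 < e -> exists2 d, 0 < d & forall h : 'rV[R]_n, enorm h < d ->
    enorm (f (x + h) - f x - h *m partials f x) <= e * enorm h.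
Proof.
move=> oU Ux df cf e e0.
pose e1 := e / p.+1%:R; have e10 : 0 < e1 by rewrite divr_gt0 // ltr0n.
have h (j : 'I_p) : exists2 d, 0 < d & forall h : 'rV[R]_n, enorm h < d ->
    `|f (x + h) 0 j - f x 0 j - \sum_i h 0 i * 'D_(delta_mx 0 i) (fun y => f y 0 j) x| <= e1 * enorm h.
  apply: (@C1_scalar_expansion n U) => //.
    by move=> i y Uy; have /derivable_mxP := df i y Uy; exact.
  move=> i; have nU : \forall y \near x, U y by exact: open_nbhs_nbhs.
  have eqn : \forall y \near x, 'D_(delta_mx 0 i) (fun y => f y 0 j) y = ('D_(delta_mx 0 i) f y) 0 j.
    by apply: filterS nU => y Uy; rewrite derive_mx ?mxE //; exact: df.
  move=> B; rewrite (nbhs_singleton eqn) => HB.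
  have h1 := continuous_comp (cf i) (@coord_continuous_row R p j ('D_(delta_mx 0 i) f x)) HB.
  by apply: (@filterS2 _ (nbhs x) _ _ _ _ _ eqn h1) => y /= ->.
exists (\big[Num.min/1]_j s2val (cid2 (h j))).
  by apply: lt_bigmin => // j _; exact: (s2valP (cid2 (h j))).
move=> v hv; rewrite (le_trans (enorm_le_norm _)) //.
apply: (@le_trans _ _ (p%:R * (e1 * enorm v))).
  rewrite ler_wpM2l ?ler0n // /Num.norm /= mx_normrE.
  apply: bigmax_le => [|[i j] _ /=]; first by rewrite mulr_ge0 ?enorm_ge0 // ltW.
  rewrite ord1 !mxE; under eq_bigr do rewrite mxE.
  apply: (s2valP' (cid2 (h j))); apply: lt_le_trans hv _; exact: bigmin_le_cond.
rewrite mulrA ler_wpM2r ?enorm_ge0 // /e1 mulrCA ler_piMr ?(ltW e0) //.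
by rewrite ler_pdivrMr ?ltr0n // mul1r ler_nat.
Qed.

(** [Ck] speaks of directional derivatives, whereas the chain rule for charts needs a differential;
    continuity of the partial derivatives provides it. *)
Lemma C1_differentiable n p (U : set 'rV[R]_n) (f : 'rV[R]_n -> 'rV[R]_p) x : open U -> U x ->
  (forall i y, U y -> derivable f y (delta_mx 0 i)) ->
  (forall i, {for x, continuous ('D_(delta_mx 0 i) f)}) ->
  differentiable f x /\ 'd f x = mulmxr (partials f x) :> ('rV[R]_n -> 'rV[R]_p).
Proof.
move=> oU Ux df cf.
have cJ : continuous (mulmxr (partials f x) : 'rV[R]_n -> 'rV[R]_p).
  by move=> v; exact: (@continuous_mulmxr n p (partials f x) v).
have ex : f \o shift x = cst (f x) + mulmxr (partials f x) +o_ (0 : 'rV[R]_n) id.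
  apply/eqaddoP => e e0.
  have en : 0 < e / n.+1%:R by rewrite divr_gt0 // ltr0n.
  have [d d0 hd] := C1_expansion oU Ux df cf en.
  apply: (eball_nbhs d0) => h; rewrite subr0 => /hd hh /=.
  rewrite (le_trans (norm_le_enorm _)) //.
  rewrite -![(_ + _ : _ -> _) _]/(_ + _) -![(- _ : _ -> _) _]/(- _) /= opprD addrA addrC /= [h + x]addrC.
  rewrite addrC (le_trans hh) // -mulrA ler_wpM2l ?(ltW e0) // ler_pdivrMl ?ltr0n //.
  rewrite (le_trans (enorm_le_norm _)) // ler_wpM2r ?normr_ge0 // ler_nat //.
have eqd := diff_unique cJ ex.
split => //; apply/diff_locallyP; rewrite eqd; split => //.
Qed.

End Differentials.

(** * Orthonormal frames *)

Section Frames.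
Context {R : realType}.

Definition mx_span d n (B : 'M[R]_(d, n)) : set 'rV[R]_n := [set u *m B | u in [set: 'rV[R]_d]].

Lemma mx_span_sub d e n (B : 'M[R]_(d, n)) (A : 'M[R]_(e, d)) : mx_span (A *m B) `<=` mx_span B.
Proof. by move=> _ [u _ <-]; exists (u *m A) => //; rewrite mulmxA. Qed.

Lemma orthonormal_row_free d n (E : 'M[R]_(d, n)) : E *m E^T = 1%:M -> row_free E.
Proof.
move=> EE; apply: inj_row_free => v /(congr1 (mulmx^~ E^T)).
by rewrite -mulmxA EE mulmx1 mul0mx.
Qed.

Lemma orthonormal_basis d n (B : 'M[R]_(d, n)) : row_free B ->
  exists2 E : 'M[R]_(d, n), E *m E^T = 1%:M & mx_span E = mx_span B.
Proof.
elim: d B => [|d IH] B fB; first by exists B => //; apply/matrixP => -[].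
move: B fB; rewrite -[d.+1]/(1 + d)%N => B fB.
set b := usubmx B; set B' := dsubmx B.
have BE : B = col_mx b B' by rewrite vsubmxK.
have inj (a : 'rV[R]_1) (w : 'rV[R]_d) : a *m b + w *m B' = 0 -> a = 0.
  rewrite -mul_row_col -BE => h; have /eqP := h.
  rewrite -(mul0mx _ B) => /eqP /(row_free_inj fB).
  by rewrite -row_mx0 => /eq_row_mx[].
have fB' : row_free B'.
  apply: inj_row_free => w wB; have : row_mx 0 w *m B = 0 by rewrite BE mul_row_col mul0mx add0r.
  by rewrite -[RHS](mul0mx _ B) => /(row_free_inj fB); rewrite -row_mx0 => /eq_row_mx[].
have [E' EE' sE'] := IH _ fB'.
(* A Gram-Schmidt step: subtract from the first row its projection on the span of the others. *)
pose b' := b - b *m E'^T *m E'.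
have b'0 : b' != 0.
  apply/eqP => /eqP; rewrite subr_eq0 => /eqP bE.
  have : mx_span E' (b *m E'^T *m E') by exists (b *m E'^T).
  rewrite sE' -bE => -[w _ wE]; have := inj 1%:M (- w).
  rewrite mul1mx mulNmx wE subrr => /(_ erefl) /matrixP /(_ 0 0).
  by rewrite !mxE eqxx => /eqP; rewrite oner_eq0.
have np := enorm_gt0 b'0; have n0 : enorm b' != 0 by rewrite gt_eqF.
pose o := (enorm b')^-1 *: b'.
have b'E : b' *m E'^T = 0 by rewrite mulmxBl -(mulmxA _ E') EE' mulmx1 subrr.
have oE : o *m E'^T = 0 by rewrite -scalemxAl b'E scaler0.
have oo : o *m o^T = 1%:M.
  apply/matrixP => i j; rewrite !ord1 -edotE mxE eqxx /= -enorm_sqr enormZ.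
  by rewrite ger0_norm ?invr_ge0 ?enorm_ge0 // mulVf // expr1n.
exists (col_mx o E').
  rewrite tr_col_mx mul_col_row oo EE' oE -(trmxK (E' *m o^T)) trmx_mul trmxK oE trmx0.
  by rewrite -scalar_mx_block.
have X1 : exists A, col_mx o E' = A *m B.
  have /choice[f hf] i : exists w, row i E' = w *m B'.
    have : mx_span E' (row i E') by exists (delta_mx 0 i) => //; rewrite -rowE.
    by rewrite sE' => -[w _ <-]; exists w.
  have [A AE] : exists A, E' = A *m B'.
    exists (\matrix_i f i); apply/row_matrixP => i; rewrite hf row_mul; congr (_ *m _).
    by rewrite rowK.
  exists (block_mx (enorm b')^-1%:M (- ((enorm b')^-1 *: (b *m E'^T *m A))) 0 A).
  rewrite BE mul_block_col mul0mx add0r -AE; congr col_mx.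
  rewrite mul_scalar_mx mulNmx -scalemxAl -(mulmxA _ A) -AE.
  by rewrite /o /b' scalerBr.
have X2 : exists A, B = A *m col_mx o E'.
  have /choice[f hf] i : exists w, row i B' = w *m E'.
    have : mx_span B' (row i B') by exists (delta_mx 0 i) => //; rewrite -rowE.
    by rewrite -sE' => -[w _ <-]; exists w.
  have [A AE] : exists A, B' = A *m E'.
    exists (\matrix_i f i); apply/row_matrixP => i; rewrite hf row_mul; congr (_ *m _).
    by rewrite rowK.
  exists (block_mx (enorm b')%:M (b *m E'^T) 0 A).
  rewrite mul_block_col mul0mx add0r -AE mul_scalar_mx /o scalerA divff // scale1r /b' subrK.
  exact: BE.
apply/seteqP; split.
  by have [A ->] := X1; exact: mx_span_sub.
by have [A AE] := X2; rewrite {1}AE; exact: mx_span_sub.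
Qed.

(** The new rows are an orthonormal basis of the kernel of [E^T], whose rank is [m]. *)
Lemma orthonormal_completion d m (E : 'M[R]_(d, d + m)) : E *m E^T = 1%:M ->
  exists E2 : 'M[R]_(m, d + m), col_mx E E2 *m (col_mx E E2)^T = 1%:M.
Proof.
move=> EE; have fE := orthonormal_row_free EE.
have rk : \rank (kermx E^T) = m.
  by rewrite mxrank_ker mxrank_tr (eqP fE) addKn.
have [E2 EE2 sE2] := orthonormal_basis (row_base_free (kermx E^T)).
have E2E : E2 *m E^T = 0.
  apply/row_matrixP => i; rewrite row_mul row0.
  have : mx_span E2 (row i E2) by exists (delta_mx 0 i) => //; rewrite -rowE.
  rewrite sE2 => -[w _ <-]; apply/sub_kermxP; rewrite (submx_trans (submxMl _ _)) //.
  by rewrite eq_row_base.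
move: E2 EE2 {sE2} E2E; rewrite rk => E2 EE2 E2E; exists E2.
rewrite tr_col_mx mul_col_row EE EE2 E2E -(trmxK (E *m E2^T)) trmx_mul trmxK E2E trmx0.
by rewrite -scalar_mx_block.
Qed.

Lemma frame_exists d m (B : 'M[R]_(d, d + m)) : row_free B ->
  exists2 Q : 'M[R]_(d + m), Q *m Q^T = 1%:M &
    mx_span B = [set row_mx u 0 *m Q | u in [set: 'rV[R]_d]].
Proof.
move=> fB; have [E EE sE] := orthonormal_basis fB; have [E2 QQ] := orthonormal_completion EE.
exists (col_mx E E2) => //; rewrite -sE; apply/seteqP.
by split=> _ [u _ <-]; exists u => //; rewrite mul_row_col mul0mx addr0.
Qed.

End Frames.

(** * Tangent spaces of a submanifold *)

Section ChartTangent.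
Context {R : realType} {d m : nat}.
Implicit Types (M : set 'rV[R]_(d + m)).

(** Let [K] and [L] be the Jacobians of the slice chart at [p] and of its inverse. A vector is
    tangent when its image under [K] has no normal part, so the first [d] rows of [L] form a basis.
    The last claim is flatness to first order: the chart has normal part 0 at both [p] and [q],
    hence the normal part of [(q - p) *m K] is o(|q - p|). *)
Lemma chart_tangent M p : submanifold 2 M -> M p ->
  exists2 B : 'M[R]_(d, d + m), row_free B & tangent M p = mx_span B /\
    forall e, 0 < e -> exists2 r, 0 < r & forall q nu, M q -> enorm (q - p) < r ->
      (forall v, tangent M p v -> edot nu v = 0) ->
      `|edot nu (q - p)| <= e * enorm nu * enorm (q - p).
Proof.
move=> sM Mp; have [U [W [Phi [Psi [[oU oW Up] [PsiPhi PhiPsi CPhi CPsi MU]]]]]] := sM p Mp.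
have [Wy0 Psiy0] := PsiPhi p Up; set y0 := Phi p in Wy0 Psiy0.
have C1 (V : set 'rV[R]_(d + m)) (f : 'rV[R]_(d + m) -> 'rV[R]_(d + m)) x : open V -> V x -> Ck 2 V f ->
    [/\ differentiable f x, forall v, 'd f x v = v *m partials f x &
    forall e, 0 < e -> exists2 d0, 0 < d0 & forall h : 'rV[R]_(d + m), enorm h < d0 ->
    enorm (f (x + h) - f x - h *m partials f x) <= e * enorm h].
  move=> oV Vx [_ hf].
  have h1 i y : V y -> derivable f y (delta_mx 0 i) by move=> Vy; have [h _] := hf (delta_mx 0 i); exact: h.
  have h2 i : {for x, continuous ('D_(delta_mx 0 i) f)}.
    by have [_ [h _]] := hf (delta_mx 0 i); exact: h.
  have [h3 h4] := C1_differentiable oV Vx h1 h2.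
  split => //; first by move=> v; exact: (congr1 (@^~ v) h4).
  exact: C1_expansion oV Vx h1 h2.
have [dPhi dPhiE ePhi] := C1 U Phi p oU Up CPhi.
have [dPsi dPsiE _] := C1 W Psi y0 oW Wy0 CPsi.
set K := partials Phi p in dPhiE ePhi; set L := partials Psi y0 in dPsiE.
have nU : \forall x \near p, U x by exact: open_nbhs_nbhs.
have KL : K *m L = 1%:M.
  apply/row_matrixP => i; rewrite row_mul row1 rowE.
  suff <- : 'd (Psi \o Phi) p (delta_mx 0 i) = delta_mx 0 i *m K *m L.
    rewrite -deriveE; last exact: differentiable_comp.
    transitivity ('D_(delta_mx 0 i) (@id 'rV[R]_(d + m)) p); last by rewrite derive_id.
    apply: near_eq_derive; apply: (@filterS _ (nbhs p) _ _ _ _ nU) => x Ux.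
    by rewrite /= (PsiPhi x Ux).2.
  have h1 := congr1 (@^~ (delta_mx 0 i)) (diff_comp dPhi dPsi).
  apply: (etrans h1); exact: (etrans (congr1 ('d Psi (Phi p)) (dPhiE _)) (dPsiE _)).
have LK : L *m K = 1%:M by exact: mulmx1C.
have M0 x : M x -> U x -> rsubmx (Phi x) = 0 by move=> Mx Ux; apply/(MU x Ux).
have tang v : tangent M p v <-> rsubmx (v *m K) = 0.
  split=> [[g [g0 gM gd]]|vK].
    have dg : differentiable g 0 by apply/derivable1_diffP; case: gd.
    have gv : 'd g 0 1 = v by rewrite -deriveE //; exact: derive_val.
    have dPg : differentiable (Phi \o g) 0 by apply: differentiable_comp => //; rewrite g0.
    have dr x : differentiable (rsubmx : 'rV[R]_(d + m) -> 'rV[R]_m) x by exact: differentiable_rsubmx.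
    have : 'D_1 (rsubmx \o (Phi \o g)) 0 = 'D_1 (cst (0 : 'rV[R]_m)) (0 : R).
      apply: near_eq_derive.
      have gU : \forall t \near (0 : R), U (g t).
        have := differentiable_continuous dg; rewrite /prop_for /continuous_at g0 => cg.
        exact: (cg _ nU).
      by near=> t; rewrite /=; apply: M0; near: t.
    rewrite derive_cst deriveE; last exact: differentiable_comp.
    have rl : 'd (rsubmx : 'rV[R]_(d + m) -> 'rV[R]_m) ((Phi \o g) 0) = rsubmx :> ('rV[R]_(d + m) -> 'rV[R]_m).
      by apply: diff_lin; exact: continuous_rsubmx.
    move=> <-; apply/esym.
    transitivity ('d (rsubmx : 'rV[R]_(d + m) -> 'rV[R]_m) ((Phi \o g) 0) ('d (Phi \o g) 0 1)).
      exact: (congr1 (@^~ 1) (diff_comp dPg (dr _))).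
    rewrite (congr1 (@^~ ('d (Phi \o g) 0 1)) rl); congr rsubmx.
    have dPhig : differentiable Phi (g 0) by rewrite g0.
    transitivity ('d Phi (g 0) ('d g 0 1)).
      exact: (congr1 (@^~ 1) (diff_comp dg dPhig)).
    by rewrite gv g0; exact: dPhiE.
  exists (fun t => Psi (y0 + t *: (v *m K))); split.
  - by rewrite scale0r addr0.
  - have cl : {for 0, continuous (fun t : R => y0 + t *: (v *m K))}.
      apply: continuousD; first exact: cst_continuous.
      exact: scalel_continuous.
    have : \forall t \near (0 : R), W (y0 + t *: (v *m K)).
      apply: cl; rewrite scale0r addr0; exact: open_nbhs_nbhs.
    apply: filterS => t Wt; apply/(MU _ (PhiPsi _ Wt).1); rewrite (PhiPsi _ Wt).2.
    rewrite linearD linearZ /= vK scaler0 addr0; exact: M0.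
  - have dv : derivable Psi y0 (v *m K) by exact: diff_derivable.
    have dE : 'D_(v *m K) Psi y0 = v.
      apply: (etrans (deriveE _ dPsi)); apply: (etrans (dPsiE _)).
      by rewrite -mulmxA KL mulmx1.
    have h : is_derive (0 : R) (1 : R) (fun s : R => Psi (y0 + s *: (v *m K)))
        ('D_(v *m K) Psi (y0 + (0 : R) *: (v *m K))).
      by apply: is_derive_line; rewrite scale0r addr0.
    by move: h; rewrite scale0r addr0 dE.
have rE (u : 'rV[R]_d) : u *m usubmx L = row_mx u 0 *m L.
  by rewrite -{2}(vsubmxK L) mul_row_col mul0mx addr0.
exists (usubmx L).
  apply: inj_row_free => u; rewrite rE => /(congr1 (mulmx^~ K)).
  by rewrite -mulmxA LK mulmx1 mul0mx -row_mx0 => /eq_row_mx[].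
have tE : tangent M p = mx_span (usubmx L).
  apply/seteqP; split=> [v /tang vK|_ [u _ <-]].
    exists (lsubmx (v *m K)) => //; rewrite rE -vK hsubmxK.
    by rewrite -mulmxA KL mulmx1.
  by apply/tang; rewrite rE -mulmxA LK mulmx1 row_mxKr.
split=> // e e0.
have [C C0 hC] := mulmx_bound (dsubmx L).
have [r r0 hr] := ePhi (e / C) (divr_gt0 e0 C0).
have [s s0 hs] := nbhs_eball nU.
exists (Num.min r s) => [|q nu Mq]; first by rewrite lt_min r0.
rewrite lt_min => /andP[qr qs] nuT; set v := q - p.
have qE : p + v = q by rewrite /v addrC subrK.
have := hr _ qr; rewrite -/v qE -/y0 => hv.
have rq : enorm (rsubmx (v *m K)) <= e / C * enorm v.
  apply: le_trans hv; rewrite -(enormN (_ - _)) (le_trans _ (enorm_rsubmx _)) //.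
  by rewrite opprB linearB /= linearB /= (M0 q) ?(M0 p) ?subr0 //; exact: hs.
have vE : v = lsubmx (v *m K) *m usubmx L + rsubmx (v *m K) *m dsubmx L.
  by rewrite -mul_row_col hsubmxK vsubmxK -mulmxA KL mulmx1.
rewrite {1}vE edotDr nuT ?add0r; last by rewrite tE; exists (lsubmx (v *m K)).
rewrite (le_trans (edot_norm_le _ _)) // mulrC -mulrA (mulrC (enorm nu)) mulrA ler_wpM2r ?enorm_ge0 //.
rewrite (le_trans (hC _)) // mulrC -ler_pdivlMr // mulrAC //.
Unshelve. all: by end_near. Qed.

Lemma frame_of_submanifold M p : submanifold 2 M -> M p -> exists Q, tangent_frame M p Q.
Proof.
move=> sM Mp; have [B fB [tE _]] := chart_tangent sM Mp.
by have [Q QQ QE] := frame_exists fB; exists Q; split => //; rewrite tE.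
Qed.

End ChartTangent.

(** * Unique nearest points and normal rays *)

Section Reach.
Context {R : realType} {n : nat}.
Implicit Types (A : set 'rV[R]_n) (x p q : 'rV[R]_n).

(** Continuous induction. Let [u] be the supremum of the initial segments on which [P] holds:
    closedness gives [P u], and the step excludes [u < a]. It serves to prolong normal rays and to
    integrate a differential inequality for a function that need not be differentiable. *)
Lemma real_induction (a : R) (P : R -> Prop) :
  (exists2 s0, 0 < s0 & forall s, 0 < s -> s <= s0 -> P s) ->
  (forall s, 0 < s -> s < a -> (forall t, 0 < t -> t <= s -> P t) ->
     exists2 h, 0 < h & forall t, s < t -> t <= s + h -> P t) ->
  (forall s, 0 < s -> s <= a -> (forall t, 0 < t -> t < s -> P t) -> P s) ->
  forall s, 0 < s -> s <= a -> P s.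
Proof.
move=> [s0 s00 h0] hstep hclosed.
pose S := [set s | s <= a /\ forall t, 0 < t -> t <= s -> P t].
have [a0|a0] := leP a 0; first by move=> s sp sa; have := lt_le_trans sp (le_trans sa a0); rewrite ltxx.
have S0 : S (Num.min s0 a).
  split; first by rewrite ge_min lexx orbT.
  by move=> t tp; rewrite le_min => /andP[ts _]; exact: h0.
have hs : has_sup S.
  by split; [exists (Num.min s0 a)|exists a => s []].
set u := sup S.
have u0 : 0 < u.
  apply: lt_le_trans (_ : Num.min s0 a <= u); first by rewrite lt_min s00.
  by apply: ub_le_sup => //; case: hs.
have ua : u <= a by apply: ge_sup; [case: hs|move=> s []].
have Pu t : 0 < t -> t < u -> P t.
  move=> tp tu; have [s Ss ts] : exists2 s, S s & t < s.
    have utp : 0 < u - t by rewrite subr_gt0.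
    have [s Ss hs2] := sup_adherent utp hs; exists s => //.
    by move: hs2; rewrite -/u opprB addrC subrK.
  by apply: Ss.2 => //; exact: ltW.
have Pu' t : 0 < t -> t <= u -> P t.
  move=> tp; rewrite le_eqVlt => /orP[/eqP->|]; last exact: Pu.
  exact: hclosed.
have [->|une] := eqVneq a u; first exact: Pu'.
have ult : u < a by rewrite lt_def ua andbT.
have [h hp hP] := hstep u u0 ult Pu'.
have : Num.min (u + h) a <= u.
  apply: ub_le_sup; first by case: hs.
  split; first by rewrite ge_min lexx orbT.
  move=> t tp; rewrite le_min => /andP[th _].
  by have [tu|ut] := leP t u; [exact: Pu'|exact: hP].
by rewrite leNgt lt_min ult ltrDl hp.
Qed.

Definition unique_nearest (tau : R) A := forall x a q q', A a -> enorm (x - a) < tau ->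
  nearest A x q -> nearest A x q' -> q = q'.

Lemma edist_le A x a : A a -> (Defs.edist x A <= (enorm (x - a))%:E)%E.
Proof. by move=> Aa; apply: ereal_inf_lbound; exists a. Qed.

Lemma reach_unique_nearest A tau : (tau%:E <= reach A)%E -> unique_nearest tau A.
Proof.
move=> tr x a q q' Aa xa nq nq'.
have : ((enorm (x - a))%:E < reach A)%E by rewrite (lt_le_trans _ tr) // lte_fin.
move=> /ereal_sup_gt[_ [r [r0 hr] <-]]; rewrite lte_fin => ar.
have [|z [_ uz]] := hr x.
  by apply: le_trans (edist_le x Aa) _; rewrite lee_fin ltW.
by rewrite -(uz q nq) -(uz q' nq').
Qed.

(** A real-valued distance, read off a chosen nearest point; its value does not depend on the
    choice, and [nearest_exists] gives such a point for a closed nonempty set. *)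
Definition mdist A x := enorm (x - xget 0 [set q | nearest A x q]).

Lemma mdist_nearest A x q : nearest A x q -> mdist A x = enorm (x - q).
Proof.
move=> nq; rewrite /mdist; case: xgetP => [z _ [Az zmin]|/(_ q)//].
by apply/eqP; rewrite eq_le zmin ?nq.2 //; exact: nq.1.
Qed.

Lemma mdist_le A x a : closed A -> A a -> mdist A x <= enorm (x - a).
Proof.
move=> cA Aa; have [q nq] := nearest_exists x cA (ex_intro _ a Aa).
by rewrite (mdist_nearest nq); exact: nq.2.
Qed.

Lemma mdist_lip A x y : closed A -> A !=set0 -> mdist A x <= mdist A y + enorm (x - y).
Proof.
move=> cA A0; have [q nq] := nearest_exists y cA A0.
rewrite (mdist_nearest nq) (le_trans (mdist_le x cA nq.1)) //.
by rewrite [leRHS]addrC enorm_triangle.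
Qed.

Lemma mdist_dist A x y : closed A -> A !=set0 -> `|mdist A x - mdist A y| <= enorm (x - y).
Proof.
move=> cA A0; rewrite ler_norml lerBlDl mdist_lip // andbT.
by rewrite lerNl opprB lerBlDl enormBC mdist_lip.
Qed.

Lemma continuous_mdist A : closed A -> A !=set0 -> continuous (mdist A).
Proof.
move=> cA A0 x B /nbhs_ballP[e /= e0 eB].
apply: (eball_nbhs e0) => y yx; apply: eB; rewrite /ball /=.
by rewrite (le_lt_trans (mdist_dist _ _ cA A0)) // enormBC.
Qed.

Lemma closed_edot_le (v x : 'rV[R]_n) : closed [set a : 'rV[R]_n | edot v (x - a) <= 0].
Proof.
apply: (closed_comp (f := fun a : 'rV[R]_n => edot v (x - a)) (D := [set t | t <= 0])); last exact: closed_le.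
move=> a _; apply: (@continuous_edot _ _ (fun=> v) (fun a : 'rV[R]_n => x - a)); first exact: cst_continuous.
by apply: continuousB; [exact: cst_continuous|move=> P].
Qed.

(* Maximize the distance to A on a small ball around x0: where the nearest
   point is unique the distance increases in the direction away from it, so the
   maximum is reached on the normal ray. *)
Lemma nearest_extend_step A tau p nu r : compact A -> unique_nearest tau A ->
  enorm nu = 1 -> 0 < r -> r < tau -> nearest A (p + r *: nu) p ->
  exists2 eta, 0 < eta & nearest A (p + (r + eta) *: nu) p.
Proof.
move=> cpA uA nu1 r0 rt np.
have cA : closed A by exact: compact_closed_row.
have A0 : A !=set0 by exists p; exact: np.1.
set x0 := p + r *: nu in np.
have x0p : enorm (x0 - p) = r by rewrite /x0 addrAC subrr add0r enormZ nu1 mulr1 gtr0_norm.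
pose eta := Num.min r (tau - r) / 2.
have m0 : 0 < Num.min r (tau - r) by rewrite lt_min r0 subr_gt0.
have eta0 : 0 < eta by rewrite divr_gt0.
have [er et] : 2 * eta <= r /\ 2 * eta <= tau - r.
  by split; rewrite /eta mulrC divfK // ge_min lexx ?orbT.
pose B := [set x | enorm (x - x0) <= eta].
have [||x1 /set_mem Bx1 x1max] := @EVT_max_rV R n (mdist A) B _ (@compact_eball R n x0 eta).
- by exists x0; rewrite /B /= subrr enorm0 ltW.
- by apply: continuous_subspaceT; exact: continuous_mdist.
have [q1 nq1] := nearest_exists x1 cA A0.
pose f1 := enorm (x1 - q1); have f1E : mdist A x1 = f1 by exact: mdist_nearest.
have f1r : r <= f1.
  have := x1max x0; rewrite f1E (mdist_nearest np) x0p; apply.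
  by rewrite inE /B /= subrr enorm0 ltW.
have f10 : 0 < f1 by exact: lt_le_trans f1r.
have x1p : enorm (x1 - p) <= r + eta.
  by rewrite [leRHS]addrC -x0p (le_trans (enorm_triangle x0 _ _)) // lerD2r.
have uq1 q : nearest A x1 q -> q = q1.
  move=> nq; apply: (uA x1 p) => //; first exact: np.1.
  by rewrite (le_lt_trans x1p) //; lra.
have [g g1 gE] : exists2 g, enorm g = 1 & x1 - q1 = f1 *: g.
  exists (f1^-1 *: (x1 - q1)); last by rewrite scalerA divff ?scale1r // gt_eqF.
  by rewrite enormZ gtr0_norm ?invr_gt0 // mulVf // gt_eqF.
pose x2 := x0 + eta *: g.
have x12 : x1 = x2.
  apply/eqP; rewrite -subr_eq0; apply/negPn/negP => ne.
  pose v := x2 - x1.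
  have v0 : 0 < enorm v by apply: enorm_gt0; rewrite -oppr_eq0 opprB.
  have vg : 0 < edot v g.
    rewrite ltNge; apply/negP => vg; suff : enorm v ^+ 2 <= 0 by rewrite leNgt exprn_gt0.
    have vE : v = eta *: g - (x1 - x0) by rewrite /v /x2; vec.
    have : edot v g = eta - edot (x1 - x0) g.
      by rewrite vE (edotBl (eta *: g)) (edotZl eta g) -enorm_sqr g1 expr1n mulr1.
    move=> e1; rewrite vE enormB_sqr enormZ g1 mulr1 real_normK ?num_real // edotZl (edotC g).
    have : enorm (x1 - x0) ^+ 2 <= eta ^+ 2 by rewrite lerXn2r ?nnegrE ?enorm_ge0 // ltW.
    nra.
  pose K := A `&` [set a | edot v (x1 - a) <= 0].
  have [t [t0 t1 Kt]] : exists t, [/\ 0 < t, t <= 1 & forall a, K a -> f1 + t * enorm v < enorm (x1 - a)].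
    have cK : closed K.
      apply: closedI => //.
      exact: closed_edot_le.
    have [K0|/nonemptyPn K0] := pselect (K !=set0); last by exists 1; split => // a; rewrite K0.
    have [k [Kk kmin]] := nearest_exists x1 cK K0.
    have dk : f1 < enorm (x1 - k).
      rewrite lt_def (nq1.2 _ Kk.1) andbT; apply/eqP => e1.
      have kq : k = q1 by apply: uq1; split => [|a Aa]; [exact: Kk.1|rewrite e1; exact: nq1.2].
      by have := Kk.2; rewrite /= kq gE edotZr leNgt mulr_gt0.
    exists (Num.min 1 ((enorm (x1 - k) - f1) / (2 * enorm v))); split.
    - by rewrite lt_min ltr01 divr_gt0 ?subr_gt0 // mulr_gt0.
    - by rewrite ge_min lexx.
    - move=> a Ka; apply: lt_le_trans (kmin _ Ka).
      have : Num.min 1 ((enorm (x1 - k) - f1) / (2 * enorm v)) * enorm v <= (enorm (x1 - k) - f1) / 2.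
        have -> : (enorm (x1 - k) - f1) / 2 = (enorm (x1 - k) - f1) / (2 * enorm v) * enorm v.
          by field; rewrite gt_eqF.
        by rewrite ler_wpM2r ?enorm_ge0 // ge_min lexx orbT.
      lra.
  pose xt := x1 + t *: v.
  have [qt nqt] := nearest_exists xt cA A0.
  have Bxt : B xt.
    rewrite /B /=; have -> : xt - x0 = (1 - t) *: (x1 - x0) + t *: (eta *: g).
      by rewrite /xt /v /x2; vec.
    rewrite (le_trans (enormD_le _ _)) // !enormZ g1 mulr1 !ger0_norm ?subr_ge0 // ?(ltW t0) ?(ltW eta0) //.
    have : (1 - t) * enorm (x1 - x0) <= (1 - t) * eta by rewrite ler_wpM2l ?subr_ge0.
    lra.
  have : mdist A xt <= f1 by rewrite -f1E; apply: x1max; rewrite inE.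
  rewrite (mdist_nearest nqt) leNgt => /negP; apply.
  have [vq|vq] := leP (edot v (x1 - qt)) 0.
    have := Kt qt (conj nqt.1 vq).
    have := enorm_triangle xt x1 qt; rewrite (enormBC x1 xt) /xt addrAC subrr add0r enormZ gtr0_norm //.
    lra.
  have -> : xt - qt = (x1 - qt) + t *: v by rewrite /xt addrAC.
  rewrite -ltr_sqr ?nnegrE ?enorm_ge0 ?(ltW f10) // (enormD_sqr (x1 - qt)) (edotZr t) (edotC (x1 - qt)).
  have : f1 ^+ 2 <= enorm (x1 - qt) ^+ 2.
    by rewrite lerXn2r ?nnegrE ?enorm_ge0 ?(ltW f10) //; apply: nq1.2; exact: nqt.1.
  have : 0 <= enorm (t *: v) ^+ 2 by rewrite sqr_ge0.
  have : 0 < t * edot v (x1 - qt) by rewrite mulr_gt0.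
  lra.
have x0q : x0 - q1 = (f1 - eta) *: g.
  by rewrite scalerBl -gE {1}x12 /x2; vec.
have fe : 0 < f1 - eta by lra.
have dq : enorm (x0 - q1) = f1 - eta by rewrite x0q enormZ g1 mulr1 gtr0_norm.
have f1le : f1 <= r + eta by apply: le_trans x1p; apply: nq1.2; exact: np.1.
have nq0 : nearest A x0 q1.
  split; first exact: nq1.1.
  by move=> a /np.2; rewrite x0p dq; lra.
have q1p : q1 = p.
  by apply: (uA x0 p) => //; [exact: np.1|rewrite x0p].
have fr : f1 - eta = r by rewrite -dq q1p x0p.
have gnu : g = nu.
  have : r *: nu = r *: g by rewrite -{2}fr -x0q q1p /x0 addrAC subrr add0r.
  by move/scalerI; rewrite gt_eqF // => /(_ isT).
exists eta => //; have -> : p + (r + eta) *: nu = x1.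
  have -> : r + eta = f1 by rewrite -fr subrK.
  by rewrite -gnu -gE q1p addrC subrK.
by rewrite -q1p.
Qed.

Lemma nearest_shrink A p nu r s : enorm nu = 1 -> 0 <= s -> s <= r ->
  nearest A (p + r *: nu) p -> nearest A (p + s *: nu) p.
Proof.
move=> nu1 s0 sr [Ap pmin]; split=> // a Aa; have := pmin a Aa.
have r0 : 0 <= r by exact: le_trans sr.
rewrite ![p + _ *: nu - p]addrAC !subrr !add0r !enormZ nu1 !mulr1 !ger0_norm //.
have := enorm_triangle (p + s *: nu) (p + r *: nu) a.
rewrite opprD addrACA subrr add0r -scalerBl enormZ nu1 mulr1 ger0_norm ?subr_ge0 //.
lra.
Qed.

(** Federer's argument: a normal segment can be prolonged to any length below [tau] without changing
    its foot. It is [real_induction] along the ray, with [nearest_extend_step] as the open step and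
    a limit of inequalities as the closed one. *)
Lemma nearest_extend A tau p x : compact A -> unique_nearest tau A ->
  nearest A x p -> 0 < enorm (x - p) -> enorm (x - p) < tau ->
  forall r, 0 <= r -> r < tau -> nearest A (p + (r / enorm (x - p)) *: (x - p)) p.
Proof.
move=> cA uA np; set r0 := enorm (x - p) => r00 r0t.
pose nu := r0^-1 *: (x - p).
have nu1 : enorm nu = 1 by rewrite enormZ gtr0_norm ?invr_gt0 // mulVf // gt_eqF.
have good0 : nearest A (p + r0 *: nu) p.
  by rewrite scalerA divff ?gt_eqF // scale1r addrC subrK.
suff h r : 0 < r -> r < tau -> nearest A (p + r *: nu) p.
  move=> r; rewrite le_eqVlt => /orP[/eqP<- _|r1 r2]; last by rewrite -scalerA; exact: h.
  rewrite mul0r scale0r addr0; split; first exact: np.1.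
  by move=> a _; rewrite subrr enorm0 enorm_ge0.
move=> rp rt; apply: (real_induction (a := r) (P := fun s => nearest A (p + s *: nu) p)) => //.
- by exists r0 => // s s0 sr; apply: nearest_shrink good0 => //; exact: ltW.
- move=> s s0 sr hs; have [eta e0 he] := nearest_extend_step cA uA nu1 s0 (lt_trans sr rt) (hs s s0 (lexx _)).
  exists eta => // t st te; apply: nearest_shrink he => //.
  by rewrite ltW // (lt_trans s0).
- move=> s s0 _ hs; split; first exact: np.1.
  move=> a Aa; apply/ler_addgt0Pr => e e0.
  rewrite addrAC subrr add0r enormZ nu1 mulr1 gtr0_norm //.
  pose t := Num.max (s / 2) (s - e / 2).
  have t0 : 0 < t by rewrite lt_max divr_gt0.
  have ts : t < s by rewrite gt_max; apply/andP; split; lra.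
  have te : s - e / 2 <= t by rewrite le_max lexx orbT.
  have := (hs t t0 ts).2 a Aa; rewrite addrAC subrr add0r enormZ nu1 mulr1 gtr0_norm //.
  have := enorm_triangle (p + s *: nu) (p + t *: nu) a.
  rewrite opprD addrACA subrr add0r -scalerBl enormZ nu1 mulr1 ler0_norm ?subr_le0 ?(ltW ts) //.
  lra.
Qed.

(** A ball of radius [r < tau] touching [A] at [p] has no point of [A] inside; expanding the square
    gives the inequality, and [r] tends to [tau]. The obstacle is that flatness to first order does
    not make [p] the foot of any point on its normal ray. So take the foot [q] of [p + t *: nu],
    which is within [2 * t * e] of [p], prolong the ray issued from [q] to length [r], and let [e]
    tend to 0. *)
Lemma ball_free_normal A tau p nu : compact A -> unique_nearest tau A -> 0 < tau -> A p ->
  enorm nu = 1 ->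
  (forall e, 0 < e -> exists2 r, 0 < r & forall q, A q -> enorm (q - p) < r ->
     `|edot nu (q - p)| <= e * enorm (q - p)) ->
  forall a, A a -> 2 * tau * edot nu (a - p) <= enorm (a - p) ^+ 2.
Proof.
move=> cpA uA tau0 Ap nu1 fo a Aa.
have cA : closed A by exact: compact_closed_row.
have key r : 0 < r -> r < tau -> 2 * r * edot nu (a - p) <= enorm (a - p) ^+ 2.
  move=> r0 rt; suff h : r <= enorm (p + r *: nu - a).
    have : r ^+ 2 <= enorm (p + r *: nu - a) ^+ 2 by rewrite lerXn2r ?nnegrE ?enorm_ge0 ?(ltW r0).
    have -> : p + r *: nu - a = r *: nu - (a - p) by rewrite opprB addrCA addrA.
    by rewrite (enormB_sqr (r *: nu)) edotZl enormZ nu1 mulr1 real_normK ?num_real //; lra.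
  apply/ler_addgt0Pr => eps eps0.
  (* The displacement of the foot costs at most [tau * e] and the change of direction twice
     [4 * tau * e], together less than [10 * tau * e]. *)
  pose e := Num.min (1 / 4) (eps / (10 * tau)).
  have e0 : 0 < e by rewrite lt_min divr_gt0 //= divr_gt0 // mulr_gt0.
  have e4 : e <= 1 / 4 by rewrite ge_min lexx.
  have ee : 10 * tau * e <= eps.
    by rewrite mulrC -ler_pdivlMr ?mulr_gt0 // ge_min lexx orbT.
  have [s s0 hs] := fo e e0.
  pose t := Num.min (s / 4) (tau / 2).
  have t0 : 0 < t by rewrite lt_min !divr_gt0.
  have ts : t <= s / 4 by rewrite ge_min lexx.
  have tt : t <= tau / 2 by rewrite ge_min lexx orbT.
  pose x := p + t *: nu.
  have [q nq] := nearest_exists x cA (ex_intro _ p Ap).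
  pose w := q - p.
  have xq : x - q = t *: nu - w by rewrite /x /w opprB addrCA addrA.
  have xqt : enorm (x - q) <= t.
    have xp : x - p = t *: nu by rewrite /x; vec.
    by have := nq.2 p Ap; rewrite xp enormZ nu1 mulr1 gtr0_norm.
  have w2 : enorm w <= 2 * t.
    have -> : w = t *: nu - (x - q) by rewrite xq opprB addrC subrK.
    rewrite (le_trans (enormB_le _ _)) // enormZ nu1 mulr1 gtr0_norm //; lra.
  have wn : `|edot nu w| <= e * enorm w by apply: hs; [exact: nq.1|rewrite -/w; lra].
  have we : enorm w <= 2 * t * e.
    have : enorm (x - q) ^+ 2 <= t ^+ 2 by rewrite lerXn2r ?nnegrE ?enorm_ge0 // ltW.
    rewrite xq enormB_sqr edotZl enormZ nu1 mulr1 real_normK ?num_real // => h.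
    have h2 : edot nu w <= e * enorm w by rewrite (le_trans (ler_norm _)).
    have [->|wp] := eqVneq (enorm w) 0; first by rewrite !mulr_ge0 // ltW.
    have wpos : 0 < enorm w by rewrite lt_def wp enorm_ge0.
    rewrite -(ler_pM2r wpos); have : t * edot nu w <= t * (e * enorm w) by rewrite ler_wpM2l // ltW.
    nra.
  set D := enorm (x - q) in xqt.
  have Dt : t - 2 * t * e <= D.
    have := enormD_le (x - q) w; rewrite xq subrK enormZ nu1 mulr1 gtr0_norm // -xq -/D; lra.
  have te : 2 * t * e <= t / 2 by nra.
  have D0 : 0 < D by lra.
  have Dtau : D < tau by lra.
  have := (nearest_extend cpA uA nq D0 Dtau (ltW r0) rt).2 a Aa.
  rewrite -/D [q + _ - q]addrAC subrr add0r enormZ -/D ger0_norm; last by rewrite divr_ge0 ?(ltW r0) ?(ltW D0).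
  rewrite divfK ?gt_eqF // => h; apply: (le_trans h).
  apply: (le_trans (enorm_triangle (p + r *: nu) _ _)); rewrite addrC lerD2l.
  have -> : q + (r / D) *: (x - q) - (p + r *: nu) = w + ((r * (t - D) / D) *: nu - (r / D) *: w).
    have -> : r * (t - D) / D = r / D * t - r by field; rewrite gt_eqF.
    by rewrite xq /w; vec.
  rewrite (le_trans (enormD_le _ _)) // (le_trans (lerD (lexx _) (enormB_le _ _))) //.
  rewrite !enormZ nu1 mulr1 !ger0_norm ?divr_ge0 ?mulr_ge0 ?subr_ge0 ?(ltW D0) ?(ltW r0) //.
  have h1 : r * (t - D) / D <= 4 * r * e.
    rewrite ler_pdivrMr //; have : t - D <= 4 * e * D by nra.
    by move=> h1; rewrite -!mulrA mulrCA ler_pM2l // mulrA.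
  have h2 : r / D * enorm w <= 4 * r * e.
    rewrite mulrAC ler_pdivrMr // -!mulrA mulrCA ler_pM2l // (le_trans we) //; nra.
  have : 4 * r * e <= 4 * tau * e by rewrite ler_wpM2r ?(ltW e0) // ler_wpM2l // ltW.
  nra.
have [h|h] := leP (edot nu (a - p)) 0.
  by rewrite (le_trans (_ : _ <= 0)) ?sqr_ge0 // mulr_ge0_le0 // mulr_ge0 // ltW.
rewrite leNgt; apply/negP => lt2.
have hp : 0 < 2 * edot nu (a - p) by rewrite mulr_gt0.
pose r1 := enorm (a - p) ^+ 2 / (2 * edot nu (a - p)).
have r1t : r1 < tau by rewrite ltr_pdivrMr //; move: lt2; rewrite mulrAC mulrC mulrA.
have r10 : 0 <= r1 by rewrite divr_ge0 ?sqr_ge0 // ltW.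
have := key ((r1 + tau) / 2); have [m1 m2] : r1 < (r1 + tau) / 2 /\ (r1 + tau) / 2 < tau by split; lra.
move=> /(_ (le_lt_trans r10 m1) m2); apply/negP; rewrite -ltNge.
have : r1 * (2 * edot nu (a - p)) = enorm (a - p) ^+ 2 by rewrite /r1 divfK // gt_eqF.
nra.
Qed.

End Reach.

(** * Manifolds without points in tangent balls *)

Section GoodManifold.
Context {R : realType} {d m : nat}.

(** The later geometry uses nothing but this: compactness, tangent frames, and the fact that no
    point of [M] lies inside a ball of radius [tau] touching it. Unlike membership in the class, it
    passes to rescaled manifolds without a return to charts or to [reach]. *)
Definition good_mfd (tau : R) (M : set 'rV[R]_(d + m)) :=
  [/\ 0 < tau, compact M, forall p, M p -> exists Q, tangent_frame M p Q &
    forall p nu, M p -> (forall v, tangent M p v -> edot nu v = 0) ->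
    forall a, M a -> 2 * tau * edot nu (a - p) <= enorm nu * enorm (a - p) ^+ 2].

Lemma good_mfd_of_class Vmax tau (M : set 'rV[R]_(d + m)) :
  0 < tau -> manifold_class Vmax tau M -> good_mfd tau M.
Proof.
move=> tau0 [cM sM _ _ rM]; split=> // [p Mp|p nu Mp nuT a Ma].
  exact: frame_of_submanifold.
have [->|nu0] := eqVneq nu 0; first by rewrite edot0l mulr0 enorm0 mul0r.
have np := enorm_gt0 nu0; have nn : enorm nu != 0 by rewrite gt_eqF.
pose nu' := (enorm nu)^-1 *: nu.
have nu1 : enorm nu' = 1 by rewrite enormZ ger0_norm ?invr_ge0 ?enorm_ge0 // mulVf.
have [B _ [_ fo]] := chart_tangent sM Mp.
have nT' v : tangent M p v -> edot nu' v = 0 by move=> Tv; rewrite edotZl nuT ?mulr0.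
have := ball_free_normal cM (reach_unique_nearest rM) tau0 Mp nu1 _ Ma.
have fo' e : 0 < e -> exists2 r, 0 < r & forall q, M q -> enorm (q - p) < r ->
     `|edot nu' (q - p)| <= e * enorm (q - p).
  move=> e0; have [r r0 hr] := fo e e0; exists r => // q Mq qr.
  by have := hr q nu' Mq qr nT'; rewrite nu1 mulr1.
move=> /(_ fo'); rewrite edotZl mulrCA ler_pdivrMl //.
Qed.

End GoodManifold.
Section Frame.
Context {R : realType} {d m : nat}.
Implicit Types (Q : 'M[R]_(d + m)) (v w : 'rV[R]_(d + m)) (M : set 'rV[R]_(d + m)).

(** Tangential coordinates [tc] and normal coordinates [nc] of a vector in the orthonormal frame
    [Q]. *)
Definition tc Q v : 'rV[R]_d := lsubmx (v *m Q^T).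
Definition nc Q v : 'rV[R]_m := rsubmx (v *m Q^T).

Lemma tcD Q v w : tc Q (v + w) = tc Q v + tc Q w.
Proof. by rewrite /tc mulmxDl; apply/rowP => i; rewrite !mxE. Qed.
Lemma tcN Q v : tc Q (- v) = - tc Q v.
Proof. by rewrite /tc mulNmx; apply/rowP => i; rewrite !mxE. Qed.
Lemma tcB Q v w : tc Q (v - w) = tc Q v - tc Q w.
Proof. by rewrite tcD tcN. Qed.
Lemma tcZ Q a v : tc Q (a *: v) = a *: tc Q v.
Proof. by rewrite /tc -scalemxAl; apply/rowP => i; rewrite !mxE. Qed.
Lemma ncD Q v w : nc Q (v + w) = nc Q v + nc Q w.
Proof. by rewrite /nc mulmxDl; apply/rowP => i; rewrite !mxE. Qed.
Lemma ncN Q v : nc Q (- v) = - nc Q v.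
Proof. by rewrite /nc mulNmx; apply/rowP => i; rewrite !mxE. Qed.
Lemma ncB Q v w : nc Q (v - w) = nc Q v - nc Q w.
Proof. by rewrite ncD ncN. Qed.
Lemma ncZ Q a v : nc Q (a *: v) = a *: nc Q v.
Proof. by rewrite /nc -scalemxAl; apply/rowP => i; rewrite !mxE. Qed.

Lemma tc0 Q : tc Q 0 = 0.
Proof. by rewrite -(subrr 0) tcB subrr. Qed.
Lemma nc0 Q : nc Q 0 = 0.
Proof. by rewrite -(subrr 0) ncB subrr. Qed.

Section Orth.
Variable Q : 'M[R]_(d + m).
Hypothesis QQ : Q *m Q^T = 1%:M.

Lemma tc_row_mx a b : tc Q (row_mx a b *m Q) = a.
Proof. by rewrite /tc (mulmx_orthK QQ) row_mxKl. Qed.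
Lemma nc_row_mx a b : nc Q (row_mx a b *m Q) = b.
Proof. by rewrite /nc (mulmx_orthK QQ) row_mxKr. Qed.
Lemma tcnc_row_mx v : row_mx (tc Q v) (nc Q v) *m Q = v.
Proof. by rewrite /tc /nc hsubmxK (mulmx_orthVK QQ). Qed.
Lemma enorm_tcnc v : enorm v ^+ 2 = enorm (tc Q v) ^+ 2 + enorm (nc Q v) ^+ 2.
Proof. by rewrite -{1}(tcnc_row_mx v) (enorm_orthmx QQ) enorm_row_mx. Qed.
Lemma enorm_tc v : enorm (tc Q v) <= enorm v.
Proof. by rewrite /tc (le_trans (enorm_lsubmx _)) // (enorm_orthmxV QQ). Qed.
Lemma enorm_nc v : enorm (nc Q v) <= enorm v.
Proof. by rewrite /nc (le_trans (enorm_rsubmx _)) // (enorm_orthmxV QQ). Qed.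
Lemma enorm_le_tcnc v : enorm v <= enorm (tc Q v) + enorm (nc Q v).
Proof.
rewrite -(@ler_sqr R) ?nnegrE ?addr_ge0 ?enorm_ge0 // enorm_tcnc sqrrD.
by rewrite lerD2r lerDl mulrn_wge0 // mulr_ge0 ?enorm_ge0.
Qed.

Lemma enorm_tc_lower k v : 0 <= k -> k <= 1 / 2 -> enorm (nc Q v) <= k * enorm v ->
  enorm v <= (1 + k) * enorm (tc Q v).
Proof.
move=> k0 k2 h; rewrite -(@ler_sqr R) ?nnegrE ?mulr_ge0 ?addr_ge0 ?enorm_ge0 //.
have e := enorm_tcnc v.
have h2 : enorm (nc Q v) ^+ 2 <= k ^+ 2 * enorm v ^+ 2.
  by rewrite -exprMn lerXn2r ?nnegrE ?mulr_ge0 ?enorm_ge0.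
rewrite exprMn; set a := enorm v ^+ 2 in e h2 *; set b := enorm (tc Q v) ^+ 2 in e *.
have a0 : 0 <= a by exact: sqr_ge0.
have hb : (1 - k ^+ 2) * a <= b by lra.
have hk : 1 <= (1 + k) ^+ 2 * (1 - k ^+ 2) by nra.
apply: le_trans (_ : (1 + k) ^+ 2 * ((1 - k ^+ 2) * a) <= _); last by rewrite ler_wpM2l ?sqr_ge0.
by rewrite mulrA ler_peMl.
Qed.

Lemma continuous_tc (a : 'rV[R]_(d + m)) : continuous (fun x : 'rV[R]_(d + m) => tc Q (x - a)).
Proof.
move=> x B /nbhs_eball[e e0 he]; apply: (eball_nbhs e0) => y yx; apply: he.
by rewrite -tcB opprB addrA subrK (le_lt_trans (enorm_tc _)).
Qed.
End Orth.

Lemma tangentP M p Q v : tangent_frame M p Q -> tangent M p v <-> nc Q v = 0.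
Proof.
move=> [QQ TE]; rewrite TE; split => [[u _ <-]|h]; first by rewrite nc_row_mx.
by exists (tc Q v) => //; rewrite -h tcnc_row_mx.
Qed.

End Frame.

(** * Local geometry: angles, bilipschitz and onto projections *)

Section GoodGeometry.
Context {R : realType} {d m : nat} {tau : R} {M : set 'rV[R]_(d + m)}.
Hypothesis gM : good_mfd tau M.
Implicit Types (p q x v : 'rV[R]_(d + m)) (Q : 'M[R]_(d + m)).

Let tau0 : 0 < tau. Proof. by case: gM. Qed.
Let cM : closed M. Proof. by case: gM => _ /compact_closed_row. Qed.

(** Take the normal part of [q - p] itself as the normal vector in the inequality of [good_mfd]. *)
Lemma nc_quadratic p Q q : tangent_frame M p Q -> M p -> M q ->
  2 * tau * enorm (nc Q (q - p)) <= enorm (q - p) ^+ 2.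
Proof.
move=> fQ Mp Mq; have [QQ TE] := fQ; have [_ _ _ bf] := gM.
pose b := nc Q (q - p); have [b0|b0] := eqVneq (enorm b) 0.
  by rewrite -/b b0 mulr0 sqr_ge0.
have bp : 0 < enorm b by rewrite lt_def b0 enorm_ge0.
have := bf p (row_mx 0 b *m Q) Mp _ q Mq.
rewrite (enorm_orthmx QQ) enorm_row_0mx -{1}(tcnc_row_mx QQ (q - p)) (edot_orthmx QQ).
rewrite edot_row_mx edot0l add0r -/b -enorm_sqr expr2 mulrA [leRHS]mulrC ler_pM2r //; apply.
by move=> v; rewrite TE => -[u _ <-]; rewrite (edot_orthmx QQ) edot_row_mx edot0l edot0r addr0.
Qed.

Lemma tangentN p v : M p -> tangent M p v -> tangent M p (- v).
Proof.
move=> Mp; have [_ _ /(_ p Mp)[Q fQ] _] := gM.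
by rewrite !(tangentP _ fQ) ncN => ->; rewrite oppr0.
Qed.

Lemma tangentZ p c v : M p -> tangent M p v -> tangent M p (c *: v).
Proof.
move=> Mp; have [_ _ /(_ p Mp)[Q fQ] _] := gM.
by rewrite !(tangentP _ fQ) ncZ => ->; rewrite scaler0.
Qed.

Lemma tangent_curve p v : tangent M p v -> forall e, 0 < e ->
  exists2 s0, 0 < s0 & forall s, 0 < s -> s < s0 -> exists2 a, M a & enorm (a - (p + s *: v)) <= e * s.
Proof.
move=> [g [g0 Mg [dg dE]]] e e0.
have := dg; rewrite /derivable /= => /cvg_ex[l hl].
have le : l = v by rewrite -dE /derive; exact/esym/cvg_lim.
move: hl; rewrite le => hl.
have hb : nbhs v [set w | enorm (w - v) < e] by apply: (eball_nbhs e0).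
have := hl _ hb; rewrite /nbhs /= => /nbhs_ballP[r1 /= r10 h1].
have /nbhs_ballP[r2 /= r20 h2] := Mg.
exists (Num.min r1 r2); first by rewrite lt_min r10.
move=> s s0; rewrite lt_min => /andP[sr1 sr2]; exists (g s).
  by apply: h2; rewrite /ball /= sub0r normrN gtr0_norm.
have := h1 s; rewrite /ball /= sub0r normrN gtr0_norm // => /(_ sr1).
rewrite gt_eqF // => /(_ isT); rewrite /GRing.scale /= mulr1 addr0 g0 => h.
have -> : g s - (p + s *: v) = s *: (s^-1 *: (g s - p) - v).
  by rewrite scalerBr scalerA divff ?gt_eqF // scale1r opprD addrA.
by rewrite enormZ gtr0_norm // mulrC ler_wpM2r // ltW.
Qed.

(** First variation: if the product with a tangent vector [w] were [c > 0], moving by [s] along a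
    curve of velocity [w] would change the squared distance by about [- 2 * s * c]. *)
Lemma nearest_normal x p v : nearest M x p -> tangent M p v -> edot (x - p) v = 0.
Proof.
move=> np.
have key w : tangent M p w -> edot (x - p) w <= 0.
  move=> Tw; rewrite leNgt; apply/negP => c0; set c := edot (x - p) w in c0.
  set D := enorm (x - p); have D0 : 0 <= D by exact: enorm_ge0.
  have D1 : 0 < 4 * (D + 1) by rewrite mulr_gt0 // ltr_wpDl.
  pose e := c / (4 * (D + 1)); have e0 : 0 < e by rewrite divr_gt0.
  have De : D * e <= c / 4.
    have -> : c / 4 = (D + 1) * e by rewrite /e; field; rewrite gt_eqF // ltr_wpDl.
    by rewrite ler_wpM2r ?(ltW e0) // lerDl.
  have [s0 s00 hs] := tangent_curve Tw e0.
  pose W := enorm w ^+ 2 + 1; have W0 : 0 < W by rewrite ltr_wpDl ?sqr_ge0.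
  pose s := Num.min (s0 / 2) (c / (2 * W)).
  have sp : 0 < s by rewrite lt_min !divr_gt0 // mulr_gt0.
  have ss : s < s0.
    by apply: le_lt_trans (_ : s0 / 2 < _); [rewrite ge_min lexx|rewrite ltr_pdivrMr //; lra].
  have sW : s * W <= c / 2.
    have -> : c / 2 = c / (2 * W) * W by field; rewrite gt_eqF.
    by rewrite ler_wpM2r ?(ltW W0) // ge_min lexx orbT.
  have [a Ma ha] := hs s sp ss.
  have h1 : D - e * s <= enorm (x - (p + s *: w)).
    have := np.2 a Ma; have := enorm_triangle (p + s *: w) x a.
    rewrite (enormBC (p + s *: w) a) -/D; lra.
  have h2 : enorm (x - (p + s *: w)) ^+ 2 = D ^+ 2 - 2 * s * c + s ^+ 2 * enorm w ^+ 2.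
    by rewrite opprD addrA enormB_sqr edotZr -/c enormZ exprMn real_normK ?num_real // -/D; ring.
  have h3 : D ^+ 2 - 2 * D * e * s <= enorm (x - (p + s *: w)) ^+ 2.
    have [h|h] := leP 0 (D - e * s).
      apply: le_trans (_ : (D - e * s) ^+ 2 <= _); last by rewrite lerXn2r ?nnegrE ?enorm_ge0.
      have : 0 <= (e * s) ^+ 2 by exact: sqr_ge0.
      by rewrite sqrrB; lra.
    apply: le_trans (sqr_ge0 _).
    have : D * (D - e * s) <= 0 by rewrite mulr_ge0_le0 // ltW.
    have : 0 <= D * e * s by nneg.
    have : 0 <= D * (e * s) by nneg.
    nra.
  have h4 : s * (2 * c - 2 * (D * e) - s * enorm w ^+ 2) <= 0 by rewrite h2 in h3; lra.
  move: h4; rewrite leNgt => /negP; apply; rewrite mulr_gt0 //.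
  by rewrite /W mulrDr mulr1 in sW; lra.
move=> Tv; apply/eqP; rewrite eq_le key //=.
by have := key _ (tangentN np.1 Tv); rewrite edotNr oppr_le0.
Qed.

Lemma normal_quadratic p nu a : M p -> M a -> (forall v, tangent M p v -> edot nu v = 0) ->
  2 * tau * `|edot nu (a - p)| <= enorm nu * enorm (a - p) ^+ 2.
Proof.
move=> Mp Ma nuT; have [_ _ _ bf] := gM.
have [h|h] := ger0P (edot nu (a - p)); first exact: bf.
have := bf p (- nu) Mp _ a Ma; rewrite edotNl enormN; apply => v Tv.
by rewrite edotNl nuT // oppr0.
Qed.

(* Along the tangent line the distance f to M satisfies f' <= f / s + 2 s / tau. *)
Lemma tangent_dist q v a : M q -> tangent M q v -> enorm v = 1 -> 0 < a ->
  mdist M (q + a *: v) <= 3 * a ^+ 2 / tau.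
Proof.
move=> Mq Tv v1 a0; have M0 : M !=set0 by exists q.
pose f s := mdist M (q + s *: v).
have lip s h : 0 <= h -> f (s + h) <= f s + h /\ f s <= f (s + h) + h.
  move=> h0; split; [apply: (le_trans (mdist_lip _ (q + s *: v) cM M0))|apply: (le_trans (mdist_lip _ (q + (s + h) *: v) cM M0))]; rewrite lerD2l.
    have -> : q + (s + h) *: v - (q + s *: v) = h *: v by vec.
    by rewrite enormZ v1 mulr1 ger0_norm.
  have -> : q + s *: v - (q + (s + h) *: v) = - (h *: v) by vec.
  by rewrite enormN enormZ v1 mulr1 ger0_norm.
apply/ler_addgt0Pr => eps eps0.
pose eta := eps / a; have eta0 : 0 < eta by rewrite divr_gt0.
suff : f a <= a * (3 * a / tau + eta).
  move=> h; apply: (le_trans h); rewrite /eta le_eqVlt; apply/orP; left; apply/eqP.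
  by field; rewrite !gt_eqF.
(* A barrier for [f]. The term in [eta] makes the inequality hold for small [s], where only
   [f s = o(s)] is known. *)
pose b s := s * (3 * s / tau + eta).
have ti0 : 0 < tau^-1 by rewrite invr_gt0.
have b_inc s h : 0 < s -> 0 <= h -> b s <= b (s + h).
  move=> s0 h0; rewrite /b; have : 0 <= 3 * s * h * tau^-1 by rewrite !mulr_ge0 // ltW.
  have : 0 <= 3 * h * (s + h) * tau^-1 by rewrite !mulr_ge0 ?addr_ge0 // ltW.
  have : 0 <= h * eta by rewrite mulr_ge0 // ltW.
  nra.
apply: (@real_induction R a (fun s => f s <= b s)) => //.
- have [s0 s00 hs] := tangent_curve Tv eta0.
  exists (s0 / 2); first by rewrite divr_gt0.
  move=> s sp ss; have [|y My hy] := hs s sp; first by lra.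
  rewrite /f (le_trans (mdist_le _ cM My)) // enormBC (le_trans hy) // /b mulrC ler_wpM2l ?(ltW sp) //.
  by rewrite lerDr !mulr_ge0 // ltW.
- move=> s s0 sa hst; have hs := hst s s0 (lexx _).
  have [lt|ge] := ltP (f s) (b s).
    exists (b s - f s); first by rewrite subr_gt0.
    move=> t st tb; have -> : t = s + (t - s) by rewrite addrC subrK.
    have h0 : 0 <= t - s by rewrite subr_ge0 ltW.
    apply: (le_trans (lip s _ h0).1); apply: le_trans (b_inc s _ s0 h0).
    by rewrite -lerBrDl lerBlDl.
  have fE : f s = b s by apply/eqP; rewrite eq_le hs.
  set x := q + s *: v.
  have [p np] := nearest_exists x cM M0.
  set D := enorm (x - p); have DE : f s = D by rewrite /f (mdist_nearest np).
  have D0 : 0 < D by rewrite -DE fE /b mulr_gt0 // ltr_wpDl // !mulr_ge0 // ltW.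
  have xq : x - q = s *: v by rewrite /x; vec.
  have Ds : D <= s by have := np.2 q Mq; rewrite xq enormZ v1 mulr1 gtr0_norm.
  have h0 : 0 < 2 * D * s / tau by rewrite divr_gt0 // !mulr_gt0.
  (* Where [f] meets the barrier its slope is at most [5 * s / tau + eta], against
     [6 * s / tau + eta] for [b]. The margin [h * s / tau] covers the quadratic term
     [h ^ 2 / (2 * D)] exactly up to this step. *)
  exists (2 * D * s / tau) => // t st tb.
  pose h := t - s; have hp : 0 < h by rewrite subr_gt0.
  have -> : t = s + h by rewrite addrC subrK.
  have hD : h <= 2 * D * s / tau by rewrite /h lerBlDl.
  have uv : s * edot (x - p) v <= D * (D + 2 * s ^+ 2 / tau).
    have -> : s * edot (x - p) v = edot (x - p) (x - p) - edot (x - p) (q - p).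
      by rewrite -edotBr -edotZr; congr edot; rewrite /x; vec.
    have := normal_quadratic np.1 Mq (fun w => @nearest_normal x p w np).
    have qp : enorm (q - p) <= 2 * s.
      apply: (le_trans (enorm_triangle x _ _)); rewrite -/D /x opprD addNKr enormN enormZ v1 mulr1 gtr0_norm //.
      lra.
    have qp2 : enorm (q - p) ^+ 2 <= 4 * s ^+ 2.
      have -> : 4 * s ^+ 2 = (2 * s) ^+ 2 by ring.
      by rewrite lerXn2r ?nnegrE ?enorm_ge0 // mulr_ge0 // ltW.
    rewrite -/D -enorm_sqr -/D => h1.
    have h2 : `|edot (x - p) (q - p)| <= D * (2 * s ^+ 2 / tau).
      have : 2 * tau * `|edot (x - p) (q - p)| <= D * (4 * s ^+ 2).
        by rewrite (le_trans h1) // ler_wpM2l ?(ltW D0).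
      have -> : D * (2 * s ^+ 2 / tau) = D * (4 * s ^+ 2) / (2 * tau) by field; rewrite gt_eqF.
      by rewrite ler_pdivlMr ?mulr_gt0 // mulrC.
    have : - edot (x - p) (q - p) <= `|edot (x - p) (q - p)| by rewrite -normrN ler_norm.
    lra.
  have step : f (s + h) <= D + h * (D + 2 * s ^+ 2 / tau) / s + h ^+ 2 / (2 * D).
    have H0 : 0 <= D + h * (D + 2 * s ^+ 2 / tau) / s + h ^+ 2 / (2 * D) by nneg.
    apply: (le_trans (mdist_le _ cM np.1)); rewrite -(@ler_sqr R) ?nnegrE ?enorm_ge0 //.
    have -> : q + (s + h) *: v - p = (x - p) + h *: v by rewrite /x; vec.
    rewrite enormD_sqr -/D edotZr enormZ v1 mulr1 real_normK ?num_real //.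
    have : h * edot (x - p) v <= h * (D * ((D + 2 * s ^+ 2 / tau) / s)).
      by rewrite ler_wpM2l ?(ltW hp) // mulrA ler_pdivlMr // mulrC.
    set A := (D + 2 * s ^+ 2 / tau) / s; have A0 : 0 <= A by rewrite /A; nneg.
    have -> : D + h * (D + 2 * s ^+ 2 / tau) / s = D + h * A by rewrite /A; ring.
    have e1 : h ^+ 2 = 2 * D * (h ^+ 2 / (2 * D)) by field; rewrite gt_eqF.
    set B := h ^+ 2 / (2 * D) in e1 *; have B0 : 0 <= B by rewrite /B; nneg.
    have : 0 <= h * A by rewrite mulr_ge0 // ltW.
    nra.
  apply: (le_trans step).
  have hh : h ^+ 2 / (2 * D) <= h * (s / tau).
    rewrite expr2 -mulrA ler_wpM2l ?(ltW hp) // ler_pdivrMr ?mulr_gt0 //.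
    by rewrite (le_trans hD) // le_eqVlt; apply/orP; left; apply/eqP; ring.
  have Db : D = s * (3 * s / tau + eta) by rewrite -DE fE.
  have -> : h * (D + 2 * s ^+ 2 / tau) / s = h * (5 * s / tau + eta).
    by rewrite Db; field; rewrite !gt_eqF.
  have : 0 <= h ^+ 2 * tau^-1 by rewrite mulr_ge0 ?sqr_ge0 // ltW.
  have -> : b (s + h) = D + h * (5 * s / tau + eta) + (h * (s / tau) + 3 * (h ^+ 2 / tau)).
    by rewrite Db /b; ring.
  by move=> h3; rewrite lerD2l (le_trans hh) // lerDl mulr_ge0.
- move=> s s0 sa hs; apply/ler_addgt0Pr => e e0.
  pose h := Num.min (e / 2) (s / 2).
  have hp : 0 < h by rewrite lt_min !divr_gt0.
  have he : h <= e / 2 by rewrite ge_min lexx.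
  have h2 : h <= s / 2 by rewrite ge_min lexx orbT.
  have sh : 0 < s - h by lra.
  have := (lip (s - h) h (ltW hp)).1; have := b_inc (s - h) h sh (ltW hp); rewrite subrK => b1 l1.
  apply: (le_trans l1); apply: lerD; last by clear b1 l1; lra.
  by apply: le_trans b1; apply: hs => //; clear l1; lra.
Qed.

(** Walk from [q] along a unit tangent vector [u] over the distance [L = |q - p|]. By [tangent_dist]
    the end is within [3 * L ^ 2 / tau] of some [p'] in [M]. The normal parts of [q - p] and of
    [p' - p] are quadratically small, hence so is that of [L *: u]. For [7 * L > tau] the bound is
    trivial. *)
Lemma tangent_angle p Q q v : tangent_frame M p Q -> M p -> M q -> tangent M q v ->
  enorm (nc Q v) <= 7 * (enorm (q - p) / tau) * enorm v.
Proof.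
move=> fQ Mp Mq Tv; have QQ := fQ.1.
have [->|v0] := eqVneq v 0; first by rewrite nc0 !enorm0 mulr0.
have vp := enorm_gt0 v0.
have [/enorm_eq0/eqP|L0] := eqVneq (enorm (q - p)) 0.
  rewrite subr_eq0 => /eqP qp; move: Tv; rewrite qp (tangentP _ fQ) => ->.
  by rewrite enorm0 subrr enorm0 mul0r mulr0 mul0r.
set L := enorm (q - p) in L0 *.
have Lp : 0 < L by rewrite lt_def L0 enorm_ge0.
have [big|small] := ltP tau (7 * L).
  by rewrite (le_trans (enorm_nc QQ _)) // ler_peMl ?(ltW vp) // mulrA ler_pdivlMr // mul1r ltW.
pose u := (enorm v)^-1 *: v.
have u1 : enorm u = 1 by rewrite enormZ gtr0_norm ?invr_gt0 // mulVf // gt_eqF.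
have vu : v = enorm v *: u by rewrite scalerA divff ?gt_eqF // scale1r.
suff : enorm (nc Q u) <= 7 * (L / tau).
  by move=> h; rewrite {1}vu ncZ enormZ gtr0_norm // mulrC ler_wpM2r // ltW.
have Tu : tangent M q u by exact: tangentZ.
have [p' np'] := nearest_exists (q + L *: u) cM (ex_intro _ q Mq).
have := tangent_dist Mq Tu u1 Lp; rewrite (mdist_nearest np').
set w := q + L *: u - p' => hw.
pose k := L / tau; have k0 : 0 < k by rewrite divr_gt0.
have k7 : 7 * k <= 1 by rewrite /k mulrA ler_pdivrMr // mul1r.
have hw' : enorm w <= 3 * k * L by rewrite (le_trans hw) // /k le_eqVlt; apply/orP; left; apply/eqP; field; rewrite gt_eqF.
have e1 : L *: nc Q u = nc Q w + nc Q (p' - p) - nc Q (q - p).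
  by rewrite -ncD -ncB -ncZ; congr nc; rewrite /w; vec.
have pp : enorm (p' - p) <= (2 + 3 * k) * L.
  have -> : p' - p = (q - p) + L *: u - w by rewrite /w; vec.
  rewrite (le_trans (enormB_le _ _)) // (le_trans (lerD (enormD_le _ _) (lexx _))) // -/L.
  by rewrite enormZ u1 mulr1 gtr0_norm //; lra.
have n1 := nc_quadratic fQ Mp Mq; have n2 := nc_quadratic fQ Mp np'.1.
have n1' : 2 * enorm (nc Q (q - p)) <= k * L.
  have -> : k * L = L ^+ 2 / tau by rewrite /k; field; rewrite gt_eqF.
  by rewrite ler_pdivlMr // mulrAC.
have n2' : 2 * enorm (nc Q (p' - p)) <= (2 + 3 * k) ^+ 2 * k * L.
  have -> : (2 + 3 * k) ^+ 2 * k * L = ((2 + 3 * k) * L) ^+ 2 / tau by rewrite /k; field; rewrite gt_eqF.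
  rewrite ler_pdivlMr // mulrAC (le_trans n2) // lerXn2r ?nnegrE ?enorm_ge0 //.
  by nneg.
have : L * enorm (nc Q u) <= enorm w + enorm (nc Q (p' - p)) + enorm (nc Q (q - p)).
  rewrite -{1}(gtr0_norm Lp) -enormZ e1 (le_trans (enormB_le _ _)) // lerD2r.
  by rewrite (le_trans (enormD_le _ _)) // lerD2r enorm_nc.
have : (2 + 3 * k) ^+ 2 * k * L <= 6 * k * L.
  by rewrite !ler_wpM2r ?(ltW k0) ?(ltW Lp) //; nra.
have kL : 0 <= k * L by nneg.
have kk : L * (7 * (L / tau)) = 7 * (k * L) by rewrite /k; ring.
move=> h1 h2; rewrite -(ler_pM2l Lp) kk.
have h3 := le_trans n2' h1; rewrite -mulrA in h3; rewrite -mulrA in hw'.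
move: (enorm (nc Q (p' - p))) (enorm (nc Q (q - p))) (enorm w) (L * enorm (nc Q u)) (k * L) n1' h3 hw' h2 kL.
by move=> A1 A2 A3 A4 A5 *; lra.
Qed.

(** Split the secant in a frame at [q1]: its tangential part is handled by [tangent_angle], its
    normal part by [nc_quadratic]. *)
Lemma secant_angle p Q q1 q2 r : tangent_frame M p Q -> M p -> M q1 -> M q2 ->
  enorm (q1 - p) <= r -> enorm (q2 - p) <= r ->
  enorm (nc Q (q2 - q1)) <= 8 * r / tau * enorm (q2 - q1).
Proof.
move=> fQ Mp Mq1 Mq2 r1 r2; have QQ := fQ.1.
have [_ _ /(_ q1 Mq1)[Q1 fQ1] _] := gM; have Q11 := fQ1.1.
set w := q2 - q1; pose T := row_mx (tc Q1 w) 0 *m Q1.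
have wr : enorm w <= 2 * r.
  by rewrite (le_trans (enorm_triangle p _ _)) // (enormBC p); lra.
have r0 : 0 <= r by exact: le_trans (enorm_ge0 _) r1.
have TT : tangent M q1 T by apply/(tangentP _ fQ1); rewrite nc_row_mx.
have NE : enorm (w - T) = enorm (nc Q1 w).
  rewrite -{1}(tcnc_row_mx Q11 w) -mulmxBl (enorm_orthmx Q11) -(@enorm_row_0mx R d m); congr enorm.
  by rewrite opp_row_mx add_row_mx subrr oppr0 addr0.
have Tw : enorm T <= enorm w by rewrite /T (enorm_orthmx Q11) enorm_row_mx0 enorm_tc.
have h1 := tangent_angle fQ Mp Mq1 TT.
have h2 : 2 * tau * enorm (nc Q1 w) <= enorm w ^+ 2 by exact: nc_quadratic.
have h3 : enorm (nc Q1 w) <= r / tau * enorm w.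
  rewrite mulrAC ler_pdivlMr //; have : enorm w * enorm w <= 2 * r * enorm w by rewrite ler_wpM2r ?enorm_ge0.
  by rewrite expr2 in h2; lra.
have h4 : enorm (nc Q T) <= 7 * (r / tau) * enorm w.
  have ti : 0 <= tau^-1 by rewrite invr_ge0 ltW.
  apply: (le_trans h1); apply: ler_pM => //; first by rewrite !mulr_ge0 ?enorm_ge0.
    exact: enorm_ge0.
  by rewrite ler_wpM2l // ler_wpM2r.
have : enorm (nc Q w) <= enorm (nc Q T) + enorm (w - T).
  have {1}-> : w = T + (w - T) by rewrite addrC subrK.
  by rewrite ncD (le_trans (enormD_le _ _)) // lerD2l enorm_nc.
rewrite NE; lra.
Qed.

Lemma tc_bilipschitz p Q q1 q2 r : tangent_frame M p Q -> M p -> M q1 -> M q2 ->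
  enorm (q1 - p) <= r -> enorm (q2 - p) <= r -> 16 * r <= tau ->
  enorm (q2 - q1) <= (1 + 8 * r / tau) * enorm (tc Q (q2 - q1)).
Proof.
move=> fQ Mp Mq1 Mq2 r1 r2 rt; have r0 : 0 <= r by exact: le_trans (enorm_ge0 _) r1.
have k0 : 0 <= 8 * r / tau by rewrite divr_ge0 ?mulr_ge0 // ltW.
have k2 : 8 * r / tau <= 1 / 2 by rewrite ler_pdivrMr //; lra.
exact: (enorm_tc_lower fQ.1 k0 k2 (secant_angle fQ Mp Mq1 Mq2 r1 r2)).
Qed.

(** Surjectivity by minimization. Among the points of [M] at distance at most [4 * r] from [p], one
    whose projection is closest to [y] is in fact within [3 * r]. If its defect [e] were nonzero,
    moving along a tangent vector that projects to [- e] would reduce it. Such a vector exists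
    because the projection between the two tangent spaces is injective, by [tangent_angle]. *)
Lemma tc_onto p Q r y : tangent_frame M p Q -> M p -> 0 < r -> 128 * r <= tau ->
  enorm y <= r -> exists q, [/\ M q, tc Q (q - p) = y & enorm (q - p) <= 4 * r].
Proof.
move=> fQ Mp r0 rt yr; have QQ := fQ.1.
pose K := M `&` [set q | enorm (q - p) <= 4 * r].
have cK : compact K.
  rewrite /K setIC; apply: compact_closedI => //; exact: compact_eball.
have Kp : K p by split => //=; rewrite subrr enorm0 mulr_ge0 // ltW.
pose f q := - enorm (tc Q (q - p) - y).
have cf : continuous f.
  move=> x; have h1 : {for x, continuous (fun q => tc Q (q - p))} by exact: continuous_tc.
  exact: (continuousN (continuous_comp h1 (@continuous_enormB R d y (tc Q (x - p))))).
have [||q /set_mem[Mq qr] qmax] := @EVT_max_rV R _ f K _ cK.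
- by exists p.
- by apply: continuous_subspaceT.
have qmin a : K a -> enorm (tc Q (q - p) - y) <= enorm (tc Q (a - p) - y).
  by move=> Ka; have := qmax a; rewrite inE => /(_ Ka); rewrite /f lerN2.
exists q; split => //; apply/eqP; rewrite -subr_eq0; apply/negPn/negP => ne.
set e := tc Q (q - p) - y in ne; have e0 := enorm_gt0 ne.
have er : enorm e <= r.
  have := qmin p Kp; rewrite -/e subrr tc0 sub0r enormN => h; exact: le_trans h yr.
have tq : enorm (tc Q (q - p)) <= 2 * r.
  have -> : tc Q (q - p) = e + y by rewrite /e subrK.
  by rewrite (le_trans (enormD_le _ _)) //; lra.
have q3 : enorm (q - p) <= 3 * r.
  have pp : enorm (p - p) <= 4 * r by rewrite subrr enorm0 mulr_ge0 // ltW.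
  have rt16 : 16 * (4 * r) <= tau by lra.
  have := tc_bilipschitz fQ Mp Mp Mq pp qr rt16.
  have : 8 * (4 * r) / tau <= 1 / 4 by rewrite ler_pdivrMr //; lra.
  set k := 8 * _ / tau => k1.
  have : (1 + k) * enorm (tc Q (q - p)) <= (1 + 1 / 4) * (2 * r) by rewrite ler_pM ?enorm_ge0 ?addr_ge0 ?divr_ge0 ?mulr_ge0 ?(ltW r0) ?(ltW tau0) //; lra.
  lra.
have [_ _ /(_ q Mq)[Qq fQq] _] := gM; have Qqq := fQq.1.
have [v Tv tv] : exists2 v, tangent M q v & tc Q v = - e.
  pose A := \matrix_(i < d) tc Q (row_mx (delta_mx 0 i) 0 *m Qq).
  have AE u : u *m A = tc Q (row_mx u 0 *m Qq).
    rewrite mulmx_sum_row.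
    transitivity (\sum_i u 0 i *: tc Q (row_mx (delta_mx 0 i) 0 *m Qq)).
      by apply: eq_bigr => i _; rewrite rowK.
    rewrite {2}(row_sum_delta u) /tc.
    have -> : row_mx (\sum_(j < d) u 0 j *: delta_mx 0 j) (0 : 'rV[R]_m) =
      \sum_(j < d) u 0 j *: row_mx (delta_mx 0 j) 0.
      apply: (big_ind2 (fun a b => row_mx a (0 : 'rV[R]_m) = b)) => [|a b a' b' <- <-|i _].
      - by rewrite row_mx0.
      - by rewrite add_row_mx addr0.
      - by rewrite scale_row_mx scaler0.
    rewrite mulmx_suml mulmx_suml linear_sum; apply: eq_bigr => i _.
    by rewrite -!scalemxAl linearZ.
  have uA : A \in unitmx.
    rewrite -row_free_unit; apply: inj_row_free => u uA0.
    have Tu : tangent M q (row_mx u 0 *m Qq) by apply/(tangentP _ fQq); rewrite nc_row_mx.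
    have h := tangent_angle fQ Mp Mq Tu; have h2 := enorm_le_tcnc QQ (row_mx u 0 *m Qq).
    move: h h2; rewrite -AE uA0 enorm0 add0r (enorm_orthmx Qqq) enorm_row_mx0 => h h2.
    apply: enorm_eq0; apply/eqP; rewrite eq_le enorm_ge0 andbT.
    have : 7 * (enorm (q - p) / tau) <= 1 / 4 by rewrite mulrA ler_pdivrMr //; lra.
    move=> h3; have : 7 * (enorm (q - p) / tau) * enorm u <= 1 / 4 * enorm u by rewrite ler_wpM2r ?enorm_ge0.
    lra.
  exists (row_mx (- e *m invmx A) 0 *m Qq); first by apply/(tangentP _ fQq); rewrite nc_row_mx.
  by rewrite -AE mulmxKV.
have e2 : 0 < enorm e / 2 by rewrite divr_gt0.
have [s0 s00 hs] := tangent_curve Tv e2.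
pose s := Num.min (Num.min (s0 / 2) 1) (r / (enorm v + enorm e / 2)).
have ve : 0 < enorm v + enorm e / 2 by rewrite ltr_wpDl ?enorm_ge0.
have sp : 0 < s by rewrite lt_min lt_min ltr01 andbT; apply/andP; split; exact: divr_gt0.
have [ss s1] : s <= s0 / 2 /\ s <= 1 by rewrite /s !ge_min !lexx !orbT.
have sr : s * (enorm v + enorm e / 2) <= r by rewrite -ler_pdivlMr // ge_min lexx orbT.
have [|a Ma ha] := hs s sp; first by lra.
have aE : a - p = (q - p) + (s *: v + (a - (q + s *: v))) by vec.
have Ka : K a.
  split => //=; rewrite aE (le_trans (enormD_le _ _)) //.
  have := enormD_le (s *: v) (a - (q + s *: v)); rewrite enormZ gtr0_norm //; lra.
have := qmin a Ka; rewrite -/e leNgt => /negP; apply.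
have -> : tc Q (a - p) - y = (1 - s) *: e + tc Q (a - (q + s *: v)).
  by rewrite aE (tcD Q (q - p)) (tcD Q (s *: v)) tcZ tv /e; move: (tc Q (a - _)) (tc Q (q - p)) => t1 t2; vec.
apply: (le_lt_trans (enormD_le _ _)); rewrite enormZ ger0_norm ?subr_ge0 //.
have := enorm_tc QQ (a - (q + s *: v)).
have : 0 < s * enorm e by rewrite mulr_gt0.
lra.
Qed.

End GoodGeometry.

(** * Volumes of balls and cylinders in the manifold *)

Section Cylinder.
Context {R : realType} {d m : nat} {M : set 'rV[R]_(d + m)}.
Variables (z : 'rV[R]_(d + m)) (Q : 'M[R]_(d + m)).
Hypothesis fQ : tangent_frame M z Q.

Let QQ : Q *m Q^T = 1%:M. Proof. exact: fQ.1. Qed.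

Lemma cylinderP t y : cylinder M z t y <->
  enorm (nc Q (y - z)) <= t /\ enorm (tc Q (y - z)) <= t.
Proof.
split=> [[p [[Tp hp] h1 h2]]|[h1 h2]].
  have np : nc Q (p - z) = 0 by apply/(tangentP _ fQ).
  have ty : tc Q (y - p) = 0.
    apply: edot_orth => u; have := hp (row_mx u 0 *m Q).
    rewrite -{1}(tcnc_row_mx QQ (y - p)) (edot_orthmx QQ) edot_row_mx edot0r addr0; apply.
    by apply/(tangentP _ fQ); rewrite nc_row_mx.
  have -> : y - z = (y - p) + (p - z) by rewrite addrA subrK.
  rewrite ncD np addr0 tcD ty add0r; split; first exact: le_trans (enorm_nc QQ _) h1.
  by rewrite (le_trans (enorm_tc QQ _)) // enormBC.
exists (z + row_mx (tc Q (y - z)) 0 *m Q).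
have e1 : y - (z + row_mx (tc Q (y - z)) 0 *m Q) = row_mx 0 (nc Q (y - z)) *m Q.
  rewrite opprD addrA -{1}(tcnc_row_mx QQ (y - z)) -mulmxBl; congr (_ *m Q).
  by rewrite opp_row_mx add_row_mx subrr oppr0 addr0.
split; first split.
- by apply/(tangentP _ fQ); rewrite addrC addKr nc_row_mx.
- move=> v /(tangentP _ fQ) nv; rewrite e1 -{1}(tcnc_row_mx QQ v) (edot_orthmx QQ).
  by rewrite edot_row_mx edot0l nv edot0r addr0.
- by rewrite e1 (enorm_orthmx QQ) enorm_row_0mx.
- by rewrite opprD addrA subrr add0r enormN (enorm_orthmx QQ) enorm_row_mx0.
Qed.

Lemma hvol_tc (S : set 'rV[R]_(d + m)) :
  (hvol d ((fun q => tc Q (q - z)) @` S) <= hvol d S)%E.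
Proof.
have := @hvol_lip R _ _ d (fun q => tc Q (q - z)) 1 S ltr01.
rewrite expr1n mul1e; apply => x y _ _.
by rewrite -tcB opprB addrA subrK mul1r enorm_tc.
Qed.

Lemma hvol_cylinder_affine t : 0 < t ->
  hvol d (cylinder M z t `&` affine_tangent M z) = (ball_vol R d * t ^+ d)%:E.
Proof.
move=> t0; set S := _ `&` _; rewrite -(hvol_eball 0 t0).
have SE : S = (fun u => z + row_mx u 0 *m Q) @` [set x : 'rV[R]_d | enorm (x - 0) <= t].
  apply/seteqP; split=> [y [/cylinderP[_ h2] /(tangentP _ fQ) h]|_ [u /= hu <-]].
    exists (tc Q (y - z)); first by rewrite /= subr0.
    by rewrite -h (tcnc_row_mx QQ) addrC subrK.
  have e : z + row_mx u 0 *m Q - z = row_mx u 0 *m Q by rewrite addrC addKr.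
  split; last by apply/(tangentP _ fQ); rewrite e nc_row_mx.
  by apply/cylinderP; rewrite e nc_row_mx // tc_row_mx // enorm0 ltW //; rewrite subr0 in hu.
apply/eqP; rewrite eq_le; apply/andP; split.
  rewrite SE; have := @hvol_lip R _ _ d (fun u => z + row_mx u 0 *m Q) 1 [set x : 'rV[R]_d | enorm (x - 0) <= t] ltr01.
  rewrite expr1n mul1e; apply => x y _ _.
  rewrite opprD addrACA subrr add0r -mulmxBl (enorm_orthmx QQ) opp_row_mx add_row_mx oppr0 addr0.
  by rewrite enorm_row_mx0 mul1r.
apply: le_trans (hvol_tc S); apply: hvol_mono => u /= hu.
exists (z + row_mx u 0 *m Q); last by rewrite addrC addKr tc_row_mx.
by rewrite SE; exists u.
Qed.
End Cylinder.

Section Volumes.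
Context {R : realType} {d m : nat} {tau : R} {M : set 'rV[R]_(d + m)}.
Hypothesis gM : good_mfd tau M.
Implicit Types (p q z : 'rV[R]_(d + m)).

Let tau0 : 0 < tau. Proof. by case: gM. Qed.

(** On the patch the projection to the tangent space is injective, and by [tc_bilipschitz] its
    inverse [g] is Lipschitz with constant [1 + 8 * r / tau]. *)
Lemma hvol_patch_upper p Q r t (S : set 'rV[R]_(d + m)) : tangent_frame M p Q -> M p ->
  0 < r -> 16 * r <= tau -> 0 < t ->
  (forall q, S q -> [/\ M q, enorm (q - p) <= r & enorm (tc Q (q - p)) <= t]) ->
  (hvol d S <= ((1 + 8 * r / tau) ^+ d * (ball_vol R d * t ^+ d))%:E)%E.
Proof.
move=> fQ Mp r0 rt t0 hS; have QQ := fQ.1.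
pose g (y : 'rV[R]_d) := xget p [set q | S q /\ tc Q (q - p) = y].
pose TS := (fun q => tc Q (q - p)) @` S.
have gS y : TS y -> S (g y) /\ tc Q (g y - p) = y.
  by move=> [q Sq <-]; rewrite /g; case: xgetP => [_ _ []//|/(_ q)]; case.
have k0 : 0 < 1 + 8 * r / tau by rewrite ltr_wpDr // divr_ge0 ?mulr_ge0 // ltW.
have lipg x y : TS x -> TS y -> enorm (g x - g y) <= (1 + 8 * r / tau) * enorm (x - y).
  move=> /gS[Sx xE] /gS[Sy yE].
  have [[Mx rx _] [My ry _]] := (hS _ Sx, hS _ Sy).
  have := tc_bilipschitz gM fQ Mp My Mx ry rx rt.
  have -> // : tc Q (g x - g y) = x - y.
  by rewrite -[in RHS]xE -[in RHS]yE -tcB opprB addrA subrK.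
have SgT : S `<=` g @` TS.
  move=> q Sq; have Tq : TS (tc Q (q - p)) by exists q.
  exists (tc Q (q - p)) => //; have [Sg gE] := gS _ Tq.
  have [[M1 r1 _] [M2 r2 _]] := (hS _ Sg, hS _ Sq).
  have := tc_bilipschitz gM fQ Mp M2 M1 r2 r1 rt.
  have -> : tc Q (g (tc Q (q - p)) - q) = 0.
    have -> : g (tc Q (q - p)) - q = (g (tc Q (q - p)) - p) - (q - p) by vec.
    by rewrite tcB gE subrr.
  rewrite enorm0 mulr0 => h; apply/eqP; rewrite -subr_eq0; apply/eqP/enorm_eq0.
  by apply/eqP; rewrite eq_le h enorm_ge0.
apply: (le_trans (hvol_mono SgT)); apply: (le_trans (@hvol_lip R _ _ d _ _ _ k0 lipg)).
have Kd : (0 < (1 + 8 * r / tau) ^+ d)%R by rewrite exprn_gt0.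
rewrite (EFinM ((1 + 8 * r / tau) ^+ d)) lee_pmul2l ?lte_fin // -(hvol_eball 0 t0).
by apply: hvol_mono => _ [q /hS[_ _ h] <-] /=; rewrite subr0.
Qed.

Lemma hvol_ball_upper p r : M p -> 0 < r -> 16 * r <= tau ->
  (hvol d ([set q | (enorm (q - p) <= r)%R] `&` M) <= ((1 + 8 * r / tau) ^+ d * (ball_vol R d * r ^+ d))%:E)%E.
Proof.
move=> Mp r0 rt; have [_ _ /(_ p Mp)[Q fQ] _] := gM.
by apply: (hvol_patch_upper fQ) => // q [/= qr Mq]; split => //; rewrite (le_trans (enorm_tc fQ.1 _)).
Qed.

(** By [tc_onto] every tangent vector of length at most [r' = r / (1 + 32 * r / tau)] is the
    projection of a point of [M]. The reduced radius compensates the bilipschitz factor, so this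
    point is in the ball; and projecting does not increase volume. *)
Lemma hvol_ball_lower p r : M p -> 0 < r -> 128 * r <= tau ->
  ((ball_vol R d * (r / (1 + 32 * r / tau)) ^+ d)%:E <= hvol d ([set q | (enorm (q - p) <= r)%R] `&` M))%E.
Proof.
move=> Mp r0 rt; have [_ _ /(_ p Mp)[Q fQ] _] := gM.
have K0 : 0 <= 32 * r / tau by rewrite divr_ge0 ?mulr_ge0 // ltW.
have K1 : 0 < 1 + 32 * r / tau by rewrite ltr_wpDr.
set r' := r / _; have r'0 : 0 < r' by rewrite divr_gt0.
have r'r : r' <= r by rewrite ler_pdivrMr // ler_peMr ?(ltW r0) // lerDl.
rewrite -(hvol_eball 0 r'0); apply: le_trans (hvol_tc fQ _); apply: hvol_mono => u /=.
rewrite subr0 => hu; have r't : 128 * r' <= tau by rewrite (le_trans _ rt) // ler_pM2l.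
have [q [Mq qE q4]] := tc_onto gM fQ Mp r'0 r't hu.
exists q => //; split => //=.
have pp : enorm (p - p) <= 4 * r' by rewrite subrr enorm0 mulr_ge0 // ltW.
have t16 : 16 * (4 * r') <= tau by lra.
apply: (le_trans (tc_bilipschitz gM fQ Mp Mp Mq pp q4 t16)).
rewrite qE; apply: le_trans (_ : (1 + 32 * r / tau) * r' <= _); last by rewrite /r' mulrC divfK // gt_eqF.
have h1 : 1 + 8 * (4 * r') / tau <= 1 + 32 * r / tau.
  by rewrite lerD2l ler_pM2r ?invr_gt0 //; lra.
have h0 : 0 <= 1 + 8 * (4 * r') / tau by nneg.
by apply: (ler_pM h0 (enorm_ge0 _) h1).
Qed.

Lemma hvol_cylinder_upper z t : M z -> 0 < t -> 32 * t <= tau ->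
  (hvol d (cylinder M z t `&` M) <= ((1 + 16 * t / tau) ^+ d * (ball_vol R d * t ^+ d))%:E)%E.
Proof.
move=> Mz t0 tt; have [_ _ /(_ z Mz)[Q fQ] _] := gM.
have -> : 16 * t / tau = 8 * (2 * t) / tau by congr (_ / _); ring.
apply: (hvol_patch_upper fQ) => //; [by rewrite mulr_gt0|by lra|].
move=> q [/(cylinderP fQ)[h1 h2] Mq]; split => //.
by rewrite (le_trans (enorm_le_tcnc fQ.1 _)) //; lra.
Qed.

Lemma hvol_cylinder_lower z t : M z -> 0 < t -> 128 * t <= tau ->
  ((ball_vol R d * t ^+ d)%:E <= hvol d (cylinder M z t `&` M))%E.
Proof.
move=> Mz t0 tt; have [_ _ /(_ z Mz)[Q fQ] _] := gM.
rewrite -(hvol_eball 0 t0); apply: le_trans (hvol_tc fQ _); apply: hvol_mono => u /=.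
rewrite subr0 => hu; have [q [Mq qE q4]] := tc_onto gM fQ Mz t0 tt hu.
exists q => //; split => //; apply/(cylinderP fQ); rewrite qE; split => //.
have := nc_quadratic gM fQ Mz Mq.
have : enorm (q - z) ^+ 2 <= (4 * t) ^+ 2 by rewrite lerXn2r ?nnegrE ?enorm_ge0 // mulr_ge0 // ltW.
move=> h1 h2; have h3 : 2 * tau * enorm (nc Q (q - z)) <= 2 * tau * t.
  by apply: (le_trans h2); apply: (le_trans h1); nra.
by rewrite ler_pM2l // in h3; rewrite mulr_gt0.
Qed.

Lemma hvol_good_gt0 : M !=set0 -> (0 < hvol d M)%E.
Proof.
move=> [p Mp]; have r0 : 0 < tau / 128 by rewrite divr_gt0.
have := @hvol_ball_lower p _ Mp r0; rewrite mulrC divfK // => /(_ (lexx _)) h.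
apply: lt_le_trans (hvol_mono (@subIsetr _ [set q | enorm (q - p) <= tau / 128] M)).
apply: lt_le_trans h; rewrite lte_fin mulr_gt0 ?ball_vol_gt0 // exprn_gt0 // divr_gt0 //.
by rewrite ltr_wpDr // divr_ge0 ?mulr_ge0 ?divr_ge0 // ltW.
Qed.

(** The product is the ratio between the volumes of the curved and of the flat disc. It is at least
    1 since the curved one projects onto the flat one, and at most the bilipschitz factor to the
    power [d]. *)
Lemma normalization_bounds z t : M z -> 0 < t -> 128 * t <= tau -> (hvol d M < +oo)%E ->
  let V := fine (hvol d M) in
  [/\ 0 < V, 1 <= normalization d M t z * V & normalization d M t z * V <= (1 + 16 * t / tau) ^+ d].
Proof.
move=> Mz t0 tt Vfin V.
have V0 : 0 < V by rewrite fine_gt0 // Vfin andbT hvol_good_gt0 //; exists z.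
have [_ _ /(_ z Mz)[Q fQ] _] := gM.
have t32 : 32 * t <= tau by lra.
have up := hvol_cylinder_upper Mz t0 t32; have lo := hvol_cylinder_lower Mz t0 tt.
have b0 : 0 < ball_vol R d * t ^+ d by rewrite mulr_gt0 ?ball_vol_gt0 ?exprn_gt0.
have fin : hvol d (cylinder M z t `&` M) \is a fin_num.
  by rewrite ge0_fin_numE ?hvol_ge0 // (le_lt_trans up) // ltry.
rewrite /normalization (hvol_cylinder_affine fQ t0) /= -/V.
move: up lo; rewrite -(fineK fin) !lee_fin => up lo.
have -> : forall c, c / (ball_vol R d * t ^+ d * V) * V = c / (ball_vol R d * t ^+ d).
  by move=> c; field; rewrite ?gt_eqF ?exprn_gt0 ?ball_vol_gt0.
by split => //; [rewrite ler_pdivlMr // mul1r|rewrite ler_pdivrMr].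
Qed.

End Volumes.

(** * Rescaling *)

Section Rescale.
Context {R : realType} {d m : nat}.
Implicit Types (M : set 'rV[R]_(d + m)).

Lemma scale_gt0 (sigma : R) : 0 < sigma -> 0 < scale sigma.
Proof. by move=> s0; rewrite mulr_gt0 // sqrtr_gt0 mulr_gt0 // pi_gt0. Qed.

Lemma rescale_setP (sigma : R) M q : 0 < sigma -> rescale_set sigma M q <-> M (scale sigma *: q).
Proof.
move=> s0; have c0 := scale_gt0 s0; split=> [[a Ma <-]|h].
  by rewrite scalerA divff ?gt_eqF // scale1r.
by exists (scale sigma *: q) => //; rewrite scalerA mulVf ?gt_eqF // scale1r.
Qed.

Lemma tangent_rescale (sigma : R) M q Q : 0 < sigma ->
  tangent_frame M (scale sigma *: q) Q -> tangent_frame (rescale_set sigma M) q Q.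
Proof.
move=> s0 [QQ TE]; split => //; have c0 := scale_gt0 s0; set c := scale sigma in TE c0.
have tZ b v p : b != 0 -> tangent M p v ->
    exists g : R -> 'rV[R]_(d + m), [/\ g 0 = b *: p, \forall t \near (0 : R), M (b^-1 *: g t) & is_derive (0 : R) (1 : R) g (b *: v)].
  move=> b0 [g [g0 Mg dg]]; exists (fun t => b *: g t); split; first by rewrite g0.
    by apply: filterS Mg => t Mg; rewrite scalerA mulVf // scale1r.
  exact: is_deriveZ.
apply/seteqP; split=> [v [g [g0 Mg dg]]|_ [u _ <-]].
  have Tv : tangent M (c *: q) (c *: v).
    exists (fun t => c *: g t); split; first by rewrite g0.
      by apply: filterS Mg => t /(rescale_setP _ _ s0).
    exact: is_deriveZ.
  move: Tv; rewrite TE => -[u _ uE]; exists (c^-1 *: u) => //.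
  have -> : row_mx (c^-1 *: u) 0 = c^-1 *: row_mx u (0 : 'rV[R]_m) by rewrite scale_row_mx scaler0.
  by rewrite -scalemxAl uE scalerA mulVf ?gt_eqF // scale1r.
have : tangent M (c *: q) (row_mx (c *: u) 0 *m Q) by rewrite TE; exists (c *: u).
have -> : row_mx (c *: u) 0 = c *: row_mx u (0 : 'rV[R]_m) by rewrite scale_row_mx scaler0.
rewrite -scalemxAl => /(tZ c^-1); rewrite invr_eq0 gt_eqF // => /(_ isT)[g [g0 Mg dg]].
exists g; split.
- by rewrite g0 scalerA mulVf ?gt_eqF // scale1r.
- by apply: filterS Mg => t; rewrite invrK => h; apply/(rescale_setP _ _ s0).
- by move: dg; rewrite scalerA mulVf ?gt_eqF // scale1r.
Qed.

Lemma good_rescale (sigma tau : R) M : 0 < sigma -> good_mfd tau M ->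
  good_mfd (tau / scale sigma) (rescale_set sigma M).
Proof.
move=> s0 [t0 cM fM bM]; have c0 := scale_gt0 s0; split.
- by rewrite divr_gt0.
- apply: continuous_compact cM; apply: continuous_subspaceT => x; exact: scaler_continuous.
- move=> q /(rescale_setP _ _ s0) /fM[Q fQ]; exists Q; exact: tangent_rescale.
- move=> p nu Mp nuT a Ma; have Mp' : M (scale sigma *: p) by apply/(rescale_setP _ _ s0).
  have Ma' : M (scale sigma *: a) by apply/(rescale_setP _ _ s0).
  have [Q fQ] := fM _ Mp'; have [_ TE'] := tangent_rescale s0 fQ.
  have := bM _ nu Mp' _ _ Ma'; rewrite -scalerBr edotZr enormZ exprMn real_normK ?num_real //.
  have h1 v : tangent M (scale sigma *: p) v -> edot nu v = 0.
    by rewrite fQ.2 -TE'; exact: nuT.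
  move=> /(_ h1) h; rewrite -(ler_pM2l (exprn_gt0 2 c0)) mulrCA [leRHS]mulrCA (le_trans _ h) //.
  by rewrite le_eqVlt; apply/orP; left; apply/eqP; field; rewrite gt_eqF.
Qed.

Lemma hvol_rescale (sigma : R) M : 0 < sigma ->
  hvol d (rescale_set sigma M) = (((scale sigma)^-1 ^+ d)%:E * hvol d M)%E.
Proof.
move=> s0; have c0 := scale_gt0 s0; set c := scale sigma in c0 *.
have ci : 0 < c^-1 by rewrite invr_gt0.
have lip (b : R) (x y : 'rV[R]_(d + m)) : 0 < b -> enorm (b *: x - b *: y) <= b * enorm (x - y).
  by move=> b0; rewrite -scalerBr enormZ gtr0_norm.
apply/eqP; rewrite eq_le; apply/andP; split; first by apply: hvol_lip => // x y _ _; exact: lip.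
rewrite exprVn lee_pdivrMl ?exprn_gt0 //.
apply: le_trans (@hvol_lip R _ _ d (fun x => c *: x) c (rescale_set sigma M) c0 (fun x y _ _ => lip c x y c0)).
apply: hvol_mono => x Mx; exists (c^-1 *: x); first by exists x.
by rewrite scalerA divff ?gt_eqF // scale1r.
Qed.

End Rescale.

(** * Simple functions and Chebyshev's inequality *)

Definition ind {R : realType} {T : Type} (A : set T) (x : T) : R := (`[< A x >])%:R.

Section SimpleFunctions.
Context {R : realType} {disp : measure_display} {T : measurableType disp} (P : probability T R).

Lemma indE (A : set T) x : A x -> ind A x = 1 :> R.
Proof. by move=> Ax; rewrite /ind asboolT. Qed.

Lemma indN (A : set T) x : ~ A x -> ind A x = 0 :> R.
Proof. by move=> Ax; rewrite /ind asboolF. Qed.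

Lemma ind_ge0 (U : Type) (A : set U) x : 0 <= ind A x :> R.
Proof. exact: ler0n. Qed.

Lemma indI (U : Type) (A B : set U) x : ind (A `&` B) x = ind A x * ind B x :> R.
Proof. by rewrite /ind asbool_and; case: asbool; case: asbool; rewrite ?mulr0 ?mul0r ?mulr1. Qed.

Lemma integral_simple (I : finType) (a : I -> R) (A : I -> set T) :
  (forall i, 0 <= a i) -> (forall i, measurable (A i)) ->
  (\int[P]_w (\sum_i a i * ind (A i) w)%:E = (\sum_i a i * fine (P (A i)))%:E)%E.
Proof.
move=> a0 mA.
have mi i : measurable_fun [set: T] (EFin \o (\1_(A i) : T -> R)).
  by apply/measurable_EFinP; exact: measurable_indic.
transitivity (\int[P]_w (\sum_i ((a i)%:E * (\1_(A i) w)%:E)))%E.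
  by apply: eq_integral => w _; rewrite -sumEFin; apply: eq_bigr => i _; rewrite -EFinM indicE.
rewrite ge0_integral_sum //; last 2 first.
- by move=> i; apply: measurable_funeM; exact: mi.
- by move=> i w _; rewrite lee_fin mulr_ge0 // indicE.
rewrite -sumEFin; apply: eq_bigr => i _.
rewrite ge0_integralZl_EFin //; first by rewrite integral_indic // setIT EFinM fineK // fin_num_measure.
exact: (mi i).
Qed.

(** The only form in which integrals enter: a pointwise inequality between simple functions yields
    the one between weighted probabilities. *)
Lemma simple_le (I J : finType) (a : I -> R) (A : I -> set T) (b : J -> R) (B : J -> set T) :
  (forall i, 0 <= a i) -> (forall i, measurable (A i)) ->
  (forall j, 0 <= b j) -> (forall j, measurable (B j)) ->
  (forall w, \sum_i a i * ind (A i) w <= \sum_j b j * ind (B j) w) ->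
  \sum_i a i * fine (P (A i)) <= \sum_j b j * fine (P (B j)).
Proof.
move=> a0 mA b0 mB h; rewrite -lee_fin -!integral_simple //.
have ms (K : finType) (c : K -> R) (C : K -> set T) : (forall i, measurable (C i)) ->
    measurable_fun [set: T] (EFin \o (fun w : T => \sum_i c i * ind (C i) w)).
  move=> mC; apply/measurable_EFinP; apply: measurable_sum => i.
  apply: measurable_funM => //; exact: measurable_indic.
apply: ge0_le_integral => //; try exact: ms.
- by move=> w _; rewrite lee_fin sumr_ge0 // => i _; rewrite mulr_ge0 // ind_ge0.
- by move=> w _; rewrite lee_fin.
Qed.

Lemma measurable_bits N (B : 'I_N -> set T) (phi : pred {ffun 'I_N -> bool}) :
  (forall i, measurable (B i)) -> measurable [set w | phi [ffun i => `[< B i w >]]].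
Proof.
move=> mB.
have -> : [set w | phi [ffun i => `[< B i w >]]] =
    \bigcup_(b in [set b : {ffun 'I_N -> bool} | phi b]) \bigcap_(i in [set: 'I_N]) (if b i then B i else ~` B i).
  apply/seteqP; split=> [w hw|w [b /= hb hw]].
    by exists [ffun i => `[< B i w >]] => // i _; rewrite ffunE; case: asboolP.
  have -> // : [ffun i => `[< B i w >]] = b.
  apply/ffunP => i; rewrite ffunE; have := hw i I.
  by case: (b i) => h; [rewrite asboolT|rewrite asboolF].
apply: fin_bigcup_measurable; first exact: finite_finset.
move=> b _; apply: fin_bigcap_measurable; first exact: finite_finset.
by move=> i _; case: ifP => _ //; exact: measurableC.
Qed.

Lemma sum_option (I : finType) (F : option I -> R) : \sum_x F x = F None + \sum_i F (Some i).
Proof.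
rewrite (bigD1 None) //=; congr (_ + _).
rewrite (reindex_omap Some id) /=; last by case.
by apply: eq_bigl => i; rewrite eqxx.
Qed.

(** Chebyshev with the square expanded. With [S] the sum of the indicators, [(N * eta) ^ 2 * 1_bad +
    2 * N * p * S <= (N * p) ^ 2 + S ^ 2] is an inequality between simple functions; pairwise
    independence evaluates [S ^ 2] as a double sum. *)
Lemma chebyshev_bits N (B : 'I_N -> set T) (p eta : R) : (forall i, measurable (B i)) ->
  (forall i, fine (P (B i)) = p) -> (forall i j, i != j -> fine (P (B i `&` B j)) = p ^+ 2) ->
  0 < eta -> (0 < N)%N -> 0 <= p -> p <= 1 ->
  let bad := [set w | N%:R * eta < `|\sum_i ind (B i) w - N%:R * p|] in
  measurable bad /\ fine (P bad) <= (N%:R * eta ^+ 2)^-1.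
Proof.
move=> mB Bp Bpp eta0 N0 p0 p1 bad.
have NR : 0 < N%:R :> R by rewrite ltr0n.
have mbad : measurable bad.
  have := @measurable_bits N B (fun b => N%:R * eta < `|\sum_i (b i)%:R - N%:R * p|) mB.
  congr measurable; apply/seteqP; split=> w /=.
    by under eq_bigr do rewrite ffunE.
  by under [in X in _ -> X]eq_bigr do rewrite ffunE.
split=> //.
(* The [option] types add one term to each family: the bad event on the left, the constant
   [(N * p) ^ 2] on the right. *)
have := @simple_le (option 'I_N) (option ('I_N * 'I_N))
  (fun x => if x is Some i then 2 * N%:R * p else (N%:R * eta) ^+ 2) (fun x => if x is Some i then B i else bad)
  (fun x => if x is Some ij then 1 else (N%:R * p) ^+ 2) (fun x => if x is Some ij then B ij.1 `&` B ij.2 else setT).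
rewrite !sum_option probability_setT mulr1.
have np0 : 0 <= 2 * N%:R * p by rewrite !mulr_ge0 ?ler0n.
move=> H; have {H} H : (N%:R * eta) ^+ 2 * fine (P bad) + \sum_(i < N) 2 * N%:R * p * fine (P (B i)) <=
    (N%:R * p) ^+ 2 + \sum_(ij : 'I_N * 'I_N) 1 * fine (P (B ij.1 `&` B ij.2)).
  apply: H; [by case=> *; rewrite ?sqr_ge0|by case|by case=> *; rewrite ?sqr_ge0| |].
    by case=> // -[i j]; exact: measurableI.
  move=> w; rewrite !sum_option; pose S : R := \sum_i ind (B i) w; rewrite -/S.
  have -> : \sum_(i < N) 2 * N%:R * p * ind (B i) w = 2 * N%:R * p * S by rewrite mulr_sumr.
  have -> : \sum_(ij : 'I_N * 'I_N) 1 * ind (B ij.1 `&` B ij.2) w = S ^+ 2.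
    rewrite expr2 big_distrlr pair_bigA /=; apply: eq_bigr => ij _.
    by rewrite mul1r indI.
  rewrite (@indE setT) // mulr1.
  have hs : (N%:R * eta) ^+ 2 * ind bad w <= (S - N%:R * p) ^+ 2.
    have [bw|bw] := pselect (bad w); last by rewrite indN // mulr0 sqr_ge0.
    rewrite indE // mulr1 -[leRHS]real_normK ?num_real // lerXn2r ?nnegrE //; first by nneg.
    exact: ltW.
  by rewrite sqrrB in hs; lra.
have e1 : \sum_(i < N) 2 * N%:R * p * fine (P (B i)) = 2 * (N%:R * p) ^+ 2.
  by under eq_bigr do rewrite Bp; rewrite sumr_const card_ord -mulr_natl; ring.
have e2 : \sum_(ij : 'I_N * 'I_N) 1 * fine (P (B ij.1 `&` B ij.2)) <= (N%:R * p) ^+ 2 + N%:R.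
  rewrite -(pair_bigA _ (fun i j => 1 * fine (P (B i `&` B j)))) /=.
  apply: (@le_trans _ _ (\sum_(i < N) \sum_(j < N) (p ^+ 2 + (i == j)%:R))).
    apply: ler_sum => i _; apply: ler_sum => j _; rewrite mul1r.
    have [->|ij] := eqVneq i j; last by rewrite Bpp // addr0.
    by rewrite setIid Bp (le_trans p1) // lerDr sqr_ge0.
  have h3 (i : 'I_N) : \sum_(j < N) (p ^+ 2 + (i == j)%:R) = N%:R * p ^+ 2 + 1.
    rewrite big_split /= sumr_const card_ord mulr_natl; congr (_ + _).
    by rewrite (bigD1 i) //= eqxx big1 ?addr0 // => j; rewrite eq_sym => /negbTE->.
  under eq_bigr do rewrite h3.
  by rewrite sumr_const card_ord -[_ *+ N]mulr_natl le_eqVlt; apply/orP; left; apply/eqP; ring.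
have e3 : (N%:R * eta) ^+ 2 * fine (P bad) <= N%:R by lra.
rewrite -[leRHS]mul1r ler_pdivlMr ?mulr_gt0 ?exprn_gt0 //.
by rewrite -(ler_pM2l NR) mulr1; apply: le_trans e3; rewrite le_eqVlt; apply/orP; left; apply/eqP; ring.
Qed.

End SimpleFunctions.

(** * Empirical measures of the cells of a net *)

Section Cells.
Context {R : realType} {n : nat}.

Lemma borelE : @borel R n = @measurable _ (g_sigma_algebraType [set U : set 'rV[R]_n | open U]).
Proof. by []. Qed.

Lemma borel_open (A : set 'rV[R]_n) : open A -> borel A.
Proof. by move=> oA; apply: sub_gen_smallest. Qed.

Lemma borelC (A : set 'rV[R]_n) : borel A -> borel (~` A).
Proof. by rewrite borelE => h; exact: measurableC. Qed.

Lemma borelI (A B : set 'rV[R]_n) : borel A -> borel B -> borel (A `&` B).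
Proof. by rewrite borelE => h1 h2; exact: measurableI. Qed.

Lemma borel_closed (A : set 'rV[R]_n) : closed A -> borel A.
Proof. by move=> cA; have := borelC (borel_open (closed_openC cA)); rewrite setCK. Qed.

Lemma borelT : borel [set: 'rV[R]_n].
Proof. by apply: borel_open; exact: openT. Qed.

(** A finite cover of the unit ball by small balls, made disjoint by removing from each the earlier
    ones. The cells depend on [eps] only, which makes the sample size uniform over all manifolds in
    the ball. *)
Lemma net_cells (eps : R) : 0 < eps -> exists (J : nat) (c : 'I_J -> 'rV[R]_n) (C : 'I_J -> set 'rV[R]_n),
  [/\ forall j, borel (C j), forall j x, C j x -> enorm (x - c j) <= eps,
      forall x, enorm x <= 1 -> exists j, C j x & forall i j x, C i x -> C j x -> i = j].
Proof.
move=> eps0; have := @compact_eball R n 0 1; rewrite compact_cover => cpt.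
have [||D _ hD] := cpt 'rV[R]_n setT (fun c : 'rV[R]_n => [set x | enorm (x - c) < eps]).
- by move=> c _; exact: open_eball.
- by move=> x _; exists x => //=; rewrite subrr enorm0.
pose s := finmap.enum_fset D.
pose U (c : 'rV[R]_n) := [set x : 'rV[R]_n | enorm (x - c) < eps].
exists (size s), (fun j => nth 0 s j), (fun j => U (nth 0 s j) `&`
  \bigcap_(i in [set i : 'I_(size s) | (i < j)%N]) ~` U (nth 0 s i)); split.
- move=> j; apply: borelI; first by apply: borel_open; exact: open_eball.
  rewrite borelE; apply: fin_bigcap_measurable; first exact: finite_finset.
  by move=> i _; have := borelC (borel_open (@open_eball R n (nth 0 s i) eps)).
- by move=> j x [/ltW].
- move=> x x1; have [|c /= cD cx] := hD x; first by rewrite /= subr0.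
  have hs : has (fun c => enorm (x - c) < eps) s by apply/hasP; exists c.
  have hk : (find (fun c => (enorm (x - c) < eps)%R) s < size s)%N by rewrite -has_find.
  exists (Ordinal hk); split; first exact: (nth_find 0 hs).
  by move=> i /= ik Ui; have := before_find 0 ik; rewrite Ui.
- move=> i j x [Ui hi] [Uj hj]; apply: val_inj => /=; case: (ltngtP i j) => // ij.
  + by have := hj i ij.
  + by have := hi j ij.
Qed.

End Cells.

Section Empirical.
Context {R : realType} {n : nat}.

Definition prob d (M0 A : set 'rV[R]_n) : R := fine (hvol d (A `&` M0)) / fine (hvol d M0).

Lemma empirical_cells d J (C : 'I_J -> set 'rV[R]_n) (eta delta : R) :
  (forall j, borel (C j)) -> 0 < eta -> 0 < delta ->
  exists N0 : nat, forall N : nat, (N0 <= N)%N -> (0 < N)%N -> forall (M0 : set 'rV[R]_n), borel M0 ->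
    forall (disp : measure_display) (T : measurableType disp)
      (P : probability T R) (X : 'I_N -> T -> 'rV[R]_n), iid_uniform d M0 P X ->
    exists E : set T, [/\ measurable E, ((1 - delta)%:E <= P E)%E &
      forall w, E w -> (forall i, M0 (X i w)) /\
        forall j, `|\sum_i ind (C j) (X i w) - N%:R * prob d M0 (C j)| <= N%:R * eta].
Proof.
move=> bC eta0 delta0.
have e2 : 0 < eta ^+ 2 by rewrite exprn_gt0.
(* Union bound: one of the [J] frequencies is off by more than [eta] with probability at most
   [J / (N * eta ^ 2)]. *)
pose N0 := Num.trunc (J%:R / (delta * eta ^+ 2)).
have J0 : 0 <= J%:R / (delta * eta ^+ 2) by rewrite divr_ge0 // mulr_ge0 // ltW.
have hN0 : J%:R / (delta * eta ^+ 2) < N0.+1%:R by exact: truncnS_gt.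
exists N0.+1 => N hN Np M0 bM disp T P X [mX uX iX].
have NR : 0 < N%:R :> R by rewrite ltr0n.
have dE : 0 < delta * eta ^+ 2 by rewrite mulr_gt0.
have hN' : J%:R <= N%:R * (delta * eta ^+ 2).
  by rewrite -ler_pdivrMr // (le_trans (ltW hN0)) // ler_nat.
have i0 : 'I_N by exact: (Ordinal Np).
have prob_fine i A : borel A -> fine (P (X i @^-1` A)) = prob d M0 A by move=> bA; rewrite uX.
have prob_le1 A : borel A -> prob d M0 A <= 1.
  move=> bA; rewrite -(prob_fine i0) // -lee_fin fineK ?fin_num_measure //; last exact: mX.
  by apply: probability_le1; exact: mX.
have prob_ge0 A : 0 <= prob d M0 A by rewrite /prob divr_ge0 // fine_ge0 // hvol_ge0.
have PM0 i : P (X i @^-1` M0) = 1%E.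
  have := uX i setT borelT; rewrite preimage_setT probability_setT setTI => e.
  by rewrite uX // setIid.
pose G := [set w | forall i, M0 (X i w)].
have GE : G = \bigcap_(i in [set: 'I_N]) (X i @^-1` M0) by apply/seteqP; split=> w h i; [move=> _; exact: h|exact: h].
have mG : measurable G.
  by rewrite GE; apply: fin_bigcap_measurable; [exact: finite_finset|move=> i _; exact: mX].
have PG : P G = 1%E.
  rewrite (iX (fun=> M0)) // big1 // => i _; exact: PM0.
pose bad j := [set w | N%:R * eta < `|\sum_i ind (X i @^-1` C j) w - N%:R * prob d M0 (C j)|].
have hbad j : measurable (bad j) /\ fine (P (bad j)) <= (N%:R * eta ^+ 2)^-1.
  apply: chebyshev_bits => //.
  - by move=> i; exact: mX.
  - by move=> i; exact: prob_fine.
  - move=> i i' ii'.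
    have -> : X i @^-1` C j `&` X i' @^-1` C j =
        [set w | forall k, (if (k == i) || (k == i') then C j else setT) (X k w)].
      apply/seteqP; split=> [w [h1 h2] k|w h].
        by case: ifP => // /orP[/eqP->|/eqP->].
      by have := h i; have := h i'; rewrite !eqxx orbT.
    rewrite (iX (fun k => if (k == i) || (k == i') then C j else setT)); last by move=> k; case: ifP => _ //; exact: borelT.
    rewrite (bigD1 i) //= (bigD1 i') /=; last by rewrite eq_sym.
    rewrite big1 ?mule1; last first.
      move=> k /andP[ki ki']; rewrite (negbTE ki) (negbTE ki') /=.
      by rewrite preimage_setT probability_setT.
    by rewrite !eqxx orbT !uX //= expr2.
  - exact: prob_le1.
pose E := G `\` \bigcup_(j in [set: 'I_J]) bad j.
have mU : measurable (\bigcup_(j in [set: 'I_J]) bad j).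
  by apply: fin_bigcup_measurable; [exact: finite_finset|move=> j _; exact: (hbad j).1].
exists E; split.
- exact: measurableD.
- have mE : measurable E by exact: measurableD.
  have := @simple_le R disp T P unit (option 'I_J) (fun=> 1) (fun=> G) (fun=> 1)
    (fun x => if x is Some j then bad j else E).
  rewrite sum_option big_const card_unit /= addr0 !mul1r PG /=.
  rewrite -[P E]fineK ?fin_num_measure // lee_fin => H.
  have {}H : 1 <= fine (P E) + \sum_(j < J) 1 * fine (P (bad j)).
    apply: H => //; first by case=> // j; exact: (hbad j).1.
    move=> w; rewrite sum_option big_const card_unit /= addr0 !mul1r.
    have s0 : 0 <= \sum_(j < J) 1 * ind (bad j) w :> R by apply: sumr_ge0 => j _; rewrite mul1r ind_ge0.
    have [Gw|Gw] := pselect (G w); last by rewrite indN // addr_ge0 ?ind_ge0.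
    rewrite indE //; have [Ew|Ew] := pselect (E w); first by rewrite (indE Ew) lerDl.
    have [j bj] : exists j, bad j w.
      by apply: contrapT => nb; apply: Ew; split => // -[j _ bj]; apply: nb; exists j.
    rewrite (bigD1 j) //= mul1r (indE bj) addrCA lerDl addr_ge0 ?ind_ge0 //.
    by apply: sumr_ge0 => k _; rewrite mul1r ind_ge0.
  have : \sum_(j < J) 1 * fine (P (bad j)) <= delta.
    apply: (@le_trans _ _ (\sum_(j < J) (N%:R * eta ^+ 2)^-1)).
      by apply: ler_sum => j _; rewrite mul1r; exact: (hbad j).2.
    rewrite sumr_const card_ord -[leLHS]mulr_natl ler_pdivrMr ?mulr_gt0 //.
    by rewrite mulrCA.
  lra.
- move=> w [Gw Uw]; split=> // j; rewrite leNgt; apply/negP => h; apply: Uw.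
  by exists j.
Qed.

Definition avg N (f : 'rV[R]_n -> R) (y : 'I_N -> 'rV[R]_n) : R := N%:R^-1 * \sum_i f (y i).

(* The comparison functions g are simple, which replaces integration on M0. *)
Lemma empirical_event d (L kappa delta : R) : 0 <= L -> 0 < kappa -> 0 < delta ->
  exists N0 : nat, forall N : nat, (N0 <= N)%N -> (0 < N)%N /\ forall (M0 : set 'rV[R]_n), borel M0 ->
    (forall x, M0 x -> enorm x <= 1) ->
    forall (disp : measure_display) (T : measurableType disp)
      (P : probability T R) (X : 'I_N -> T -> 'rV[R]_n), iid_uniform d M0 P X ->
    exists E : set T, [/\ measurable E, ((1 - delta)%:E <= P E)%E &
      forall w, E w -> (forall i, M0 (X i w)) /\
        forall (f : 'rV[R]_n -> R) (K : finType) (b : K -> R) (A : K -> set 'rV[R]_n),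
        (forall x, 0 <= f x <= 1) -> (forall x y, `|f x - f y| <= L * enorm (x - y)) ->
        (forall k, 0 <= b k) -> (forall k, borel (A k)) ->
        ((forall y, M0 y -> f y <= \sum_k b k * ind (A k) y) ->
          avg f (fun i => X i w) <= \sum_k b k * prob d M0 (A k) + kappa) /\
        ((forall y, M0 y -> \sum_k b k * ind (A k) y <= f y) ->
          \sum_k b k * prob d M0 (A k) - kappa <= avg f (fun i => X i w))].
Proof.
move=> L0 kappa0 delta0.
(* Three errors of [kappa / 4] will add up: the oscillation of [f] on a cell, counted twice, and the
   frequencies of the cells. *)
pose eps := kappa / (4 * (L + 1)).
have L1 : 0 < L + 1 by rewrite ltr_wpDl.
have eps0 : 0 < eps by rewrite divr_gt0 // mulr_gt0.
have Leps : L * eps <= kappa / 4.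
  have -> : kappa / 4 = (L + 1) * eps by rewrite /eps; field; rewrite gt_eqF.
  by rewrite ler_wpM2r ?(ltW eps0) // lerDl.
have [J [c [C [bC Cc Cx Cu]]]] := @net_cells R n eps eps0.
pose eta := kappa / (4 * (J%:R + 1)).
have J1 : 0 < J%:R + 1 :> R by rewrite ltr_wpDl.
have eta0 : 0 < eta by rewrite divr_gt0 // mulr_gt0.
have Jeta : J%:R * eta <= kappa / 4.
  have -> : kappa / 4 = (J%:R + 1) * eta by rewrite /eta; field; rewrite gt_eqF.
  by rewrite ler_wpM2r ?(ltW eta0) // lerDl.
have [N0 hN0] := empirical_cells d bC eta0 delta0.
exists N0.+1 => N hN; have Np : (0 < N)%N by exact: leq_trans hN.
split=> // M0 bM M1 disp T P X iid.
have [E [mE PE hE]] := hN0 N (ltnW hN) Np M0 bM disp T P X iid.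
have [mX uX iX] := iid.
exists E; split=> // w Ew; have [XM freq] := hE w Ew; split=> // f K b A f01 fL b0 bA.
have NR : 0 < N%:R :> R by rewrite ltr0n.
have f0 x : 0 <= f x by case/andP: (f01 x).
have f1 x : f x <= 1 by case/andP: (f01 x).
have i0 : 'I_N by exact: (Ordinal Np).
pose mu j := prob d M0 (C j).
have PA B : borel B -> fine (P (X i0 @^-1` (B `&` M0))) = prob d M0 B.
  by move=> bB; rewrite uX; [rewrite -setIA setIid|exact: borelI].
have mXA B : borel B -> measurable (X i0 @^-1` (B `&` M0)) by move=> bB; apply: mX; exact: borelI.
have xpand y (g : 'rV[R]_n -> R) : M0 y -> g y = \sum_j ind (C j) y * g y.
  move=> My; have [j Cj] := Cx _ (M1 _ My).
  rewrite (bigD1 j) //= {1}/ind asboolT // mul1r big1 ?addr0 // => i ij.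
  rewrite /ind asboolF ?mul0r // => Ci; move: ij; rewrite (Cu i j y) ?eqxx //.
have fc j y : C j y -> `|f y - f (c j)| <= kappa / 4.
  by move=> Cy; rewrite (le_trans (fL _ _)) // (le_trans _ Leps) // ler_wpM2l //; exact: Cc.
pose S j : R := \sum_i ind (C j) (X i w).
have sumS : \sum_j S j = N%:R.
  rewrite exchange_big /=; transitivity (\sum_(i < N) (1 : R)); last by rewrite sumr_const card_ord.
  by apply: eq_bigr => i _; rewrite [RHS](xpand (X i w) (fun=> 1)) //; apply: eq_bigr => j _; rewrite mulr1.
have avg_sum : \sum_i f (X i w) = \sum_j \sum_i ind (C j) (X i w) * f (X i w).
  by rewrite exchange_big; apply: eq_bigr => i _; exact: xpand.
have key1 : `|\sum_i f (X i w) - \sum_j S j * f (c j)| <= N%:R * (kappa / 4).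
  rewrite avg_sum -sumrB (le_trans (ler_norm_sum _ _ _)) // -sumS mulr_suml.
  apply: ler_sum => j _; rewrite !mulr_suml -sumrB (le_trans (ler_norm_sum _ _ _)) //.
  apply: ler_sum => i _; rewrite -mulrBr normrM (ger0_norm (ind_ge0 _ _)).
  have [Cj|Cj] := pselect (C j (X i w)); last by rewrite /ind asboolF // !mul0r.
  by rewrite ler_wpM2l ?ind_ge0 //; exact: fc.
have key2 : `|\sum_j S j * f (c j) - N%:R * \sum_j mu j * f (c j)| <= N%:R * (kappa / 4).
  rewrite mulr_sumr -sumrB (le_trans (ler_norm_sum _ _ _)) //.
  apply: (@le_trans _ _ (\sum_(j < J) N%:R * eta)); last first.
    by rewrite sumr_const card_ord -[leLHS]mulr_natl mulrCA ler_wpM2l // ltW.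
  apply: ler_sum => j _; rewrite mulrA -mulrBl normrM (ger0_norm (f0 _)).
  by rewrite -[leRHS]mulr1; apply: ler_pM (normr_ge0 _) (f0 _) (freq j) (f1 _).
have sum_mu : \sum_j mu j <= 1.
  have := @simple_le R disp T P 'I_J unit (fun=> 1) (fun j => X i0 @^-1` (C j `&` M0)) (fun=> 1) (fun=> setT).
  rewrite big_const card_unit /= addr0 mul1r probability_setT => H.
  apply: le_trans (H _ _ _ _ _) => //.
  - by apply: ler_sum => j _; rewrite mul1r PA.
  - by move=> j; exact: mXA.
  - move=> v; rewrite big_const card_unit /= addr0 mul1r indE //.
    have [Mv|Mv] := pselect (M0 (X i0 v)).
      rewrite [leRHS](xpand _ (fun=> 1) Mv); apply: ler_sum => j _; rewrite mul1r mulr1.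
      by rewrite /ind /preimage /= asbool_and; case: asbool; case: asbool; rewrite ?lexx ?ler01.
    by rewrite big1 // => j _; rewrite /ind asboolF ?mulr0 // => -[].
have avgE : `|avg f (fun i => X i w) - \sum_j mu j * f (c j)| <= kappa / 2.
  rewrite -(ler_pM2l NR) -{1}(gtr0_norm NR) -normrM mulrBr /avg mulrA divff ?gt_eqF // mul1r.
  rewrite (le_trans (ler_distD (\sum_j S j * f (c j)) _ _)) //.
  by rewrite (le_trans (lerD key1 key2)) // -mulrDr ler_wpM2l ?(ltW NR) //; lra.
have mu0 j : 0 <= mu j by rewrite /mu /prob divr_ge0 // fine_ge0 // hvol_ge0.
have eA : \sum_k b k * fine (P (X i0 @^-1` (A k `&` M0))) = \sum_k b k * prob d M0 (A k).
  by apply: eq_bigr => k _; rewrite PA.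
have eC g : \sum_j g j * fine (P (X i0 @^-1` (C j `&` M0))) = \sum_j g j * mu j.
  by apply: eq_bigr => j _; rewrite PA.
split=> hf.
  (* On its cell [f] is at least [f (c j) - kappa / 4]; the maximum with 0 keeps the coefficients of
     the simple function nonnegative. *)
  have : \sum_j Num.max 0 (f (c j) - kappa / 4) * mu j <= \sum_k b k * prob d M0 (A k).
    have := @simple_le R disp T P 'I_J K (fun j => Num.max 0 (f (c j) - kappa / 4))
      (fun j => X i0 @^-1` (C j `&` M0)) b (fun k => X i0 @^-1` (A k `&` M0)).
    rewrite eA eC.
    apply => //; try by move=> j; exact: mXA.
    - by move=> j; rewrite le_max lexx.
    - move=> v; have [Mv|Mv] := pselect (M0 (X i0 v)); last first.
        rewrite !big1 // => j _; rewrite /ind asboolF ?mulr0 //; by case.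
      have e U : ind (X i0 @^-1` (U `&` M0)) v = ind U (X i0 v) :> R.
        by rewrite /ind /preimage /= asbool_and (asboolT Mv) andbT.
      under eq_bigr do rewrite e.
      under [leRHS]eq_bigr do rewrite e.
      apply: le_trans (hf _ Mv); rewrite [leRHS](xpand _ f Mv); apply: ler_sum => j _.
      have [Cj|Cj] := pselect (C j (X i0 v)); last by rewrite /ind asboolF // mulr0 mul0r.
      rewrite /ind asboolT // mulr1 mul1r ge_max f0 /=.
      by have := fc j _ Cj; rewrite ler_norml => /andP[]; lra.
  have : \sum_j mu j * f (c j) - kappa / 4 <= \sum_j Num.max 0 (f (c j) - kappa / 4) * mu j.
    apply: (@le_trans _ _ (\sum_j (f (c j) - kappa / 4) * mu j)); last first.
      by apply: ler_sum => j _; rewrite ler_wpM2r // le_max lexx orbT.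
    under [leRHS]eq_bigr do rewrite mulrBl [f _ * _]mulrC.
    rewrite sumrB -mulr_sumr lerD2l lerN2 ler_piMr //; lra.
  by move: avgE; rewrite ler_norml => /andP[]; lra.
have : \sum_k b k * prob d M0 (A k) <= \sum_j (f (c j) + kappa / 4) * mu j.
  have := @simple_le R disp T P K 'I_J b (fun k => X i0 @^-1` (A k `&` M0))
    (fun j => f (c j) + kappa / 4) (fun j => X i0 @^-1` (C j `&` M0)).
  rewrite eA eC.
  apply => //; try by move=> j; exact: mXA.
  - by move=> j; rewrite addr_ge0 // divr_ge0 // ltW.
  - move=> v; have [Mv|Mv] := pselect (M0 (X i0 v)); last first.
      rewrite !big1 // => j _; rewrite /ind asboolF ?mulr0 //; by case.
    have e U : ind (X i0 @^-1` (U `&` M0)) v = ind U (X i0 v) :> R.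
      by rewrite /ind /preimage /= asbool_and (asboolT Mv) andbT.
    under eq_bigr do rewrite e.
    under [leRHS]eq_bigr do rewrite e.
    apply: (le_trans (hf _ Mv)); rewrite [leLHS](xpand _ f Mv); apply: ler_sum => j _.
    have [Cj|Cj] := pselect (C j (X i0 v)); last by rewrite /ind asboolF // mulr0 mul0r.
    rewrite /ind asboolT // mulr1 mul1r.
    by have := fc j _ Cj; rewrite ler_norml => /andP[]; lra.
have : \sum_j (f (c j) + kappa / 4) * mu j <= \sum_j mu j * f (c j) + kappa / 4.
  under eq_bigr do rewrite mulrDl [f _ * _]mulrC.
  rewrite big_split /= -mulr_sumr lerD2l ler_piMr //; lra.
by move: avgE; rewrite ler_norml => /andP[]; lra.
Qed.

End Empirical.

(** * Gaussian sums over the lattice *)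

Section Layers.
Context {R : realType}.
Implicit Types (h : R) (d T K J : nat).

(** [gau h T] is the Gaussian at the points of h Z^d with integer squared norm [T], and [dgau] its
    drop from one shell to the next. [layer] and [llayer] are the layer-cake sums of the truncated
    Gaussian, with volumes of balls and with lattice counts; [gsum] is its Riemann sum on the
    line. *)
Definition gau h T : R := expR (- (pi * h ^+ 2 * T%:R)).
Definition dgau h T := gau h T - gau h T.+1.
Definition layer d h K := \sum_(T < K.+1) dgau h T * (ball_vol R d * (h * Num.sqrt T%:R) ^+ d).
Definition llayer d h K := \sum_(T < K.+1) dgau h T * (h ^+ d * (lat d T)%:R).
Definition gsum h J := h * \sum_(k <- zrange J) gau h (`|k| ^ 2)%N.

Lemma gau_gt0 h T : 0 < gau h T. Proof. exact: expR_gt0. Qed.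
Lemma gau0 h : gau h 0 = 1. Proof. by rewrite /gau mulr0 oppr0 expR0. Qed.

Lemma gauD h S T : gau h (S + T) = gau h S * gau h T.
Proof. by rewrite /gau natrD mulrDr opprD expRD. Qed.

Lemma gau_le h S T : (S <= T)%N -> gau h T <= gau h S.
Proof.
move=> ST; rewrite ler_expR lerN2 ler_wpM2l ?ler_nat // mulr_ge0 ?sqr_ge0 //; exact: pi_ge0.
Qed.

Lemma gau_le1 h T : gau h T <= 1. Proof. by rewrite -(gau0 h) gau_le. Qed.

Lemma dgau_ge0 h T : 0 <= dgau h T.
Proof. by rewrite subr_ge0 gau_le. Qed.

Lemma sum_dgau h S K : (S <= K)%N -> \sum_(S <= T < K) dgau h T = gau h S - gau h K.
Proof. move=> SK; rewrite -[RHS]opprB -telescope_sumr // -sumrN.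
by apply: eq_bigr => T _; rewrite opprB. Qed.

Lemma sum_dgau0 h K : \sum_(T < K) dgau h T = 1 - gau h K.
Proof. by rewrite -(big_mkord xpredT (dgau h)) sum_dgau // gau0. Qed.

Lemma layer_ge0 d h K : 0 <= h -> 0 <= layer d h K.
Proof.
move=> h0; apply: sumr_ge0 => T _; rewrite mulr_ge0 ?dgau_ge0 // mulr_ge0 ?ball_vol_ge0 //.
by rewrite exprn_ge0 // mulr_ge0.
Qed.

Lemma llayer_layer d eta : 0 < eta -> exists2 C, 0 <= C & forall h K, 0 < h ->
  `|llayer d h K - layer d h K| <= eta * layer d h K + C * h ^+ d.
Proof.
move=> eta0; have w0 := ball_vol_gt0 d (R := R).
have [C C0 hC] := lat_asymp d (mulr_gt0 eta0 w0).
exists C => // h K h0; have hd : 0 < h ^+ d by rewrite exprn_gt0.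
rewrite /llayer /layer -sumrB (le_trans (ler_norm_sum _ _ _)) //.
apply: (@le_trans _ _ (\sum_(T < K.+1) dgau h T * (eta * (ball_vol R d * (h * Num.sqrt T%:R) ^+ d) + C * h ^+ d))).
  apply: ler_sum => T _; rewrite -mulrBr normrM (ger0_norm (dgau_ge0 _ _)) ler_wpM2l ?dgau_ge0 //.
  rewrite exprMn mulrCA -mulrBr normrM (gtr0_norm hd).
  have h1 := ler_wpM2l (ltW hd) (hC T); apply: (le_trans h1).
  by rewrite le_eqVlt; apply/orP; left; apply/eqP; ring.
under eq_bigr do rewrite mulrDr mulrCA.
rewrite big_split /= -mulr_sumr lerD2l -mulr_suml sum_dgau0 ler_piMl ?mulr_ge0 ?(ltW hd) //.
by rewrite gerBl ltW // gau_gt0.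
Qed.

Lemma count_box_le d T J : (count (fun u => sqn u <= T)%N (box d J) <= lat d T)%N.
Proof.
have h : (T < (J + T).+1 ^ 2)%N by rewrite -mulnn; nia.
rewrite -(lat_box d h) -!size_filter; apply: uniq_leq_size; first by rewrite filter_uniq // uniq_box.
move=> u; rewrite !mem_filter => /andP[-> /=]; rewrite !mem_box => /forallP hu.
by apply/forallP => i; rewrite (leq_trans (hu i)) // leq_addr.
Qed.

Lemma layer_cake d h J K : \sum_(u <- box d J | (sqn u <= K)%N) (gau h (sqn u) - gau h K.+1) =
  \sum_(T < K.+1) dgau h T * (count (fun u => sqn u <= T)%N (box d J))%:R.
Proof.
transitivity (\sum_(u <- box d J) \sum_(T < K.+1) dgau h T * ((sqn u <= T)%N)%:R).
  rewrite big_mkcond; apply: eq_bigr => u _; case: leqP => uK.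
    rewrite -sum_dgau ?leqW // -(big_mkord xpredT (fun T => dgau h T * ((sqn u <= T)%N)%:R)).
    rewrite [RHS](big_cat_nat (n := sqn u)) //= ?leqW // [X in _ = X + _]big_nat_cond [X in _ = X + _]big1 ?add0r; last first.
      by move=> T /andP[/andP[_ Tu] _]; rewrite leqNgt Tu mulr0.
    by apply: eq_big_nat => T /andP[uT _]; rewrite uT mulr1.
  by rewrite big1 // => T _; rewrite leqNgt (leq_trans (ltn_ord T) uK) mulr0.
rewrite exchange_big /=; apply: eq_bigr => T _; rewrite -mulr_sumr -sum1_count natr_sum.
by rewrite [in RHS]big_mkcond; congr (_ * _); apply: eq_bigr => u _; case: leqP.
Qed.

Lemma big_box_consr d J (F : 'rV[int]_d.+1 -> R) :
  \sum_(u <- box d.+1 J) F u =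
  \sum_(i <- zrange J) \sum_(u <- box d J) F (row_mx (const_mx i : 'rV_1) u).
Proof. exact: (big_allpairs_dep (op := +%R)). Qed.

(** The Gaussian is a product, so its sum over a box factors. Comparing boxes with balls then links
    [gsum ^+ d] to [llayer]. *)
Lemma gsumX d h J : gsum h J ^+ d = h ^+ d * \sum_(u <- box d J) gau h (sqn u).
Proof.
rewrite exprMn; congr (_ * _); elim: d => [|d IH].
  by rewrite /= big_seq1 /sqn big_ord0 gau0.
rewrite exprS IH big_box_consr mulr_suml; apply: eq_bigr => i _.
by rewrite mulr_sumr; apply: eq_bigr => u _; rewrite sqn_cons gauD.
Qed.

Lemma gsum_ge0 h J : 0 <= h -> 0 <= gsum h J.
Proof. by move=> h0; rewrite mulr_ge0 // sumr_ge0 // => k _; rewrite ltW // gau_gt0. Qed.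

Lemma llayer_le_gsum d h J K : 0 <= h -> (K <= J ^ 2)%N -> llayer d h K <= gsum h J ^+ d.
Proof.
move=> h0 KJ; rewrite gsumX /llayer.
under eq_bigr do rewrite mulrCA; rewrite -mulr_sumr ler_wpM2l ?exprn_ge0 //.
have e T : (T < K.+1)%N -> lat d T = count (fun u => sqn u <= T)%N (box d J).
  rewrite ltnS => TK; rewrite lat_box //; apply: (leq_ltn_trans TK).
  by have : (K < J.+1 ^ 2)%N by rewrite (leq_ltn_trans KJ) // ltn_sqr.
under eq_bigr do rewrite e //; rewrite -layer_cake big_mkcond; apply: ler_sum => u _.
case: ifP => _; last by rewrite ltW // gau_gt0.
by rewrite gerBl ltW // gau_gt0.
Qed.

Lemma sqn_box d J u : u \in box d J -> (sqn u <= d * J ^ 2)%N.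
Proof.
rewrite mem_box => /forallP h; rewrite /sqn -[d in (d * _)%N]card_ord -sum_nat_const.
by apply: leq_sum => i _; rewrite leq_sqr.
Qed.

(** The box lies in the ball of squared radius [K]. The last term pays for the truncation, in which
    each point of the box loses [gau h K.+1]. *)
Lemma gsum_le_llayer d h J K : 0 <= h -> (d * J ^ 2 <= K)%N ->
  gsum h J ^+ d <= llayer d h K + h ^+ d * (gau h K.+1 * (lat d K)%:R).
Proof.
move=> h0 JK; rewrite gsumX /llayer.
under [X in _ <= X + _]eq_bigr do rewrite mulrCA; rewrite -mulr_sumr -mulrDr ler_wpM2l ?exprn_ge0 //.
have sK u : u \in box d J -> (sqn u <= K)%N by move=> /sqn_box /leq_trans; apply.
have -> : \sum_(u <- box d J) gau h (sqn u) =
    \sum_(u <- box d J | (sqn u <= K)%N) (gau h (sqn u) - gau h K.+1) + \sum_(u <- box d J) gau h K.+1.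
  rewrite [X in _ = X + _]big_mkcond -big_split /= big_seq [RHS]big_seq; apply: eq_bigr => u /sK ->.
  by rewrite subrK.
rewrite layer_cake; apply: lerD.
  by apply: ler_sum => T _; rewrite ler_wpM2l ?dgau_ge0 // ler_nat count_box_le.
rewrite big_const_seq count_predT iter_addr_0 -[leLHS]mulr_natr ler_wpM2l ?(ltW (gau_gt0 _ _)) // ler_nat.
have <- : count (fun u => sqn u <= K)%N (box d J) = size (box d J).
  by apply/eqP; rewrite -all_count; apply/allP => u /sK.
exact: count_box_le.
Qed.

Lemma mul_expRN_le (u : R) : u * expR (- u) <= expR (- (u / 2)).
Proof.
have e1 : expR (- u) = expR (- (u / 2)) * expR (- (u / 2)) by rewrite -expRD; congr expR; lra.
rewrite e1 mulrA ler_piMl ?expR_ge0 // expRN ler_pdivrMr ?expR_gt0 // mul1r.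
have -> : u / 2 = u / 4 + u / 4 by lra.
rewrite expRD -expr2; have h := expR_ge1Dx (u / 4).
have [u0|u0] := leP u 0; first by rewrite (le_trans u0) // sqr_ge0.
apply: (@le_trans _ _ ((1 + u / 4) ^+ 2)); last by rewrite lerXn2r ?nnegrE ?expR_ge0 // addr_ge0 // divr_ge0 // ltW.
have := sqr_ge0 (1 - u / 4); rewrite sqrrB sqrrD !expr1n; lra.
Qed.

(** In dimension 2 the volume of a ball is linear in [T], and summation by parts leaves a geometric
    series. This is the discrete form of the polar coordinates that evaluate the Gaussian
    integral. *)
Lemma layer2E h K : layer 2 h K = pi * h ^+ 2 * (\sum_(T < K) gau h T.+1 - K%:R * gau h K.+1).
Proof.
transitivity (pi * h ^+ 2 * \sum_(T < K.+1) dgau h T * T%:R).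
  rewrite mulr_sumr; apply: eq_bigr => T _; rewrite exprMn sqrt_nat_sqr /=.
  have -> : 2 * pi / 2%:R * 1 = pi :> R by field.
  by ring.
congr (_ * _); elim: K => [|K IH]; first by rewrite big_ord1 big_ord0 mulr0 mul0r subrr.
rewrite big_ord_recr IH [in RHS]big_ord_recr /= /dgau -(natr1 K); ring.
Qed.

Lemma layer2_bounds h K : 0 < h -> let x := pi * h ^+ 2 in
  layer 2 h K <= 1 /\ 1 - x - 2 * expR (- (x * K%:R / 2)) <= layer 2 h K.
Proof.
move=> h0 x; have x0 : 0 < x by rewrite mulr_gt0 ?pi_gt0 ?exprn_gt0.
rewrite layer2E -/x; set S := \sum_(T < K) _.
have gS : (expR x - 1) * S = 1 - gau h K.
  have e1 T : gau h T = expR x * gau h T.+1.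
    by rewrite -addn1 gauD mulrCA /gau mulr1 -/x -expRD subrr expR0 mulr1.
  rewrite mulrBl mul1r mulr_sumr -sum_dgau0 -sumrB; apply: eq_bigr => T _.
  by rewrite -e1.
have S0 : 0 <= S by apply: sumr_ge0 => T _; rewrite ltW // gau_gt0.
have ex : x <= expR x - 1 by have := expR_ge1Dx x; lra.
have xS : x * S <= 1 - gau h K by rewrite -gS ler_wpM2r.
have g0 := gau_gt0 h K; have g1 := gau_le1 h K.
have gS1 := gau_gt0 h K.+1.
have xg : 0 <= x * (K%:R * gau h K.+1) by nneg.
split; first by rewrite mulrBr; lra.
have xS2 : (1 - gau h K) * (1 - x) <= x * S.
  have h1 : expR x * (1 - x) <= 1.
    by have := expR_ge1Dx (- x); rewrite expRN -ler_pdivlMl ?expR_gt0 // mulr1.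
  have h2 : (expR x - 1) * (1 - x) <= x by lra.
  rewrite -gS mulrAC; exact: ler_wpM2r.
have e2 : x * (K%:R * gau h K.+1) <= expR (- (x * K%:R / 2)).
  apply: le_trans (mul_expRN_le (x * K%:R)); rewrite mulrA ler_wpM2l //; last exact: gau_le.
  by nneg.
have e3 : gau h K <= expR (- (x * K%:R / 2)).
  rewrite /gau -/x ler_expR lerN2; have : 0 <= x * K%:R by nneg.
  by move: (x * K%:R) => y; lra.
have : 0 <= gau h K * x by nneg.
rewrite mulrBr; lra.
Qed.

(** The square of the sum on the line is a sum over the plane, evaluated by [layer2_bounds]; then
    [|x - 1| <= |x ^ 2 - 1|] for [x >= 0]. *)
Lemma gsum_lim eps : 0 < eps -> exists2 h0, 0 < h0 & forall h J, 0 < h -> h < h0 -> 1 <= h * J%:R ->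
  `|gsum h J - 1| <= eps + 2 * expR (- (h * J%:R)).
Proof.
move=> eps0; pose eta := Num.min 1 (eps / 8).
have eta0 : 0 < eta by rewrite lt_min ltr01 divr_gt0.
have eta1 : eta <= 1 by rewrite ge_min lexx.
have eta8 : eta <= eps / 8 by rewrite ge_min lexx orbT.
have [C C0 hC] := llayer_layer 2 eta0.
have [C' C'0 hC'] := lat_asymp 2 eta0.
have p0 := pi_gt0 R.
pose D := 2 * C + 2 * C' + 2 * pi; have D0 : 0 < D by rewrite ltr_wpDl ?addr_ge0 ?mulr_ge0 // mulr_gt0.
pose h0 := Num.min 1 (eps / (2 * D)).
have h00 : 0 < h0 by rewrite lt_min ltr01 divr_gt0 // mulr_gt0.
exists h0 => // h J hp; rewrite lt_min => /andP[h1 h2] hJ.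
have h21 : h ^+ 2 <= h by rewrite expr2 ler_piMl // ltW.
have hD : D * h ^+ 2 <= eps / 2.
  apply: (@le_trans _ _ (D * h)); first by rewrite ler_wpM2l // ltW.
  by move: h2; rewrite ltr_pdivlMr ?mulr_gt0 // => h2; lra.
set y := h * J%:R in hJ *.
have W0 := gsum_ge0 J (ltW hp).
suff key : `|gsum h J ^+ 2 - 1| <= eps + 2 * expR (- y).
  apply: le_trans key; have -> : gsum h J ^+ 2 - 1 = (gsum h J - 1) * (gsum h J + 1) by ring.
  by rewrite normrM ler_peMr // ger0_norm ?addr_ge0 // lerDr.
have y0 : 0 < y by lra.
have p2 := pi_ge2 R.
have y2 : y <= y ^+ 2 by rewrite expr2 ler_peMl // ltW.
have py : 2 * y ^+ 2 <= pi * y ^+ 2 by rewrite ler_wpM2r ?sqr_ge0.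
have xJ : pi * h ^+ 2 * (J ^ 2)%:R = pi * y ^+ 2 by rewrite /y natrX; ring.
have p1 : 0 <= C * h ^+ 2 by nneg.
have p3 : 0 <= C' * h ^+ 2 by nneg.
have p4 : 0 <= pi * h ^+ 2 by nneg.
rewrite ler_norml; apply/andP; split.
  have [_ lo] := layer2_bounds (J ^ 2) hp.
  have [up _] := layer2_bounds (J ^ 2) hp.
  have l1 := llayer_le_gsum 2 (ltW hp) (leqnn (J ^ 2)).
  have := hC h (J ^ 2)%N hp; rewrite ler_norml => /andP[l2 _].
  have e1 : expR (- (pi * h ^+ 2 * (J ^ 2)%:R / 2)) <= expR (- y).
    by rewrite xJ ler_expR lerN2; clear -y2 py; lra.
  have := layer_ge0 2 (J ^ 2) (ltW hp).
  set A := layer 2 h (J ^ 2) in lo up l1 l2 *; move=> A0.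
  have : eta * A <= eta by rewrite ler_piMr // ltW.
  rewrite /D in hD; clear -eta8 hD p1 p3 p4 e1 lo l1 l2; lra.
have l1 := gsum_le_llayer (ltW hp) (leqnn (2 * J ^ 2)).
have [up _] := layer2_bounds (2 * J ^ 2) hp.
have := hC h (2 * J ^ 2)%N hp; rewrite ler_norml => /andP[_ l2].
have := hC' (2 * J ^ 2)%N; rewrite ler_norml => /andP[_ l3].
set A := layer 2 h (2 * J ^ 2) in up l2; set L := llayer _ _ _ in l1 l2.
have etaA : eta * A <= eta by rewrite ler_piMr // ltW.
have b2 : ball_vol R 2 = pi by rewrite /=; field.
have lt2 : h ^+ 2 * (lat 2 (2 * J ^ 2))%:R <= 2 * (pi * (2 * y ^+ 2)) + C' * h ^+ 2.
  move: l3; rewrite b2 sqrt_nat_sqr natrM natrX => l3.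
  have {}l3 : (lat 2 (2 * J ^ 2))%:R <= (pi + eta) * (2 * J%:R ^+ 2) + C' by clear -l3; lra.
  have := ler_wpM2l (sqr_ge0 h) l3; rewrite mulrDr => l4; apply: (le_trans l4).
  have -> : h ^+ 2 * ((pi + eta) * (2 * J%:R ^+ 2)) = (pi + eta) * (2 * y ^+ 2) by rewrite /y; ring.
  have : (pi + eta) * (2 * y ^+ 2) <= 2 * pi * (2 * y ^+ 2) by rewrite ler_wpM2r ?mulr_ge0 ?sqr_ge0 //; clear -eta1 hp p2; lra.
  by rewrite [h ^+ 2 * C']mulrC lerD2r [2 * (pi * _)]mulrA.
pose u := pi * (2 * y ^+ 2).
have g1 : gau h (2 * J ^ 2).+1 <= expR (- u).
  apply: (le_trans (gau_le _ (leqnSn _))); rewrite /gau ler_expR lerN2 natrM.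
  by rewrite mulrCA xJ /u; clear; lra.
have u0 : 0 <= u by rewrite /u; nneg.
have t1 : h ^+ 2 * (gau h (2 * J ^ 2).+1 * (lat 2 (2 * J ^ 2))%:R) <= 2 * expR (- (u / 2)) + C' * h ^+ 2.
  rewrite mulrCA; apply: (@le_trans _ _ (expR (- u) * (2 * u + C' * h ^+ 2))).
    exact: (ler_pM (ltW (gau_gt0 _ _)) (mulr_ge0 (sqr_ge0 h) (ler0n _ _)) g1 lt2).
  have eu : expR (- u) <= 1 by rewrite -[leRHS]expR0 ler_expR oppr_le0.
  rewrite mulrDr; apply: lerD; last exact: ler_piMl.
  by have := mul_expRN_le u; rewrite mulrCA [expR (- u) * u]mulrC; clear; lra.
have e1 : expR (- (u / 2)) <= expR (- y) by rewrite ler_expR lerN2 /u; clear -y0 y2 py; lra.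
rewrite /D in hD; clear -eta8 hD p1 p3 p4 up l1 l2 etaA t1 e1; lra.
Qed.

Lemma pow_sub1_le d (w : R) : 0 <= w -> w <= 3 -> `|w ^+ d - 1| <= 4 ^+ d * `|w - 1|.
Proof.
move=> w0 w3; elim: d => [|d IH]; first by rewrite subrr normr0 mul1r.
have -> : w ^+ d.+1 - 1 = w * (w ^+ d - 1) + (w - 1) by rewrite exprS; ring.
rewrite (le_trans (ler_normD _ _)) // normrM (ger0_norm w0).
have h1 : w * `|w ^+ d - 1| <= 3 * (4 ^+ d * `|w - 1|) by apply: ler_pM.
have h2 : `|w - 1| <= 4 ^+ d * `|w - 1| by rewrite ler_peMl // exprn_ege1 // ler1n.
rewrite exprS; lra.
Qed.

Lemma pow_le_expR d (y : R) : 0 <= y -> y ^+ d <= d%:R ^+ d * expR y.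
Proof.
move=> y0; case: d => [|d]; first by rewrite !expr0 mul1r -expR0 ler_expR.
have dp : 0 < d.+1%:R :> R by rewrite ltr0n.
have -> : expR y = expR (y / d.+1%:R) ^+ d.+1 by rewrite -expRM_natl mulrC divfK // gt_eqF.
rewrite -exprMn lerXn2r ?nnegrE ?mulr_ge0 ?expR_ge0 ?ler0n //.
have h := ler_wpM2l (ltW dp) (expR_ge1Dx (y / d.+1%:R)).
have e : d.+1%:R * (1 + y / d.+1%:R) = d.+1%:R + y by field; rewrite gt_eqF.
apply: le_trans h; rewrite e lerDr; exact: ltW.
Qed.

(** Back from the line to any dimension: [gsum] close to 1 makes [gsum ^+ d], and with it [layer d],
    close to 1. Hence [ball_vol] is the constant for which the Gaussian integrates to 1. The factor
    [Cd] is chosen before [eps], because [kde_estimate] takes [eps = b ^ 4] with [b] arbitrarily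
    small. *)
Lemma layer_lim d : exists2 Cd, 0 <= Cd & forall eps, 0 < eps -> exists2 h0, 0 < h0 &
  forall h J, 0 < h -> h < h0 -> 1 <= h * J%:R ->
  layer d h (d.+1 * J ^ 2).+1 <= 1 + eps + Cd * expR (- (h * J%:R)) /\
  1 - eps - Cd * expR (- (h * J%:R)) <= layer d h (d.+1 * J ^ 2).
Proof.
have p2 := pi_ge2 R; have p0 := pi_gt0 R.
have gJ h J K : 0 < h -> 1 <= h * J%:R -> (J ^ 2 <= K)%N -> gau h K <= expR (- (h * J%:R)).
  move=> h0 hJ JK; apply: (le_trans (gau_le h JK)); rewrite /gau ler_expR lerN2 natrX.
  have -> : pi * h ^+ 2 * J%:R ^+ 2 = pi * (h * J%:R) ^+ 2 by ring.
  set y := h * J%:R in hJ *; have : y <= y ^+ 2 by rewrite expr2 ler_peMl // (le_trans _ hJ).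
  have : 1 * y ^+ 2 <= pi * y ^+ 2 by rewrite ler_wpM2r ?sqr_ge0 //; lra.
  lra.
case: d => [|d].
  exists 1 => // eps eps0; exists 1 => // h J hp _ hJ.
  have e K : layer 0 h K = 1 - gau h K.+1.
    by rewrite /layer -sum_dgau0; apply: eq_bigr => T _; rewrite expr0 !mulr1.
  rewrite !e !mul1r; have := gau_gt0 h (J ^ 2).+2; have := gJ h J (J ^ 2).+1 hp hJ (leqnSn _).
  have := expR_gt0 (- (h * J%:R)); rewrite !mul1n; lra.
set w := ball_vol R d.+1; have w0 : 0 < w by exact: ball_vol_gt0.
pose C1 := (w + 1) * d.+1%:R ^+ d.+1.
have C10 : 0 <= C1 by rewrite mulr_ge0 ?exprn_ge0 // addr_ge0 // ltW.
pose q : R := 4 ^+ d.+1; have q1 : 1 <= q by rewrite exprn_ege1 // ler1n.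
exists (4 * q + C1); first by rewrite addr_ge0 // mulr_ge0 //; lra.
move=> eps eps0; pose eta := Num.min (1 / 2) (eps / 8).
have eta0 : 0 < eta by rewrite lt_min !divr_gt0.
have eta1 : eta <= 1 / 2 by rewrite ge_min lexx.
have eta8 : eta <= eps / 8 by rewrite ge_min lexx orbT.
have [C C0 hC] := llayer_layer d.+1 eta0.
have [C' C'0 hC'] := lat_asymp d.+1 eta0.
have e1 : 0 < Num.min 1 (eps / (8 * q)) by rewrite lt_min ltr01 divr_gt0 // mulr_gt0 //; lra.
have [h1 h10 hG] := gsum_lim e1; set ee := Num.min _ _ in e1 hG.
have ee1 : ee <= 1 by rewrite ge_min lexx.
have qee : q * ee <= eps / 8.
  have -> : eps / 8 = q * (eps / (8 * q)) by field; rewrite gt_eqF //; lra.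
  by rewrite ler_wpM2l ?(le_trans ler01 q1) // ge_min lexx orbT.
pose D := C + C' + 1; have D0 : 0 < D by rewrite ltr_wpDl // addr_ge0.
exists (Num.min (Num.min 1 h1) (eps / (8 * D))).
  by rewrite !lt_min ltr01 h10 divr_gt0 // mulr_gt0.
move=> h J hp; rewrite !lt_min => /andP[/andP[hl1 hh1] hD] hJ.
have hX : h ^+ d.+1 <= h by rewrite exprS ler_piMr ?(ltW hp) // exprn_ile1 ?ltW.
have DX : D * h ^+ d.+1 <= eps / 8.
  apply: (@le_trans _ _ (D * h)); first by rewrite ler_wpM2l // ltW.
  by move: hD; rewrite ltr_pdivlMr ?mulr_gt0 // => hD; clear -hD; lra.
have hX0 : 0 < h ^+ d.+1 by rewrite exprn_gt0.
set y := h * J%:R in hJ *; set E := expR (- y).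
have E0 : 0 < E by exact: expR_gt0.
have E1 : E <= 1 / 2.
  rewrite /E expRN -[leLHS]mul1r ler_pdivrMr ?expR_gt0 //; have := expR_ge1Dx y; clear -hJ; lra.
have hq := layer_ge0 d.+1.
have CX : C * h ^+ d.+1 + C' * h ^+ d.+1 <= eps / 8 by rewrite /D in DX; clear -DX hX0; lra.
have C0X : 0 <= C * h ^+ d.+1 by nneg.
have C0X' : 0 <= C' * h ^+ d.+1 by nneg.
have qE : 0 <= q * E by rewrite mulr_ge0 ?(ltW E0) //; clear -q1; lra.
have Wd K : 1 <= h * K%:R -> expR (- (h * K%:R)) <= E -> `|gsum h K ^+ d.+1 - 1| <= q * ee + 2 * (q * E).
  move=> hK KE; have W0 := gsum_ge0 K (ltW hp); have hW := hG h K hp hh1 hK.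
  have W3 : gsum h K <= 3 by move: hW; rewrite ler_norml => /andP[_]; lra.
  apply: (le_trans (pow_sub1_le d.+1 W0 W3)); rewrite -/q.
  have : q * `|gsum h K - 1| <= q * (ee + 2 * E) by rewrite ler_wpM2l ?(le_trans ler01 q1) //; clear -KE hW; lra.
  clear; lra.
split.
  (* Half the side of a box that contains the ball summed by the layer. *)
  pose K := (d.+3 * J)%N.
  have JK : ((d.+2 * J ^ 2).+1 <= K ^ 2)%N.
    have J0 : (0 < J)%N by rewrite lt0n; apply/eqP => J0; move: hJ; rewrite /y J0 mulr0 ler10.
    rewrite /K expnMn; have : (0 < J ^ 2)%N by rewrite expn_gt0 J0.
    by move=> J20; rewrite ltn_pmul2r // (leq_trans (ltnSn _)) // -mulnn leq_pmulr.
  have yK : y <= h * K%:R.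
    by rewrite ler_wpM2l ?(ltW hp) // ler_nat leq_pmull.
  have := Wd K (le_trans hJ yK); rewrite ler_expR lerN2 => /(_ yK); rewrite ler_norml => /andP[_ W1].
  have l1 := llayer_le_gsum d.+1 (ltW hp) JK.
  have := hC h (d.+2 * J ^ 2).+1 hp; rewrite ler_norml => /andP[l2 _].
  have A0 := hq h (d.+2 * J ^ 2).+1 (ltW hp); set A := layer _ _ _ in l2 A0 *.
  have : (1 - eta) * A <= 1 + eps / 4 + 2 * (q * E) by clear -qee CX C0X' W1 l1 l2; lra.
  set X := eps / 4 + 2 * (q * E) => hX1.
  have X0 : 0 <= X by rewrite /X; clear -qE eps0; lra.
  have {}hX1 : (1 - eta) * A <= 1 + X by rewrite /X; clear -hX1; lra.
  have : (1 + 2 * eta) * ((1 - eta) * A) <= (1 + 2 * eta) * (1 + X) by rewrite ler_wpM2l //; clear -eta0; lra.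
  have : A <= (1 + 2 * eta) * ((1 - eta) * A).
    rewrite mulrA; apply: ler_peMl => //.
    have : 0 <= eta * (1 / 2 - eta) by rewrite mulr_ge0 ?subr_ge0 // ltW.
    clear; lra.
  have : 2 * eta * X <= X by rewrite ler_piMl //; clear -eta1; lra.
  have : 0 <= C1 * E by rewrite mulr_ge0 // ltW.
  rewrite /X; clear -eta0 eta8; lra.
pose K := (d.+2 * J ^ 2)%N.
have JK : (d.+1 * J ^ 2 <= K)%N by rewrite leq_mul2r leqnSn orbT.
have := Wd J hJ (lexx _); rewrite ler_norml => /andP[W1 _].
have l1 := gsum_le_llayer (ltW hp) JK.
have := hC h K hp; rewrite ler_norml => /andP[_ l2].
have := hC' K; rewrite ler_norml => /andP[_ l3].
have A0 := hq h K (ltW hp); rewrite -/K; set A := layer _ _ _ in l2 A0 *.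
pose z := h * Num.sqrt K%:R; have z0 : 0 <= z by rewrite mulr_ge0 ?sqrtr_ge0 // ltW.
have yz : y <= z.
  rewrite ler_wpM2l ?(ltW hp) // -(@ler_sqr R) ?nnegrE ?sqrtr_ge0 ?ler0n // sqrt_nat_sqr -natrX ler_nat.
  by rewrite /K leq_pmull.
have lt : h ^+ d.+1 * (lat d.+1 K)%:R <= (w + 1) * z ^+ d.+1 + C' * h ^+ d.+1.
  have := ler_wpM2l (ltW hX0) (_ : (lat d.+1 K)%:R <= (w + 1) * Num.sqrt K%:R ^+ d.+1 + C').
  rewrite mulrDr mulrCA -exprMn -/z [C' * _]mulrC; apply.
  have : eta * Num.sqrt K%:R ^+ d.+1 <= 1 * Num.sqrt K%:R ^+ d.+1.
    by rewrite ler_wpM2r ?exprn_ge0 ?sqrtr_ge0 //; clear -eta1; lra.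
  rewrite -/w in l3; clear -l3; lra.
have t1 : h ^+ d.+1 * (gau h K.+1 * (lat d.+1 K)%:R) <= C1 * E + C' * h ^+ d.+1.
  (* One factor [expR (- z)] beats the polynomial growth of the lattice count, the other one remains
     as the tail. *)
  rewrite mulrCA; have g1 : gau h K.+1 <= expR (- z) * expR (- z).
    apply: (le_trans (gau_le _ (leqnSn _))); rewrite -expRD /gau ler_expR -opprD lerN2.
    have -> : pi * h ^+ 2 * K%:R = pi * z ^+ 2 by rewrite /z exprMn sqrt_nat_sqr; ring.
    have : 2 * z ^+ 2 <= pi * z ^+ 2 by rewrite ler_wpM2r ?sqr_ge0.
    have : z <= z ^+ 2 by rewrite expr2 ler_peMl // (le_trans hJ).
    clear; lra.
  have W1' : 0 <= w + 1 by rewrite addr_ge0 // ltW.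
  apply: (@le_trans _ _ (expR (- z) * expR (- z) * ((w + 1) * z ^+ d.+1 + C' * h ^+ d.+1))).
    apply: ler_pM => //; first exact: ltW (gau_gt0 _ _).
    by rewrite mulr_ge0 // ltW.
  rewrite mulrDr; apply: lerD.
    have h3 : expR (- z) * z ^+ d.+1 <= d.+1%:R ^+ d.+1.
      by rewrite expRN mulrC ler_pdivrMr ?expR_gt0 // pow_le_expR.
    have h4 : expR (- z) <= E by rewrite ler_expR lerN2.
    have -> : expR (- z) * expR (- z) * ((w + 1) * z ^+ d.+1) =
        (w + 1) * (expR (- z) * z ^+ d.+1) * expR (- z) by ring.
    apply: ler_pM => //; first by rewrite !mulr_ge0 ?expR_ge0 ?exprn_ge0.
    by rewrite ler_wpM2l.
  have ez : expR (- z) * expR (- z) <= 1 by rewrite -expRD -[leRHS]expR0 ler_expR; clear -z0; lra.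
  exact: ler_piMl.
have hl : 1 - eps / 4 - 2 * (q * E) - C1 * E <= (1 + eta) * A by clear -qee CX W1 l1 l2 t1; lra.
set X := 1 - eps / 4 - 2 * (q * E) - C1 * E in hl.
have X1 : X <= 1.
  have : 0 <= C1 * E by rewrite mulr_ge0 // ltW.
  rewrite /X; clear -CX C0X C0X' qE; lra.
have : X - eta <= A.
  rewrite -(ler_pM2l (_ : 0 < 1 + eta)); last lra.
  apply: le_trans hl; have : eta * X <= eta by rewrite ler_piMr // ltW.
  have : 0 <= eta * eta by nneg.
  clear; lra.
rewrite /X; clear -eta0 eta8 qE; lra.
Qed.

End Layers.
Section LayerFunctions.
Context {R : realType}.

Lemma dgauS (h : R) T : dgau h T.+1 = gau h 1 * dgau h T.
Proof. by rewrite /dgau mulrBr -!gauD !add1n. Qed.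

(** Step functions around the Gaussian, in the squared radius [s]: for [T < s <= T + 1] it lies
    between [gau h T.+1] and [gau h T]. By [dgauS], a shift of index is a factor [gau h 1], close to
    1 for small [h]. *)
Lemma layer_upper (h s : R) K : 0 <= s ->
  expR (- (pi * h ^+ 2 * s)) <= \sum_(T < K) dgau h T * (s <= T.+1%:R)%R%:R + gau h K.
Proof.
move=> s0; have x0 : 0 <= pi * h ^+ 2 by rewrite mulr_ge0 ?sqr_ge0 ?pi_ge0.
elim: K => [|K IH]; first by rewrite big_ord0 add0r gau0 -[leRHS]expR0 ler_expR oppr_le0 mulr_ge0.
rewrite big_ord_recr /=; have [sK|Ks] := leP s K.+1%:R.
  by rewrite mulr1 /dgau -addrA subrK.
rewrite mulr0 addr0; apply: le_trans (_ : gau h K.+1 <= _).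
  by rewrite ler_expR lerN2 ler_wpM2l // ltW.
by rewrite lerDr sumr_ge0 // => T _; rewrite mulr_ge0 ?dgau_ge0.
Qed.

Lemma layer_lower (h s : R) K : 0 <= s ->
  \sum_(T < K) dgau h T.+1 * (s <= T.+1%:R)%R%:R <= expR (- (pi * h ^+ 2 * s)).
Proof.
move=> s0; have x0 : 0 <= pi * h ^+ 2 by rewrite mulr_ge0 ?sqr_ge0 ?pi_ge0.
suff : \sum_(T < K) dgau h T.+1 * (s <= T.+1%:R)%R%:R <= Num.max 0 (expR (- (pi * h ^+ 2 * s)) - gau h K.+1).
  move/le_trans; apply; rewrite ge_max expR_ge0 /= gerBl; exact: expR_ge0.
elim: K => [|K IH]; first by rewrite big_ord0 le_max lexx.
rewrite big_ord_recr /=; have [sK|Ks] := leP s K.+1%:R.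
  have gK : gau h K.+1 <= expR (- (pi * h ^+ 2 * s)) by rewrite ler_expR lerN2 ler_wpM2l.
  rewrite mulr1; apply: (le_trans (lerD IH (lexx _))); rewrite le_max.
  have -> : Num.max 0 (expR (- (pi * h ^+ 2 * s)) - gau h K.+1) = expR (- (pi * h ^+ 2 * s)) - gau h K.+1.
    by apply/max_idPr; rewrite subr_ge0.
  by rewrite /dgau addrA subrK lexx orbT.
rewrite mulr0 addr0 big1 ?le_max ?lexx // => T _.
rewrite leNgt (_ : T.+1%:R < s) ?mulr0 // (le_lt_trans _ Ks) // ler_nat ltnS ltnW //.
Qed.

Lemma gauss_lip (u v : R) : 0 <= u -> 0 <= v ->
  `|expR (- pi * u ^+ 2) - expR (- pi * v ^+ 2)| <= 2 * pi * `|u - v|.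
Proof.
have p0 := pi_gt0 R; have p2 := pi_ge2 R.
wlog uv : u v / u <= v.
  move=> H u0 v0; case: (leP u v) => uv; first exact: H.
  by rewrite distrC (distrC u) H // ltW.
move=> u0 v0; have uv2 : u ^+ 2 <= v ^+ 2 by rewrite lerXn2r.
rewrite ger0_norm ?subr_ge0 ?ler_expR; last by rewrite !mulNr lerN2 ler_wpM2l // ltW.
rewrite ler0_norm ?subr_le0 // opprB.
have e1 : expR (- pi * u ^+ 2) <= 1.
  by rewrite -[leRHS]expR0 ler_expR mulNr oppr_le0 mulr_ge0 ?sqr_ge0 // ltW.
have e0 := expR_gt0 (- pi * v ^+ 2).
have [big|small] := leP 1 (v - u).
  have : 2 * pi * 1 <= 2 * pi * (v - u) by rewrite ler_wpM2l // mulr_ge0 // ltW.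
  lra.
have -> : expR (- pi * v ^+ 2) = expR (- pi * u ^+ 2) * expR (- (pi * (v ^+ 2 - u ^+ 2))).
  by rewrite -expRD; congr expR; ring.
have h1 := expR_ge1Dx (- (pi * (v ^+ 2 - u ^+ 2))).
have h2 : expR (- pi * u ^+ 2) * (1 + pi * u ^+ 2) <= 1.
  have := expR_ge1Dx (pi * u ^+ 2); rewrite -(ler_pM2l (expR_gt0 (- pi * u ^+ 2))) -expRD.
  by rewrite mulNr addNr expR0.
set E := expR (- pi * u ^+ 2) in e1 h2 *; set F := expR _ in h1 *.
have E0 : 0 < E by exact: expR_gt0.
have -> : E - E * F = E * (1 - F) by ring.
apply: (@le_trans _ _ (E * (pi * (v ^+ 2 - u ^+ 2)))); first by rewrite ler_wpM2l ?(ltW E0) //; lra.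
have -> : E * (pi * (v ^+ 2 - u ^+ 2)) = pi * (v - u) * (E * (v + u)) by ring.
have -> : 2 * pi * (v - u) = pi * (v - u) * 2 by ring.
apply: ler_wpM2l; first by rewrite mulr_ge0 ?subr_ge0 // ltW.
have h3 : v + u <= 2 * (1 + pi * u ^+ 2).
  have : 2 * u ^+ 2 <= pi * u ^+ 2 by rewrite ler_wpM2r ?sqr_ge0.
  have := sqr_ge0 (u - 1 / 2); rewrite sqrrB; lra.
have := ler_wpM2l (ltW E0) h3; lra.
Qed.

End LayerFunctions.

(** * Density estimate against the Gaussian of the distance *)

Section KdeBounds.
Context {R : realType} {d m : nat}.
Implicit Types (M : set 'rV[R]_(d + m)) (x y z : 'rV[R]_(d + m)).

(** Pythagoras up to curvature: [x - z] is normal to [M] at [z], so [normal_quadratic] bounds the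
    cross term. *)
Lemma nearest_quadratic (tau : R) M x z y : good_mfd tau M -> nearest M x z -> M y ->
  `|enorm (x - y) ^+ 2 - enorm (x - z) ^+ 2 - enorm (y - z) ^+ 2| <=
  enorm (x - z) / tau * enorm (y - z) ^+ 2.
Proof.
move=> gM nz My; have t0 : 0 < tau by case: gM.
have -> : x - y = (x - z) - (y - z) by vec.
rewrite (enormB_sqr (x - z)).
have -> : forall A B C : R, A - 2 * B + C - A - C = - (2 * B) by move=> *; ring.
have := normal_quadratic gM nz.1 My (fun v => @nearest_normal R d m tau M gM x z v nz).
rewrite normrN normrM (ger0_norm (ler0n _ 2)) [enorm (x - z) / tau * _]mulrAC ler_pdivlMr //.
by rewrite mulrAC.
Qed.

Lemma ball_rescale (sigma : R) M0 z r : 0 < sigma ->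
  rescale_set sigma ([set X : 'rV[R]_(d + m) | enorm (X - scale sigma *: z) <= scale sigma * r] `&` M0) =
  [set q | enorm (q - z) <= r] `&` rescale_set sigma M0.
Proof.
move=> s0; have c0 := scale_gt0 s0; apply/seteqP; split=> q.
  move=> /(rescale_setP _ _ s0)[/= h Mq]; split; last exact/rescale_setP.
  by move: h; rewrite -scalerBr enormZ gtr0_norm // ler_pM2l.
move=> [/= h /(rescale_setP _ _ s0) Mq]; apply/rescale_setP => //; split => //=.
by rewrite -scalerBr enormZ gtr0_norm // ler_pM2l.
Qed.

Section Fixed.
Variables (sigma tau : R) (M0 : set 'rV[R]_(d + m)).
Hypotheses (s0 : 0 < sigma) (gM0 : good_mfd tau M0) (Vfin : (hvol d M0 < +oo)%E).

Let s := scale sigma.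
Let M := rescale_set sigma M0.
Let tau' := tau / s.
Let V := fine (hvol d M).

Let c0 : 0 < s. Proof. exact: scale_gt0. Qed.
Let gM : good_mfd tau' M. Proof. exact: good_rescale. Qed.
Let t0 : 0 < tau'. Proof. by case: gM. Qed.

Lemma hvol_rescale_fin : (hvol d M < +oo)%E.
Proof. by rewrite hvol_rescale // lte_mul_pinfty // lee_fin exprn_ge0 // invr_ge0 ltW. Qed.

Lemma prob_ball z r : M0 !=set0 ->
  prob d M0 [set X | enorm (X - s *: z) <= s * r] * V = fine (hvol d ([set q | enorm (q - z) <= r] `&` M)).
Proof.
move=> M00; have h0 : (0 < hvol d M0)%E by exact: (hvol_good_gt0 gM0).
have f0 : 0 < fine (hvol d M0) by rewrite fine_gt0 // h0.
rewrite /prob /V /M -ball_rescale // !hvol_rescale //.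
have finA : hvol d ([set X | enorm (X - s *: z) <= s * r] `&` M0) \is a fin_num.
  by rewrite ge0_fin_numE ?hvol_ge0 // (le_lt_trans (hvol_mono (@subIsetr _ _ _))).
have finM : hvol d M0 \is a fin_num by rewrite ge0_fin_numE ?hvol_ge0.
by rewrite !fineM //= -/s; field; rewrite !gt_eqF.
Qed.

Lemma prob_ball_upper z r : M z -> 0 < r -> 16 * r <= tau' ->
  prob d M0 [set X | enorm (X - s *: z) <= s * r] * V <= (1 + 8 * r / tau') ^+ d * (ball_vol R d * r ^+ d).
Proof.
move=> Mz r0 rt; rewrite prob_ball; last by exists (s *: z); exact/rescale_setP.
have := hvol_ball_upper gM Mz r0 rt => h; rewrite -lee_fin fineK //.
by rewrite ge0_fin_numE ?hvol_ge0 // (le_lt_trans h) // ltry.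
Qed.

Lemma prob_ball_lower z r : M z -> 0 < r -> 128 * r <= tau' ->
  ball_vol R d * (r / (1 + 32 * r / tau')) ^+ d <= prob d M0 [set X | enorm (X - s *: z) <= s * r] * V.
Proof.
move=> Mz r0 rt; rewrite prob_ball; last by exists (s *: z); exact/rescale_setP.
have := hvol_ball_lower gM Mz r0 rt => h; rewrite -lee_fin fineK //.
by rewrite ge0_fin_numE ?hvol_ge0 // (le_lt_trans (hvol_mono (@subIsetr _ _ _))) // hvol_rescale_fin.
Qed.

Section Kde.
Variables (kappa : R) (N : nat) (Y : 'I_N -> 'rV[R]_(d + m)).
(** The conclusion of [empirical_event] on the good event, with the Lipschitz constant of the
    rescaled Gaussian. *)
Hypothesis cmp : forall (f : 'rV[R]_(d + m) -> R) (K : finType) (b : K -> R) (A : K -> set 'rV[R]_(d + m)),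
  (forall x, 0 <= f x <= 1) -> (forall x y, `|f x - f y| <= 2 * pi / s * enorm (x - y)) ->
  (forall k, 0 <= b k) -> (forall k, borel (A k)) ->
  ((forall y, M0 y -> f y <= \sum_k b k * ind (A k) y) ->
    avg f Y <= \sum_k b k * prob d M0 (A k) + kappa) /\
  ((forall y, M0 y -> \sum_k b k * ind (A k) y <= f y) ->
    \sum_k b k * prob d M0 (A k) - kappa <= avg f Y).

Variables (x z : 'rV[R]_(d + m)) (k h : R) (K : nat).
Hypotheses (nz : nearest M x z) (h0 : 0 < h) (k0 : 0 <= k) (k1 : k < 1) (xk : enorm (x - z) <= k * tau').

Let p0 : 0 < (pi : R). Proof. exact: pi_gt0. Qed.
Let f (X : 'rV[R]_(d + m)) := expR (- pi * enorm (x - s^-1 *: X) ^+ 2).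
Let E := expR (- pi * enorm (x - z) ^+ 2).

Let f01 X : 0 <= f X <= 1.
Proof.
rewrite expR_ge0 /= -[leRHS]expR0 ler_expR mulNr oppr_le0 mulr_ge0 ?sqr_ge0 //; exact: ltW.
Qed.

Let fL X X' : `|f X - f X'| <= 2 * pi / s * enorm (X - X').
Proof.
apply: (le_trans (gauss_lip (enorm_ge0 _) (enorm_ge0 _))).
rewrite -[leRHS]mulrA ler_wpM2l ?mulr_ge0 ?(ltW p0) //.
apply: (le_trans (enorm_dist_le _ _)).
have -> : x - s^-1 *: X - (x - s^-1 *: X') = - (s^-1 *: (X - X')) by vec.
by rewrite enormN enormZ gtr0_norm // invr_gt0.
Qed.

Let fup X : M0 X -> f X <= E * expR (- (pi * ((1 - k) * enorm (s^-1 *: X - z) ^+ 2))).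
Proof.
move=> MX; have My : M (s^-1 *: X) by exists X.
rewrite /f /E -expRD ler_expR; have := nearest_quadratic gM nz My; rewrite ler_norml => /andP[h1 _].
have kt : enorm (x - z) / tau' <= k by rewrite ler_pdivrMr.
have := ler_wpM2r (sqr_ge0 (enorm (s^-1 *: X - z))) kt => h2.
have h3 : enorm (x - z) ^+ 2 + (1 - k) * enorm (s^-1 *: X - z) ^+ 2 <= enorm (x - s^-1 *: X) ^+ 2 by lra.
have := ler_wpM2l (ltW p0) h3; lra.
Qed.

Let fdown X : M0 X -> E * expR (- (pi * ((1 + k) * enorm (s^-1 *: X - z) ^+ 2))) <= f X.
Proof.
move=> MX; have My : M (s^-1 *: X) by exists X.
rewrite /f /E -expRD ler_expR; have := nearest_quadratic gM nz My; rewrite ler_norml => /andP[_ h1].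
have kt : enorm (x - z) / tau' <= k by rewrite ler_pdivrMr.
have := ler_wpM2r (sqr_ge0 (enorm (s^-1 *: X - z))) kt => h2.
have h3 : enorm (x - s^-1 *: X) ^+ 2 <= enorm (x - z) ^+ 2 + (1 + k) * enorm (s^-1 *: X - z) ^+ 2 by lra.
have := ler_wpM2l (ltW p0) h3; lra.
Qed.

Let ballI a T X : 0 < a -> (0 < T)%N ->
  ind [set X | enorm (X - s *: z) <= s * (h / Num.sqrt a * Num.sqrt T%:R)] X =
  (a * enorm (s^-1 *: X - z) ^+ 2 / h ^+ 2 <= T%:R)%R%:R :> R.
Proof.
move=> a0 T0; rewrite /ind /=; congr (_ %:R); congr nat_of_bool.
have sa : 0 < Num.sqrt a by rewrite sqrtr_gt0.
have -> : X - s *: z = s *: (s^-1 *: X - z) by rewrite scalerBr scalerA divff ?gt_eqF // scale1r.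
rewrite asboolb enormZ gtr0_norm // ler_pM2l // -[in LHS]ler_sqr ?nnegrE ?enorm_ge0 ?mulr_ge0 ?divr_ge0 ?sqrtr_ge0 ?(ltW h0) //.
rewrite exprMn expr_div_n (sqr_sqrtr (ltW a0)) (sqr_sqrtr (ler0n R T)).
have -> : h ^+ 2 / a * T%:R = T%:R * h ^+ 2 / a by ring.
by rewrite ler_pdivlMr // ler_pdivrMr ?exprn_gt0 // mulrC.
Qed.

Let bball r : borel [set X : 'rV[R]_(d + m) | enorm (X - s *: z) <= s * r].
Proof. by apply: borel_closed; exact: closed_eball. Qed.

Let kdeE : kde (fun i => s^-1 *: Y i) x = avg f Y. Proof. by []. Qed.

(** On [M] the kernel is at most [E] times a Gaussian of the distance to [z], flattened by
    [a = 1 - k] on account of curvature. [layer_upper] decomposes it into balls of radius at most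
    [rho], whose volumes are known. The factor [(Num.sqrt a)^-1 ^+ d] comes from the radii,
    [(gau h 1)^-1] from the shift of index. *)
Lemma kde_upper : let a := 1 - k in let rho := h / Num.sqrt a * Num.sqrt K.+1%:R in 16 * rho <= tau' ->
  V * kde (fun i => s^-1 *: Y i) x <=
  E * ((1 + 8 * rho / tau') ^+ d * (Num.sqrt a)^-1 ^+ d * ((gau h 1)^-1 * layer d h K.+1)) +
  V * (gau h K.+1 + kappa).
Proof.
move=> a rho rt; have a0 : 0 < a by rewrite subr_gt0.
have sa : 0 < Num.sqrt a by rewrite sqrtr_gt0.
have V0 : 0 <= V by rewrite fine_ge0 // hvol_ge0.
have E0 : 0 <= E by exact: expR_ge0.
have E1 : E <= 1.
  by rewrite -[leRHS]expR0 ler_expR mulNr oppr_le0 mulr_ge0 ?sqr_ge0 // ltW.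
pose r T := h / Num.sqrt a * Num.sqrt T%:R.
pose A (T : option 'I_K.+1) := if T is Some T then [set X : 'rV[R]_(d + m) | enorm (X - s *: z) <= s * r T.+1] else setT.
pose b (T : option 'I_K.+1) := if T is Some T then E * dgau h T else E * gau h K.+1.
have [||] := @cmp f (option 'I_K.+1) b A f01 fL.
- by case=> [T|]; rewrite mulr_ge0 ?dgau_ge0 // ltW // gau_gt0.
- by case=> [T|] /=; [exact: bball|exact: borelT].
move=> up _; have {}up : avg f Y <= \sum_T b T * prob d M0 (A T) + kappa.
  apply: up => X MX; rewrite sum_option /= /ind asboolT // mulr1.
  under eq_bigr do rewrite -mulrA.
  rewrite -mulr_sumr addrC -mulrDr; apply: (le_trans (fup MX)); rewrite ler_wpM2l //.
  pose q := a * enorm (s^-1 *: X - z) ^+ 2 / h ^+ 2.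
  have q0 : 0 <= q by rewrite /q divr_ge0 ?exprn_ge0 ?(ltW h0) // mulr_ge0 ?sqr_ge0 // ltW.
  have := layer_upper h K.+1 q0.
  have -> : pi * h ^+ 2 * q = pi * (a * enorm (s^-1 *: X - z) ^+ 2) by rewrite /q; field; rewrite gt_eqF.
  move=> h1; apply: (le_trans h1); rewrite lerD2r.
  by apply: ler_sum => T _; rewrite ler_wpM2l ?dgau_ge0 // -ballI.
rewrite kdeE; have := ler_wpM2l V0 up => h1; apply: (le_trans h1).
rewrite sum_option /= mulrDr mulrDr mulrDr.
have M00 : M0 !=set0 by exists (s *: z); apply/rescale_setP => //; exact: nz.1.
have pT : prob d M0 setT = 1.
  rewrite /prob setTI divff // gt_eqF // fine_gt0 // Vfin andbT; exact: (hvol_good_gt0 gM0).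
rewrite pT mulr1 [leRHS]addrA lerD2r [leLHS]addrC; apply: lerD; last first.
  by rewrite ler_wpM2l // ler_piMl // ltW // gau_gt0.
rewrite mulr_sumr.
have h2 (T : 'I_K.+1) : V * (E * dgau h T * prob d M0 [set X | enorm (X - s *: z) <= s * r T.+1]) <=
    E * ((1 + 8 * rho / tau') ^+ d * (Num.sqrt a)^-1 ^+ d * ((gau h 1)^-1 *
      (dgau h T.+1 * (ball_vol R d * (h * Num.sqrt T.+1%:R) ^+ d)))).
  have r0 : 0 < r T.+1 by rewrite mulr_gt0 ?divr_gt0 // sqrtr_gt0 ltr0n.
  have rr : r T.+1 <= rho.
    by rewrite ler_wpM2l ?divr_ge0 ?(ltW h0) ?(ltW sa) // ler_wsqrtr // ler_nat ltn_ord.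
  have rt' : 16 * r T.+1 <= tau' by lra.
  have := prob_ball_upper nz.1 r0 rt'; set pr := prob _ _ _ => h2.
  have dE : dgau h T = (gau h 1)^-1 * dgau h T.+1.
    by rewrite dgauS mulKf // gt_eqF // gau_gt0.
  have -> : V * (E * dgau h T * pr) = E * (dgau h T * (pr * V)) by ring.
  rewrite ler_wpM2l // dE.
  have g0 : 0 <= (gau h 1)^-1 by rewrite invr_ge0 ltW // gau_gt0.
  have D0 := dgau_ge0 h T.+1.
  apply: (@le_trans _ _ ((gau h 1)^-1 * dgau h T.+1 * ((1 + 8 * rho / tau') ^+ d * (ball_vol R d * r T.+1 ^+ d)))).
    rewrite ler_wpM2l ?mulr_ge0 //; apply: (le_trans h2).
    have ti0 : 0 <= tau'^-1 by rewrite invr_ge0 ltW.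
    have rho0 : 0 <= rho by rewrite (le_trans (ltW r0)).
    have h30 : 0 <= 1 + 8 * r T.+1 / tau' := addr_ge0 ler01 (mulr_ge0 (mulr_ge0 (ler0n _ 8) (ltW r0)) ti0).
    have h31 : 0 <= 1 + 8 * rho / tau' := addr_ge0 ler01 (mulr_ge0 (mulr_ge0 (ler0n _ 8) rho0) ti0).
    have h3 : 1 + 8 * r T.+1 / tau' <= 1 + 8 * rho / tau' by rewrite lerD2l ler_wpM2r // ler_wpM2l.
    have hX : (1 + 8 * r T.+1 / tau') ^+ d <= (1 + 8 * rho / tau') ^+ d by rewrite lerXn2r ?nnegrE.
    by apply: ler_wpM2r => //; rewrite mulr_ge0 ?ball_vol_ge0 ?exprn_ge0 ?(ltW r0).
  rewrite /r !exprMn le_eqVlt; apply/orP; left; apply/eqP; ring.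
apply: (le_trans (ler_sum _ (fun T _ => h2 T))).
rewrite -mulr_sumr -mulr_sumr -mulr_sumr.
have a1 : 0 <= (1 + 8 * rho / tau') ^+ d * (Num.sqrt a)^-1 ^+ d.
  have rho0 : 0 <= rho by rewrite mulr_ge0 ?divr_ge0 ?sqrtr_ge0 // ltW.
  have ti0 : 0 <= tau'^-1 by rewrite invr_ge0 ltW.
  have h31 : 0 <= 1 + 8 * rho / tau' := addr_ge0 ler01 (mulr_ge0 (mulr_ge0 (ler0n _ 8) rho0) ti0).
  by rewrite mulr_ge0 ?exprn_ge0 // invr_ge0 ltW.
rewrite ler_wpM2l // ler_wpM2l // ler_wpM2l ?invr_ge0 ?(ltW (gau_gt0 _ _)) //.
rewrite /layer [leRHS]big_ord_recl /= lerDr mulr_ge0 ?dgau_ge0 // mulr_ge0 ?ball_vol_ge0 //.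
by rewrite exprn_ge0 // mulr_ge0 // ltW.
Qed.

(** The mirror image of [kde_upper]. The subtracted [pi * h ^ 2 * ball_vol R d] bounds the term
    [T = 0] of [layer], to which no ball corresponds after the shift of index; that term is nonzero
    only for [d = 0]. *)
Lemma kde_lower : let a := 1 + k in let rho := h / Num.sqrt a * Num.sqrt K%:R in 128 * rho <= tau' ->
  E * ((1 + 32 * rho / tau')^-1 ^+ d * (Num.sqrt a)^-1 ^+ d * (layer d h K - pi * h ^+ 2 * ball_vol R d)) -
  V * kappa <= V * kde (fun i => s^-1 *: Y i) x.
Proof.
move=> a rho rt; have a0 : 0 < a by rewrite ltr_wpDr.
have sa : 0 < Num.sqrt a by rewrite sqrtr_gt0.
have V0 : 0 <= V by rewrite fine_ge0 // hvol_ge0.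
have E0 : 0 <= E by exact: expR_ge0.
pose r T := h / Num.sqrt a * Num.sqrt T%:R.
pose A (T : 'I_K) := [set X : 'rV[R]_(d + m) | enorm (X - s *: z) <= s * r T.+1].
pose b (T : 'I_K) := E * dgau h T.+1.
have [||] := @cmp f 'I_K b A f01 fL.
- by move=> T; rewrite mulr_ge0 ?dgau_ge0.
- by move=> T; exact: bball.
move=> _ lo; have {}lo : \sum_T b T * prob d M0 (A T) - kappa <= avg f Y.
  apply: lo => X MX; under eq_bigr do rewrite -mulrA.
  rewrite -mulr_sumr; apply: le_trans (fdown MX); rewrite ler_wpM2l //.
  pose q := a * enorm (s^-1 *: X - z) ^+ 2 / h ^+ 2.
  have q0 : 0 <= q by rewrite /q divr_ge0 ?exprn_ge0 ?(ltW h0) // mulr_ge0 ?sqr_ge0 // ltW.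
  have := layer_lower h K q0.
  have -> : pi * h ^+ 2 * q = pi * (a * enorm (s^-1 *: X - z) ^+ 2) by rewrite /q; field; rewrite gt_eqF.
  apply: le_trans; apply: ler_sum => T _; rewrite ler_wpM2l ?dgau_ge0 // -ballI //.
rewrite kdeE; apply: le_trans (ler_wpM2l V0 lo); rewrite (mulrBr V) lerD2r mulr_sumr.
pose P := (1 + 32 * rho / tau')^-1 ^+ d * (Num.sqrt a)^-1 ^+ d.
have rho0 : 0 <= rho by rewrite mulr_ge0 ?divr_ge0 ?sqrtr_ge0 // ltW.
have ti0 : 0 <= tau'^-1 by rewrite invr_ge0 ltW.
have rt0 : 0 < 1 + 32 * rho / tau' by apply: ltr_wpDr => //; nneg.
have P0 : 0 <= P by rewrite mulr_ge0 ?exprn_ge0 ?invr_ge0 ?(ltW sa) // ltW.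
apply: (@le_trans _ _ (\sum_(T < K) E * (P * (dgau h T.+1 * (ball_vol R d * (h * Num.sqrt T.+1%:R) ^+ d))))).
  rewrite -mulr_sumr -mulr_sumr ler_wpM2l // ler_wpM2l // lerBlDr /layer big_ord_recl /= addrC lerD2l.
  have d0 : dgau h 0 <= pi * h ^+ 2.
    rewrite /dgau gau0 /gau mulr1; have := expR_ge1Dx (- (pi * h ^+ 2)); lra.
  have hb : 0 <= ball_vol R d * (h * Num.sqrt 0%:R) ^+ d.
    by rewrite mulr_ge0 ?ball_vol_ge0 // exprn_ge0 // mulr_ge0 ?sqrtr_ge0 // ltW.
  have e0 : ball_vol R d * (h * Num.sqrt 0%:R) ^+ d <= ball_vol R d.
    rewrite sqrtr0 mulr0 ler_piMr ?ball_vol_ge0 //.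
    by case: (d) => [|d']; rewrite ?expr0 // expr0n.
  exact: (ler_pM (dgau_ge0 h 0) hb d0 e0).
apply: ler_sum => T _.
have r0 : 0 < r T.+1 by rewrite mulr_gt0 ?divr_gt0 // sqrtr_gt0 ltr0n.
have rr : r T.+1 <= rho.
  by rewrite ler_wpM2l ?divr_ge0 ?(ltW h0) ?(ltW sa) // ler_wsqrtr // ler_nat ltn_ord.
have rt' : 128 * r T.+1 <= tau' by lra.
have := prob_ball_lower nz.1 r0 rt'; set pr := prob _ _ _ => h2.
have -> : V * (b T * pr) = E * (dgau h T.+1 * (pr * V)) by rewrite /b; ring.
rewrite ler_wpM2l //.
have D0 := dgau_ge0 h T.+1.
apply: (@le_trans _ _ (dgau h T.+1 * (ball_vol R d * (r T.+1 / (1 + 32 * rho / tau')) ^+ d))).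
  by rewrite /P /r !exprMn le_eqVlt; apply/orP; left; apply/eqP; ring.
rewrite ler_wpM2l //; apply: le_trans h2; rewrite ler_wpM2l ?ball_vol_ge0 //.
have pq : 0 <= 32 * r T.+1 / tau' := mulr_ge0 (mulr_ge0 (ler0n _ 32) (ltW r0)) ti0.
have q0 : 0 < 1 + 32 * r T.+1 / tau' by apply: ltr_wpDr.
rewrite lerXn2r ?nnegrE ?divr_ge0 ?(ltW r0) ?(ltW rt0) ?(ltW q0) //.
rewrite ler_wpM2l ?(ltW r0) // lef_pV2 ?posrE // lerD2l ler_wpM2r ?invr_ge0 ?(ltW t0) // ler_wpM2l //.
Qed.

End Kde.
End Fixed.
End KdeBounds.

(** * Choice of the scales in terms of the bandwidth *)

Section Bandwidth.
Context {R : realType}.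
Implicit Types (u b : R).

Lemma pow1D_le u d : 0 <= u -> u <= 1 -> (1 + u) ^+ d <= 1 + 3 ^+ d * u.
Proof.
move=> u0 u1; elim: d => [|d IH]; first by rewrite !expr0 mul1r lerDl.
rewrite exprS; have q1 : 1 <= 3 ^+ d :> R by rewrite exprn_ege1 // ler1n.
have := ler_wpM2l (addr_ge0 ler01 u0) IH => h; apply: (le_trans h).
have : 3 ^+ d * u * u <= 3 ^+ d * u by rewrite ler_piMr // mulr_ge0 // (le_trans ler01).
have : u <= 3 ^+ d * u by rewrite ler_peMl.
rewrite exprS; lra.
Qed.

Lemma pow1B_ge u d : 0 <= u -> u <= 1 -> 1 - 3 ^+ d * u <= (1 - u) ^+ d.
Proof.
move=> u0 u1; elim: d => [|d IH]; first by rewrite !expr0 mul1r gerBl.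
have u10 : 0 <= 1 - u by rewrite subr_ge0.
rewrite [(1 - u) ^+ d.+1]exprS; have q1 : 1 <= 3 ^+ d :> R by rewrite exprn_ege1 // ler1n.
apply: le_trans (ler_wpM2l u10 IH).
have : 0 <= 3 ^+ d * u * u by rewrite !mulr_ge0 // (le_trans ler01).
have : u <= 3 ^+ d * u by rewrite ler_peMl.
rewrite exprS; lra.
Qed.

Lemma expRN_inv_le b p : 0 < b -> expR (- b^-1) <= p%:R ^+ p * b ^+ p.
Proof.
move=> b0; have := pow_le_expR p (ltW (_ : 0 < b^-1)); rewrite invr_gt0 => /(_ b0) h.
rewrite expRN -[leLHS]mul1r ler_pdivrMr ?expR_gt0 // mulrAC -ler_pdivrMr ?exprn_gt0 // mul1r -exprVn //.
Qed.

(** Four factors of at most [1 + th] make at most [1 + 15 * th], and the additive error is one more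
    [th]; hence [th = b ^ 3 / 16] in [kde_estimate]. *)
Lemma combine_upper (th E V k Nf P1 P2 P3 P4 P5 : R) : 0 <= th -> th <= 1 -> 0 <= E -> E <= 1 ->
  0 <= P1 -> 0 <= P2 -> 0 <= P3 -> 0 <= P4 ->
  P1 <= 1 + th -> P2 <= 1 + th -> P3 <= 1 + th -> P4 <= 1 + th -> P5 <= th ->
  0 < V -> 0 < Nf -> 1 <= Nf * V -> V * k <= E * (P1 * P2 * (P3 * P4)) + P5 -> k / Nf <= E + 16 * th.
Proof.
move=> t0 t1 E0 E1 p1 p2 p3 p4 h1 h2 h3 h4 h5 V0 N0 NV hk.
have T0 : 0 <= 1 + th by rewrite addr_ge0.
have q1 : P1 * P2 <= (1 + th) * (1 + th) by exact: ler_pM.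
have q2 : P3 * P4 <= (1 + th) * (1 + th) by exact: ler_pM.
have q3 : P1 * P2 * (P3 * P4) <= (1 + th) * (1 + th) * ((1 + th) * (1 + th)) by apply: ler_pM => //; exact: mulr_ge0.
have q0 : th * th <= th by rewrite ler_piMl.
have q4 : (1 + th) * (1 + th) <= 1 + 3 * th by lra.
have q5 : (1 + th) * (1 + th) * ((1 + th) * (1 + th)) <= (1 + 3 * th) * (1 + 3 * th).
  by apply: ler_pM => //; exact: mulr_ge0.
have q6 : (1 + 3 * th) * (1 + 3 * th) <= 1 + 15 * th by lra.
have q7 : E * (P1 * P2 * (P3 * P4)) <= E * (1 + 15 * th).
  by rewrite ler_wpM2l // (le_trans q3) // (le_trans q5).
have q8 : E * th <= th by rewrite ler_piMl.
have q9 : V * k <= E + 16 * th by lra.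
rewrite ler_pdivrMr // -(ler_pM2l V0) (le_trans q9) //.
have -> : V * ((E + 16 * th) * Nf) = (Nf * V) * (E + 16 * th) by ring.
by rewrite ler_peMl // addr_ge0 // mulr_ge0.
Qed.

Lemma combine_lower (th E V k Nf P1 P2 P4 P5 : R) : 0 <= th -> th <= 1 -> 0 <= E -> E <= 1 ->
  1 - th <= P1 -> 1 - th <= P2 -> 1 - th <= P4 -> P5 <= th ->
  0 < V -> 0 < Nf -> Nf * V <= 1 + th -> E * (P1 * P2 * P4) - P5 <= V * k -> 0 <= k -> E - 16 * th <= k / Nf.
Proof.
move=> t0 t1 E0 E1 h1 h2 h4 h5 V0 N0 NV hk k0.
have T0 : 0 <= 1 - th by rewrite subr_ge0.
have q1 : (1 - th) * (1 - th) <= P1 * P2 by exact: ler_pM.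
have q2 : (1 - th) * (1 - th) * (1 - th) <= P1 * P2 * P4 by apply: ler_pM => //; exact: mulr_ge0.
have q3 : 1 - 3 * th <= (1 - th) * (1 - th) * (1 - th).
  have : 0 <= th * th * (3 - th) by rewrite !mulr_ge0 //; lra.
  lra.
have q4 : E * (1 - 3 * th) <= E * (P1 * P2 * P4) by rewrite ler_wpM2l // (le_trans q3).
have q5 : E * th <= th by rewrite ler_piMl.
have q6 : E - 4 * th <= V * k by lra.
rewrite ler_pdivlMr //.
have [neg|pos] := leP (E - 16 * th) 0; first by rewrite (le_trans _ k0) // mulr_le0_ge0 // ltW.
rewrite -(ler_pM2l V0); apply: le_trans q6.
have -> : V * ((E - 16 * th) * Nf) = (Nf * V) * (E - 16 * th) by ring.
apply: (@le_trans _ _ ((1 + th) * (E - 16 * th))); first by rewrite ler_wpM2r // ltW.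
have : 0 <= th * th by rewrite mulr_ge0.
lra.
Qed.

Lemma inv_sqrt_upper u : 0 <= u -> u <= 1 / 2 -> (Num.sqrt (1 - u))^-1 <= 1 + u.
Proof.
move=> u0 u2; have a0 : 0 < 1 - u by lra.
have s0 : 0 < Num.sqrt (1 - u) by rewrite sqrtr_gt0.
rewrite -[leLHS]mul1r ler_pdivrMr // -(@ler_sqr R) ?nnegrE ?mulr_ge0 ?(ltW s0) ?addr_ge0 //.
rewrite expr1n exprMn (sqr_sqrtr (ltW a0)).
have uu : u * u <= u * (1 / 2) by rewrite ler_wpM2l.
have : 0 <= u * (1 - u - u * u) by rewrite mulr_ge0 //; lra.
lra.
Qed.

Lemma inv_sqrt_lower u : 0 <= u -> u <= 1 / 2 -> 1 - u <= (Num.sqrt (1 + u))^-1.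
Proof.
move=> u0 u2; have a0 : 0 < 1 + u by lra.
have s0 : 0 < Num.sqrt (1 + u) by rewrite sqrtr_gt0.
have u1 : 0 <= 1 - u by lra.
rewrite -[leRHS]mul1r ler_pdivlMr // -(@ler_sqr R) ?nnegrE ?mulr_ge0 ?(ltW s0) //.
rewrite expr1n exprMn (sqr_sqrtr (ltW a0)).
have uu : u * u <= u * (1 / 2) by rewrite ler_wpM2l.
have : 0 <= u * (1 + u - u * u) by rewrite mulr_ge0 //; lra.
lra.
Qed.

Lemma expR_le1D2 u : 0 <= u -> u <= 1 / 2 -> expR u <= 1 + 2 * u.
Proof.
move=> u0 u2; have e1 := expR_ge1Dx (- u).
have eu : expR u * expR (- u) = 1 by rewrite -expRD subrr expR0.
have g1 : expR u * (1 - u) <= 1.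
  by apply: (@le_trans _ _ (expR u * expR (- u))); [rewrite ler_wpM2l ?expR_ge0|rewrite eu].
have g2 : 1 <= (1 + 2 * u) * (1 - u).
  have : 0 <= u * (1 - 2 * u) by rewrite mulr_ge0 //; lra.
  lra.
rewrite -(@ler_pM2r _ (1 - u)); last lra.
exact: le_trans g1 g2.
Qed.

End Bandwidth.

(* The bandwidth is written sigma = b ^ 6, so that sigma ^ (5/6) = b ^ 5. *)
Definition root6 (R : realType) (sigma : R) : R := sigma `^ (1 / 6).

Lemma root6_gt0 (R : realType) (sigma : R) : 0 < sigma -> 0 < root6 sigma.
Proof. exact: powR_gt0. Qed.

Lemma root6X (R : realType) (sigma : R) : 0 < sigma -> root6 sigma ^+ 6 = sigma.
Proof.
move=> s0; rewrite /root6 -powR_mulrn ?powR_ge0 // -powRrM.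
by rewrite (_ : 1 / 6 * 6%:R = 1) ?powRr1 ?ltW //; field.
Qed.

Lemma root6_56 (R : realType) (sigma : R) : 0 < sigma -> sigma `^ (5 / 6) = root6 sigma ^+ 5.
Proof.
move=> s0; rewrite /root6 -powR_mulrn ?powR_ge0 // -powRrM; congr (_ `^ _); by field.
Qed.

(** The scales in terms of [b]: the reach [tau'] is of order b^-6, the balls have radius up to the
    order of [Y = b^-1], and the mesh [h] is as small as desired. Curvature costs b^-1 / b^-6 = b^5
    and the layer sums b^4, while the tail [expR (- Y)] beats the volume of the rescaled manifold,
    of order b^(-6d). A spare power of [b] absorbs each constant, leaving less than a fraction of
    [th = b ^ 3 / 16]. *)
Lemma kde_estimate (R : realType) (d m : nat) (D0 Vmax tau : R) : 0 <= D0 -> 0 < tau -> exists2 b0 : R, 0 < b0 &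
  forall sigma : R, 0 < sigma -> root6 sigma < b0 -> forall delta : R, 0 < delta ->
  exists N0 : nat, forall N : nat, (N0 <= N)%N -> (0 < N)%N /\
  forall M0 : set 'rV[R]_(d + m), manifold_class Vmax tau M0 ->
  forall (disp : measure_display) (T : measurableType disp)
      (P : probability T R) (X : 'I_N -> T -> 'rV[R]_(d + m)), iid_uniform d M0 P X ->
  exists E : set T, [/\ measurable E, ((1 - delta)%:E <= P E)%E &
    forall w, E w -> (forall i, M0 (X i w)) /\
    forall x z z', nearest (rescale_set sigma M0) x z -> rescale_set sigma M0 z' -> enorm (x - z) <= D0 ->
    let Nf := normalization d (rescale_set sigma M0) (sigma `^ (5 / 6) / scale sigma) z' in
    0 < Nf /\ `|kde (fun i => (scale sigma)^-1 *: X i w) x / Nf - expR (- pi * enorm (x - z) ^+ 2)| <= root6 sigma ^+ 3].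
Proof.
move=> D00 tau0; have [Cd Cd0 hCd] := @layer_lim R d.
have p2 := pi_ge2 R; have p4 : pi <= 4 :> R by have := pihalf_lt2 R; lra.
have p0 : 0 < pi :> R by exact: pi_gt0.
pose S2 : R := Num.sqrt (2 * pi).
have S22 : S2 ^+ 2 = 2 * pi by rewrite sqr_sqrtr //; lra.
have S20 : 0 < S2 by rewrite sqrtr_gt0; lra.
have S21 : 1 <= S2 by rewrite -(@ler_sqr R) ?nnegrE ?(ltW S20) // S22 expr1n; lra.
pose w := ball_vol R d; have w0 : 0 <= w by exact: ball_vol_ge0.
(* [A * b ^+ 5] bounds every ratio of a length to the reach: the terms come from [|x - z|], from the
   truncation radius and from the cylinder of the normalization. *)
pose A := D0 * S2 / tau + 256 * d.+2%:R * S2 / tau + 128 / tau + 1.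
have ti : 0 < tau^-1 by rewrite invr_gt0.
have d20 : 0 < d.+2%:R :> R by rewrite ltr0n.
have a1 : 0 <= D0 * S2 / tau by rewrite !mulr_ge0 // ltW.
have a2 : 0 <= d.+2%:R * S2 / tau by rewrite !mulr_ge0 // ltW.
have a3 : 0 <= 128 / tau by rewrite mulr_ge0 // ltW.
have A1 : 1 <= A by rewrite /A; lra.
pose q : R := 3 ^+ d; have q1 : 1 <= q by rewrite exprn_ege1 // ler1n.
(* With this exponent [expRN_inv_le] cancels the volume factor b^(-6d) and still leaves [b ^ 4]. *)
pose p := (6 * d + 4)%N.
pose Vp : R := `|Vmax| * p%:R ^+ p.
have Vp0 : 0 <= Vp by rewrite mulr_ge0 // exprn_ge0.
pose Xc := 16 * q * A + 32 * (1 + 256 * Cd) + 32 * Vp.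
have qA : 1 <= q * A by rewrite mulr_ege1.
have Xc0 : 0 < Xc by rewrite /Xc; lra.
exists (Num.min 1 Xc^-1); first by rewrite lt_min ltr01 invr_gt0.
move=> sigma s0; set b := root6 sigma; rewrite lt_min => /andP[b1 bX] delta delta0.
have b0 : 0 < b by exact: root6_gt0.
have bXc : Xc * b <= 1 by rewrite mulrC -ler_pdivlMr // mul1r ltW.
have sE : scale sigma = b ^+ 6 * S2 by rewrite /scale root6X.
have c0 := scale_gt0 s0.
pose th := b ^+ 3 / 16; have th0 : 0 < th by rewrite divr_gt0 // exprn_gt0.
have b3 : b ^+ 3 <= 1 by rewrite exprn_ile1 // ltW.
have th1 : th <= 1 by rewrite /th; lra.
have bpos k : 0 < b ^+ k by exact: exprn_gt0.
have b43 c : 0 <= c -> 16 * c * b <= 1 -> c * b ^+ 4 <= th.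
  move=> c00 h; have -> : c * b ^+ 4 = (16 * c * b) * th by rewrite /th; field.
  by rewrite ler_piMl // ltW.
have qb : 16 * q * A * b <= 1.
  apply: le_trans bXc; rewrite ler_wpM2r ?(ltW b0) // /Xc; lra.
have cb : 32 * (1 + 256 * Cd) * b <= 1.
  apply: le_trans bXc; rewrite ler_wpM2r ?(ltW b0) // /Xc; lra.
have vb : 32 * Vp * b <= 1.
  apply: le_trans bXc; rewrite ler_wpM2r ?(ltW b0) // /Xc; lra.
have qA5 : q * (A * b ^+ 5) <= th.
  have qA0 : 0 <= q * A by lra.
  have b54 : b ^+ 5 <= b ^+ 4 by rewrite exprS ler_piMl ?(ltW (bpos 4%N)) // ltW.
  rewrite mulrA; apply: (le_trans (ler_wpM2l qA0 b54)); apply: b43 => //; lra.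
have A5 : A * b ^+ 5 <= 1 / 16.
  have : A * b ^+ 5 <= q * (A * b ^+ 5) by rewrite ler_peMl // mulr_ge0 ?(ltW (bpos 5)) //; lra.
  by rewrite /th in qA5; lra.
have t1 := b43 (2 * (1 + 256 * Cd)) _ _.
have {}t1 : (1 + 256 * Cd) * b ^+ 4 <= th / 2.
  have : 2 * (1 + 256 * Cd) * b ^+ 4 <= th by apply: t1; clear -Cd0 cb; lra.
  lra.
have t2 : Vp * b ^+ 4 <= th / 2.
  have : 2 * Vp * b ^+ 4 <= th by apply: b43; clear -Vp0 vb; lra.
  lra.
pose tau' := tau / scale sigma.
have tau'0 : 0 < tau' by rewrite divr_gt0.
have tauE : tau'^-1 = S2 / tau * b ^+ 6 by rewrite /tau' invf_div sE; field; rewrite gt_eqF.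
have b65 : b ^+ 6 <= b ^+ 5 by rewrite exprS ler_piMl ?(ltW (bpos 5)) // ltW.
have ti0 : 0 <= tau'^-1 by rewrite invr_ge0 ltW.
pose k := D0 / tau'.
have k0 : 0 <= k by rewrite divr_ge0 // ltW.
have kA : k <= A * b ^+ 5.
  have -> : k = D0 * S2 / tau * b ^+ 6 by rewrite /k tauE; ring.
  apply: (@le_trans _ _ (D0 * S2 / tau * b ^+ 5)); first by rewrite ler_wpM2l.
  by rewrite ler_wpM2r ?(ltW (bpos 5)) // /A; clear -a1 a2 a3; lra.
have k16 : k <= 1 / 16 by exact: le_trans A5.
pose Y := b^-1; have Y0 : 0 < Y by rewrite invr_gt0.
have Y1 : 1 <= Y by rewrite invf_ge1 // ltW.
pose rmax := 2 * d.+2%:R * Y.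
have rmax0 : 0 < rmax by rewrite !mulr_gt0.
have rmaxt : 128 * rmax / tau' <= A * b ^+ 5.
  have -> : 128 * rmax / tau' = 256 * d.+2%:R * S2 / tau * b ^+ 5.
    by rewrite /rmax /Y tauE; field; rewrite !gt_eqF.
  by rewrite ler_wpM2r ?(ltW (bpos 5)) // /A; clear -a1 a2 a3; lra.
have eY : expR (- Y) <= 256 * b ^+ 4.
  apply: (le_trans (expRN_inv_le 4 b0)); rewrite le_eqVlt; apply/orP; left; apply/eqP; ring.
have [h1 h10 hlay] := hCd _ (bpos 4%N).
pose hm := Num.min h1 (Num.min 1 (th / (8 * (w + 1)))).
have w1 : 0 < w + 1 by rewrite ltr_wpDl.
have hm0 : 0 < hm by rewrite !lt_min h10 ltr01 divr_gt0 // mulr_gt0.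
(* Large enough for the mesh [h = Y / J] to be finer than [hm], while [h * J] is exactly the
   truncation radius [Y]. *)
pose J := (Num.trunc (Y / hm)).+1.
have J0 : 0 < J%:R :> R by rewrite ltr0n.
have YJ : Y / hm < J%:R by exact: truncnS_gt.
pose h := Y / J%:R; have h0 : 0 < h by rewrite divr_gt0.
have hhm : h < hm by rewrite /h ltr_pdivrMr // mulrC -ltr_pdivrMr.
have hJ : h * J%:R = Y by rewrite /h divfK // gt_eqF.
have hh1 : h < h1 by rewrite (lt_le_trans hhm) // ge_min lexx.
have hl1 : h <= 1 by rewrite ltW // (lt_le_trans hhm) // ge_min ge_min lexx orbT.
have hth : h * (w + 1) <= th / 8.
  have : h <= th / (8 * (w + 1)) by rewrite ltW // (lt_le_trans hhm) // !ge_min lexx !orbT.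
  rewrite ler_pdivlMr ?mulr_gt0 //; clear; lra.
have ph2 : pi * h ^+ 2 <= 4 * h.
  have : h ^+ 2 <= h by rewrite expr2 ler_piMl // ltW.
  move=> hh; apply: ler_pM => //; [exact: ltW|exact: sqr_ge0].
have ph0 : 0 <= pi * h ^+ 2 by rewrite mulr_ge0 ?sqr_ge0 // ltW.
have hwge : h <= h * (w + 1) by rewrite ler_peMr ?(ltW h0) // lerDr.
pose K := (d.+1 * J ^ 2)%N.
have hJ1 : 1 <= h * J%:R by rewrite hJ.
have [lup llo] := hlay h J h0 hh1 hJ1; rewrite hJ in lup llo.
have CdY : b ^+ 4 + Cd * expR (- Y) <= th / 2.
  have : Cd * expR (- Y) <= Cd * (256 * b ^+ 4) by rewrite ler_wpM2l.
  clear -t1; lra.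
(* A bound for the volume of every rescaled manifold of the class, available before the sample size
   is chosen. *)
pose B := `|Vmax| * (scale sigma)^-1 ^+ d.
have B0 : 0 <= B by rewrite mulr_ge0 // exprn_ge0 // invr_ge0 ltW.
have BE : B * expR (- Y) <= th / 2.
  apply: le_trans t2; apply: (@le_trans _ _ (`|Vmax| * (b ^+ 6)^-1 ^+ d * (p%:R ^+ p * b ^+ p))).
    apply: ler_pM; rewrite ?expR_ge0 ?mulr_ge0 ?exprn_ge0 ?invr_ge0 ?(ltW c0) //; last exact: expRN_inv_le.
    rewrite ler_wpM2l // lerXn2r ?nnegrE ?invr_ge0 ?(ltW c0) ?(ltW (bpos _)) //.
    by rewrite lef_pV2 ?posrE // sE ler_peMr // ltW.
  have bp : b ^+ p = b ^+ 6 ^+ d * b ^+ 4 by rewrite /p exprD exprM.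
  have binv : (b ^+ 6)^-1 ^+ d * b ^+ 6 ^+ d = 1 by rewrite -exprMn mulVf ?expr1n // gt_eqF.
  rewrite bp /Vp; set i := (b ^+ 6)^-1 ^+ d in binv *.
  have -> : `|Vmax| * i * (p%:R ^+ p * (b ^+ 6 ^+ d * b ^+ 4)) = `|Vmax| * p%:R ^+ p * b ^+ 4 * (i * b ^+ 6 ^+ d) by ring.
  by rewrite binv mulr1.
pose kappa := th / (2 * (B + 1)).
have B1 : 0 < B + 1 by rewrite ltr_wpDl.
have kappa0 : 0 < kappa by rewrite divr_gt0 // mulr_gt0.
have Bk : B * kappa <= th / 2.
  have -> : th / 2 = (B + 1) * kappa by rewrite /kappa; field; rewrite gt_eqF.
  by rewrite ler_wpM2r ?(ltW kappa0) // lerDl.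
have L0 : 0 <= 2 * pi / scale sigma by rewrite divr_ge0 ?mulr_ge0 // ltW.
have [N0 hN0] := @empirical_event R (d + m) d _ _ _ L0 kappa0 delta0.
exists N0 => N hN; have [Np hN'] := hN0 N hN; split => // M0 cM0 disp T P X iid.
have gM0 := good_mfd_of_class tau0 cM0.
have [cpM _ M01 volM _] := cM0.
have bM : borel M0 by apply: borel_closed; exact: compact_closed_row.
have [E [mE PE hE]] := hN' M0 bM M01 disp T P X iid.
exists E; split=> // v Ev; have [XM cmp] := hE v Ev; split=> // x z z' nz Mz' xz.
set M := rescale_set sigma M0 in nz Mz' *.
have gM : good_mfd tau' M by exact: good_rescale.
have Vfin : (hvol d M0 < +oo)%E by rewrite (le_lt_trans volM) // ltry.
pose V := fine (hvol d M).
have VB : V <= B.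
  have VmaxV : fine (hvol d M0) <= `|Vmax|.
    by rewrite (le_trans _ (ler_norm Vmax)) // -lee_fin fineK // ge0_fin_numE // hvol_ge0.
  rewrite /V /M hvol_rescale // fineM //; last by rewrite ge0_fin_numE // hvol_ge0.
  by rewrite /B mulrC ler_wpM2r //= exprn_ge0 // invr_ge0 ltW.
pose t := sigma `^ (5 / 6) / scale sigma.
have t0 : 0 < t by rewrite divr_gt0 // powR_gt0.
have tt : t / tau' = b ^+ 5 / tau.
  by rewrite /t root6_56 // -/b /tau' sE; field; rewrite !gt_eqF.
have tA : 128 * t / tau' <= A * b ^+ 5.
  by rewrite -mulrA tt mulrCA mulrC ler_wpM2r ?(ltW (bpos 5)) // mulrC /A; clear -a1 a2; lra.
have t128 : 128 * t <= tau' by rewrite -(mul1r tau') -ler_pdivrMr // (le_trans tA) //; clear -A5; lra.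
have [V0 N1 NL] := normalization_bounds gM Mz' t0 t128 (hvol_rescale_fin s0 Vfin).
rewrite -/V in V0 N1 NL; set Nf := normalization d M t z' in N1 NL *.
have Nf0 : 0 < Nf by rewrite -(pmulr_lgt0 _ V0) (lt_le_trans ltr01).
have small u : 0 <= u -> u <= A * b ^+ 5 -> (1 + u) ^+ d <= 1 + th /\ 1 - th <= (1 - u) ^+ d.
  move=> u0 uA; have u1 : u <= 1 by rewrite (le_trans uA) // (le_trans A5) //; clear; lra.
  have quth : q * u <= th by rewrite (le_trans _ qA5) // ler_wpM2l // (le_trans ler01).
  split; first by rewrite (le_trans (pow1D_le d u0 u1)) // lerD2l.
  by apply: le_trans (pow1B_ge d u0 u1); rewrite lerD2l lerN2.
have NLt : Nf * V <= 1 + th.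
  apply: (le_trans NL); have [||//] := small (16 * t / tau').
  - exact: mulr_ge0 (mulr_ge0 (ler0n _ 16) (ltW t0)) ti0.
  - by apply: le_trans tA; rewrite ler_wpM2r ?invr_ge0 ?(ltW tau'0) // ler_wpM2r ?(ltW t0) // ler_nat.
pose Ex := expR (- pi * enorm (x - z) ^+ 2).
have Ex0 : 0 <= Ex by exact: expR_ge0.
have Ex1 : Ex <= 1 by rewrite -[leRHS]expR0 ler_expR mulNr oppr_le0 mulr_ge0 ?sqr_ge0 // ltW.
have kt : enorm (x - z) <= k * tau' by rewrite /k divfK // gt_eqF.
have k1 : k < 1 by clear -k16; lra.
have kde0 : 0 <= kde (fun i => (scale sigma)^-1 *: X i v) x.
  by rewrite /kde mulr_ge0 ?invr_ge0 // sumr_ge0 // => i _; exact: expR_ge0.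
have sqK k' : (k' <= (d.+2 * J) ^ 2)%N -> h * Num.sqrt k'%:R <= d.+2%:R * Y.
  move=> kJ; have -> : d.+2%:R * Y = h * (d.+2 * J)%:R by rewrite natrM -hJ; ring.
  by rewrite ler_wpM2l ?(ltW h0) // -(@ler_sqr R) ?nnegrE ?sqrtr_ge0 ?ler0n // sqrt_nat_sqr -natrX ler_nat.
have J20 : (0 < J ^ 2)%N by rewrite expn_gt0.
have KK : (K.+1 <= (d.+2 * J) ^ 2)%N.
  apply: (@leq_trans (d.+2 * J ^ 2)); first by rewrite [X in (_ <= X)%N]mulSn -addn1 addnC leq_add2r.
  by rewrite expnMn leq_mul2r -mulnn leq_pmulr // orbT.
have k12 : k <= 1 / 2 by clear -k16; lra.
have inv_up := inv_sqrt_upper k0 k12.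
have inv_lo := inv_sqrt_lower k0 k12.
have gK : V * (gau h K.+1 + kappa) <= th.
  have gY : gau h K.+1 <= expR (- Y).
    apply: (@le_trans _ _ (gau h (J ^ 2))); first by rewrite gau_le // leqW // leq_pmull.
    rewrite /gau natrX ler_expR lerN2.
    have -> : pi * h ^+ 2 * J%:R ^+ 2 = pi * Y ^+ 2 by rewrite -hJ; ring.
    have : Y <= Y ^+ 2 by rewrite expr2 ler_peMl // ltW.
    have : 1 * Y ^+ 2 <= pi * Y ^+ 2 by rewrite ler_wpM2r ?sqr_ge0 //; clear -p2; lra.
    clear; lra.
  have g0 := gau_gt0 h K.+1.
  apply: (@le_trans _ _ (B * (expR (- Y) + kappa))); last by rewrite mulrDr; clear -BE Bk; lra.
  apply: ler_pM => //; [exact: ltW|by rewrite addr_ge0 // ltW|by rewrite lerD2r].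
split=> //; rewrite ler_norml -/Ex; apply/andP; split.
  pose rho := h / Num.sqrt (1 + k) * Num.sqrt K%:R.
  have rho0 : 0 <= rho by rewrite /rho mulr_ge0 ?divr_ge0 ?sqrtr_ge0 // ltW.
  have rr : rho <= rmax.
    have sk : 1 <= Num.sqrt (1 + k) by rewrite -[leLHS]sqrtr1 ler_wsqrtr // lerDl.
    apply: (@le_trans _ _ (h * Num.sqrt K%:R)).
      by rewrite /rho ler_wpM2r ?sqrtr_ge0 // ler_pdivrMr ?(lt_le_trans ltr01) // ler_peMr // ltW.
    apply: (le_trans (sqK _ (leq_trans (leqnSn _) KK))); rewrite /rmax -mulrA.
    have : 0 < d.+2%:R * Y by rewrite mulr_gt0.
    clear; lra.
  have r128 : 128 * rho <= tau'.
    rewrite -(mul1r tau') -ler_pdivrMr //; apply: (@le_trans _ _ (128 * rmax / tau')).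
      by rewrite ler_wpM2r ?invr_ge0 ?(ltW tau'0) // ler_wpM2l.
    by rewrite (le_trans rmaxt) // (le_trans A5) //; clear; lra.
  have uA : 32 * rho / tau' <= A * b ^+ 5.
    apply: le_trans rmaxt; rewrite ler_wpM2r //; clear -rr rho0; lra.
  have u0 : 0 <= 32 * rho / tau' := mulr_ge0 (mulr_ge0 (ler0n _ 32) rho0) ti0.
  have := kde_lower s0 gM0 Vfin cmp nz h0 k0 kt r128; rewrite -/V -/Ex => lo.
  rewrite lerBrDr addrC.
  have -> : b ^+ 3 = 16 * th by rewrite /th; field.
  apply: (combine_lower (ltW th0) th1 Ex0 Ex1 _ _ _ _ V0 Nf0 NLt lo kde0).
  - apply: le_trans (small _ u0 uA).2 _.
    have up0 : 0 < 1 + 32 * rho / tau' by rewrite ltr_wpDr.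
    rewrite lerXn2r ?nnegrE ?invr_ge0 ?(ltW up0) //; first by rewrite subr_ge0 (le_trans uA) // (le_trans A5) //; clear; lra.
    rewrite -[leRHS]mul1r ler_pdivlMr //.
    have := sqr_ge0 (32 * rho / tau'); set u := 32 * rho / tau'; clear; lra.
  - apply: le_trans (small _ k0 kA).2 _.
    rewrite lerXn2r ?nnegrE ?invr_ge0 ?sqrtr_ge0 ?subr_ge0 ?(ltW k1) //.
  - have : pi * h ^+ 2 * w <= th / 2.
      have : pi * h ^+ 2 * w <= 4 * h * (w + 1).
        by apply: ler_pM => //; rewrite lerDl.
      clear -hth th0; lra.
    rewrite -/K in llo; rewrite -/w; clear -llo CdY; lra.
  - by apply: (@le_trans _ _ (B * kappa)); [rewrite ler_wpM2r // ltW|clear -Bk th0; lra].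
pose rho := h / Num.sqrt (1 - k) * Num.sqrt K.+1%:R.
have rho0 : 0 <= rho by rewrite /rho mulr_ge0 ?divr_ge0 ?sqrtr_ge0 // ltW.
have rr : rho <= rmax.
  have -> : rho = (Num.sqrt (1 - k))^-1 * (h * Num.sqrt K.+1%:R) by rewrite /rho; ring.
  apply: (@le_trans _ _ (2 * (d.+2%:R * Y))); last by rewrite /rmax mulrA.
  have g1 : 0 <= (Num.sqrt (1 - k))^-1 by rewrite invr_ge0 sqrtr_ge0.
  have g2 : 0 <= h * Num.sqrt K.+1%:R := mulr_ge0 (ltW h0) (sqrtr_ge0 _).
  have g3 : (Num.sqrt (1 - k))^-1 <= 2 by clear -inv_up k12; lra.
  exact: (ler_pM g1 g2 g3 (sqK _ KK)).
have r16 : 16 * rho <= tau'.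
  rewrite -(mul1r tau') -ler_pdivrMr //; apply: (@le_trans _ _ (128 * rmax / tau')).
    by rewrite ler_wpM2r //; clear -rr rmax0; lra.
  by rewrite (le_trans rmaxt) // (le_trans A5) //; clear; lra.
have uA : 8 * rho / tau' <= A * b ^+ 5.
  apply: le_trans rmaxt; rewrite ler_wpM2r //; clear -rr rmax0; lra.
have u0 : 0 <= 8 * rho / tau' := mulr_ge0 (mulr_ge0 (ler0n _ 8) rho0) ti0.
have := kde_upper s0 gM0 Vfin cmp nz h0 k1 kt r16; rewrite -/V -/Ex => up.
rewrite lerBlDl.
have -> : b ^+ 3 = 16 * th by rewrite /th; field.
apply: (combine_upper (ltW th0) th1 Ex0 Ex1 _ _ _ _ _ _ _ _ gK V0 Nf0 N1 up).
- by rewrite exprn_ge0 // addr_ge0.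
- by rewrite exprn_ge0 // invr_ge0 sqrtr_ge0.
- by rewrite invr_ge0 ltW // gau_gt0.
- by apply: layer_ge0; exact: ltW.
- exact: (small _ u0 uA).1.
- apply: le_trans (small _ k0 kA).1.
  by rewrite lerXn2r ?nnegrE ?invr_ge0 ?sqrtr_ge0 ?addr_ge0.
- rewrite /gau mulr1 -expRN opprK.
  have y8 : pi * h ^+ 2 <= th / 2 by clear -ph2 hwge hth; lra.
  apply: (le_trans (expR_le1D2 ph0 _)); first by clear -y8 th1; lra.
  by clear -y8; lra.
- by rewrite -/K in lup; clear -lup CdY th0; lra.
Qed.

(** * Functions with bounded derivatives *)

Section BoundedDerivatives.
Context {R : realType} {n : nat}.
Implicit Types (U : set 'rV[R]_n) (f g : 'rV[R]_n -> R) (v w x : 'rV[R]_n).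

(* f is of class C^k on U and its derivatives of order at most k along v_1, ...,
   v_j are bounded by B times the product of the lengths of the v_i. *)
Fixpoint Bk k U (B : R) f : Prop :=
  (forall x, U x -> {for x, continuous f} /\ `|f x| <= B) /\
  match k with
  | 0 => True
  | k'.+1 => forall v, (forall x, U x -> derivable f x v) /\ Bk k' U (B * enorm v) ('D_v f)
  end.

Lemma Bk_pos k U B f x : U x -> Bk k U B f -> 0 <= B.
Proof. by move=> Ux; case: k => [|k] [/(_ x Ux)[_ h] _]; exact: le_trans h. Qed.

Lemma Bk_le k U B B' f : B <= B' -> Bk k U B f -> Bk k U B' f.
Proof.
elim: k B B' f => [|k IH] B B' f BB [h hk]; split => //.
- by move=> x /h[h1 h2]; split => //; exact: le_trans BB.
- by move=> x /h[h1 h2]; split => //; exact: le_trans BB.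
- by move=> v; have [h1 h2] := hk v; split => //; apply: IH h2; rewrite ler_wpM2r ?enorm_ge0.
Qed.

Lemma Bk_sub k U U' B f : U' `<=` U -> Bk k U B f -> Bk k U' B f.
Proof.
move=> UU; elim: k B f => [|k IH] B f [h hk]; split => //.
- by move=> x /UU /h.
- by move=> x /UU /h.
- by move=> v; have [h1 h2] := hk v; split; [move=> x /UU /h1|exact: IH].
Qed.

Lemma Bk_pred k U B f : Bk k.+1 U B f -> Bk k U B f.
Proof.
elim: k B f => [|k IH] B f [h hk]; split => // v.
by have [h1 h2] := hk v; split => //; exact: IH.
Qed.

Lemma Bk_leq k j U B f : (j <= k)%N -> Bk k U B f -> Bk j U B f.
Proof.
elim: k => [|k IH]; first by rewrite leqn0 => /eqP->.
by rewrite leq_eqVlt => /orP[/eqP->//|]; rewrite ltnS => jk /Bk_pred; exact: IH.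
Qed.

Lemma continuous_near_eq f g x : (\near x, f x = g x) -> {for x, continuous f} -> {for x, continuous g}.
Proof.
move=> nfg cf A nA; have fgx : f x = g x by exact: (nbhs_singleton nfg).
have nA' : nbhs (f x) A by rewrite fgx.
have c1 : nbhs x (f @^-1` A) := cf A nA'.
by apply: (@filterS2 _ (nbhs x) _ (f @^-1` A) _ (g @^-1` A) _ c1 nfg) => y /= Ay <-.
Qed.

Lemma Bk_ext k U B f g : open U -> (forall x, U x -> f x = g x) -> Bk k U B f -> Bk k U B g.
Proof.
move=> oU; elim: k B f g => [|k IH] B f g fg [h hk].
all: have nfg x : U x -> \near x, f x = g x by
  move=> Ux; apply: (@filterS _ (nbhs x) _ U); [by move=> y /fg|exact: open_nbhs_nbhs].
all: have hc x : U x -> {for x, continuous g} /\ `|g x| <= B by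
  move=> Ux; have [c1 b1] := h x Ux; split; [exact: (continuous_near_eq (nfg x Ux))|by rewrite -fg].
- by split.
- split => // v; have [h1 h2] := hk v; split.
    by move=> x Ux; apply: (near_eq_derivable (nfg x Ux)); exact: h1.
  by apply: IH h2 => x Ux; apply: near_eq_derive; exact: nfg.
Qed.

Lemma Bk_Ck k U B f : Bk k U B f -> Ck k U f.
Proof.
elim: k B f => [|k IH] B f [h hk]; split => //; try by move=> x /h[].
by move=> v; have [h1 h2] := hk v; split => //; exact: IH h2.
Qed.

Lemma Bk_iter_derive k U B f (vs : seq 'rV[R]_n) : (size vs <= k)%N -> Bk k U B f ->
  Bk (k - size vs) U (B * \prod_(v <- vs) enorm v) (iter_derive vs f).
Proof.
move=> sk hf; elim: vs sk => [|v vs IH] /= sk; first by rewrite big_nil mulr1 subn0.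
have := IH (ltnW sk); have -> : (k - size vs = (k - (size vs).+1).+1)%N by lia.
move=> [_ /(_ v)[_]]; apply: Bk_le; rewrite big_cons [enorm v * _]mulrC mulrA //.
Qed.

Lemma derive_of_line f x v (d : R) : is_derive (0 : R) (1 : R) (fun s : R => f (x + s *: v)) d ->
  derivable f x v /\ 'D_v f x = d.
Proof.
move=> [h1 h2]; have x0 : x + 0 *: v = x by rewrite scale0r addr0.
rewrite -x0; split; first by rewrite /derivable -line_quotient; exact: h1.
by rewrite -h2 /derive -line_quotient.
Qed.

Lemma line_derive f x v : derivable f x v ->
  is_derive (0 : R) (1 : R) (fun s : R => f (x + s *: v)) ('D_v f x).
Proof.
have x0 : x + 0 *: v = x by rewrite scale0r addr0.
move=> h; have h' : derivable f (x + 0 *: v) v by rewrite x0.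
by have := is_derive_line h'; rewrite x0.
Qed.

Lemma Bk_cst k U (c : R) : Bk k U `|c| (fun=> c).
Proof.
elim: k c => [|k IH] c; split => //; try by move=> x _; split => //; exact: cst_continuous.
move=> v; split; first by move=> x _; exact: derivable_cst.
have -> : 'D_v (fun _ : 'rV[R]_n => c) = (fun=> 0) by apply/funext => x; exact: derive_cst.
by apply: Bk_le (IH 0); rewrite normr0 mulr_ge0 // enorm_ge0.
Qed.

Lemma Bk_add k U A B f g : open U -> Bk k U A f -> Bk k U B g -> Bk k U (A + B) (fun x => f x + g x).
Proof.
move=> oU; elim: k A B f g => [|k IH] A B f g [hf kf] [hg kg].
all: have hc x : U x -> {for x, continuous (fun x => f x + g x)} /\ `|f x + g x| <= A + B by
  move=> Ux; have [c1 b1] := hf x Ux; have [c2 b2] := hg x Ux; split;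
  [exact: continuousD|rewrite (le_trans (ler_normD _ _)) // lerD].
- by split.
- split => // v; have [f1 f2] := kf v; have [g1 g2] := kg v; split.
    by move=> x Ux; apply: derivableD; [exact: f1|exact: g1].
  rewrite mulrDl; apply: Bk_ext (IH _ _ _ _ f2 g2) => // x Ux.
  by rewrite (deriveD (f1 x Ux) (g1 x Ux)).
Qed.

Lemma Bk_mul k U A B f g : open U -> 0 <= A -> 0 <= B -> Bk k U A f -> Bk k U B g ->
  Bk k U (2 ^+ k * (A * B)) (fun x => f x * g x).
Proof.
move=> oU; elim: k A B f g => [|k IH] A B f g A0 B0 [hf kf] [hg kg].
all: have AB0 : 0 <= A * B by exact: mulr_ge0.
all: have hc j x : U x -> {for x, continuous (fun x => f x * g x)} /\ `|f x * g x| <= 2 ^+ j * (A * B) by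
  move=> Ux; have [c1 b1] := hf x Ux; have [c2 b2] := hg x Ux; split;
  [exact: continuousM|rewrite normrM (le_trans (ler_pM _ _ b1 b2)) // ler_peMl // exprn_ege1 // ler1n].
- by split; [exact: (hc 0%N)|].
- split; [exact: (hc k.+1)|]; move=> v; have [f1 f2] := kf v; have [g1 g2] := kg v; split.
    by move=> x Ux; apply: derivableM; [exact: f1|exact: g1].
  have p1 := IH _ _ _ _ A0 (mulr_ge0 B0 (enorm_ge0 v)) (Bk_pred (conj hf kf)) g2.
  have p2 := IH _ _ _ _ (mulr_ge0 A0 (enorm_ge0 v)) B0 f2 (Bk_pred (conj hg kg)).
  have := Bk_add oU p1 p2; apply: (fun P Q (h : P -> Q) => h) => h.
  apply: Bk_le (Bk_ext oU _ h); first by rewrite exprS le_eqVlt; apply/orP; left; apply/eqP; ring.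
  move=> x Ux /=; have := deriveM (f1 x Ux) (g1 x Ux).
  by rewrite /GRing.scale /= => ->; rewrite [g x * _]mulrC.
Qed.

Lemma Bk_lin k U a r : open U -> (forall x, U x -> enorm x <= r) -> 0 <= r ->
  Bk k U ((r + 1) * enorm a) (fun x => edot x a).
Proof.
move=> oU Ur r0.
have c x : {for x, continuous (fun x => edot x a)}.
  by apply: (@continuous_edot R n id (fun=> a)); [move=> P|exact: cst_continuous].
have h x : U x -> {for x, continuous (fun x => edot x a)} /\ `|edot x a| <= (r + 1) * enorm a.
  move=> Ux; split; first exact: c.
  rewrite (le_trans (edot_norm_le _ _)) // ler_wpM2r ?enorm_ge0 // (le_trans (Ur _ Ux)) // lerDl //.
case: k => [|k]; split => // v.
have d x : derivable (fun x => edot x a) x v /\ 'D_v (fun x => edot x a) x = edot v a.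
  apply: derive_of_line.
  have -> : (fun s : R => edot (x + s *: v) a) = (fun s => edot x a + s * edot v a).
    by apply/funext => s; rewrite edotDl edotZl.
  apply: is_derive_eq; rewrite /GRing.scale /=; ring.
split; first by move=> x _; exact: (d x).1.
have -> : 'D_v (fun x => edot x a) = (fun=> edot v a) by apply/funext => x; exact: (d x).2.
apply: Bk_le (Bk_cst k U (edot v a)); rewrite (le_trans (edot_norm_le _ _)) // mulrC ler_wpM2r ?enorm_ge0 //.
by rewrite ler_peMl ?enorm_ge0 // lerDr.
Qed.

Lemma Bk_scale k U B f c : open U -> Bk k U B f -> Bk k U (`|c| * B) (fun x => c * f x).
Proof.
move=> oU; elim: k B f => [|k IH] B f [hf kf].
all: have hc x : U x -> {for x, continuous (fun x => c * f x)} /\ `|c * f x| <= `|c| * B by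
  move=> Ux; have [c1 b1] := hf x Ux; split;
  [apply: continuousM => //; exact: cst_continuous|rewrite normrM ler_wpM2l].
- by split.
- split => // v; have [f1 f2] := kf v; split.
    by move=> x Ux; apply: derivableM; [exact: derivable_cst|exact: f1].
  rewrite -mulrA; apply: Bk_ext (IH _ _ f2) => // x Ux.
  have := deriveM (derivable_cst c x v) (f1 x Ux); rewrite derive_cst scaler0 addr0 => ->.
  by [].
Qed.

(** Induction on the order, as the derivative of [1 / f] is [- f' / f ^ 2] and [1 / f] is controlled
    at the previous order. The bound depends on [k], [B] and [c] only, hence is uniform in the
    sample. *)
Lemma Bk_inv k (B c : R) : 0 <= B -> 0 < c -> exists2 B', 0 <= B' & forall U f, open U ->
  Bk k U B f -> (forall x, U x -> c <= f x) -> Bk k U B' (fun x => (f x)^-1).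
Proof.
move=> B0 c0; elim: k => [|k [B' B'0 IH]].
  exists c^-1; first by rewrite invr_ge0 ltW.
  move=> U f oU [hf _] fc; split => // x Ux; have [c1 b1] := hf x Ux.
  have fx : 0 < f x by exact: lt_le_trans (fc x Ux).
  split; first by apply: continuousV => //; rewrite gt_eqF.
  by rewrite ger0_norm ?invr_ge0 ?(ltW fx) // lef_pV2 ?posrE //; exact: fc.
pose C := 2 ^+ k * (2 ^+ k * (B' * B') * B).
have C0 : 0 <= C by rewrite !mulr_ge0 ?exprn_ge0.
exists (c^-1 + C); first by rewrite addr_ge0 // invr_ge0 ltW.
move=> U f oU hf fc; have hinv := IH U f oU (Bk_pred hf) fc; case: (hf) => h hk.
split.
  move=> x Ux; have [c1 b1] := h x Ux.
  have fx : 0 < f x by exact: lt_le_trans (fc x Ux).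
  split; first by apply: continuousV => //; rewrite gt_eqF.
  rewrite ger0_norm ?invr_ge0 ?(ltW fx) // (@le_trans _ _ c^-1) ?lerDl //.
  by rewrite lef_pV2 ?posrE //; exact: fc.
move=> v; have [h1 h2] := hk v.
have f0 x : U x -> f x != 0 by move=> Ux; rewrite gt_eqF // (lt_le_trans c0) // fc.
split; first by move=> x Ux; apply: derivableV; [exact: f0|exact: h1].
have p1 := Bk_mul oU B'0 B'0 hinv hinv.
have p2 := Bk_mul oU (mulr_ge0 (exprn_ge0 k (ler0n R 2)) (mulr_ge0 B'0 B'0)) (mulr_ge0 B0 (enorm_ge0 v)) p1 h2.
have p3 := Bk_scale (-1) oU p2.
apply: Bk_le (Bk_ext oU _ p3).
  rewrite normrN1 mul1r mulrDl; have : 0 <= c^-1 * enorm v by rewrite mulr_ge0 ?enorm_ge0 // invr_ge0 ltW.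
  by rewrite /C !mulrA; lra.
move=> x Ux; rewrite (deriveV (f0 x Ux) (h1 x Ux)) /GRing.scale /= -exprVn expr2; ring.
Qed.

Lemma Bk_ln k (B c : R) : 0 <= B -> 0 < c -> exists2 B', 0 <= B' & forall U f, open U ->
  Bk k U B f -> (forall x, U x -> c <= f x) -> Bk k U B' (fun x => ln (f x)).
Proof.
move=> B0 c0.
pose C0 := `|ln c| + `|ln (B + c)|; have C00 : 0 <= C0 by rewrite addr_ge0.
have hln U f x : U x -> {for x, continuous f} -> `|f x| <= B -> c <= f x ->
    {for x, continuous (fun x => ln (f x))} /\ `|ln (f x)| <= C0.
  move=> Ux c1 b1 fc; have fx : 0 < f x by exact: lt_le_trans fc.
  split; first by apply: (continuous_comp c1); exact: continuous_ln.
  have l1 : ln c <= ln (f x) by rewrite ler_ln ?posrE.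
  have l2 : ln (f x) <= ln (B + c).
    rewrite ler_ln ?posrE //; last by rewrite ltr_wpDl.
    by move: b1; rewrite ler_norml => /andP[_ h]; rewrite (le_trans h) // lerDl ltW.
  rewrite ler_norml /C0; have := ler_norm (ln (B + c)); have := ler_norm (- ln c); rewrite normrN.
  by have := normr_ge0 (ln c); have := normr_ge0 (ln (B + c)); move=> *; apply/andP; split; lra.
case: k => [|k].
  exists C0 => // U f oU [hf _] fc; split=> // x Ux; have [c1 b1] := hf x Ux.
  exact: (hln U f x Ux c1 b1 (fc x Ux)).
have [B' B'0 hB'] := Bk_inv k B0 c0.
pose C := 2 ^+ k * (B' * B); have Cp : 0 <= C by rewrite !mulr_ge0 ?exprn_ge0.
exists (C0 + C); first by rewrite addr_ge0.
move=> U f oU hf fc; case: (hf) => h hk.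
split.
  move=> x Ux; have [c1 b1] := h x Ux; have [a1 a2] := hln U f x Ux c1 b1 (fc x Ux).
  by split => //; rewrite (le_trans a2) // lerDl.
move=> v; have [h1 h2] := hk v.
have d x : U x -> derivable (fun x => ln (f x)) x v /\ 'D_v (fun x => ln (f x)) x = (f x)^-1 * 'D_v f x.
  move=> Ux; apply: derive_of_line; have fx : 0 < f x by exact: lt_le_trans (fc x Ux).
  have l := line_derive (h1 x Ux).
  have := @is_derive1_comp R (@ln R) (fun s : R => f (x + s *: v)) 0 (f x)^-1 ('D_v f x) _ l.
  by apply; rewrite scale0r addr0; exact: is_derive1_ln.
split; first by move=> x Ux; exact: (d x Ux).1.
have p := Bk_mul oU B'0 (mulr_ge0 B0 (enorm_ge0 v)) (hB' U f oU (Bk_pred hf) fc) h2.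
apply: Bk_le (Bk_ext oU _ p); last by move=> x Ux; rewrite (d x Ux).2.
have : 0 <= C0 * enorm v by rewrite mulr_ge0 ?enorm_ge0.
have -> : 2 ^+ k * (B' * (B * enorm v)) = C * enorm v by rewrite /C; ring.
by move=> C0v; rewrite mulrDl lerDr.
Qed.

Lemma is_derive_bigsum (I : Type) (s : seq I) (F : I -> R -> R) (t : R) (df : I -> R) :
  (forall i, is_derive t (1 : R) (F i) (df i)) ->
  is_derive t (1 : R) (fun y => \sum_(i <- s) F i y) (\sum_(i <- s) df i).
Proof.
move=> h; elim: s => [|i s IH].
  rewrite big_nil; have -> : (fun y => \sum_(i <- [::]) F i y) = cst 0 by apply/funext => y; rewrite big_nil.
  exact: is_derive_cst.
rewrite big_cons; have -> : (fun y => \sum_(j <- i :: s) F j y) = F i + (fun y => \sum_(i <- s) F i y).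
  by apply/funext => y; rewrite big_cons.
exact: is_deriveD.
Qed.

(** Differentiating along [v] multiplies the term of index [i] by [edot v (u i)], so derivatives of
    order [j] are moments of order [j]. All orders up to [k] are assumed together to let the
    induction run. *)
Lemma Bk_expsum k U (I : finType) (c : I -> R) (u : I -> 'rV[R]_n) B :
  (forall x, U x -> forall j, (j <= k)%N ->
    \sum_i `|c i| * enorm (u i) ^+ j * expR (edot x (u i)) <= B) ->
  Bk k U B (fun x => \sum_i c i * expR (edot x (u i))).
Proof.
have ce i x : {for x, continuous (fun x => expR (edot x (u i)))}.
  have h : {for x, continuous (fun x => edot x (u i))}.
    by apply: (@continuous_edot R n id (fun=> u i)); [move=> P|exact: cst_continuous].
  by apply: (continuous_comp h); exact: continuous_expR.
have cc (c' : I -> R) x : {for x, continuous (fun x => \sum_i c' i * expR (edot x (u i)))}.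
  apply: continuous_sumr => i; apply: continuousM; [exact: cst_continuous|exact: ce].
elim: k c B => [|k IH] c B hB.
all: have h x : U x -> {for x, continuous (fun x => \sum_i c i * expR (edot x (u i)))} /\
    `|\sum_i c i * expR (edot x (u i))| <= B.
all: try by move=> Ux; split; [exact: cc|]; apply: le_trans (hB x Ux 0%N isT);
  rewrite (le_trans (ler_norm_sum _ _ _)) //; apply: ler_sum => i _;
  rewrite normrM expr0 mulr1 (ger0_norm (expR_ge0 _)).
- by split.
- split => // v.
  have d x : derivable (fun x => \sum_i c i * expR (edot x (u i))) x v /\
      'D_v (fun x => \sum_i c i * expR (edot x (u i))) x = \sum_i (c i * edot v (u i)) * expR (edot x (u i)).
    apply: derive_of_line.
    pose F i (s : R) := c i * expR (edot x (u i) + s * edot v (u i)).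
    have -> : (fun s : R => \sum_i c i * expR (edot (x + s *: v) (u i))) = (fun s => \sum_i F i s).
      apply/funext => s; apply: eq_bigr => i _.
      by rewrite /F edotDl edotZl.
    have dF i : is_derive (0 : R) (1 : R) (F i) (c i * edot v (u i) * expR (edot x (u i))).
      have l : is_derive (0 : R) (1 : R) (fun s => edot x (u i) + s * edot v (u i)) (edot v (u i)).
        by apply: is_derive_eq; rewrite /GRing.scale /=; ring.
      have e := @is_derive1_comp R expR (fun s => edot x (u i) + s * edot v (u i)) 0 _ _ (is_derive_expR _) l.
      have := is_deriveZ (c i) e; rewrite /GRing.scale /= mul0r addr0 => dd.
      have -> : c i * edot v (u i) * expR (edot x (u i)) = c i * (expR (edot x (u i)) * edot v (u i)) by ring.
      exact: dd.
    exact: is_derive_bigsum.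
  split; first by move=> x _; exact: (d x).1.
  have -> : 'D_v (fun x => \sum_i c i * expR (edot x (u i))) =
      (fun x => \sum_i (c i * edot v (u i)) * expR (edot x (u i))) by apply/funext => x; exact: (d x).2.
  apply: IH => x Ux j jk.
  apply: (@le_trans _ _ (\sum_i `|c i| * enorm (u i) ^+ j.+1 * expR (edot x (u i)) * enorm v)).
    apply: ler_sum => i _; rewrite normrM.
    have : `|c i| * `|edot v (u i)| * enorm (u i) ^+ j <= `|c i| * enorm (u i) ^+ j.+1 * enorm v.
      rewrite -[leLHS]mulrA -[leRHS]mulrA ler_wpM2l // exprS.
      have := ler_wpM2r (exprn_ge0 j (enorm_ge0 (u i))) (edot_norm_le v (u i)).
      by move/le_trans; apply; rewrite le_eqVlt; apply/orP; left; apply/eqP; ring.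
    by move=> e; rewrite [leRHS]mulrAC ler_wpM2r ?expR_ge0.
  by rewrite -mulr_suml ler_wpM2r ?enorm_ge0 // hB.
Qed.

End BoundedDerivatives.

(** * Exponential moments and the derivatives of the density estimate *)

Section LocalKde.
Context {R : realType} {n : nat}.
Implicit Types (w x q u v : 'rV[R]_n) (Q : 'M[R]_n).

Lemma open_eball0 (r : R) : open (@eball R n r).
Proof.
have -> : eball r = [set x : 'rV[R]_n | enorm (x - 0) < r].
  by apply/seteqP; split => x; rewrite /eball /= subr0.
exact: open_eball.
Qed.

(** With the signs of [u], the product with [u] is its l1 norm, hence at least [enorm u]. These
    vectors turn [expR (enorm u)] into finitely many exponentials of linear forms. *)
Definition sgnv (s : {ffun 'I_n -> bool}) : 'rV[R]_n := \row_i (-1) ^+ s i.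

Lemma enorm_sgnv s : enorm (sgnv s) <= n%:R.
Proof.
rewrite (row_sum_delta (sgnv s)) (le_trans (enorm_sum_le _ _ _)) //.
rewrite (eq_bigr (fun=> 1)); first by rewrite sumr_const card_ord.
by move=> i _; rewrite enormZ enorm_delta mulr1 mxE normr_sign.
Qed.

Lemma enorm_le_sgnv u : exists s, enorm u <= edot (sgnv s) u.
Proof.
exists [ffun i => u 0 i < 0].
rewrite [X in enorm X](row_sum_delta u) (le_trans (enorm_sum_le _ _ _)) // ler_sum // => i _.
rewrite enormZ enorm_delta mulr1 mxE ffunE; case: (ltP (u 0 i) 0) => h.
  by rewrite expr1 mulN1r ltr0_norm.
by rewrite expr0 mul1r ger0_norm.
Qed.

Lemma expR_enorm_le u : expR (enorm u) <= \sum_(s : {ffun 'I_n -> bool}) expR (edot (sgnv s) u).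
Proof.
have [s hs] := enorm_le_sgnv u; rewrite (bigD1 s) //=.
by rewrite -[leLHS]addr0 lerD ?ler_expR // sumr_ge0 // => i _; exact: expR_ge0.
Qed.

(** Expanding the squares separates a Gaussian in [w], whose logarithm is a polynomial, from a sum
    of exponentials of linear forms. *)
Lemma kde_expsum N (y : 'I_N -> 'rV[R]_n) q Q w : Q *m Q^T = 1%:M ->
  kde y (q + w *m Q) = expR (- pi * enorm w ^+ 2) *
    \sum_(i < N) (N%:R^-1 * expR (- pi * enorm ((y i - q) *m Q^T) ^+ 2)) *
      expR (edot w ((2 * pi) *: ((y i - q) *m Q^T))).
Proof.
move=> QQ; rewrite /kde !mulr_sumr; apply: eq_bigr => i _.
have -> : q + w *m Q - y i = w *m Q - (y i - q) by vec.
have -> : enorm (w *m Q - (y i - q)) = enorm (w - (y i - q) *m Q^T).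
  by rewrite -[RHS](enorm_orthmx QQ) mulmxBl mulmx_orthVK.
set u := (y i - q) *m Q^T.
have -> : - pi * enorm (w - u) ^+ 2 = - pi * enorm w ^+ 2 + - pi * enorm u ^+ 2 + edot w ((2 * pi) *: u).
  by rewrite (enormB_sqr w) edotZr; ring.
by rewrite !expRD; ring.
Qed.

(** A power of [|u|] is at most a constant times [expR |u|], which is at most the sum of
    [expR (edot (sgnv s) u)] over all signs. A moment at [w] is thus bounded by values of the
    density at the shifted points [w + sgnv s], all of norm at most [n + 2]: an upper bound of the
    density on that larger ball controls derivatives of every order. *)
Lemma kde_moments k N (y : 'I_N -> 'rV[R]_n) q Q Nf : Q *m Q^T = 1%:M -> 0 < Nf ->
  (forall w, enorm w <= n%:R + 2 -> kde y (q + w *m Q) / Nf <= 2) ->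
  forall w, enorm w < 2 -> forall j, (j <= k)%N ->
  \sum_(i < N) `|N%:R^-1 * expR (- pi * enorm ((y i - q) *m Q^T) ^+ 2) / Nf| *
    enorm ((2 * pi) *: ((y i - q) *m Q^T)) ^+ j * expR (edot w ((2 * pi) *: ((y i - q) *m Q^T)))
  <= k.+1%:R ^+ k * (\sum_(s : {ffun 'I_n -> bool}) 2 * expR (pi * (n%:R + 2) ^+ 2)).
Proof.
move=> QQ Nf0 hk w w2 j jk.
pose u i := (2 * pi) *: ((y i - q) *m Q^T); pose c i := N%:R^-1 * expR (- pi * enorm ((y i - q) *m Q^T) ^+ 2) / Nf.
have c0 i : 0 <= c i by rewrite divr_ge0 ?(ltW Nf0) // mulr_ge0 ?invr_ge0 ?expR_ge0.
have kj : j%:R ^+ j <= k.+1%:R ^+ k :> R.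
  by rewrite -!natrX ler_nat; apply: (@leq_trans (k.+1 ^ j)); [case: (j) jk => // l lk; rewrite leq_exp2r // ltnW|rewrite leq_pexp2l].
apply: (@le_trans _ _ (k.+1%:R ^+ k * (\sum_(i < N) c i * (\sum_(s : {ffun 'I_n -> bool}) expR (edot (w + sgnv s) (u i)))))).
  rewrite mulr_sumr ler_sum // => i _; rewrite ger0_norm ?c0 // -/(u i) -/(c i) mulrCA -mulrA ler_wpM2l //.
  have -> : \sum_s expR (edot (w + sgnv s) (u i)) = (\sum_(s : {ffun 'I_n -> bool}) expR (edot (sgnv s) (u i))) * expR (edot w (u i)).
    by rewrite mulr_suml; apply: eq_bigr => s _; rewrite edotDl expRD mulrC.
  rewrite mulrA ler_wpM2r ?expR_ge0 //.
  apply: (le_trans (pow_le_expR j (enorm_ge0 (u i)))).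
  by apply: ler_pM; rewrite ?exprn_ge0 ?expR_ge0 //; exact: expR_enorm_le.
rewrite ler_wpM2l ?exprn_ge0 //.
under eq_bigr do rewrite mulr_sumr.
rewrite exchange_big /= ler_sum // => s _.
have ws : enorm (w + sgnv s) <= n%:R + 2.
  by rewrite (le_trans (enormD_le _ _)) // addrC lerD ?enorm_sgnv ?(ltW w2).
have := hk _ ws; rewrite kde_expsum // ler_pdivrMr // => h.
have e0 := expR_gt0 (- pi * enorm (w + sgnv s) ^+ 2).
have -> : \sum_i c i * expR (edot (w + sgnv s) (u i)) = (\sum_(i < N) N%:R^-1 *
    expR (- pi * enorm ((y i - q) *m Q^T) ^+ 2) * expR (edot (w + sgnv s) (u i))) / Nf.
  by rewrite mulr_suml; apply: eq_bigr => i _; rewrite /c; ring.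
rewrite ler_pdivrMr //.
rewrite -(ler_pM2l e0); apply: (le_trans h).
have -> : expR (- pi * enorm (w + sgnv s) ^+ 2) * (2 * expR (pi * (n%:R + 2) ^+ 2) * Nf) =
  2 * Nf * (expR (- pi * enorm (w + sgnv s) ^+ 2) * expR (pi * (n%:R + 2) ^+ 2)) by ring.
rewrite ler_peMr ?mulr_ge0 ?(ltW Nf0) //.
rewrite -expRD -[leLHS]expR0 ler_expR mulNr addrC subr_ge0 ler_wpM2l ?pi_ge0 // lerXn2r ?nnegrE ?enorm_ge0 //.
Qed.

Lemma Bk_sum k (U : set 'rV[R]_n) (B : R) (I : Type) (s : seq I) (f : I -> 'rV[R]_n -> R) : open U ->
  (forall i, Bk k U B (f i)) -> Bk k U ((size s)%:R * B) (fun x => \sum_(i <- s) f i x).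
Proof.
move=> oU hf; elim: s => [|i s IH].
  have -> : (fun x => \sum_(i <- [::]) f i x) = (fun=> 0) by apply/funext => x; rewrite big_nil.
  by rewrite mul0r ; have := Bk_cst k U 0; rewrite normr0.
have -> : (fun x => \sum_(j <- i :: s) f j x) = (fun x => f i x + \sum_(j <- s) f j x).
  by apply/funext => x; rewrite big_cons.
by rewrite /= -addn1 natrD mulrDl mul1r addrC; exact: Bk_add.
Qed.

Lemma Bk_sqr k (U : set 'rV[R]_n) r : open U -> (forall x, U x -> enorm x <= r) -> 0 <= r ->
  Bk k U (n%:R * (2 ^+ k * ((r + 1) * (r + 1)))) (fun x => enorm x ^+ 2).
Proof.
move=> oU Ur r0.
have -> : (fun x => enorm x ^+ 2) = (fun x : 'rV[R]_n => \sum_(i <- enum 'I_n) edot x (delta_mx 0 i) * edot x (delta_mx 0 i)).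
  by apply/funext => x; rewrite enorm_sqr big_enum; apply: eq_bigr => i _; rewrite edot_delta.
have -> : n%:R = (size (enum 'I_n))%:R :> R by rewrite size_enum_ord.
have r1 : 0 <= r + 1 by rewrite addr_ge0.
by apply: Bk_sum => // i; apply: Bk_mul => //; have := @Bk_lin R n k U (delta_mx 0 i) r oU Ur r0; rewrite enorm_delta mulr1.
Qed.

Lemma kde_local_bounds (k : nat) (c : R) : 0 < c -> exists2 K, 0 <= K &
  forall N (y : 'I_N -> 'rV[R]_n) q Q Nf, Q *m Q^T = 1%:M -> 0 < Nf ->
  (forall w, enorm w <= n%:R + 2 -> kde y (q + w *m Q) / Nf <= 2) ->
  (forall w, enorm w < 2 -> c <= kde y (q + w *m Q) / Nf) ->
  Bk k (eball 2) K (fun w => - ln (kde y (q + w *m Q)) + ln Nf).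
Proof.
move=> c0; pose B : R := k.+1%:R ^+ k * (\sum_(s : {ffun 'I_n -> bool}) 2 * expR (pi * (n%:R + 2) ^+ 2)).
have B0 : 0 <= B by rewrite mulr_ge0 ?exprn_ge0 // sumr_ge0 // => s _; rewrite mulr_ge0 ?expR_ge0.
have [B' B'0 hln] := @Bk_ln R n k B c B0 c0.
have o2 : open (@eball R n 2) by apply: open_eball0.
have e2 (x : 'rV[R]_n) : eball 2 x -> enorm x <= 2 by move=> /ltW.
pose A : R := n%:R * (2 ^+ k * ((2 + 1) * (2 + 1))).
have hsq : Bk k (eball 2) A (fun x : 'rV[R]_n => enorm x ^+ 2) by apply: Bk_sqr.
exists (`|pi| * A + `|-1| * B'); first by rewrite addr_ge0 // mulr_ge0 // /A; nneg.
move=> N y q Q Nf QQ Nf0 hu hl.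
pose a i := N%:R^-1 * expR (- pi * enorm ((y i - q) *m Q^T) ^+ 2) / Nf.
pose u i := (2 * pi) *: ((y i - q) *m Q^T).
pose S w := \sum_(i < N) a i * expR (edot w (u i)).
have SE w : kde y (q + w *m Q) / Nf = expR (- pi * enorm w ^+ 2) * S w.
  rewrite kde_expsum // -mulrA; congr (_ * _); rewrite mulr_suml; apply: eq_bigr => i _.
  by rewrite /a -/(u i); ring.
have hS : Bk k (eball 2) B S.
  by apply: Bk_expsum => x x2 j jk; exact: (kde_moments QQ Nf0 hu).
have cS x : eball 2 x -> c <= S x.
  move=> x2; apply: (le_trans (hl _ x2)); rewrite SE.
  have S0 : 0 <= S x by apply: sumr_ge0 => i _; rewrite mulr_ge0 ?expR_ge0 // divr_ge0 ?(ltW Nf0) // mulr_ge0 ?invr_ge0 ?expR_ge0.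
  by rewrite ler_piMl // -expR0 ler_expR mulNr oppr_le0 mulr_ge0 ?pi_ge0 ?sqr_ge0.
have hL := hln _ _ o2 hS cS.
have hG := Bk_add o2 (Bk_scale pi o2 hsq) (Bk_scale (-1) o2 hL).
apply: (Bk_ext o2) hG => x x2.
have K0 : 0 < kde y (q + x *m Q) by have := lt_le_trans c0 (hl _ x2); rewrite pmulr_lgt0 // invr_gt0.
have Sx : 0 < S x := lt_le_trans c0 (cS _ x2).
have : ln (kde y (q + x *m Q) / Nf) = - pi * enorm x ^+ 2 + ln (S x).
  by rewrite SE lnM ?posrE ?expR_gt0 // expRK.
rewrite lnM ?posrE ?invr_gt0 // lnV ?posrE // => h.
have -> : ln (S x) = ln (kde y (q + x *m Q)) - ln Nf + pi * enorm x ^+ 2 by rewrite h; ring.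
by ring.
Qed.

End LocalKde.

(** * Closeness to the squared distance in tangent frames *)

Section LocalModel.
Context {R : realType}.

Lemma ln_dist (c s t : R) : 0 < c -> c <= s -> c <= t -> `|ln t - ln s| <= `|t - s| / c.
Proof.
move=> c0; have half (s1 t1 : R) : c <= s1 -> c <= t1 -> ln t1 - ln s1 <= `|t1 - s1| / c.
  move: s1 t1 => {s t} s t cs ct; have s0 := lt_le_trans c0 cs; have t0 := lt_le_trans c0 ct.
  rewrite -ln_div ?posrE //; have -> : t / s = 1 + (t - s) / s by field; rewrite gt_eqF.
  apply: (@le_trans _ _ ((t - s) / s)).
    apply: le_ln1Dx; have -> : (t - s) / s = t / s - 1 by field; rewrite gt_eqF.
    by have : 0 < t / s by [exact: divr_gt0]; lra.
  apply: (@le_trans _ _ (`|t - s| / s)); first by rewrite ler_wpM2r ?ler_norm // invr_ge0 ltW.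
  by rewrite ler_wpM2l // lef_pV2.
by move=> cs ct; rewrite ler_norml half // lerNl opprB distrC half.
Qed.

Lemma sqr_dist (a b e : R) : 0 <= a -> a <= 2 -> 0 <= b -> b <= 2 -> a <= b + e -> b <= a + e -> `|a ^+ 2 - b ^+ 2| <= 4 * e.
Proof.
move=> a0 a2 b0 b2 ab ba; have -> : a ^+ 2 - b ^+ 2 = (a + b) * (a - b) by ring.
rewrite normrM ger0_norm ?addr_ge0 //; apply: ler_pM; rewrite ?addr_ge0 //; first lra.
by rewrite ler_norml; apply/andP; split; lra.
Qed.

Section FrameDist.
Context {d m : nat} {tau : R} {M : set 'rV[R]_(d + m)}.
Hypothesis gM : good_mfd tau M.

(** Go first along the normal coordinates to the tangent space, then from there to [M] by
    [tangent_dist]. *)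
Lemma frame_dist_le q Q (w : 'rV[R]_(d + m)) : M q -> tangent_frame M q Q ->
  mdist M (q + w *m Q) <= enorm (rsubmx w) + 3 * enorm (lsubmx w) ^+ 2 / tau.
Proof.
move=> Mq fQ; have [QQ _] := fQ; have [tau0 /compact_closed_row cM _ _] := gM.
have M0 : M !=set0 by exists q.
apply: (le_trans (mdist_lip _ (q + row_mx (lsubmx w) 0 *m Q) cM M0)).
have -> : q + w *m Q - (q + row_mx (lsubmx w) 0 *m Q) = row_mx 0 (rsubmx w) *m Q.
  rewrite -{1}[w]hsubmxK opprD addrACA subrr add0r -mulmxBl; congr (_ *m _).
  by rewrite opp_row_mx add_row_mx subrr oppr0 addr0.
rewrite (enorm_orthmx QQ) enorm_row_0mx addrC lerD2l.
have [x0|xn0] := eqVneq (lsubmx w) 0.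
  rewrite x0 row_mx0 mul0mx addr0 (le_trans (mdist_le _ cM Mq)) //.
  by rewrite subrr !enorm0 expr0n /= mulr0 mul0r.
have a0 := enorm_gt0 xn0; set a := enorm (lsubmx w) in a0 *.
pose v : 'rV[R]_(d + m) := row_mx (a^-1 *: lsubmx w) 0 *m Q.
have Tv : tangent M q v by rewrite (tangentP v fQ) /v nc_row_mx.
have v1 : enorm v = 1.
  by rewrite (enorm_orthmx QQ) enorm_row_mx0 enormZ ger0_norm ?invr_ge0 ?(ltW a0) // mulVf // gt_eqF.
have E : row_mx (lsubmx w) 0 *m Q = a *: v; last first.
  rewrite E; have := tangent_dist gM Mq Tv v1 a0.
  by move=> h; exact: h.
by rewrite /v scalemxAl scale_row_mx scaler0 scalerA mulfV ?gt_eqF // scale1r.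
Qed.

Lemma frame_dist_ge q Q z (w : 'rV[R]_(d + m)) : M q -> tangent_frame M q Q ->
  nearest M (q + w *m Q) z ->
  enorm (rsubmx w) <= enorm (q + w *m Q - z) + 2 * enorm w ^+ 2 / tau.
Proof.
move=> Mq fQ [Mz hz]; have [QQ _] := fQ; have [tau0 _ _ _] := gM.
have wq : enorm (q + w *m Q - z) <= enorm w.
  by apply: (le_trans (hz q Mq)); rewrite addrC addKr enorm_orthmx.
have zq : enorm (z - q) <= 2 * enorm w.
  apply: (le_trans (enorm_triangle (q + w *m Q) _ _)); rewrite enormBC.
  have -> : q + w *m Q - q = w *m Q by vec.
  by rewrite (enorm_orthmx QQ) mulr_natl mulr2n lerD2r.
have h := nc_quadratic gM fQ Mq Mz.
have -> : rsubmx w = nc Q (q + w *m Q - z) + nc Q (z - q).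
  rewrite -ncD; have -> : q + w *m Q - z + (z - q) = w *m Q by vec.
  by rewrite /nc mulmx_orthK.
apply: (le_trans (enormD_le _ _)); apply: lerD; first exact: enorm_nc.
rewrite ler_pdivlMr // -(ler_pM2l (ltr0n R 2)); have -> : 2 * (enorm (nc Q (z - q)) * tau) = 2 * tau * enorm (nc Q (z - q)) by ring.
apply: (le_trans h); apply: (@le_trans _ _ ((2 * enorm w) ^+ 2)).
  by rewrite lerXn2r ?nnegrE ?mulr_ge0 ?enorm_ge0.
by have := sqr_ge0 (enorm w); lra.
Qed.

End FrameDist.

(** The two facts about F in a frame on which everything else rests: uniform derivative bounds and
    C^0 closeness to the model. The radius 2, larger than [local_radius], leaves room for two
    interpolations. *)
Definition local_model d m kk (K eps : R) (G : 'rV[R]_(d + m) -> R) :=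
  Bk kk (eball 2) K G /\ forall w, enorm w < 2 -> `|G w - pi * enorm (rsubmx w) ^+ 2| <= eps.

Lemma scale_root6 (sigma : R) : 0 < sigma -> 0 <= scale sigma /\ scale sigma <= 3 * root6 sigma ^+ 6.
Proof.
move=> s0; rewrite /scale root6X // mulrC; split; first by rewrite mulr_ge0 ?sqrtr_ge0 // ltW.
rewrite ler_wpM2r ?(ltW s0) // -(ler_pXn2r (_ : (0 < 2)%N)) ?nnegrE ?sqrtr_ge0 //.
by rewrite sqr_sqrtr ?mulr_ge0 ?pi_ge0 //; have := pihalf_lt2 R; lra.
Qed.

Lemma kde_local_model d m kk : exists K C : R, [/\ 0 <= K, 0 <= C &
  forall tau, 0 < tau -> exists2 b1, 0 < b1 & forall sigma, 0 < sigma -> root6 sigma < b1 ->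
  forall (M : set 'rV[R]_(d + m)) N (y : 'I_N -> 'rV[R]_(d + m)) (t : R),
  good_mfd (tau / scale sigma) M ->
  (forall x z z', nearest M x z -> M z' -> enorm (x - z) <= (d + m)%:R + 2 ->
    let Nf := normalization d M t z' in
    0 < Nf /\ `|kde y x / Nf - expR (- pi * enorm (x - z) ^+ 2)| <= root6 sigma ^+ 3) ->
  forall q Q z', M q -> tangent_frame M q Q -> M z' ->
  local_model kk K (C * root6 sigma ^+ 3)
    (fun w => - ln (kde y (q + w *m Q)) + ln (normalization d M t z'))].
Proof.
(* Half the minimum of the Gaussian at distances up to 2: the normalized density stays above [c]
   once its error is below [c]. *)
pose c : R := expR (- pi * 2 ^+ 2) / 2.
have c0 : 0 < c by rewrite divr_gt0 ?expR_gt0.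
have [K K0 hK] := @kde_local_bounds R (d + m) kk c c0.
(* [c^-1] is a Lipschitz constant of [ln] above [c], and 200 exceeds 4 * 48, the bound for [pi]
   times the difference of the squared distances. *)
exists K, (c^-1 + 200); split=> //; first by rewrite addr_ge0 // invr_ge0 ltW.
move=> tau tau0; exists (Num.min 1 (Num.min (tau / 3) c)); first by rewrite !lt_min ltr01 c0 divr_gt0.
move=> sigma s0; rewrite !lt_min; set b := root6 sigma => /andP[b1 /andP[btau bc]] M N y t gM hM q Q z' Mq fQ Mz'.
have b0 : 0 < b by exact: root6_gt0.
have [_ sb] := scale_root6 s0; have sc0 := scale_gt0 s0.
have b31 : b ^+ 3 <= b by rewrite -[leRHS]expr1 ler_wiXn2l // ltW.
have [tau'0 /compact_closed_row cM _ _] := gM.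
have M0 : M !=set0 by exists q.
have itau : (tau / scale sigma)^-1 <= b ^+ 3.
  rewrite invfM invrK mulrC ler_pdivrMr // (le_trans sb) //.
  have -> : b ^+ 6 = b ^+ 3 * b ^+ 3 by rewrite -exprD.
  rewrite mulrCA ler_wpM2l ?exprn_ge0 ?(ltW b0) //; move: btau; rewrite ltr_pdivlMr //; lra.
have [Nf0 _] : 0 < normalization d M t z' /\ True.
  have [z hz] := nearest_exists q cM M0; split => //.
  have nq : nearest M q q by split => // a _; rewrite subrr enorm0 enorm_ge0.
  by have [] := hM _ _ z' nq Mz'; rewrite ?subrr ?enorm0 ?addr_ge0.
set Nf := normalization d M t z' in Nf0 *.
have [QQ _] := fQ.
have key w r : enorm w <= r -> r <= (d + m)%:R + 2 -> exists2 z, nearest M (q + w *m Q) z &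
    enorm (q + w *m Q - z) <= r /\ `|kde y (q + w *m Q) / Nf - expR (- pi * enorm (q + w *m Q - z) ^+ 2)| <= b ^+ 3.
  move=> wr rD; have [z hz] := nearest_exists (q + w *m Q) cM M0.
  have zr : enorm (q + w *m Q - z) <= r.
    by case: hz => _ /(_ q Mq) hz; rewrite (le_trans hz) // addrC addKr enorm_orthmx.
  by exists z => //; split => //; have [] := hM _ _ z' hz Mz' (le_trans zr rD).
have key2 w : enorm w < 2 -> exists2 z, nearest M (q + w *m Q) z & [/\ enorm (q + w *m Q - z) <= 2,
    2 * c <= expR (- pi * enorm (q + w *m Q - z) ^+ 2), c <= kde y (q + w *m Q) / Nf &
    `|kde y (q + w *m Q) / Nf - expR (- pi * enorm (q + w *m Q - z) ^+ 2)| <= b ^+ 3].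
  move=> w2; have [|z hz [z2 hk]] := key w 2 (ltW w2); first by rewrite lerDr.
  have ce : 2 * c <= expR (- pi * enorm (q + w *m Q - z) ^+ 2).
    rewrite /c mulrC divfK // ler_expR !mulNr lerN2 ler_wpM2l ?pi_ge0 //.
    by rewrite lerXn2r ?nnegrE ?enorm_ge0.
  exists z => //; split => //; move: hk; rewrite ler_norml => /andP[h1 _].
  by clear -h1 ce bc b31 c0; lra.
split.
  apply: hK => //.
    move=> w wD; have [z _ [_]] := key w _ wD (lexx _); rewrite ler_norml => /andP[_ h2].
    have e1 : expR (- pi * enorm (q + w *m Q - z) ^+ 2) <= 1.
      by rewrite -expR0 ler_expR mulNr oppr_le0 mulr_ge0 ?pi_ge0 ?sqr_ge0.
    by clear -h2 e1 b31 b1; lra.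
  by move=> w /key2[z _ []].
move=> w w2; have [z hz [z2 ce ck hk]] := key2 w w2.
have l1 : enorm (rsubmx w) <= 2 by rewrite (le_trans (enorm_rsubmx _)) // ltW.
have hD : `|enorm (q + w *m Q - z) ^+ 2 - enorm (rsubmx w) ^+ 2| <= 4 * (12 * b ^+ 3).
  have w4 : enorm w ^+ 2 <= 4.
    by have -> : 4 = 2 ^+ 2 :> R by [ring]; rewrite lerXn2r ?nnegrE ?enorm_ge0 // ltW.
  have lw4 : enorm (lsubmx w) ^+ 2 <= 4.
    by apply: le_trans w4; rewrite lerXn2r ?nnegrE ?enorm_ge0 // enorm_lsubmx.
  have hX a e : 0 <= a -> 0 <= e -> e <= 4 -> a * e / (tau / scale sigma) <= a * 4 * b ^+ 3.
    move=> a0 e0 e4; apply: ler_pM => //; first exact: mulr_ge0.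
      by rewrite invr_ge0 ltW.
    by rewrite ler_wpM2l.
  apply: sqr_dist; rewrite ?enorm_ge0 //.
    rewrite -(mdist_nearest hz) (le_trans (frame_dist_le gM w Mq fQ)) // lerD2l.
    by apply: (le_trans (hX _ _ _ _ lw4)); rewrite ?sqr_ge0 // le_eqVlt; apply/orP; left; apply/eqP; ring.
  rewrite (le_trans (frame_dist_ge gM Mq fQ hz)) // lerD2l.
  apply: (le_trans (hX _ _ _ _ w4)); rewrite ?sqr_ge0 //.
  by have := exprn_ge0 3 (ltW b0); clear; lra.
have kdeN : 0 < kde y (q + w *m Q) / Nf := lt_le_trans c0 ck.
have kde0 : 0 < kde y (q + w *m Q) by move: kdeN; rewrite pmulr_lgt0 // invr_gt0.
have hl := ln_dist c0 (_ : c <= expR (- pi * enorm (q + w *m Q - z) ^+ 2)) ck.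
have {}hl : `|ln (kde y (q + w *m Q)) - ln Nf + pi * enorm (q + w *m Q - z) ^+ 2| <= b ^+ 3 / c.
  have := hl _; rewrite ln_div ?posrE // expRK => hl'.
  have ce' : c <= expR (- pi * enorm (q + w *m Q - z) ^+ 2) by clear -ce c0; lra.
  rewrite -[pi * _]opprK -mulNr (le_trans (hl' ce')) //.
  by rewrite ler_wpM2r ?invr_ge0 ?(ltW c0).
have -> : - ln (kde y (q + w *m Q)) + ln Nf - pi * enorm (rsubmx w) ^+ 2 =
  - (ln (kde y (q + w *m Q)) - ln Nf + pi * enorm (q + w *m Q - z) ^+ 2) +
  pi * (enorm (q + w *m Q - z) ^+ 2 - enorm (rsubmx w) ^+ 2) by ring.
rewrite (le_trans (ler_normD _ _)) // [leRHS]mulrDl; apply: lerD; first by rewrite normrN [leRHS]mulrC.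
rewrite normrM ger0_norm ?pi_ge0 //.
apply: (@le_trans _ _ (4 * (4 * (12 * b ^+ 3)))).
  by apply: ler_pM; rewrite ?pi_ge0 //; have := pihalf_lt2 R; lra.
by have := exprn_ge0 3 (ltW b0); lra.
Qed.

End LocalModel.

(** * Taylor bounds, interpolation and symmetry of second derivatives *)

Section Taylor.
Context {R : realType} {n : nat}.
Implicit Types (f : 'rV[R]_n -> R) (x h u v : 'rV[R]_n).

Lemma enorm_le_coord u c : (forall i, `|u 0 i| <= c) -> enorm u <= n%:R * c.
Proof.
move=> hu; rewrite [X in enorm X](row_sum_delta u) (le_trans (enorm_sum_le _ _ _)) //.
rewrite -[n in n%:R]card_ord -sum1_card natr_sum mulr_suml ler_sum // => i _.
by rewrite enormZ enorm_delta mulr1 mul1r.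
Qed.

Lemma eball_line r x h c : enorm x + enorm h < r -> `|c| <= 1 -> eball r (x + c *: h).
Proof.
move=> xr c1; apply: le_lt_trans xr; apply: (le_trans (enormD_le _ _)); rewrite lerD2l.
by rewrite enormZ ler_piMl // enorm_ge0.
Qed.

Lemma taylor0 r B f x h : Bk 1 (eball r) B f -> enorm x + enorm h < r ->
  `|f (x + h) - f x| <= B * enorm h.
Proof.
move=> [_ /(_ h)[df [bf _]]] xr.
have [c] : exists2 c, `|c| <= `|1 : R| & f (x + 1 *: h) - f x = 1 * 'D_h f (x + c *: h).
  by apply: mvt_dir => c; rewrite normr1 => c1; apply: df; exact: eball_line.
rewrite normr1 scale1r mul1r => c1 ->.
by have [] := bf _ (eball_line xr c1).
Qed.

Lemma taylor1 r B f x h : Bk 2 (eball r) B f -> enorm x + enorm h < r ->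
  `|f (x + h) - f x - 'D_h f x| <= B * enorm h ^+ 2.
Proof.
move=> [_ /(_ h)[df bf]] xr.
have [c] : exists2 c, `|c| <= `|1 : R| & f (x + 1 *: h) - f x = 1 * 'D_h f (x + c *: h).
  by apply: mvt_dir => c; rewrite normr1 => c1; apply: df; exact: eball_line.
rewrite normr1 scale1r mul1r => c1 ->.
have ch : enorm (c *: h) <= enorm h by rewrite enormZ ler_piMl // enorm_ge0.
have xr' : enorm x + enorm (c *: h) < r by apply: le_lt_trans xr; rewrite lerD2l.
apply: (le_trans (taylor0 bf xr')); rewrite expr2 mulrA; apply: ler_wpM2l => //.
have xr0 : eball r x by apply: le_lt_trans xr; rewrite lerDl enorm_ge0.
by have [_ b1] := bf.1 _ xr0; exact: le_trans b1.
Qed.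

(** Landau's interpolation: over a step [Num.sqrt eps] the difference quotient is at most
    [2 * Num.sqrt eps], and the derivative varies by at most [B * Num.sqrt eps]. *)
Lemma derive_small r B eps f x v : Bk 2 (eball r) B f -> (forall y, enorm y < r -> `|f y| <= eps) ->
  enorm v = 1 -> 0 < eps -> enorm x + Num.sqrt eps < r -> `|'D_v f x| <= (2 + B) * Num.sqrt eps.
Proof.
move=> [_ /(_ v)[df bf]] fe v1 e0; set h := Num.sqrt eps => xr.
have h0 : 0 < h by rewrite sqrtr_gt0.
have hh : eps = h ^+ 2 by rewrite sqr_sqrtr // ltW.
have xv c : `|c| <= h -> enorm x + enorm (c *: v) < r.
  by move=> ch; apply: le_lt_trans xr; rewrite lerD2l enormZ v1 mulr1.
have xv' c : `|c| <= h -> eball r (x + c *: v).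
  by move=> /xv; apply: le_lt_trans; exact: enormD_le.
have [c] : exists2 c, `|c| <= `|h| & f (x + h *: v) - f x = h * 'D_v f (x + c *: v).
  by apply: mvt_dir => c; rewrite (ger0_norm (ltW h0)) => ch; apply: df; exact: xv'.
rewrite (ger0_norm (ltW h0)) => ch E.
have := taylor0 bf (xv _ ch); rewrite enormZ v1 !mulr1 => T.
have B0 : 0 <= B by have := normr_ge0 (f 0); have [_] := bf.1 _ (xv' _ ch); rewrite v1 mulr1 => b1 _; exact: le_trans b1.
have {}T : `|'D_v f (x + c *: v) - 'D_v f x| <= B * h by apply: (le_trans T); rewrite ler_wpM2l.
have f1 : `|f (x + h *: v)| <= eps by apply: fe; apply: xv'; rewrite ger0_norm // ltW.
have f2 : `|f x| <= eps by apply: fe; apply: le_lt_trans xr; rewrite lerDl ltW.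
have F : `|h * 'D_v f (x + c *: v)| <= 2 * h ^+ 2.
  by rewrite -E (le_trans (ler_normB _ _)) // -hh; clear -f1 f2; lra.
have {}F : `|'D_v f (x + c *: v)| <= 2 * h.
  by rewrite -(ler_pM2l h0) -{1}(ger0_norm (ltW h0)) -normrM (le_trans F) // expr2 mulrCA.
have -> : 'D_v f x = 'D_v f (x + c *: v) - ('D_v f (x + c *: v) - 'D_v f x) by ring.
by rewrite (le_trans (ler_normB _ _)) // mulrDl lerD.
Qed.

Lemma le_small (a b : R) : (forall e, 0 < e -> a <= b + e) -> a <= b.
Proof. by move=> h; apply/ler_addgt0Pr => e /h. Qed.

Lemma derive_sum r B f x v : Bk 2 (eball r) B f -> eball r x ->
  'D_v f x = \sum_i v 0 i * 'D_(delta_mx 0 i) f x.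
Proof.
move=> bf xr; have [_ hk] := bf; have B0 := Bk_pos xr bf.
pose L := \sum_i v 0 i * 'D_(delta_mx 0 i) f x; have nv := enorm_ge0 v.
apply/eqP; rewrite -subr_eq0 -normr_le0; apply: le_small => e e0; rewrite add0r.
pose e1 := e / (2 * (enorm v + 1)).
have e10 : 0 < e1 by rewrite divr_gt0 // mulr_gt0 // ltr_wpDl.
have oU : open (@eball R n r) by apply: open_eball0.
have [] := @C1_scalar_expansion R n (eball r) f x oU xr _ _ e1 e10.
- by move=> i y yr; have [d1 _] := hk (delta_mx 0 i); exact: d1.
- by move=> i; have [_ [c1 _]] := hk (delta_mx 0 i); have [] := c1 _ xr.
move=> dl dl0 hC.
pose s := (r - enorm x) / (2 * (enorm v + 1)).
have s0 : 0 < s by rewrite divr_gt0 ?subr_gt0 // mulr_gt0 // ltr_wpDl.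
pose t := Num.min s (Num.min (dl / (2 * (enorm v + 1))) (e / (2 * (B * enorm v ^+ 2 + 1)))).
have B1 : 0 < B * enorm v ^+ 2 + 1 by rewrite ltr_wpDl // mulr_ge0 ?sqr_ge0.
have t0 : 0 < t by rewrite !lt_min s0 !divr_gt0 // mulr_gt0 // ltr_wpDl.
have ts : t <= s by rewrite ge_min lexx.
have td : t <= dl / (2 * (enorm v + 1)) by rewrite !ge_min lexx orbT.
have te : t <= e / (2 * (B * enorm v ^+ 2 + 1)) by rewrite !ge_min lexx !orbT.
have half (a : R) : 0 < a -> t <= a / (2 * (enorm v + 1)) -> t * enorm v < a.
  move=> a0; rewrite ler_pdivlMr ?mulr_gt0 ?ltr_wpDl // => h.
  by have : 0 < t * (enorm v + 2) by [rewrite mulr_gt0 // ltr_wpDl //]; have := mulr_ge0 (ltW t0) nv; clear -h t0; lra.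
have ntv : enorm (t *: v) = t * enorm v by rewrite enormZ ger0_norm // ltW.
have tr : enorm x + enorm (t *: v) < r.
  by have := half _ _ ts; rewrite subr_gt0 => /(_ xr); rewrite ntv; clear; lra.
have td' : enorm (t *: v) < dl by rewrite ntv half.
have E := hC _ td'; rewrite ntv in E.
have [c] : exists2 c, `|c| <= `|t| & f (x + t *: v) - f x = t * 'D_v f (x + c *: v).
  apply: mvt_dir => c ct; have [d1 _] := hk v; apply: d1; apply: le_lt_trans tr.
  by rewrite (le_trans (enormD_le _ _)) // lerD2l !enormZ ler_wpM2r.
rewrite (ger0_norm (ltW t0)) => ct F; rewrite F in E.
have [_ bv] := hk v.
have xc : enorm x + enorm (c *: v) < r.
  by apply: le_lt_trans tr; rewrite lerD2l !enormZ ler_wpM2r // (ger0_norm (ltW t0)).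
have := taylor0 bv xc; rewrite enormZ mulrCA -mulrA -expr2 => T.
have {}T : `|'D_v f (x + c *: v) - 'D_v f x| <= e / 2.
  apply: (le_trans T); apply: (@le_trans _ _ (t * (B * enorm v ^+ 2))).
    by rewrite ler_wpM2r // mulr_ge0 ?sqr_ge0.
  move: te; rewrite ler_pdivlMr ?mulr_gt0 // => te.
  by have := mulr_ge0 (ltW t0) (ltW B1); clear -te t0; lra.
have sumE : \sum_i (t *: v) 0 i * 'D_(delta_mx 0 i) f x = t * L.
  by rewrite mulr_sumr; apply: eq_bigr => i _; rewrite mxE mulrA.
rewrite sumE -mulrBr normrM (ger0_norm (ltW t0)) mulrCA (ler_pM2l t0) in E.
have {}E : `|'D_v f (x + c *: v) - L| <= e / 2.
  apply: (le_trans E); rewrite /e1 mulrAC ler_pdivrMr ?mulr_gt0 ?ltr_wpDl //; have := mulr_ge0 (ltW e0) nv.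
  by clear -e0; lra.
rewrite -/L; have -> : 'D_v f x - L = ('D_v f (x + c *: v) - L) - ('D_v f (x + c *: v) - 'D_v f x) by ring.
by rewrite (le_trans (ler_normB _ _)) //; clear -E T; lra.
Qed.

(** The second difference is symmetric in [u] and [v]. Two applications of the mean value theorem
    show that its quotient by [t ^ 2] tends to the mixed derivative taken in this order, hence also
    in the other. *)
Lemma schwarz_quotient r B f x u v t : Bk 3 (eball r) B f -> 0 <= t ->
  enorm x + t * (enorm u + enorm v) < r ->
  `|f (x + t *: u + t *: v) - f (x + t *: u) - f (x + t *: v) + f x - t ^+ 2 * 'D_v ('D_u f) x|
   <= t ^+ 3 * (B * enorm u * (enorm v * (enorm u + enorm u + enorm v))).
Proof.
move=> bf t0 xr; have [_ /(_ u)[du bu]] := bf; have [_ /(_ v)[dv bv]] := bu.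
have u0 := enorm_ge0 u; have v0 := enorm_ge0 v.
have B0 : 0 <= B by apply: (Bk_pos (x := x)) bf; apply: le_lt_trans xr; rewrite lerDl mulr_ge0 // addr_ge0.
have xc c c' : `|c| <= t -> `|c'| <= t -> eball r (x + c *: u + c' *: v).
  move=> ct ct'; apply: le_lt_trans xr; rewrite (le_trans (enormD_le _ _)) // mulrDr addrA lerD ?enormZ ?ler_wpM2r //.
  by rewrite (le_trans (enormD_le _ _)) // lerD2l enormZ ler_wpM2r.
have t0' : `|0 : R| <= t by rewrite normr0.
pose g := fun y => f (y + t *: v) - f y.
have dg c : `|c| <= t -> derivable (fun y => f (y + t *: v)) (x + c *: u) u /\
    'D_u (fun y => f (y + t *: v)) (x + c *: u) = 'D_u f (x + c *: u + t *: v).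
  move=> ct; apply: derive_of_line.
  have -> : (fun s => f (x + c *: u + s *: u + t *: v)) = (fun s => f (x + c *: u + t *: v + s *: u)).
    by apply/funext => s; rewrite addrAC.
  by apply: line_derive; apply: du; apply: xc => //; rewrite ger0_norm.
have df c : `|c| <= t -> derivable f (x + c *: u) u.
  by move=> ct; apply: du; have := xc c 0 ct t0'; rewrite scale0r addr0.
have [c] : exists2 c, `|c| <= `|t| & g (x + t *: u) - g x = t * 'D_u g (x + c *: u).
  apply: mvt_dir => c; rewrite (ger0_norm t0) => ct; apply: derivableB; last exact: df.
  by have [] := dg c ct.
rewrite (ger0_norm t0) => ct E.
have Dg : 'D_u g (x + c *: u) = 'D_u f (x + c *: u + t *: v) - 'D_u f (x + c *: u).
  by have [h1 h2] := dg c ct; rewrite -h2; apply: deriveB => //; exact: df.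
have xcu : enorm (x + c *: u) + enorm (t *: v) < r.
  apply: le_lt_trans xr; rewrite mulrDr addrA lerD //; last by rewrite enormZ ger0_norm.
  by rewrite (le_trans (enormD_le _ _)) // lerD2l enormZ ler_wpM2r.
have dd c' : `|c'| <= `|t| -> derivable ('D_u f) (x + c *: u + c' *: v) v.
  by rewrite (ger0_norm t0) => ct'; apply: dv; exact: xc.
have [c'] := @mvt_dir R n ('D_u f) (x + c *: u) v t dd.
rewrite (ger0_norm t0) => ct' E'.
have ncc : enorm (c *: u + c' *: v) <= t * (enorm u + enorm v).
  by rewrite (le_trans (enormD_le _ _)) // mulrDr !enormZ lerD // ler_wpM2r.
have := taylor0 bv (le_lt_trans (_ : enorm x + enorm (c *: u + c' *: v) <= _) xr).
rewrite lerD2l addrA => /(_ ncc) T.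
have -> : f (x + t *: u + t *: v) - f (x + t *: u) - f (x + t *: v) + f x = g (x + t *: u) - g x.
  by rewrite /g; ring.
rewrite E Dg E'.
have RR (a b : R) : t * (t * a) - t ^+ 2 * b = t ^+ 2 * (a - b) by ring.
have E3 (Z : R) : t ^+ 3 * Z = t ^+ 2 * (t * Z) by ring.
rewrite RR normrM ger0_norm ?exprn_ge0 // E3 ler_wpM2l ?exprn_ge0 //.
apply: (le_trans T); have Buv : 0 <= B * enorm u * enorm v by rewrite !mulr_ge0.
apply: (le_trans (ler_wpM2l Buv ncc)).
have -> : B * enorm u * enorm v * (t * (enorm u + enorm v)) = t * (B * enorm u * (enorm v * (enorm u + enorm v))) by ring.
rewrite !ler_wpM2l ?mulr_ge0 //.
by rewrite lerD2r lerDl.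
Qed.

Lemma schwarz r B f x u v : Bk 3 (eball r) B f -> eball r x -> 'D_u ('D_v f) x = 'D_v ('D_u f) x.
Proof.
move=> bf xr; apply/eqP; rewrite -subr_eq0 -normr_le0; apply: le_small => e e0; rewrite add0r.
have u0 := enorm_ge0 u; have v0 := enorm_ge0 v; have B0 := Bk_pos xr bf.
pose C1 := B * enorm u * (enorm v * (enorm u + enorm u + enorm v)).
pose C2 := B * enorm v * (enorm u * (enorm v + enorm v + enorm u)).
have C10 : 0 <= C1 by rewrite /C1 !mulr_ge0 // !addr_ge0.
have C20 : 0 <= C2 by rewrite /C2 !mulr_ge0 // !addr_ge0.
pose s := (r - enorm x) / (2 * (enorm u + enorm v + 1)).
have s0 : 0 < s by rewrite divr_gt0 ?subr_gt0 // mulr_gt0 // ltr_wpDl // addr_ge0.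
pose t := Num.min s (e / (C1 + C2 + 1)).
have C3 : 0 < C1 + C2 + 1 by rewrite ltr_wpDl // addr_ge0.
have t0 : 0 < t by rewrite lt_min s0 divr_gt0.
have ts : t <= s by rewrite ge_min lexx.
have te : t <= e / (C1 + C2 + 1) by rewrite ge_min lexx orbT.
have tr : enorm x + t * (enorm u + enorm v) < r.
  move: ts; rewrite ler_pdivlMr ?mulr_gt0 ?ltr_wpDl ?addr_ge0 // => ts.
  have h : 0 <= t * (enorm u + enorm v) by rewrite mulr_ge0 ?addr_ge0 // ltW.
  have -> : enorm x + t * (enorm u + enorm v) = (enorm x + t * (2 * (enorm u + enorm v + 1))) - (t * (enorm u + enorm v) + 2 * t) by ring.
  by clear -ts h t0; lra.
have h1 := schwarz_quotient bf (ltW t0) tr.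
have h2 : `|f (x + t *: u + t *: v) - f (x + t *: u) - f (x + t *: v) + f x - t ^+ 2 * 'D_u ('D_v f) x| <= t ^+ 3 * C2.
  have := @schwarz_quotient r B f x v u t bf (ltW t0); rewrite [enorm v + enorm u]addrC => /(_ tr).
  have -> : x + t *: v + t *: u = x + t *: u + t *: v by rewrite addrAC.
  rewrite /C2; set D1 := f (x + t *: u + t *: v) - f (x + t *: v) - f (x + t *: u) + f x.
  by have -> : D1 = f (x + t *: u + t *: v) - f (x + t *: u) - f (x + t *: v) + f x by rewrite /D1; ring.
have : t ^+ 2 * `|'D_u ('D_v f) x - 'D_v ('D_u f) x| <= t ^+ 2 * e.
  set D := f _ - _ - _ + _ in h1 h2.
  have -> : t ^+ 2 * `|'D_u ('D_v f) x - 'D_v ('D_u f) x| = `|(D - t ^+ 2 * 'D_v ('D_u f) x) - (D - t ^+ 2 * 'D_u ('D_v f) x)|.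
    rewrite -{1}(ger0_norm (exprn_ge0 2 (ltW t0))) -normrM; congr `|_|.
    have RR (D' a b c : R) : c * (a - b) = (D' - c * b) - (D' - c * a) by ring.
    exact: RR.
  apply: (le_trans (ler_normB _ _)); apply: (le_trans (lerD h1 h2)).
  rewrite -/C1 -mulrDr exprSr -mulrA ler_wpM2l ?exprn_ge0 ?(ltW t0) //.
  move: te; rewrite ler_pdivlMr // => te.
  by clear -te t0; lra.
by rewrite ler_pM2l // exprn_gt0.
Qed.

End Taylor.
Ltac vec_mx_tac := by apply/matrixP => ? ?; rewrite ?mxE; ring.

(** * Frobenius norm and approximate projections *)

Section Frobenius.
Context {R : realType}.

Definition fnorm p q (A : 'M[R]_(p, q)) := enorm (mxvec A).

Lemma fnormD p q (A B : 'M[R]_(p, q)) : fnorm (A + B) <= fnorm A + fnorm B.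
Proof. by rewrite /fnorm linearD; exact: enormD_le. Qed.

Lemma fnormN p q (A : 'M[R]_(p, q)) : fnorm (- A) = fnorm A.
Proof. by rewrite /fnorm linearN enormN. Qed.

Lemma fnormB p q (A B : 'M[R]_(p, q)) : fnorm (A - B) <= fnorm A + fnorm B.
Proof. by rewrite -(fnormN B); exact: fnormD. Qed.

Lemma fnormBC p q (A B : 'M[R]_(p, q)) : fnorm (A - B) = fnorm (B - A).
Proof. by rewrite -fnormN opprB. Qed.

Lemma fnormZ p q c (A : 'M[R]_(p, q)) : fnorm (c *: A) = `|c| * fnorm A.
Proof. by rewrite /fnorm linearZ /= enormZ. Qed.

Lemma fnorm_ge0 p q (A : 'M[R]_(p, q)) : 0 <= fnorm A.
Proof. exact: enorm_ge0. Qed.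

Lemma fnorm0_eq p q (A : 'M[R]_(p, q)) : fnorm A = 0 -> A = 0.
Proof. by move=> /enorm_eq0 /(congr1 vec_mx); rewrite mxvecK linear0. Qed.

Lemma edot_mxvec p q (A B : 'M[R]_(p, q)) : edot (mxvec A) (mxvec B) = \tr (A *m B^T).
Proof.
rewrite /edot /mxtrace (reindex _ (curry_mxvec_bij _ _)) /=.
transitivity (\sum_i \sum_j A i j * B i j).
  by rewrite pair_bigA /=; apply: eq_bigr => -[i j] _ /=; rewrite !mxvecE.
by apply: eq_bigr => i _; rewrite mxE; apply: eq_bigr => j _; rewrite mxE.
Qed.

Lemma fnorm_sqr p q (A : 'M[R]_(p, q)) : fnorm A ^+ 2 = \tr (A *m A^T).
Proof. by rewrite enorm_sqr edot_mxvec. Qed.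

Lemma tr_mul_le p q (A : 'M[R]_(p, q)) (B : 'M[R]_(q, p)) : \tr (A *m B) <= fnorm A * fnorm B^T.
Proof. by rewrite -[B in leLHS]trmxK -edot_mxvec edot_le. Qed.

Lemma fnorm_tr p q (A : 'M[R]_(p, q)) : fnorm A^T = fnorm A.
Proof. by rewrite /fnorm /enorm !edot_mxvec trmxK mxtrace_mulC. Qed.

Lemma tr_rows p q (A : 'M[R]_(p, q)) : \tr (A *m A^T) = \sum_i enorm (row i A) ^+ 2.
Proof.
apply: eq_bigr => i _; rewrite enorm_sqr edotE mxE [RHS]mxE.
by apply: eq_bigr => j _; rewrite !mxE.
Qed.

Lemma fnorm_mulr_le p q r (A : 'M[R]_(p, q)) (B : 'M[R]_(q, r)) C : 0 <= C ->
  (forall v : 'rV[R]_q, enorm (v *m B) <= C * enorm v) -> fnorm (A *m B) <= C * fnorm A.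
Proof.
move=> C0 hB; rewrite -(ler_pXn2r (_ : (0 < 2)%N)) ?nnegrE ?mulr_ge0 ?fnorm_ge0 //.
rewrite exprMn !fnorm_sqr !tr_rows mulr_sumr ler_sum // => i _.
by rewrite -exprMn row_mul lerXn2r ?nnegrE ?mulr_ge0 ?enorm_ge0.
Qed.

Lemma enorm_mul_fnorm p q (v : 'rV[R]_p) (A : 'M[R]_(p, q)) : enorm (v *m A) <= fnorm A * enorm v.
Proof.
rewrite -(ler_pXn2r (_ : (0 < 2)%N)) ?nnegrE ?mulr_ge0 ?enorm_ge0 ?fnorm_ge0 //.
have := tr_rows A^T; rewrite trmxK mxtrace_mulC => E.
rewrite exprMn fnorm_sqr E mulr_suml enorm_sqr ler_sum // => j _.
have -> : (v *m A) 0 j = edot v (row j A^T).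
  by rewrite edotE mxE [RHS]mxE; apply: eq_bigr => i _; rewrite !mxE.
rewrite -expr2 -exprMn -real_normK ?num_real // lerXn2r ?nnegrE ?mulr_ge0 ?enorm_ge0 //.
by rewrite mulrC edot_norm_le.
Qed.

Lemma fnormM p q r (A : 'M[R]_(p, q)) (B : 'M[R]_(q, r)) : fnorm (A *m B) <= fnorm A * fnorm B.
Proof. by rewrite mulrC; apply: fnorm_mulr_le => [|v]; [exact: fnorm_ge0|exact: enorm_mul_fnorm]. Qed.

Lemma fnorm_le_coord p q (A : 'M[R]_(p, q)) c : (forall i j, `|A i j| <= c) -> fnorm A <= (p * q)%:R * c.
Proof.
move=> h; rewrite /fnorm [X in enorm X](row_sum_delta (mxvec A)) (le_trans (enorm_sum_le _ _ _)) //.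
rewrite -[X in X%:R * _]card_ord -sum1_card natr_sum mulr_suml ler_sum // => k _.
by rewrite enormZ enorm_delta mulr1 mul1r; case/mxvec_indexP: k => i j; rewrite mxvecE.
Qed.

Section Projections.
Context {n : nat}.
Implicit Types A B E H P T D : 'M[R]_n.

Definition oproj P := P^T = P /\ P *m P = P.

Lemma oproj_contr P (v : 'rV[R]_n) : oproj P -> enorm (v *m P) <= enorm v.
Proof.
move=> [Ps PP]; have := enorm_sqr (v *m P); rewrite edot_mulmx Ps -mulmxA PP edotC => h.
have := edot_le (v *m P) v; rewrite -h expr2.
have [->|x0] := eqVneq (enorm (v *m P)) 0; first by rewrite enorm_ge0.
by rewrite ler_pM2l // lt_def x0 enorm_ge0.
Qed.

Lemma fnorm_oprojr P p (A : 'M[R]_(p, n)) : oproj P -> fnorm (A *m P) <= fnorm A.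
Proof. by move=> oP; rewrite -[leRHS]mul1r; apply: fnorm_mulr_le => // v; rewrite mul1r oproj_contr. Qed.

Lemma fnorm_oprojl P p (A : 'M[R]_(n, p)) : oproj P -> fnorm (P *m A) <= fnorm A.
Proof.
by move=> oP; rewrite -fnorm_tr trmx_mul (proj1 oP) (le_trans (fnorm_oprojr _ oP)) // fnorm_tr.
Qed.

Lemma fnorm_oproj2 P P' A : oproj P -> oproj P' -> fnorm (P *m A *m P') <= fnorm A.
Proof. by move=> oP oP'; rewrite (le_trans (fnorm_oprojr _ oP')) // fnorm_oprojl. Qed.

Lemma oprojC P : oproj P -> oproj (1%:M - P).
Proof.
move=> [Ps PP]; split; first by rewrite linearB /= trmx1 Ps.
by rewrite mulmxBr mulmx1 mulmxBl mul1mx PP subrr subr0.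
Qed.

Definition mcomm A B := A *m B - B *m A.

(** As [A] and [B] commute with [H], the block of the commutator is a Sylvester operator applied to
    the block of [D], and this can be inverted when [H] has separated spectra on the two ranges. *)
Lemma comm_block A B H D : A *m A = A -> B *m B = B -> A *m H = H *m A -> B *m H = H *m B ->
  A *m mcomm D H *m B = (A *m D *m B) *m (H *m B) - (H *m A) *m (A *m D *m B).
Proof.
move=> AA BB AH BH; rewrite /mcomm mulmxBr mulmxBl; congr (_ - _).
  by rewrite -BH -[in RHS]mulmxA !mulmxA -[A *m D *m B *m B]mulmxA BB -!mulmxA -BH.
by rewrite -AH !mulmxA -[A *m H *m A]mulmxA -AH mulmxA AA.
Qed.

(** On a block complementary to [P] the difference [T - P] is just [T], and
    [T = T *m T - (T *m T - T)] expresses it by a square and the defect of idempotency. *)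
Lemma idem_block A P T : A *m A = A -> A *m P = 0 -> P *m A = 0 ->
  A *m (T - P) *m A = A *m ((T - P) *m (T - P)) *m A - A *m (T *m T - T) *m A.
Proof.
move=> AA AP PA; have AT : A *m (T - P) = A *m T by rewrite mulmxBr AP subr0.
have TA : (T - P) *m A = T *m A by rewrite mulmxBl PA subr0.
have -> : A *m ((T - P) *m (T - P)) *m A = A *m T *m (T *m A) by rewrite mulmxA AT -mulmxA TA.
rewrite AT mulmxBr mulmxBl !mulmxA.
by rewrite opprB addrCA subrr addr0.
Qed.

(* With D = T - P, the off-diagonal blocks of D are controlled by the
   commutator, since H is close to 2 pi on the range of P and to 0 on its
   kernel; the diagonal ones are controlled by T^2 - T. *)
Lemma approx_projection P H T (kappa e : R) : oproj P -> P *m H = H *m P ->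
  fnorm (H *m P - (2 * pi) *: P) <= kappa -> fnorm (H *m (1%:M - P)) <= kappa -> kappa <= 1 ->
  fnorm (T - P) <= 1 / 8 -> fnorm (T *m T - T) <= e -> fnorm (mcomm T H) <= e ->
  fnorm (T - P) <= 4 * e.
Proof.
move=> oP PH h1 h2 k1 T8 e1 e2; have oQ := oprojC oP.
set Q := 1%:M - P in h2 oQ *; set D := T - P in T8 *.
have [_ PP] := oP; have [_ QQ] := oQ.
have QH : Q *m H = H *m Q by rewrite mulmxBl mulmxBr mulmx1 mul1mx PH.
have PQ : P *m Q = 0 by rewrite mulmxBr mulmx1 PP subrr.
have QP : Q *m P = 0 by rewrite mulmxBl mul1mx PP subrr.
have e2' : fnorm (mcomm D H) <= e.
  by rewrite /mcomm mulmxBl mulmxBr PH opprB addrA subrK.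
have pi2 := pi_ge2 R; have D0 := fnorm_ge0 D.
have hX : fnorm (P *m D *m Q) <= e / 2.
  set X := P *m D *m Q; have X0 := fnorm_ge0 X.
  have E : (2 * pi) *: X = X *m (H *m Q) - (H *m P - (2 * pi) *: P) *m X - P *m mcomm D H *m Q.
    rewrite comm_block // -/X mulmxBl -scalemxAl.
    have -> : P *m X = X by rewrite /X !mulmxA PP.
    by move: (X *m _) (_ *m X) => a b; rewrite opprB !addrA opprB addrAC -addrA; vec_mx_tac.
  have : fnorm ((2 * pi) *: X) <= 2 * fnorm X + e.
    rewrite E (le_trans (fnormB _ _)) // lerD //; last exact: le_trans (fnorm_oproj2 _ oP oQ) e2'.
    rewrite (le_trans (fnormB _ _)) // [leRHS]mulr_natl [leRHS]mulr2n lerD // (le_trans (fnormM _ _)) //.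
      by rewrite ler_piMr // (le_trans h2).
    by rewrite ler_piMl // (le_trans h1).
  by rewrite fnormZ ger0_norm ?mulr_ge0 ?pi_ge0 // => h; have := ler_wpM2r X0 pi2; clear -h X0; lra.
have hY : fnorm (Q *m D *m P) <= e / 2.
  set X := Q *m D *m P; have X0 := fnorm_ge0 X.
  have E : (2 * pi) *: X = Q *m mcomm D H *m P - X *m (H *m P - (2 * pi) *: P) + (H *m Q) *m X.
    rewrite comm_block // -/X [X *m (H *m P - _)]mulmxBr -scalemxAr.
    have -> : X *m P = X by rewrite /X -!mulmxA PP.
    by move: (X *m _) (_ *m X) => a b; vec_mx_tac.
  have : fnorm ((2 * pi) *: X) <= e + fnorm X + fnorm X.
    rewrite E (le_trans (fnormD _ _)) // lerD //; last first.
      by rewrite (le_trans (fnormM _ _)) // ler_piMl // (le_trans h2).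
    rewrite (le_trans (fnormB _ _)) // lerD //; first exact: le_trans (fnorm_oproj2 _ oQ oP) e2'.
    by rewrite (le_trans (fnormM _ _)) // ler_piMr // (le_trans h1).
  by rewrite fnormZ ger0_norm ?mulr_ge0 ?pi_ge0 // => h; have := ler_wpM2r X0 pi2; clear -h X0; lra.
have DD : fnorm (D *m D) <= fnorm D / 8.
  by rewrite (le_trans (fnormM _ _)) // ler_wpM2l // -[8^-1]mul1r.
have hW : fnorm (Q *m D *m Q) <= fnorm D / 8 + e.
  rewrite idem_block // (le_trans (fnormB _ _)) // lerD //; first exact: le_trans (fnorm_oproj2 _ oQ oQ) DD.
  exact: le_trans (fnorm_oproj2 _ oQ oQ) e1.
have hZ : fnorm (P *m D *m P) <= fnorm D / 8 + e.
  have DE : (1%:M - T) - Q = - D by rewrite /Q /D; vec_mx_tac.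
  have := @idem_block P Q (1%:M - T) PP PQ QP; rewrite DE !(mulmxN, mulNmx) opprK.
  have -> : (1%:M - T) *m (1%:M - T) - (1%:M - T) = T *m T - T.
    rewrite mulmxBr mulmx1 mulmxBl mul1mx; move: (T *m T) => TT; vec_mx_tac.
  move=> E; rewrite -fnormN E (le_trans (fnormB _ _)) // lerD //; first exact: le_trans (fnorm_oproj2 _ oP oP) DD.
  exact: le_trans (fnorm_oproj2 _ oP oP) e1.
have : fnorm D <= fnorm (P *m D *m P) + fnorm (P *m D *m Q) + (fnorm (Q *m D *m P) + fnorm (Q *m D *m Q)).
  have E : D = (P *m D *m P + P *m D *m Q) + (Q *m D *m P + Q *m D *m Q).
    by rewrite -!mulmxDr subrKC !mulmx1 -mulmxDl subrKC mul1mx.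
  rewrite {1}E (le_trans (fnormD _ _)) // lerD //; exact: fnormD.
by clear -hX hY hW hZ; lra.
Qed.

End Projections.

End Frobenius.

(** * Spectral theorem and stability of spectral projections *)

Section SpectralProjection.
Context {R : realType}.

Lemma enorm_row_orth p q (A : 'M[R]_(p, q)) i : A *m A^T = 1%:M -> enorm (row i A) ^+ 2 = 1.
Proof.
move=> AA; have e := congr1 (fun B : 'M[R]_p => B i i) AA; rewrite !mxE eqxx in e.
by rewrite enorm_sqr -[RHS]e; apply: eq_bigr => j _; rewrite !mxE.
Qed.

Section Facts.
Context {n : nat} (m : nat).
Implicit Types H P Q E A B C : 'M[R]_n.

Definition first_mx : 'rV[R]_n := \row_(i < n) ((i < m)%N)%:R.

Lemma first_projE Q : \sum_(i < n | (i < m)%N) (row i Q)^T *m row i Q = Q^T *m diag_mx first_mx *m Q.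
Proof.
apply/matrixP => a b; rewrite summxE mul_mx_diag mxE big_mkcond /=; apply: eq_bigr => i _.
rewrite !mxE; case: ltnP => _; last by rewrite mulr0 mul0r.
by rewrite big_ord1 !mxE mulr1.
Qed.

Lemma diag_first_idem : diag_mx first_mx *m diag_mx first_mx = diag_mx first_mx.
Proof.
rewrite mulmx_diag; congr diag_mx; apply/rowP => i; rewrite !mxE.
by case: ltnP => _; rewrite ?mulr1 ?mulr0.
Qed.

Lemma eigen_expand Q H l : Q *m Q^T = 1%:M -> Q *m H = diag_mx l *m Q -> H = Q^T *m diag_mx l *m Q.
Proof. by move=> QQ QH; rewrite -mulmxA -QH mulmxA (mulmx1C QQ) mul1mx. Qed.

Lemma is_Pi_hi_oproj H P : is_Pi_hi m H P -> oproj P /\ P *m H = H *m P.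
Proof.
move=> [Q [l [QQ QH _ ->]]]; rewrite first_projE (eigen_expand QQ QH).
have K (A B : 'M[R]_n) : Q^T *m A *m Q *m (Q^T *m B *m Q) = Q^T *m (A *m B) *m Q.
  by rewrite !mulmxA -[_ *m Q *m Q^T]mulmxA QQ mulmx1.
split; last by rewrite !K [diag_mx l *m _]diag_mxC.
by split; [rewrite !trmx_mul trmxK tr_diag_mx mulmxA|rewrite K diag_first_idem].
Qed.

Lemma sum_first : (m <= n)%N -> \sum_(i < n) first_mx 0 i = m%:R.
Proof.
move=> mn; under eq_bigr do rewrite mxE.
rewrite -natr_sum; congr (_%:R); rewrite -(big_mkcond (fun i : 'I_n => (i < m)%N) (fun=> 1%N)).
by rewrite (big_ord_narrow mn) sum1_card card_ord.
Qed.

Lemma tr_conj_diag Q l E : Q *m Q^T = 1%:M -> oproj E ->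
  \tr (Q^T *m diag_mx l *m Q *m E) = \sum_i l 0 i * enorm (row i Q *m E) ^+ 2.
Proof.
move=> QQ [Es EE]; rewrite -!mulmxA mxtrace_mulC -mulmxA; apply: eq_bigr => i _.
rewrite mul_diag_mx mxE; congr (_ * _).
rewrite enorm_sqr edot_mulmx Es -mulmxA EE edotE trmx_mul Es -!mulmxA mxE [RHS]mxE.
apply: eq_bigr => j _; rewrite !mxE; congr (_ * _).
by apply: eq_bigr => k _; rewrite !mxE.
Qed.

(** Ky Fan's maximum principle: the trace of [H *m E] is a sum of eigenvalues with weights in [0, 1]
    of total [m], largest when the weights sit on the first [m] eigenvalues. *)
Lemma ky_fan H P E : (m <= n)%N -> is_Pi_hi m H P -> oproj E -> \tr E = m%:R -> \tr (H *m E) <= \tr (H *m P) /\ \tr P = m%:R.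
Proof.
move=> mn [Q [l [QQ QH ls ->]]] oE tE; rewrite first_projE.
have tP : \tr (Q^T *m diag_mx first_mx *m Q) = m%:R.
  by rewrite -mulmxA mxtrace_mulC -mulmxA QQ mulmx1 mxtrace_diag sum_first.
split=> //; have HE := eigen_expand QQ QH.
have -> : \tr (H *m (Q^T *m diag_mx first_mx *m Q)) = \sum_i l 0 i * first_mx 0 i.
  rewrite {1}HE !mulmxA -[_ *m Q *m Q^T]mulmxA QQ mulmx1 -[_ *m Q]mulmxA.
  rewrite -[Q^T *m _ *m _]mulmxA mxtrace_mulC mulmxA -!mulmxA QQ mulmx1 mulmx_diag mxtrace_diag.
  by apply: eq_bigr => i _; rewrite mxE.
rewrite {1}HE tr_conj_diag //.
have e1 i : enorm (row i Q *m E) ^+ 2 <= 1.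
  have r1 := enorm_row_orth i QQ.
  by rewrite -r1 lerXn2r ?nnegrE ?enorm_ge0 // oproj_contr.
have se : \sum_i enorm (row i Q *m E) ^+ 2 = m%:R.
  rewrite -tE; have := @tr_conj_diag Q (const_mx 1) E QQ oE.
  rewrite diag_const_mx mulmx1 (mulmx1C QQ) mul1mx => ->.
  by apply: eq_bigr => i _; rewrite mxE mul1r.
(* With [t] the m-th eigenvalue, subtracting [t] times the weights, which have the same total on
   both sides, makes the comparison termwise. For [m = 0] all the weights vanish. *)
have [t ht] : exists t, forall i, l 0 i * enorm (row i Q *m E) ^+ 2 - t * enorm (row i Q *m E) ^+ 2
   <= l 0 i * first_mx 0 i - t * first_mx 0 i.
  have [m0|m0] := posnP m.
    exists 0 => i; rewrite !mul0r !subr0; have : \sum_i enorm (row i Q *m E) ^+ 2 = 0 by rewrite se m0.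
    move=> /eqP; rewrite psumr_eq0 ?sqr_ge0 // => [/allP/(_ i (mem_index_enum i))/eqP->|j _]; last exact: sqr_ge0.
    by rewrite mxE m0 ltn0.
  have mn' : (m.-1 < n)%N by rewrite prednK.
  exists (l 0 (Ordinal mn')) => i; rewrite -!mulrBl mxE; case: ltnP => im.
    rewrite mulr1 ler_piMr ?e1 // subr_ge0 ls //=; lia.
  rewrite mulr0 mulr_le0_ge0 ?sqr_ge0 // subr_le0 ls //=; lia.
have : \sum_i (l 0 i * enorm (row i Q *m E) ^+ 2 - t * enorm (row i Q *m E) ^+ 2) <=
  \sum_i (l 0 i * first_mx 0 i - t * first_mx 0 i) by exact: ler_sum.
by rewrite !sumrB -!mulr_sumr se sum_first // lerD2r.
Qed.

(** [pi * |P - E| ^ 2] is the trace of [2 * pi * E * (E - P)]. Maximality of [P] makes the trace of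
    [H * (E - P)] nonpositive, and Cauchy-Schwarz bounds what is left, the trace of
    [(2 * pi * E - H) * (E - P)]. No spectral gap is assumed in advance. *)
Lemma Pi_hi_close H P E : (m <= n)%N -> is_Pi_hi m H P -> oproj E -> \tr E = m%:R ->
  pi * fnorm (P - E) <= fnorm (H - (2 * pi) *: E).
Proof.
move=> mn hP oE tE; have [hk tP] := ky_fan mn hP oE tE; have [[Ps PP] _] := is_Pi_hi_oproj hP.
have [Es EE] := oE; set x := fnorm (P - E); set y := fnorm _.
have x2 : x ^+ 2 = 2 * m%:R - 2 * \tr (E *m P).
  rewrite fnorm_sqr linearB /= Ps Es mulmxBl !mulmxBr PP EE !linearB /= tP tE [\tr (P *m E)]mxtrace_mulC.
  by ring.
have t1 : \tr ((2 * pi) *: E *m (E - P)) = pi * x ^+ 2.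
  by rewrite -scalemxAl linearZ /= mulmxBr EE linearB /= tE x2; ring.
have t2 : \tr ((2 * pi) *: E *m (E - P)) <= y * x.
  have -> : (2 * pi) *: E *m (E - P) = H *m (E - P) + ((2 * pi) *: E - H) *m (E - P).
    by rewrite -mulmxDl subrKC.
  rewrite linearD /= [\tr (H *m _)](_ : _ = \tr (H *m E) - \tr (H *m P)); last by rewrite mulmxBr linearB.
  have := tr_mul_le ((2 * pi) *: E - H) (E - P); rewrite fnorm_tr [fnorm (E - P)]fnormBC [fnorm (_ - H)]fnormBC -/x -/y.
  by clear -hk; lra.
have [x0|x0] := eqVneq x 0; first by rewrite x0 mulr0 fnorm_ge0.
rewrite -(ler_pM2r (_ : 0 < x)) ?lt_def ?x0 ?fnorm_ge0 // -mulrA -expr2 -t1 //.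
Qed.

Lemma Pi_hi_bands H P E kappa : (m <= n)%N -> is_Pi_hi m H P -> oproj E -> \tr E = m%:R ->
  fnorm (H - (2 * pi) *: E) <= kappa ->
  fnorm (H *m P - (2 * pi) *: P) <= 3 * kappa /\ fnorm (H *m (1%:M - P)) <= 3 * kappa.
Proof.
move=> mn hP oE tE hk; have hc := Pi_hi_close mn hP oE tE.
have [oP _] := is_Pi_hi_oproj hP; have [_ PP] := oP; have [_ EE] := oE; have oQ := oprojC oP.
have p2 := pi_ge2 R.
split.
  have -> : H *m P - (2 * pi) *: P = (H - (2 * pi) *: E) *m P + (2 * pi) *: ((E - P) *m P).
    by rewrite !mulmxBl PP -scalemxAl; move: (H *m P) (E *m P) => a b; vec_mx_tac.
  rewrite (le_trans (fnormD _ _)) //; apply: (@le_trans _ _ (kappa + 2 * kappa)); last by clear; lra.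
  rewrite lerD //; first exact: le_trans (fnorm_oprojr _ oP) hk.
  rewrite fnormZ ger0_norm ?mulr_ge0 ?pi_ge0 // -mulrA ler_wpM2l //.
  apply: le_trans hk; apply: le_trans hc; rewrite ler_wpM2l ?pi_ge0 //.
  by rewrite fnormBC [leRHS]fnormBC [leRHS]fnormBC fnorm_oprojr.
have -> : H *m (1%:M - P) = (H - (2 * pi) *: E) *m (1%:M - P) + (2 * pi) *: ((E - P) *m (1%:M - P)).
  rewrite !mulmxBl !mulmxBr !mulmx1 PP -!scalemxAl; move: (H *m P) (E *m P) => a b; vec_mx_tac.
rewrite (le_trans (fnormD _ _)) //; apply: (@le_trans _ _ (kappa + 2 * kappa)); last by clear; lra.
rewrite lerD //; first exact: le_trans (fnorm_oprojr _ oQ) hk.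
rewrite fnormZ ger0_norm ?mulr_ge0 ?pi_ge0 // -mulrA ler_wpM2l //.
apply: le_trans hk; apply: le_trans hc; rewrite ler_wpM2l ?pi_ge0 //.
by rewrite [leRHS]fnormBC fnorm_oprojr.
Qed.

(** Small enough for the bands of [Pi_hi_bands], of width [3 * kappa0], and for the projections to
    stay within 1/8 of one another, as [approx_projection] demands. *)
Definition kappa0 : R := 1 / 50.

Section Near.
Variable E : 'M[R]_n.
Hypotheses (mn : (m <= n)%N) (oE : oproj E) (tE : \tr E = m%:R).

Definition near_model H := fnorm (H - (2 * pi) *: E) <= kappa0.

Lemma near_Pi H P : near_model H -> is_Pi_hi m H P -> fnorm (P - E) <= kappa0 / 2.
Proof.
move=> nH hP; have := Pi_hi_close mn hP oE tE => h.
have p2 := pi_ge2 R; have := ler_wpM2r (fnorm_ge0 (P - E)) p2.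
by move: nH; rewrite /near_model => nH; clear -h nH; lra.
Qed.

Lemma near_approx H P T e : near_model H -> is_Pi_hi m H P -> fnorm (T - P) <= 1 / 8 ->
  fnorm (T *m T - T) <= e -> fnorm (mcomm T H) <= e -> fnorm (T - P) <= 4 * e.
Proof.
move=> nH hP T8 e1 e2; have [oP PH] := is_Pi_hi_oproj hP.
have [b1 b2] := Pi_hi_bands mn hP oE tE nH.
by apply: (approx_projection oP PH b1 b2) => //; rewrite /kappa0; lra.
Qed.

Lemma mcommBr A B C : mcomm A (B - C) = mcomm A B - mcomm A C :> 'M[R]_n.
Proof. rewrite /mcomm mulmxBr mulmxBl; move: (A *m B) (A *m C) (B *m A) (C *m A) => a b c e; vec_mx_tac. Qed.

Lemma mcomm_oproj A B : oproj A -> fnorm (mcomm A B) <= 2 * fnorm B.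
Proof.
move=> oA; rewrite /mcomm (le_trans (fnormB _ _)) // mulr_natl mulr2n lerD //.
  exact: fnorm_oprojl.
exact: fnorm_oprojr.
Qed.

(** [P2] is an exact projection commuting with [H2], so its commutator with [H1] is that with
    [H1 - H2]: it is an approximate spectral projection of [H1]. *)
Lemma Pi_hi_lip H1 H2 P1 P2 : near_model H1 -> near_model H2 -> is_Pi_hi m H1 P1 -> is_Pi_hi m H2 P2 ->
  fnorm (P1 - P2) <= 8 * fnorm (H1 - H2).
Proof.
move=> nH1 nH2 h1 h2; have [op1 c1] := is_Pi_hi_oproj h1; have [op2 c2] := is_Pi_hi_oproj h2.
have d12 : fnorm (P2 - P1) <= 1 / 8.
  have -> : P2 - P1 = (P2 - E) - (P1 - E) by vec_mx_tac.
  rewrite (le_trans (fnormB _ _)) //; have := near_Pi nH1 h1; have := near_Pi nH2 h2; rewrite /kappa0; lra.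
rewrite fnormBC; have -> : 8 * fnorm (H1 - H2) = 4 * (2 * fnorm (H1 - H2)) by ring.
apply: (near_approx nH1 h1) => //; first by rewrite (proj2 op2) subrr /fnorm linear0 enorm0 mulr_ge0 ?enorm_ge0.
have -> : mcomm P2 H1 = mcomm P2 (H1 - H2) by rewrite mcommBr /mcomm c2 subrr subr0.
exact: mcomm_oproj.
Qed.

Lemma Pi_hi_uniq H P1 P2 : near_model H -> is_Pi_hi m H P1 -> is_Pi_hi m H P2 -> P1 = P2.
Proof.
move=> nH h1 h2; apply/eqP; rewrite -subr_eq0; apply/eqP; apply: fnorm0_eq; apply: le_anti.
by rewrite fnorm_ge0 andbT (le_trans (Pi_hi_lip nH nH h1 h2)) // subrr /fnorm linear0 enorm0 mulr0.
Qed.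

(** The mean [T] of the two projections has [T ^ 2 - T = - (P1 - P2) ^ 2 / 4], and its commutator
    with the mean of [H1] and [H2] is a quarter of that of [P1 - P2] and [H1 - H2], up to sign. Both
    are of second order, so [T] is an approximate projection of [H] with a quadratic error:
    second-order smoothness of the spectral projection without differentiating it. *)
Lemma Pi_hi_midpoint H H1 H2 P P1 P2 : near_model H -> near_model H1 -> near_model H2 ->
  is_Pi_hi m H P -> is_Pi_hi m H1 P1 -> is_Pi_hi m H2 P2 ->
  fnorm (2^-1 *: (P1 + P2) - P) <= 100 * fnorm (H1 - H2) ^+ 2 + 8 * fnorm (H - 2^-1 *: (H1 + H2)).
Proof.
move=> nH nH1 nH2 h h1 h2; have [op1 c1] := is_Pi_hi_oproj h1; have [op2 c2] := is_Pi_hi_oproj h2.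
set T := 2^-1 *: (P1 + P2); set x := fnorm (H1 - H2); set y := fnorm (H - _).
have x0 : 0 <= x by exact: fnorm_ge0.
have dP := Pi_hi_lip nH1 nH2 h1 h2; rewrite -/x in dP.
have dP0 := fnorm_ge0 (P1 - P2).
have T8 : fnorm (T - P) <= 1 / 8.
  have -> : T - P = 2^-1 *: (P1 - E) + 2^-1 *: (P2 - E) - (P - E) by rewrite /T; apply/matrixP => i j; rewrite !mxE; field.
  rewrite (le_trans (fnormB _ _)) //; have := fnormD (2^-1 *: (P1 - E)) (2^-1 *: (P2 - E)).
  rewrite !fnormZ ger0_norm ?invr_ge0 //.
  have := near_Pi nH1 h1; have := near_Pi nH2 h2; have := near_Pi nH h; rewrite /kappa0; clear; lra.
have TT : T *m T - T = - (4^-1 *: ((P1 - P2) *m (P1 - P2))).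
  rewrite /T -scalemxAl -scalemxAr scalerA !mulmxDl !mulmxDr !mulNmx !mulmxN opprK (proj2 op1) (proj2 op2).
  by move: (P1 *m P2) (P2 *m P1) => a b; apply/matrixP => i j; rewrite !mxE; field.
have CC : mcomm T (2^-1 *: (H1 + H2)) = - (4^-1 *: mcomm (P1 - P2) (H1 - H2)).
  rewrite /mcomm /T -!scalemxAl -!scalemxAr !scalerA !mulmxDl !mulmxDr !mulNmx !mulmxN opprK c1 c2.
  move: (H1 *m P1) (H2 *m P2) (P1 *m H2) (P2 *m H1) (H1 *m P2) (H2 *m P1) => a b c e f g.
  by apply/matrixP => i j; rewrite !mxE; field.
have e1 : fnorm (T *m T - T) <= 16 * x ^+ 2.
  rewrite TT fnormN fnormZ ger0_norm ?invr_ge0 // ler_pdivrMl //.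
  rewrite (le_trans (fnormM _ _)) //; apply: (@le_trans _ _ ((8 * x) * (8 * x))); first exact: ler_pM.
  by rewrite le_eqVlt; apply/orP; left; apply/eqP; ring.
have e2 : fnorm (mcomm T H) <= 4 * x ^+ 2 + 2 * y.
  have -> : mcomm T H = mcomm T (2^-1 *: (H1 + H2)) + mcomm T (H - 2^-1 *: (H1 + H2)).
    by rewrite mcommBr subrKC.
  rewrite (le_trans (fnormD _ _)) // lerD //.
    rewrite CC fnormN fnormZ ger0_norm ?invr_ge0 // ler_pdivrMl // /mcomm (le_trans (fnormB _ _)) //.
    have := fnormM (P1 - P2) (H1 - H2); have := fnormM (H1 - H2) (P1 - P2); rewrite -/x => k1 k2.
    have := ler_wpM2r x0 dP; rewrite mulrC in k1; move: k1 k2; rewrite expr2; clear; lra.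
  have TD (D : 'M[R]_n) : mcomm T D = 2^-1 *: (mcomm P1 D) + 2^-1 *: (mcomm P2 D).
    rewrite /mcomm /T -scalemxAl -scalemxAr mulmxDl mulmxDr.
    by move: (P1 *m D) (P2 *m D) (D *m P1) (D *m P2) => a b c e; vec_mx_tac.
  rewrite TD (le_trans (fnormD _ _)) // !fnormZ ger0_norm ?invr_ge0 //.
  have := mcomm_oproj (H - 2^-1 *: (H1 + H2)) op1; have := mcomm_oproj (H - 2^-1 *: (H1 + H2)) op2; rewrite -/y; clear; lra.
have y0 : 0 <= y by exact: fnorm_ge0.
have x20 := sqr_ge0 x.
apply: (@le_trans _ _ (4 * (16 * x ^+ 2 + 4 * x ^+ 2 + 2 * y))); last by clear -x20; lra.
apply: (near_approx nH h) => //; first by apply: (le_trans e1); clear -y0 x20; lra.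
by apply: (le_trans e2); clear -x20; lra.
Qed.

End Near.
End Facts.

Lemma Rayleigh_max n (H : 'M[R]_(1 + n)) : H^T = H ->
  exists q l, [/\ enorm q = 1, q *m H = l *: q & forall v, edot (v *m H) v <= l * enorm v ^+ 2].
Proof.
move=> Hs; pose K := [set x : 'rV[R]_(1 + n) | enorm x = 1].
pose f (x : 'rV[R]_(1 + n)) := edot (x *m H) x.
have cf : continuous f.
  by move=> x; apply: continuous_edot; [exact: continuous_mulmxr|by move=> P].
have K0 : K !=set0 by exists (delta_mx 0 (lshift n ord0)); rewrite /K /= enorm_delta.
have cK : compact K.
  apply: (subclosed_compact _ (@compact_eball R (1 + n) 0 1)); last by move=> x /=; rewrite subr0 => ->.
  have -> : K = (@enorm R (1 + n)) @^-1` [set 1] by [].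
  by apply: closed_comp => // x _; exact: continuous_enorm.
have [|q /set_mem q1 qmax] := @EVT_max_rV R _ f K K0 cK; first exact: continuous_subspaceT.
have hl v : f v <= f q * enorm v ^+ 2.
  have [->|v0] := eqVneq v 0; first by rewrite /f mul0mx edot0l enorm0 expr0n mulr0.
  have nv := enorm_gt0 v0.
  have := qmax ((enorm v)^-1 *: v) (mem_set _); rewrite /K /= enormZ ger0_norm ?invr_ge0 ?(ltW nv) // mulVf ?gt_eqF // => /(_ erefl).
  rewrite /f -scalemxAl edotZl edotZr mulrA -invfM -expr2 ler_pdivrMl ?exprn_gt0 //; by rewrite mulrC.
exists q, (f q); split=> //.
apply/eqP; rewrite eq_sym -subr_eq0; apply/eqP; apply: edot_orth => v.
set g := f q *: q - q *m H.
have quad t : 0 <= 2 * t * edot g v + t ^+ 2 * (f q * enorm v ^+ 2 - f v).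
  have := hl (q + t *: v); rewrite enormD_sqr edotZr enormZ exprMn real_normK ?num_real // q1.
  have -> : f (q + t *: v) = f q + 2 * t * edot (q *m H) v + t ^+ 2 * f v.
    rewrite /f mulmxDl -scalemxAl edotDl !edotDr !edotZl !edotZr.
    have -> : edot (v *m H) q = edot (q *m H) v by rewrite edot_mulmx Hs edotC.
    by ring.
  rewrite /g edotBl edotZl; clear; lra.
set a := edot g v in quad *; set b := f q * _ - _ in quad.
have b0 : 0 <= b by rewrite subr_ge0.
(* At this value the nonnegative quadratic [2 * t * a + t ^ 2 * b] equals a negative multiple of
   [a ^ 2]; dividing by [b + 1] rather than [b] covers [b = 0]. *)
have := quad (- a / (b + 1)).
have b1 : 0 < b + 1 by rewrite ltr_wpDl.
have -> : 2 * (- a / (b + 1)) * a + (- a / (b + 1)) ^+ 2 * b = - (a ^+ 2 * (b + 2) / (b + 1) ^+ 2).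
  by field; rewrite gt_eqF.
rewrite oppr_ge0 pmulr_lle0 ?invr_gt0 ?exprn_gt0 // pmulr_lle0 ?ltr_wpDl // => a2.
by apply/eqP; rewrite -sqrf_eq0; apply/eqP/le_anti; rewrite a2 sqr_ge0.
Qed.

(** Induction through a maximizer of the Rayleigh quotient and its orthogonal complement [B]. The
    order of the eigenvalues comes for free: the later ones are values of the quotient whose maximum
    is the first. *)
Lemma sym_spectral n (H : 'M[R]_n) : H^T = H -> exists (Q : 'M[R]_n) (l : 'rV[R]_n),
  [/\ Q *m Q^T = 1%:M, Q *m H = diag_mx l *m Q & forall i j : 'I_n, (i <= j)%N -> l 0 j <= l 0 i].
Proof.
elim: n H => [|n IH] H Hs.
  by exists 1%:M, 0; split; [rewrite flatmx0 [RHS]flatmx0|rewrite flatmx0 [RHS]flatmx0|case].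
have {H Hs} [H Hs ->] : exists2 H' : 'M[R]_(1 + n), H'^T = H' & H = H' by exists H.
have [q [l [q1 qH qmax]]] := Rayleigh_max Hs.
have qq : q *m q^T = 1%:M.
  by apply/matrixP => i j; rewrite !ord1 -edotE -enorm_sqr q1 expr1n mxE eqxx.
suff : exists (Q : 'M[R]_(1 + n)) (l : 'rV[R]_(1 + n)), [/\ Q *m Q^T = 1%:M, Q *m H = diag_mx l *m Q
  & forall i j : 'I_(1 + n), (i <= j)%N -> l 0 j <= l 0 i] by [].
have [B oB] := orthonormal_completion qq.
have [qB Bq BB] : [/\ q *m B^T = 0, B *m q^T = 0 & B *m B^T = 1%:M].
  by have := oB; rewrite tr_col_mx mul_col_row (@scalar_mx_block _ 1 n) => /eq_block_mx[_ ? ? ?].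
have HBs : (B *m H *m B^T)^T = B *m H *m B^T by rewrite !trmx_mul trmxK Hs mulmxA.
have [Q [l' [QQ QH ls]]] := IH _ HBs.
have BHq : B *m H *m q^T = 0.
  by rewrite -[RHS](scaler0 _ l) -Bq -mulmxA -[H]Hs -trmx_mul qH linearZ /= scalemxAr.
have BtB : q^T *m q + B^T *m B = 1%:M.
  by have := mulmx1C oB; rewrite tr_col_mx mul_row_col.
have BH : B *m H = (B *m H *m B^T) *m B.
  by rewrite -[LHS]mulmx1 -BtB mulmxDr mulmxA BHq mul0mx add0r !mulmxA.
exists (col_mx q (Q *m B)), (row_mx l%:M l'); split.
- rewrite tr_col_mx mul_col_row trmx_mul !mulmxA qq -[Q *m B *m q^T]mulmxA Bq mulmx0.
  by rewrite -[Q *m B *m B^T]mulmxA BB mulmx1 QQ qB mul0mx -scalar_mx_block.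
- rewrite mul_col_mx diag_mx_row mul_block_col !mul0mx addr0 add0r qH -mulmxA BH -mulmxA.
  rewrite [X in _ = col_mx X _](_ : _ = l *: q); last first.
    by apply/rowP => i; rewrite mul_diag_mx !mxE eqxx mulr1n.
  by congr col_mx; rewrite !mulmxA -QH !mulmxA.
move=> i j; case: (split_ordP i) => i' ->; case: (split_ordP j) => j' ->.
- by rewrite !ord1.
- move=> _; rewrite row_mxEr.
  have -> : row_mx l%:M l' 0 (lshift n i') = l by rewrite row_mxEl !mxE [i']ord1 eqxx mulr1n.
  have qj : enorm (row j' (Q *m B)) ^+ 2 = 1.
    by apply: enorm_row_orth; rewrite trmx_mul !mulmxA -[Q *m B *m _]mulmxA BB mulmx1.
  have := qmax (row j' (Q *m B)); rewrite qj mulr1; apply: le_trans.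
  have -> : row j' (Q *m B) *m H = l' 0 j' *: row j' (Q *m B).
    rewrite -row_mul -mulmxA BH !mulmxA -[Q *m B *m H *m _]mulmxA -!mulmxA.
    rewrite (mulmxA B) (mulmxA (B *m H)) (mulmxA Q) QH -mulmxA row_mul.
    by rewrite row_diag_mx -scalemxAl -rowE.
  by rewrite edotZl -enorm_sqr qj mulr1.
- by rewrite !ord1 /=; lia.
- rewrite !row_mxEr => ij; apply: ls; move: ij; rewrite /= leq_add2l.
  by [].
Qed.

End SpectralProjection.
Lemma two_pi_le8 (R : realType) : 2 * pi <= 8 :> R.
Proof. by have := pihalf_lt2 R; lra. Qed.

(** * Critical points of functions close to the model *)

Section ModelGeometry.
Context {R : realType} {d m : nat}.
Implicit Types (w h : 'rV[R]_(d + m)) (y : 'rV[R]_m).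

Definition normal_proj : 'M[R]_(d + m) := block_mx 0 0 0 1%:M.

Lemma oproj_normal_proj : oproj normal_proj.
Proof.
split; first by rewrite /normal_proj tr_block_mx !trmx0 trmx1.
by rewrite /normal_proj mulmx_block !mulmx0 !mul0mx mulmx1 !addr0 !add0r.
Qed.

Lemma tr_normal_proj : \tr normal_proj = m%:R.
Proof. by rewrite mxtrace_block mxtrace0 mxtrace1 add0r. Qed.

Lemma mul_normal_proj w : w *m normal_proj = row_mx 0 (rsubmx w).
Proof. by rewrite -{1}[w]hsubmxK mul_row_block !mulmx0 mulmx1 !add0r. Qed.

Lemma mul_0y_normal_proj y : row_mx (0 : 'rV[R]_d) y *m normal_proj = row_mx 0 y.
Proof. by rewrite mul_normal_proj row_mxKr. Qed.

(* g and H stand for the gradient and the Hessian of a function close to pi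
   times the squared distance to R^d x 0. *)
Definition smooth_model (C eps : R) (g : 'rV[R]_(d + m) -> 'rV[R]_(d + m)) (H : 'rV[R]_(d + m) -> 'M[R]_(d + m)) :=
  (forall w, enorm w < 1 -> [/\ (H w)^T = H w, near_model normal_proj (H w) &
     enorm (g w - (2 * pi) *: row_mx 0 (rsubmx w)) <= C * eps]) /\
  (forall w h, enorm w < 1 -> enorm h < 1 ->
     [/\ enorm (g (w + h) - g w - h *m H w) <= C * enorm h ^+ 2,
         fnorm (H (w + h) - H w) <= C * enorm h &
         fnorm (H (w + h) + H (w - h) - 2 *: H w) <= C * enorm h ^+ 2]).

(** [hi_critical] with any spectral projection in place of the chosen [Pi_hi]. Near the model the
    projection is unique, and no choice has to be followed through changes of coordinates. *)
Definition pi_critical (g : 'rV[R]_(d + m) -> 'rV[R]_(d + m)) (H : 'rV[R]_(d + m) -> 'M[R]_(d + m)) w :=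
  exists2 P, is_Pi_hi m (H w) P & g w *m P = 0.

Lemma Pi_hi_exists (A : 'M[R]_(d + m)) : A^T = A -> exists P, is_Pi_hi m A P.
Proof. by move=> /sym_spectral[Q [l [h1 h2 h3]]]; eexists; exists Q, l; split. Qed.

Lemma codim_le : (m <= d + m)%N. Proof. exact: leq_addl. Qed.

Lemma near_P (C eps : R) (g : 'rV[R]_(d + m) -> 'rV[R]_(d + m)) (H : 'rV[R]_(d + m) -> 'M[R]_(d + m)) w P : 0 <= C -> 0 <= eps -> smooth_model C eps g H ->
  enorm w < 1 -> is_Pi_hi m (H w) P -> fnorm (P - normal_proj) <= 1 / 100.
Proof.
move=> C0 eps0 sgH w1 hP; have [_ nw _] := sgH.1 w w1.
by have := near_Pi codim_le oproj_normal_proj tr_normal_proj nw hP; rewrite /kappa0; lra.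
Qed.

(** The gradient is [2 * pi] times the normal coordinates up to [C * eps], and the projection is
    nearly [normal_proj]; where the projected gradient vanishes, the normal coordinates are
    therefore of the size of the error. *)
Lemma critical_small (C eps : R) (g : 'rV[R]_(d + m) -> 'rV[R]_(d + m)) (H : 'rV[R]_(d + m) -> 'M[R]_(d + m)) w : 0 <= C -> 0 <= eps -> smooth_model C eps g H ->
  enorm w < 1 -> pi_critical g H w -> enorm (rsubmx w) <= C * eps.
Proof.
move=> C0 eps0 sgH w1 [P hP gP]; have [_ _ gw] := sgH.1 w w1; have [oP _] := is_Pi_hi_oproj hP.
have nP := near_P C0 eps0 sgH w1 hP; set y := rsubmx w in gw *; set v : 'rV[R]_(d + m) := row_mx 0 y in gw *.
have nv : enorm v = enorm y by exact: enorm_row_0mx.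
have E : (2 * pi) *: v = (2 * pi) *: (v *m (normal_proj - P)) - (g w - (2 * pi) *: v) *m P.
  by rewrite mulmxBr mulmxBl gP mul_0y_normal_proj -scalemxAl; move: (v *m P) => z; vec.
have := enormB_le ((2 * pi) *: (v *m (normal_proj - P))) ((g w - (2 * pi) *: v) *m P).
rewrite -E !enormZ ger0_norm ?mulr_ge0 ?pi_ge0 // nv => h1.
have h2 := le_trans (oproj_contr (g w - (2 * pi) *: v) oP) gw.
have h3 : enorm (v *m (normal_proj - P)) <= 1 / 100 * enorm y.
  rewrite -nv (le_trans (enorm_mul_fnorm _ _)) // ler_wpM2r ?enorm_ge0 //.
  by rewrite fnormBC.
have p2 := pi_ge2 R; have y0 := enorm_ge0 y.
have h4 := ler_wpM2l (_ : 0 <= 2 * pi :> R) h3; rewrite mulr_ge0 ?pi_ge0 // in h4.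
have {}h4 := h4 isT.
have h5 := ler_wpM2r y0 p2.
clear -h1 h2 h4 h5 y0; lra.
Qed.

Lemma grad_size (C eps : R) (g : 'rV[R]_(d + m) -> 'rV[R]_(d + m)) (H : 'rV[R]_(d + m) -> 'M[R]_(d + m)) w : 0 <= C -> 0 <= eps -> smooth_model C eps g H ->
  enorm w < 1 -> enorm (g w) <= C * eps + 8 * enorm (rsubmx w).
Proof.
move=> C0 eps0 sgH w1; have [_ _ gw] := sgH.1 w w1.
have -> : g w = (g w - (2 * pi) *: row_mx 0 (rsubmx w)) + (2 * pi) *: row_mx 0 (rsubmx w) by rewrite subrK.
rewrite (le_trans (enormD_le _ _)) // lerD // enormZ enorm_row_0mx ger0_norm ?mulr_ge0 ?pi_ge0 //.
by rewrite ler_wpM2r ?enorm_ge0 ?two_pi_le8.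
Qed.

Lemma P_lip (C eps : R) (g : 'rV[R]_(d + m) -> 'rV[R]_(d + m)) (H : 'rV[R]_(d + m) -> 'M[R]_(d + m)) w h P P' : 0 <= C -> 0 <= eps -> smooth_model C eps g H ->
  enorm w < 1 -> enorm h < 1 -> enorm (w + h) < 1 -> is_Pi_hi m (H w) P ->
  is_Pi_hi m (H (w + h)) P' -> fnorm (P' - P) <= 8 * C * enorm h.
Proof.
move=> C0 eps0 sgH w1 h1 wh hP hP'; have [_ n1 _] := sgH.1 _ w1; have [_ n2 _] := sgH.1 _ wh.
rewrite (le_trans (Pi_hi_lip codim_le oproj_normal_proj tr_normal_proj n2 n1 hP' hP)) // -mulrA ler_wpM2l //.
by have [] := sgH.2 w h w1 h1.
Qed.

(** Away from a critical point of the fibre the projected gradient grows with slope about [2 * pi];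
    after all losses at least slope 1 remains. A small residual thus forces closeness to the
    critical point. *)
Lemma fiber_lower (C eps : R) (g : 'rV[R]_(d + m) -> 'rV[R]_(d + m)) (H : 'rV[R]_(d + m) -> 'M[R]_(d + m)) ys y P : 0 <= C -> 0 <= eps -> smooth_model C eps g H ->
  C * enorm (y - ys) <= 1 / 10 -> C * (C * eps) <= 1 / 100 ->
  enorm ys < 1 -> enorm y < 1 -> enorm (y - ys) < 1 ->
  pi_critical g H (row_mx 0 ys) -> is_Pi_hi m (H (row_mx 0 y)) P ->
  enorm (y - ys) <= enorm (g (row_mx 0 y) *m P).
Proof.
move=> C0 eps0 sgH Ch Ce ys1 y1 yy1 cs hP.
pose ws : 'rV[R]_(d + m) := row_mx 0 ys; pose h : 'rV[R]_(d + m) := row_mx 0 (y - ys).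
have ws1 : enorm ws < 1 by rewrite enorm_row_0mx.
have nh : enorm h = enorm (y - ys) by rewrite enorm_row_0mx.
have h1 : enorm h < 1 by rewrite nh.
have E : row_mx 0 y = ws + h by rewrite add_row_mx addr0 subrKC.
have w1 : enorm (ws + h) < 1 by rewrite -E enorm_row_0mx.
have small := critical_small C0 eps0 sgH ws1 cs; rewrite row_mxKr in small.
have gs := grad_size C0 eps0 sgH ws1; rewrite row_mxKr in gs.
have [Ps hPs gPs] := cs; rewrite -/ws in hPs gPs.
rewrite E in hP *.
have [oP _] := is_Pi_hi_oproj hP.
have dP := P_lip C0 eps0 sgH ws1 h1 w1 hPs hP.
have [_ nws _] := sgH.1 ws ws1; have [tay _ _] := sgH.2 ws h ws1 h1.
have nP := near_P C0 eps0 sgH w1 hP.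
set x := enorm h in nh tay dP *; have x0 : 0 <= x by exact: enorm_ge0.
rewrite -nh in Ch *.
have e1 : enorm (h *m (P - normal_proj)) <= 1 / 100 * x.
  by rewrite (le_trans (enorm_mul_fnorm _ _)) // ler_wpM2r.
have e2 : enorm ((h *m (H ws - (2 * pi) *: normal_proj)) *m P) <= 1 / 50 * x.
  rewrite (le_trans (oproj_contr _ oP)) // (le_trans (enorm_mul_fnorm _ _)) // ler_wpM2r //.
have e3 : enorm ((g (ws + h) - g ws - h *m H ws) *m P) <= 1 / 10 * x.
  by rewrite (le_trans (oproj_contr _ oP)) // (le_trans tay) // expr2 mulrA ler_wpM2r.
have e4 : enorm (g ws *m (P - Ps)) <= 72 / 100 * x.
  rewrite (le_trans (enorm_mul_fnorm _ _)) //.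
  apply: (@le_trans _ _ (8 * C * x * (9 * (C * eps)))).
    by apply: ler_pM => //; rewrite ?fnorm_ge0 ?enorm_ge0 //; clear -gs small; lra.
  have -> : 8 * C * x * (9 * (C * eps)) = 72 * (C * (C * eps)) * x by ring.
  by rewrite ler_wpM2r //; clear -Ce; lra.
have EE : (2 * pi) *: h = g (ws + h) *m P - (2 * pi) *: (h *m (P - normal_proj))
   - (h *m (H ws - (2 * pi) *: normal_proj)) *m P - (g (ws + h) - g ws - h *m H ws) *m P - g ws *m (P - Ps).
  have hE : h *m normal_proj = h by exact: mul_0y_normal_proj.
  rewrite !mulmxBr !mulmxBl gPs -scalemxAr -scalemxAl hE.
  move: (g (ws + h) *m P) (g ws *m P) (h *m P) (h *m H ws *m P) => a b c e; vec.
have : 2 * pi * x <= enorm (g (ws + h) *m P) + 2 * pi * (1 / 100 * x) + 1 / 50 * x + 1 / 10 * x + 72 / 100 * x.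
  have -> : 2 * pi * x = enorm ((2 * pi) *: h) by rewrite enormZ ger0_norm ?mulr_ge0 ?pi_ge0.
  rewrite EE.
  have tri (a b c e f : 'rV[R]_(d + m)) : enorm (a - b - c - e - f) <= enorm a + enorm b + enorm c + enorm e + enorm f.
    by do 4 (rewrite (le_trans (enormB_le _ _)) // lerD //).
  apply: (le_trans (tri _ _ _ _ _)); rewrite !lerD // enormZ ger0_norm ?mulr_ge0 ?pi_ge0 //.
  by rewrite ler_wpM2l // mulr_ge0 ?pi_ge0.
have := ler_wpM2r x0 (pi_ge2 R); clear -x0; lra.
Qed.

(** Average the two critical equations. First-order terms cancel by symmetry, in the gradient by
    Taylor's formula and in the projection by [Pi_hi_midpoint]. There remain second-order terms,
    among them a quarter of the product of the differences of gradients and of projections. *)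
Lemma midpoint_residual (C eps : R) (g : 'rV[R]_(d + m) -> 'rV[R]_(d + m)) (H : 'rV[R]_(d + m) -> 'M[R]_(d + m)) w h P : 0 <= C -> 0 <= eps -> smooth_model C eps g H ->
  enorm w < 1 -> enorm h < 1 -> enorm (w + h) < 1 -> enorm (w - h) < 1 ->
  eps <= 1 -> pi_critical g H (w + h) -> pi_critical g H (w - h) -> is_Pi_hi m (H w) P ->
  enorm (g w *m P) <= ((C + 8) * (400 * C ^+ 2 + 4 * C) + C + 8 * C * (C + 9)) * enorm h ^+ 2.
Proof.
move=> C0 eps0 sgH w1 h1 wp wm e1 [Pp hPp gp] [Pm hPm gm] hP.
have h1' : enorm (- h) < 1 by rewrite enormN.
have [tp lp sp] := sgH.2 w h w1 h1; have [tm lm _] := sgH.2 w (- h) w1 h1'.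
rewrite enormN in tm lm.
have [_ nw _] := sgH.1 w w1; have [_ np _] := sgH.1 _ wp; have [_ nm _] := sgH.1 _ wm.
have [op _] := is_Pi_hi_oproj hPp; have [om _] := is_Pi_hi_oproj hPm.
set x := enorm h in tp lp sp tm lm *; have x0 : 0 <= x by exact: enorm_ge0.
have x1 : x <= 1 by exact: ltW.
set T := 2^-1 *: (Pp + Pm).
have dH : fnorm (H (w + h) - H (w - h)) <= 2 * C * x.
  have -> : H (w + h) - H (w - h) = (H (w + h) - H w) - (H (w - h) - H w) by rewrite opprB addrA subrK.
  by rewrite (le_trans (fnormB _ _)) //; clear -lp lm; lra.
have sH : fnorm (H w - 2^-1 *: (H (w + h) + H (w - h))) <= C / 2 * x ^+ 2.
  have -> : H w - 2^-1 *: (H (w + h) + H (w - h)) = - (2^-1 *: (H (w + h) + H (w - h) - 2 *: H w)).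
    by move: (H w) (H (w + h)) (H (w - h)) => a b c; apply/matrixP => i j; rewrite !mxE; field.
  by rewrite fnormN fnormZ ger0_norm ?invr_ge0 //; clear -sp; lra.
have dT : fnorm (T - P) <= (400 * C ^+ 2 + 4 * C) * x ^+ 2.
  apply: (le_trans (Pi_hi_midpoint codim_le oproj_normal_proj tr_normal_proj nw np nm hP hPp hPm)).
  have : fnorm (H (w + h) - H (w - h)) ^+ 2 <= (2 * C * x) ^+ 2.
    by rewrite lerXn2r ?nnegrE ?fnorm_ge0 // !mulr_ge0.
  have -> : (2 * C * x) ^+ 2 = 4 * (C ^+ 2 * x ^+ 2) by ring.
  by clear -sH; lra.
have dP : fnorm (Pp - Pm) <= 16 * C * x.
  apply: (le_trans (Pi_hi_lip codim_le oproj_normal_proj tr_normal_proj np nm hPp hPm)); clear -dH; lra.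
have gw : enorm (g w) <= C + 8.
  apply: (le_trans (grad_size C0 eps0 sgH w1)); apply: lerD; first by rewrite ler_piMr.
  by rewrite ler_piMr // (le_trans (enorm_rsubmx _)) // ltW.
have hH : enorm (h *m H w) <= 9 * x.
  have -> : h *m H w = h *m (H w - (2 * pi) *: normal_proj) + (2 * pi) *: (h *m normal_proj).
    by rewrite mulmxBr -scalemxAr subrK.
  rewrite (le_trans (enormD_le _ _)) // enormZ ger0_norm ?mulr_ge0 ?pi_ge0 //.
  have k1 := enorm_mul_fnorm h (H w - (2 * pi) *: normal_proj).
  have k2 : fnorm (H w - (2 * pi) *: normal_proj) * x <= 1 / 50 * x by rewrite ler_wpM2r.
  have k3 := oproj_contr h oproj_normal_proj.
  have k4 : 2 * pi * enorm (h *m normal_proj) <= 8 * x.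
    by apply: ler_pM; rewrite ?mulr_ge0 ?pi_ge0 ?enorm_ge0 ?two_pi_le8.
  by clear -k1 k2 k4 x0; rewrite -/x in k1; lra.
have dg : enorm (g (w + h) - g (w - h)) <= 2 * (C + 9) * x.
  have -> : g (w + h) - g (w - h) = (g (w + h) - g w - h *m H w) - (g (w - h) - g w - (- h) *m H w) + 2 *: (h *m H w).
    by rewrite mulNmx; move: (g _) (g (w - h)) (g w) (h *m H w) => a b c e; vec.
  rewrite (le_trans (enormD_le _ _)) // enormZ normr_nat.
  have k1 := enormB_le (g (w + h) - g w - h *m H w) (g (w - h) - g w - (- h) *m H w).
  have k2 : C * x ^+ 2 <= C * x by rewrite ler_wpM2l // expr2 ler_piMl.
  by clear -k1 k2 tp tm hH; lra.
have EE : g w *m P = g w *m (P - T) - (2^-1 *: ((g (w + h) - g w - h *m H w) + (g (w - h) - g w - (- h) *m H w))) *m T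
    - 4^-1 *: ((g (w + h) - g (w - h)) *m (Pp - Pm)).
  have -> : (g (w + h) - g w - h *m H w) + (g (w - h) - g w - (- h) *m H w) = g (w + h) + g (w - h) - 2 *: g w.
    by rewrite mulNmx; move: (g _) (g (w - h)) (g w) (h *m H w) => a b c e; vec.
  rewrite /T !(mulmxBr, mulmxBl, mulmxDl, mulmxDr, mulNmx, =^~ scalemxAl, =^~ scalemxAr) gp gm.
  move: (g w *m P) (g w *m Pp) (g w *m Pm) (g (w + h) *m Pm) (g (w - h) *m Pp) => a b c e f.
  by apply/rowP => i; rewrite !mxE; field.
have Tc v : enorm (v *m T) <= enorm v.
  rewrite /T -scalemxAr mulmxDr enormZ ger0_norm ?invr_ge0 //.
  have := enormD_le (v *m Pp) (v *m Pm); have := oproj_contr v op; have := oproj_contr v om.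
  by clear; lra.
rewrite EE (le_trans (enormB_le _ _)) // mulrDl; apply: lerD; last first.
  rewrite enormZ ger0_norm ?invr_ge0 // ler_pdivrMl //.
  have k1 := enorm_mul_fnorm (g (w + h) - g (w - h)) (Pp - Pm).
  apply: (le_trans k1); apply: (@le_trans _ _ ((16 * C * x) * (2 * (C + 9) * x))).
    by apply: ler_pM; rewrite ?fnorm_ge0 ?enorm_ge0.
  by rewrite le_eqVlt; apply/orP; left; apply/eqP; ring.
rewrite (le_trans (enormB_le _ _)) // mulrDl; apply: lerD.
  apply: (le_trans (enorm_mul_fnorm _ _)); rewrite fnormBC mulrC -mulrA.
  by apply: ler_pM; rewrite ?fnorm_ge0 ?enorm_ge0.
apply: (le_trans (Tc _)); rewrite enormZ ger0_norm ?invr_ge0 //.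
have k1 := enormD_le (g (w + h) - g w - h *m H w) (g (w - h) - g w - (- h) *m H w).
by clear -k1 tp tm; lra.
Qed.


End ModelGeometry.

(** * From C^0 closeness to closeness of gradient and Hessian *)

Section ModelDerivatives.
Context {R : realType} {d m : nat}.
Implicit Types (x u v w h : 'rV[R]_(d + m)) (G : 'rV[R]_(d + m) -> R).

Lemma derive_edot x v a : derivable (fun x : 'rV[R]_(d + m) => edot x a) x v /\
  'D_v (fun x : 'rV[R]_(d + m) => edot x a) x = edot v a.
Proof.
apply: derive_of_line.
have -> : (fun s : R => edot (x + s *: v) a) = (fun s => edot x a + s * edot v a).
  by apply/funext => s; rewrite edotDl edotZl.
apply: is_derive_eq; rewrite /GRing.scale /=; ring.
Qed.

Definition normal_sqr x : R := pi * enorm (rsubmx x) ^+ 2.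

Definition normal_grad v : 'rV[R]_(d + m) := (2 * pi) *: row_mx 0 (rsubmx v).

Lemma edot_normal_grad x v : edot x (normal_grad v) = 2 * pi * edot (rsubmx x) (rsubmx v).
Proof. by rewrite edotZr -{1}[x]hsubmxK edot_row_mx edot0r add0r. Qed.

Lemma normal_gradC x v : edot x (normal_grad v) = edot v (normal_grad x).
Proof. by rewrite !edot_normal_grad edotC. Qed.

Lemma derive_normal_sqr x v : derivable normal_sqr x v /\ 'D_v normal_sqr x = edot x (normal_grad v).
Proof.
apply: derive_of_line; rewrite edot_normal_grad.
set a := enorm (rsubmx x) ^+ 2; set b := edot (rsubmx x) (rsubmx v).
set c := enorm (rsubmx v) ^+ 2.
have -> : (fun s : R => normal_sqr (x + s *: v)) = (fun s => pi * (a + s * (2 * b + s * c))).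
  apply/funext => s; rewrite /normal_sqr; congr (_ * _).
  have -> : rsubmx (x + s *: v) = rsubmx x + s *: rsubmx v by apply/rowP => i; rewrite !mxE.
  by rewrite enormD_sqr edotZr enormZ exprMn real_normK ?num_real // -/a -/b -/c; ring.
apply: is_derive_eq; rewrite /GRing.scale /=; ring.
Qed.

Lemma Bk_normal_sqr k : Bk k (eball 2) 24 normal_sqr.
Proof.
have o2 : open (@eball R (d + m) 2) by apply: open_eball0.
have p8 := two_pi_le8 R.
have h x : eball 2 x -> {for x, continuous normal_sqr} /\ `|normal_sqr x| <= 24.
  move=> x2; split.
    apply: continuousM; first exact: cst_continuous.
    have c1 : {for x, continuous (fun x : 'rV[R]_(d + m) => enorm (rsubmx x))}.
      apply: (@continuous_comp _ _ _ (fun x : 'rV[R]_(d + m) => rsubmx x) (@enorm R m)); last exact: continuous_enorm.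
      have -> : (fun x : 'rV[R]_(d + m) => rsubmx x) = (fun x => x *m col_mx 0 1%:M).
        by apply/funext => z; rewrite -{2}[z]hsubmxK mul_row_col mulmx0 mulmx1 add0r.
      exact: continuous_mulmxr.
    by apply: (@continuous_comp _ _ _ _ (fun z : R => z ^+ 2) _ c1); exact: exprn_continuous.
  have x2' : enorm (rsubmx x) ^+ 2 <= 4.
    have -> : 4 = 2 ^+ 2 :> R by ring.
    by rewrite lerXn2r ?nnegrE ?enorm_ge0 // (le_trans (enorm_rsubmx _)) // ltW.
  rewrite /normal_sqr ger0_norm ?mulr_ge0 ?pi_ge0 ?enorm_ge0 //.
  have := ler_wpM2l (pi_ge0 R) x2'; lra.
case: k => [|k]; split => // v; split; first by move=> x _; exact: (derive_normal_sqr x v).1.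
have -> : 'D_v normal_sqr = (fun x => edot x (normal_grad v)) by apply/funext => x; exact: (derive_normal_sqr x v).2.
apply: Bk_le (@Bk_lin R (d + m) k (eball 2) (normal_grad v) 2 o2 _ _) => //; last by move=> x /ltW.
have -> : enorm (normal_grad v) = 2 * pi * enorm (rsubmx v).
  by rewrite enormZ enorm_row_0mx ger0_norm // mulr_ge0 ?pi_ge0.
rewrite mulrA; apply: ler_pM => //; rewrite ?enorm_ge0 ?enorm_rsubmx //; first by have := pi_ge0 R; lra.
lra.
Qed.

Lemma local_model_rest kk K eps G : local_model kk K eps G ->
  Bk kk (eball 2) (K + 24) (fun x => G x - normal_sqr x) /\ forall x, enorm x < 2 -> `|G x - normal_sqr x| <= eps.
Proof.
have o2 : open (@eball R (d + m) 2) by apply: open_eball0.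
move=> [bG hG]; split => //.
have -> : (fun x => G x - normal_sqr x) = (fun x => G x + (-1) * normal_sqr x) by apply/funext => x; rewrite mulN1r.
apply: Bk_add => //; have := Bk_scale (-1) o2 (Bk_normal_sqr kk).
by rewrite normrN1 mul1r.
Qed.

Lemma derive_rest k K G x v : Bk k.+1 (eball 2) K G -> eball 2 x ->
  'D_v (fun x => G x - normal_sqr x) x = 'D_v G x - edot x (normal_grad v).
Proof.
move=> [_ /(_ v)[dG _]] x2; have [d1 d2] := derive_normal_sqr x v.
by rewrite -d2; apply: deriveB => //; exact: dG.
Qed.

Lemma derive2_rest k K G x u v : Bk k.+2 (eball 2) K G -> eball 2 x ->
  'D_u ('D_v (fun x => G x - normal_sqr x)) x = 'D_u ('D_v G) x - edot u (normal_grad v).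
Proof.
move=> bG x2; have [_ /(_ v)[_ bv]] := bG.
have o2 : open (@eball R (d + m) 2) by apply: open_eball0.
have -> : 'D_u ('D_v (fun x => G x - normal_sqr x)) x = 'D_u (fun y => 'D_v G y - edot y (normal_grad v)) x.
  apply: near_eq_derive; apply: (@filterS _ (nbhs x) _ (eball 2)); last exact: open_nbhs_nbhs.
  by move=> y y2; exact: derive_rest bG y2.
have [_ /(_ v)[_ [_ /(_ u)[duv _]]]] := bG; have [e1 e2] := derive_edot x u (normal_grad v).
by rewrite -[in RHS]e2; apply: deriveB => //; exact: duv.
Qed.

Lemma Bk_derive1 k (U : set 'rV[R]_(d + m)) K G v : enorm v = 1 -> Bk k.+1 U K G -> Bk k U K ('D_v G).
Proof. by move=> v1 [_ /(_ v)[_]]; rewrite v1 mulr1. Qed.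

End ModelDerivatives.

(** [derive_small] is applied twice to the difference [f] with the model. The gradient becomes of
    order [sqrt eps], which is kept; the Hessian only of order [eps ^ (1/4)], but it merely has to
    be below [kappa0], whence the threshold [e0]. The second differences of the Hessian use
    derivatives of order 4. *)
Lemma smooth_model_of_local (R : realType) d m (K : R) : 0 <= K -> exists C e0 : R, [/\ 0 <= C, 0 < e0 &
  forall (G : 'rV[R]_(d + m) -> R) eps, 0 < eps -> eps <= e0 -> local_model 4 K eps G ->
  smooth_model C (Num.sqrt eps) (grad G) (hess G)].
Proof.
move=> K0; pose n := (d + m)%N; pose K' := K + 24; have K'0 : 0 <= K' by rewrite addr_ge0.
pose C : R := (n%:R + (n * n)%:R) * (2 * (2 + K')).
have nn1 : 0 <= n%:R :> R by []. have nn2 : 0 <= (n * n)%:R :> R by [].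
have C0 : 0 <= C by rewrite mulr_ge0 ?addr_ge0 // mulr_ge0 ?addr_ge0.
have Cn (a : R) : 0 <= a -> a <= 2 * (2 + K') -> n%:R * a <= C.
  by move=> a0 aK; apply: ler_pM => //; rewrite lerDl.
have Cnn (a : R) : 0 <= a -> a <= 2 * (2 + K') -> (n * n)%:R * a <= C.
  by move=> a0 aK; apply: ler_pM => //; rewrite lerDr.
(* Ensures [C * t <= kappa0] for the Hessian, and [t <= 1 / 4] for the step of the second
   interpolation. *)
pose t : R := (50 * C + 4)^-1; have t0 : 0 < t by rewrite invr_gt0 ltr_wpDl // mulr_ge0.
pose s := t ^+ 2 / (2 + K'); have K2 : 0 < 2 + K' by rewrite ltr_wpDr.
have s0 : 0 < s by rewrite divr_gt0 ?exprn_gt0.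
have C4 (c : R) : 0 <= c -> 1 <= 1 / 4 * (50 * c + 4) by lra.
have C50 (c : R) : 0 <= c -> c <= 1 / 50 * (50 * c + 4) by lra.
have hd : 0 < 50 * C + 4 by rewrite ltr_wpDl // mulr_ge0.
have t4 : t <= 1 / 4.
  by rewrite /t -[leLHS]mul1r (ler_pdivrMr _ _ hd); exact: C4.
exists C, (s ^+ 2); split=> //; first by rewrite exprn_gt0.
move=> G eps e0 es hG; set r := Num.sqrt eps.
have r0 : 0 < r by rewrite sqrtr_gt0.
have rs : r <= s by rewrite -(ger0_norm (ltW s0)) -sqrtr_sqr ler_sqrt // exprn_ge0 // ltW.
pose e1 := (2 + K') * r; have e10 : 0 < e1 by rewrite mulr_gt0.
have e1t : e1 <= t ^+ 2 by move: rs; rewrite /s ler_pdivlMr // mulrC.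
have st : Num.sqrt e1 <= t by rewrite -(ger0_norm (ltW t0)) -sqrtr_sqr ler_sqrt // exprn_ge0 // ltW.
have r2 : r < 1 / 2.
  have : e1 <= 1 / 16 by rewrite (le_trans e1t) // expr2; have -> : 1 / 16 = (1 / 4) * (1 / 4) :> R by [field]; apply: ler_pM => //; exact: ltW.
  have := mulr_ge0 K'0 (ltW r0); rewrite /e1; clear -r0; lra.
have [bG _] := hG; have [bf fe] := local_model_rest hG; rewrite -/K' in bf.
set f := fun x => G x - normal_sqr x in bf fe.
(* The balls of radius 2, 3/2 and 1 are those of [f], of its gradient and of its Hessian: each
   interpolation gives up some room. *)
have dsm x v : enorm v = 1 -> enorm x < 3 / 2 -> `|'D_v f x| <= e1.
  by move=> v1 x32; apply: (derive_small (Bk_leq _ bf) fe) => //; rewrite -/r; clear -x32 r2; lra.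
have bf1 v : enorm v = 1 -> Bk 2 (eball (3 / 2)) K' ('D_v f).
  move=> v1; apply: (@Bk_leq R _ 3) => //; apply: Bk_sub (Bk_derive1 v1 bf) => x.
  by rewrite /eball /= => /lt_trans; apply; clear; lra.
have d2sm x u v : enorm u = 1 -> enorm v = 1 -> enorm x < 1 -> `|'D_u ('D_v f) x| <= (2 + K') * t.
  move=> u1 v1 x1; apply: (@le_trans _ _ ((2 + K') * Num.sqrt e1)); last by rewrite ler_wpM2l // ltW.
  apply: (derive_small (bf1 v v1) _ u1 e10); first by move=> y; exact: dsm.
  by clear -st t4 x1; lra.
have x12 (x : 'rV[R]_(d + m)) : enorm x < 1 -> eball 2 x by move=> /lt_trans; apply; rewrite ltr1n.
have ed i : enorm (delta_mx 0 i : 'rV[R]_(d + m)) = 1 by exact: enorm_delta.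
have bi i : Bk 3 (eball 2) K ('D_(delta_mx 0 i) G).
  exact: Bk_derive1.
have bij i j : Bk 2 (eball 2) K ('D_(delta_mx 0 i) ('D_(delta_mx 0 j) G)).
  exact: Bk_derive1.
split.
  move=> w w1; split.
  - apply/matrixP => i j; rewrite !mxE /=; have S := schwarz (delta_mx 0 j) (delta_mx 0 i) (Bk_leq (isT : (3 <= 4)%N) bG) (x12 _ w1); exact: S.
  - rewrite /near_model; have -> : kappa0 = 1 / 50 :> R by [].
    have h1 : fnorm (hess G w - (2 * pi) *: normal_proj) <= (n * n)%:R * ((2 + K') * t).
      apply: fnorm_le_coord => i j.
      have -> : (hess G w - (2 * pi) *: normal_proj) i j = 'D_(delta_mx 0 i) ('D_(delta_mx 0 j) f) w.
        have hE (A B : 'M[R]_(d + m)) c : (A - c *: B) i j = A i j - c * B i j by rewrite !mxE.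
        rewrite (derive2_rest _ _ bG (x12 _ w1)) hE; congr (_ - _); first by rewrite mxE.
        have -> : normal_grad (delta_mx 0 j : 'rV[R]_(d + m)) = (2 * pi) *: (delta_mx 0 j *m normal_proj) :> 'rV[R]_(d + m).
          by rewrite mul_normal_proj.
        rewrite edotZr edotC edot_delta -rowE [row j _ _ _]mxE.
        have [S _] := @oproj_normal_proj R d m.
        by congr (_ * _); rewrite -{1}S; move: (normal_proj : 'M[R]_(d + m)) => B; rewrite mxE.
      exact: d2sm.
    apply: (le_trans h1); rewrite mulrA; apply: (@le_trans _ _ (C * t)).
      by rewrite ler_wpM2r ?(ltW t0) // Cnn ?(ltW K2) //; clear -K2; lra.
    by rewrite /t (ler_pdivrMr _ _ hd); exact: C50.
  - apply: (@le_trans _ _ (n%:R * e1)); last first.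
      by rewrite /e1 mulrA ler_wpM2r ?(ltW r0) // Cn ?(ltW K2) //; clear -K2; lra.
    apply: enorm_le_coord => i.
    have -> : (grad G w - (2 * pi) *: row_mx 0 (rsubmx w)) 0 i = 'D_(delta_mx 0 i) f w.
      rewrite (derive_rest _ bG (x12 _ w1)) normal_gradC edotC edot_delta mxE; congr (_ + _).
        by rewrite mxE.
      by rewrite mxE.
    by apply: dsm => //; apply: lt_trans w1 _; lra.
move=> w h w1 h1; have wh : enorm w + enorm h < 2 by clear -w1 h1; lra.
have wh' : enorm w + enorm (- h) < 2 by rewrite enormN.
have h20 := sqr_ge0 (enorm h).
have KC : K <= 2 * (2 + K') by rewrite /K'; clear -K0; lra.
have KC2 : 2 * K <= 2 * (2 + K') by rewrite /K'; clear -K0; lra.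
split.
- apply: (@le_trans _ _ (n%:R * (K * enorm h ^+ 2))); last by rewrite mulrA ler_wpM2r // Cn.
  apply: enorm_le_coord => j.
  have -> : (grad G (w + h) - grad G w - h *m hess G w) 0 j =
      'D_(delta_mx 0 j) G (w + h) - 'D_(delta_mx 0 j) G w - 'D_h ('D_(delta_mx 0 j) G) w.
    rewrite (derive_sum h (Bk_leq (isT : (2 <= 3)%N) (bi j)) (x12 _ w1)) !mxE; congr (_ - _).
    by apply: eq_bigr => i _; rewrite mxE.
  exact: taylor1 (Bk_leq (isT : (2 <= 3)%N) (bi j)) wh.
- apply: (@le_trans _ _ ((n * n)%:R * (K * enorm h))); last by rewrite mulrA ler_wpM2r ?enorm_ge0 // Cnn.
  apply: fnorm_le_coord => i j; rewrite !mxE /=.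
  exact: taylor0 (Bk_leq (isT : (1 <= 2)%N) (bij i j)) wh.
apply: (@le_trans _ _ ((n * n)%:R * (2 * K * enorm h ^+ 2))); last first.
  by rewrite mulrA ler_wpM2r // Cnn // mulr_ge0.
apply: fnorm_le_coord => i j.
have hE (A B D : 'M[R]_(d + m)) : (A + B - 2 *: D) i j = A i j + B i j - 2 * D i j by rewrite !mxE.
have hh x : hess G x i j = 'D_(delta_mx 0 i) ('D_(delta_mx 0 j) G) x by rewrite mxE.
rewrite {}hE; move: (hess G) hh => HH hh; rewrite !hh {hh HH}; have T1 := taylor1 (bij i j) wh; have T2 := taylor1 (bij i j) wh'.
rewrite (derive_sum (- h) (bij i j) (x12 _ w1)) in T2; rewrite (derive_sum h (bij i j) (x12 _ w1)) in T1.
move: ('D_(delta_mx 0 i) ('D_(delta_mx 0 j) G)) T1 T2 => F T1 T2.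
set S := \sum_i0 h 0 i0 * _ in T1.
have SN : \sum_i0 (- h) 0 i0 * 'D_(delta_mx 0 i0) F w = - S.
  by rewrite -sumrN; apply: eq_bigr => l _; rewrite mxE mulNr.
rewrite SN enormN in T2.
have RR (a b c s' : R) : a + b - 2 * c = (a - c - s') + (b - c - - s') by ring.
rewrite (RR _ _ _ S).
by apply: (le_trans (ler_normD _ _)); clear -T1 T2; lra.
Qed.

(** * Invariance of the critical set under similarities *)

Section AffineInvariance.
Context {R : realType}.

Lemma affine_quotient n p (W : normedModType R) (f : 'rV[R]_p -> W) (A : 'M[R]_(n, p)) a c v x :
  (fun h : R => h^-1 *: (((fun y => f (y *m A + a) + c) \o shift x) (h *: v) - (f (x *m A + a) + c))) =
  (fun h : R => h^-1 *: ((f \o shift (x *m A + a)) (h *: (v *m A)) - f (x *m A + a))).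
Proof.
apply/funext => h /=; rewrite opprD addrACA subrr addr0.
by rewrite mulmxDl -scalemxAl addrA.
Qed.

Lemma derive_affine n p (W : normedModType R) (f : 'rV[R]_p -> W) (A : 'M[R]_(n, p)) a c v x :
  'D_v (fun y => f (y *m A + a) + c) x = 'D_(v *m A) f (x *m A + a).
Proof. by rewrite /derive affine_quotient. Qed.

Lemma is_derive_affine n p (W : normedModType R) (f : 'rV[R]_p -> W) (A : 'M[R]_(n, p)) a v x :
  derivable f (x *m A + a) (v *m A) ->
  is_derive x v (fun y => f (y *m A + a)) ('D_(v *m A) f (x *m A + a)).
Proof.
have -> : (fun y => f (y *m A + a)) = (fun y => f (y *m A + a) + 0) by apply/funext => y; rewrite addr0.
by move=> df; split; [rewrite /derivable affine_quotient|rewrite derive_affine].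
Qed.

Section Derivatives.
Context {n : nat}.
Implicit Types (G : 'rV[R]_n -> R) (A : 'M[R]_n) (w u v : 'rV[R]_n).

Lemma derive2_hess K G w u v : Bk 4 (eball 2) K G -> eball 2 w ->
  'D_u ('D_v G) w = (u *m hess G w *m v^T) 0 0.
Proof.
move=> bG w2; have [_ hk] := bG.
have b3 (v' : 'rV[R]_n) : Bk 3 (eball 2) (K * enorm v') ('D_v' G) by have [] := hk v'.
rewrite (derive_sum u (Bk_leq (isT : (2 <= 3)%N) (b3 v)) w2) -mulmxA mxE; apply: eq_bigr => i _; congr (_ * _).
rewrite (schwarz _ _ (Bk_leq (isT : (3 <= 4)%N) bG) w2) (derive_sum v (Bk_leq (isT : (2 <= 3)%N) (b3 _)) w2) mxE.
have hE j : hess G w i j = 'D_(delta_mx 0 i) ('D_(delta_mx 0 j) G) w by rewrite mxE.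
have S j := schwarz (delta_mx 0 j) (delta_mx 0 i) (Bk_leq (isT : (3 <= 4)%N) bG) w2.
by apply: eq_bigr => j _; rewrite S hE [v^T _ _]mxE mulrC.
Qed.

Variables (K : R) (G : 'rV[R]_n -> R) (A : 'M[R]_n) (a : 'rV[R]_n) (c : R) (x : 'rV[R]_n).
Hypotheses (bG : Bk 4 (eball 2) K G) (w2 : eball 2 (x *m A + a)).

Lemma grad_affine : grad (fun y => G (y *m A + a) + c) x = grad G (x *m A + a) *m A^T.
Proof.
apply/rowP => i; rewrite mxE derive_affine (derive_sum _ (Bk_leq (isT : (2 <= 4)%N) bG) w2) [RHS]mxE.
by apply: eq_bigr => j _; rewrite -rowE !mxE mulrC.
Qed.

Lemma hess_affine : hess (fun y => G (y *m A + a) + c) x = A *m hess G (x *m A + a) *m A^T.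
Proof.
apply/matrixP => i j; rewrite mxE /=.
have -> : 'D_(delta_mx 0 j) (fun y => G (y *m A + a) + c) = (fun y => 'D_(delta_mx 0 j *m A) G (y *m A + a) + 0).
  by apply/funext => y; rewrite derive_affine addr0.
rewrite (derive_affine ('D_(delta_mx 0 j *m A) G) A a 0 (delta_mx 0 i) x) (derive2_hess _ _ bG w2) -!rowE.
rewrite mxE [RHS]mxE; move: (hess G _) => Hw; apply: eq_bigr => l _.
by rewrite -row_mul !mxE.
Qed.

End Derivatives.

Lemma scale_conj n (H L : 'M[R]_n) c : (c *: L) *m H *m (c *: L)^T = (c * c) *: (L *m H *m L^T).
Proof. by rewrite linearZ /= -!scalemxAl -scalemxAr scalerA. Qed.

Lemma is_Pi_hi_conj n m (H P L : 'M[R]_n) c : 0 < c -> L *m L^T = 1%:M -> is_Pi_hi m H P ->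
  is_Pi_hi m ((c *: L) *m H *m (c *: L)^T) (L *m P *m L^T).
Proof.
move=> c0 LL [Q [l [QQ QH ls ->]]]; have LL' := mulmx1C LL.
exists (Q *m L^T), ((c * c) *: l); split.
- by rewrite trmx_mul trmxK -mulmxA [L^T *m _]mulmxA LL' mul1mx.
- have -> : diag_mx ((c * c) *: l) = (c * c) *: diag_mx l by rewrite linearZ.
  rewrite scale_conj -scalemxAr -scalemxAl; congr (_ *: _).
  by rewrite !mulmxA -[Q *m L^T *m L]mulmxA LL' mulmx1 QH.
- by move=> i j ij; rewrite !mxE ler_wpM2l ?ls // mulr_ge0 // ltW.
by rewrite !first_projE trmx_mul trmxK !mulmxA.
Qed.

(** Under a similarity the Hessian is conjugated by a rotation and multiplied by a positive scalar,
    so its spectral projection is conjugated by the rotation. This passes between the original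
    coordinates of [M_put] and the frames at the various points of [M]; [c] accounts for different
    frozen normalizations. *)
Lemma hi_critical_affine d m (K : R) (G : 'rV[R]_(d + m) -> R) (L : 'M[R]_(d + m)) a b c x : 0 < b -> L *m L^T = 1%:M ->
  Bk 4 (eball 2) K G -> eball 2 (x *m (b *: L) + a) ->
  (hess G (x *m (b *: L) + a))^T = hess G (x *m (b *: L) + a) -> near_model normal_proj (hess G (x *m (b *: L) + a)) ->
  hi_critical m (fun y => G (y *m (b *: L) + a) + c) x <-> pi_critical (grad G) (hess G) (x *m (b *: L) + a).
Proof.
move=> b0 LL bG; set w := x *m _ + a => w2 Hs nH.
have LL' := mulmx1C LL; have bb : b^-1 * b = 1 by rewrite mulVf // gt_eqF.
rewrite /hi_critical (grad_affine c bG w2) (hess_affine c bG w2) -/w.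
have [P hP] := Pi_hi_exists Hs.
set H' := (b *: L) *m hess G w *m (b *: L)^T.
have hP' : is_Pi_hi m H' (Pi_hi m H') := @xgetI _ 0 _ _ (is_Pi_hi_conj b0 LL hP).
have hPP : P = L^T *m Pi_hi m H' *m L.
  apply: (Pi_hi_uniq codim_le oproj_normal_proj tr_normal_proj nH hP).
  have LL2 : L^T *m L^T^T = 1%:M by rewrite trmxK.
  have b0' : 0 < b^-1 by rewrite invr_gt0.
  have := is_Pi_hi_conj b0' LL2 hP'; rewrite scale_conj /H' scale_conj trmxK.
  rewrite -scalemxAr -scalemxAl scalerA mulrACA bb mulr1 scale1r !mulmxA LL' mul1mx.
  by rewrite -[hess G w *m _ *m _]mulmxA LL' mulmx1.
have E : grad G w *m (b *: L)^T *m Pi_hi m H' = b *: (grad G w *m P *m L^T).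
  rewrite hPP linearZ /= -scalemxAr -scalemxAl; congr (_ *: _).
  by rewrite !mulmxA -[_ *m L *m L^T]mulmxA LL mulmx1.
rewrite E; split=> [/eqP|[P' hP2 gP]].
  rewrite scaler_eq0 (gt_eqF b0) /= => /eqP gP; exists P => //.
  by rewrite -[LHS]mulmx1 -LL' mulmxA gP mul0mx.
by rewrite (Pi_hi_uniq codim_le oproj_normal_proj tr_normal_proj nH hP hP2) gP mul0mx scaler0.
Qed.

End AffineInvariance.

(** * Calculus of C^k maps *)

Section CkCalculus.
Context {R : realType}.

Lemma Ck_ext n (W : normedModType R) k (U : set 'rV[R]_n) (f g : 'rV[R]_n -> W) : open U ->
  (forall x, U x -> f x = g x) -> Ck k U f -> Ck k U g.
Proof.
move=> oU; elim: k f g => [|k IH] f g fg [hf kf].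
all: have nfg x : U x -> \near x, f x = g x by
  move=> Ux; apply: (@filterS _ (nbhs x) _ U); [by move=> y /fg|exact: open_nbhs_nbhs].
all: have hc x : U x -> {for x, continuous g}
  by move=> Ux A; rewrite -(fg _ Ux) => nA; apply: (@filterS2 _ (nbhs x) _ (f @^-1` A) _ (g @^-1` A) _ (hf x Ux A nA) (nfg x Ux)) => y /= Ay <-.
- by split.
- split=> // v; have [h1 h2] := kf v; split.
    by move=> x Ux; apply: (near_eq_derivable (nfg x Ux)); exact: h1.
  by apply: IH h2 => x Ux; apply: near_eq_derive; exact: nfg.
Qed.

Lemma Ck_add n (W : normedModType R) k (U : set 'rV[R]_n) (f g : 'rV[R]_n -> W) : open U ->
  Ck k U f -> Ck k U g -> Ck k U (fun x => f x + g x).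
Proof.
move=> oU; elim: k f g => [|k IH] f g [hf kf] [hg kg].
  by split => // x Ux; apply: continuousD; [exact: hf|exact: hg].
split=> [x Ux|v]; first by apply: continuousD; [exact: hf|exact: hg].
have [f1 f2] := kf v; have [g1 g2] := kg v; split=> [x Ux|].
  by apply: derivableD; [exact: f1|exact: g1].
by apply: Ck_ext (IH _ _ f2 g2) => // x Ux; rewrite deriveD; [|exact: f1|exact: g1].
Qed.

Lemma is_derive_mulmxr n p (f : 'rV[R]_n -> 'rV[R]_p) q (B : 'M[R]_(p, q)) x v :
  derivable f x v -> is_derive x v (fun y => f y *m B) ('D_v f x *m B).
Proof.
move=> df; have cB := @continuous_mulmxr R p q B.
have E : (fun h : R => h^-1 *: (((fun y => f y *m B) \o shift x) (h *: v) - f x *m B)) =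
   (fun u : 'rV[R]_p => u *m B) \o (fun h : R => h^-1 *: ((f \o shift x) (h *: v) - f x)).
  by apply/funext => h /=; rewrite -mulmxBl scalemxAl.
have L : (fun h : R => h^-1 *: (((fun y => f y *m B) \o shift x) (h *: v) - f x *m B)) @ 0^' --> 'D_v f x *m B.
  by rewrite E; exact: (@cvg_comp _ _ _ _ (fun u : 'rV[R]_p => u *m B) _ _ _ df (cB _)).
by split; [apply/cvg_ex; exists ('D_v f x *m B)|exact: cvg_lim].
Qed.

Lemma Ck_affine_comp n p q r k (U : set 'rV[R]_n) (V : set 'rV[R]_p) (f : 'rV[R]_p -> 'rV[R]_q)
  (A : 'M[R]_(n, p)) a (B : 'M[R]_(q, r)) : open U -> (forall x, U x -> V (x *m A + a)) -> Ck k V f ->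
  Ck k U (fun x => f (x *m A + a) *m B).
Proof.
move=> oU UV; have cA x : {for x, continuous (fun x : 'rV[R]_n => x *m A + a)}.
  by apply: continuousD; [exact: continuous_mulmxr|exact: cst_continuous].
elim: k f => [|k IH] f [hf kf].
all: have hc x : U x -> {for x, continuous (fun x : 'rV[R]_n => f (x *m A + a) *m B)}
  by move=> Ux; have c1 := @continuous_comp _ _ _ (fun x : 'rV[R]_n => x *m A + a) f x (cA x) (hf _ (UV _ Ux));
  apply: (@continuous_comp _ _ _ _ (fun u : 'rV[R]_q => u *m B) _ c1); exact: continuous_mulmxr.
  by split.
split=> // v; have [f1 f2] := kf (v *m A).
have dU x : U x -> is_derive x v (fun x => f (x *m A + a) *m B) ('D_(v *m A) f (x *m A + a) *m B).
  by move=> Ux; have [d1 <-] := is_derive_affine (f1 _ (UV _ Ux)); exact: is_derive_mulmxr.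
split=> [x /dU[]//|]; apply: Ck_ext (IH _ f2) => // x /dU[_ ->] //.
Qed.

Lemma Ck_id n k (U : set 'rV[R]_n) : Ck k U (fun x : 'rV[R]_n => x).
Proof.
have c0 (x : 'rV[R]_n) : {for x, continuous (fun x : 'rV[R]_n => x)} by move=> P.
case: k => [|k]; split=> // v.
have d x : is_derive x v (fun x : 'rV[R]_n => x) v by exact: is_derive_id.
split; first by move=> x _; have [] := d x.
have -> : 'D_v (fun x : 'rV[R]_n => x) = (fun=> v) by apply/funext => x; have [] := d x.
elim: k v {d} => [|k IH] v; split => //; try (by move=> x _; exact: cst_continuous).
move=> u; split; first by move=> x _; exact: derivable_cst.
have -> : 'D_u (fun _ : 'rV[R]_n => v) = (fun=> 0); last exact: IH.
by apply/funext => x; exact: derive_cst.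
Qed.

End CkCalculus.

(** * Reach from approximate midpoints *)

Section Reach.
Context {R : realType} {n : nat}.
Implicit Types (A B : set 'rV[R]_n) (x q z : 'rV[R]_n).

Lemma edist_nearest A x q : nearest A x q -> Defs.edist x A = (enorm (x - q))%:E.
Proof.
move=> [Aq hq]; apply/eqP; rewrite eq_le edist_le //=.
by apply: le_ereal_inf_tmp => _ [a Aa <-]; rewrite lee_fin hq.
Qed.

Lemma tube_nonempty A x r : tube A r x -> A !=set0.
Proof.
rewrite /tube /= => h; apply/set0P/eqP => A0; move: h; rewrite A0 /Defs.edist.
by rewrite image_set0 ereal_inf0.
Qed.

(** [x] is the distance from a centre to the midpoint of two of its nearest points. It falls short
    of [rho] by at least [e ^ 2 / (8 * rho)], which an error [K * e ^ 2] cannot make up for when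
    [8 * r * K < 1]. *)
Lemma midpoint_contra (rho e K r x : R) : 0 <= K -> 0 < e -> rho <= r -> e <= 2 * rho -> 8 * (r * K) < 1 -> 0 <= x ->
  x ^+ 2 = rho ^+ 2 - e ^+ 2 / 4 -> rho <= x + K * e ^+ 2 -> False.
Proof.
move=> K0 e0 rr er rK x0 hx hl.
have rho0 : 0 <= rho by lra.
have K8 : 8 * (rho * K) < 1 by apply: le_lt_trans rK; rewrite ler_wpM2l // ler_wpM2r.
have e20 : 0 < e ^+ 2 by exact: exprn_gt0.
have a1 : K * e ^+ 2 <= rho / 2.
  have : K * e ^+ 2 <= K * (2 * rho) ^+ 2.
    by rewrite ler_wpM2l // lerXn2r ?nnegrE ?mulr_ge0 // ltW.
  have -> : K * (2 * rho) ^+ 2 = (8 * (rho * K)) * (rho / 2) by field.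
  by have := ler_wpM2r (_ : 0 <= rho / 2) (ltW K8); rewrite mul1r divr_ge0 // => /(_ isT); lra.
have a2 : (rho - K * e ^+ 2) ^+ 2 <= x ^+ 2.
  by rewrite lerXn2r ?nnegrE //; lra.
have a3 : e ^+ 2 / 4 <= 2 * (rho * K) * e ^+ 2.
  have := sqr_ge0 (K * e ^+ 2).
  have sq : (rho - K * e ^+ 2) ^+ 2 = rho ^+ 2 - 2 * (rho * K) * e ^+ 2 + (K * e ^+ 2) ^+ 2 by ring.
  by rewrite hx sq in a2; lra.
have : 8 * (rho * K) * e ^+ 2 < e ^+ 2 by rewrite -[ltRHS]mul1r ltr_pM2r.
by lra.
Qed.

Lemma midpoint_reach B r K : closed B -> 0 <= r -> 0 <= K -> 8 * (r * K) < 1 ->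
  (forall z1 z2, B z1 -> B z2 -> enorm (z1 - z2) <= 2 * r ->
     exists2 z, B z & enorm (z - 2^-1 *: (z1 + z2)) <= K * enorm (z1 - z2) ^+ 2) ->
  (r%:E <= reach B)%E.
Proof.
move=> cB r0 K0 rK hmid; apply: ereal_sup_ubound; exists r => //; split=> // x hx.
have [q hq] := nearest_exists x cB (tube_nonempty hx); exists q; split=> // q' hq'.
have rho : enorm (x - q) <= r by move: hx; rewrite /tube /= (edist_nearest hq) lee_fin.
have rho' : enorm (x - q') = enorm (x - q).
  by apply/eqP; rewrite eq_le; case: hq hq' => Bq h1 [Bq' h2]; rewrite h1 // h2.
have qq' : enorm (q - q') <= 2 * enorm (x - q).
  by rewrite (le_trans (enorm_triangle x _ _)) // rho' enormBC mulr_natl mulr2n.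
have [z Bz hz] := hmid q q' hq.1 hq'.1 (le_trans qq' (ler_wpM2l (ler0n _ 2) rho)).
have [->//|ne] := eqVneq q q'; exfalso.
have e0 : 0 < enorm (q - q') by rewrite enorm_gt0 // subr_eq0.
have par : enorm (x - 2^-1 *: (q + q')) ^+ 2 = enorm (x - q) ^+ 2 - enorm (q - q') ^+ 2 / 4.
  have -> : x - 2^-1 *: (q + q') = 2^-1 *: ((x - q) + (x - q')) by apply/rowP => i; rewrite !mxE; field.
  have -> : q - q' = (x - q') - (x - q) by vec.
  rewrite enormZ ger0_norm ?invr_ge0 // exprMn (enormD_sqr (x - q)) (enormB_sqr (x - q')) rho'.
  by rewrite [edot (x - q') _]edotC; field.
apply: (midpoint_contra K0 e0 rho qq' rK (enorm_ge0 _) par).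
rewrite (le_trans (hq.2 _ Bz)) // (le_trans (enorm_triangle (2^-1 *: (q + q')) _ _)) // lerD2l.
by rewrite enormBC.
Qed.

End Reach.

Lemma midpoint_sizes (R : realType) (rho e : R) : 0 <= rho -> 0 <= e -> rho + 2 * e <= 1 / 3 ->
  [/\ rho + e < 1, rho < 1, rho + e + rho < 1, e < 1 & rho + 2 * e < 1].
Proof. by move=> h1 h2 h3; split; lra. Qed.

(** * The output set: charts, closedness and midpoints *)

Section Put.
Context {R : realType} {d m k : nat}.
Variables (s C eps r0 tau c3 c4 : R) (M : set 'rV[R]_(d + m)) (f cst : 'rV[R]_(d + m) -> R).
(** F in the frame at [q]. The constant [cst q] is the logarithm of the normalization frozen at [q];
    moving from one [q] to another changes F by an additive constant. *)
Let G q Q := fun w : 'rV[R]_(d + m) => f (q + w *m Q) + cst q.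
Hypotheses (s0 : 0 < s) (C0 : 0 <= C) (eps0 : 0 <= eps) (r00 : 0 < r0) (r03 : r0 < c3) (r04 : r0 < c4)
  (gM : good_mfd tau M) (eta : C * eps <= r0 / 2) (flat : 3 / tau <= r0 / 2).
Hypothesis hlr : forall (x : 'rV[R]_d) (y : 'rV[R]_m), eball c4 x -> eball c3 y -> eball 1 (row_mx x y).
Hypothesis hBk : forall q Q, M q -> tangent_frame M q Q -> exists K, Bk 4 (eball 2) K (G q Q).
Hypothesis hsm : forall q Q, M q -> tangent_frame M q Q -> smooth_model C eps (grad (G q Q)) (hess (G q Q)).
Hypothesis hgr : forall q Q, M q -> tangent_frame M q Q -> exists psi : 'rV[R]_d -> 'rV[R]_m,
  [/\ Ck (k - 2) (eball c4) psi, (forall x, eball c4 x -> eball c3 (psi x)) &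
   forall x y, eball c4 x -> eball c3 y -> (hi_critical m (G q Q) (row_mx x y) <-> y = psi x)].

(** [M_put] in rescaled terms, with the extended-real distance replaced by [mdist]; see
    [M_put_eq]. *)
Definition put z := mdist M (s^-1 *: z) <= r0 /\ exists q, nearest M (s^-1 *: z) q /\
  hi_critical m (fun y => f (s^-1 *: y) + cst q) z.

Let s1 : 0 < s^-1. Proof. by rewrite invr_gt0. Qed.
Let cM : closed M. Proof. by case: gM => _ /compact_closed_row. Qed.
Let c30 : 0 < c3. Proof. exact: lt_trans r03. Qed.
Let c40 : 0 < c4. Proof. exact: lt_trans r04. Qed.

Let sK (x : 'rV[R]_(d + m)) : s^-1 *: (s *: x) = x.
Proof. by rewrite scalerA mulVf ?gt_eqF // scale1r. Qed.
Let sVK (x : 'rV[R]_(d + m)) : s *: (s^-1 *: x) = x.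
Proof. by rewrite scalerA mulfV ?gt_eqF // scale1r. Qed.

Let e12 (w : 'rV[R]_(d + m)) : enorm w < 1 -> eball 2 w.
Proof. by move=> /lt_trans; apply; rewrite ltr1n. Qed.

Let frame q : M q -> exists Q, tangent_frame M q Q. Proof. by case: gM => _ _ h _; exact: h. Qed.

Lemma hi_critical_local q Q c w : M q -> tangent_frame M q Q -> enorm w < 1 ->
  hi_critical m (fun y => f (s^-1 *: y) + c) (s *: (q + w *m Q)) <-> pi_critical (grad (G q Q)) (hess (G q Q)) w.
Proof.
move=> Mq fQ w1; have [K bG] := hBk Mq fQ; have [QQ _] := fQ; have QQ' := mulmx1C QQ.
have [Hs nH _] := (hsm Mq fQ).1 w w1.
have E : (fun y => f (s^-1 *: y) + c) = (fun y => G q Q (y *m (s^-1 *: Q^T) + - (q *m Q^T)) + (c - cst q)).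
  apply/funext => y; rewrite /G -addrA [cst q + _]addrC subrK; congr (f _ + _).
  by rewrite mulmxDl mulNmx -scalemxAr -scalemxAl !mulmx_orthVK // addrC subrK.
have W : (s *: (q + w *m Q)) *m (s^-1 *: Q^T) + - (q *m Q^T) = w.
  rewrite -scalemxAr scalemxAl sK mulmxDl mulmx_orthK //.
  by rewrite addrC addKr.
by rewrite E; have := @hi_critical_affine R d m K (G q Q) Q^T (- (q *m Q^T)) s^-1 (c - cst q) (s *: (q + w *m Q));
  rewrite W trmxK; apply => //; exact: e12.
Qed.

Lemma hi_critical_pi q Q w : M q -> tangent_frame M q Q -> enorm w < 1 ->
  hi_critical m (G q Q) w <-> pi_critical (grad (G q Q)) (hess (G q Q)) w.
Proof.
move=> Mq fQ w1; have [K bG] := hBk Mq fQ; have [Hs nH _] := (hsm Mq fQ).1 w w1.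
have E : G q Q = (fun y => G q Q (y *m (1 *: 1%:M) + 0) + 0) by apply/funext => y; rewrite scale1r mulmx1 !addr0.
have := @hi_critical_affine R d m K (G q Q) 1%:M 0 1 0 w; rewrite -E scale1r mulmx1 addr0 trmx1 mulmx1.
by apply => //; exact: e12.
Qed.

(** Critical points are the same for all frozen normalizations and all frames, so membership can be
    read in the frame at any convenient [q], not only at the projection of the point. *)
Lemma put_local q Q w : M q -> tangent_frame M q Q -> enorm w < 1 ->
  put (s *: (q + w *m Q)) <-> mdist M (q + w *m Q) <= r0 /\ pi_critical (grad (G q Q)) (hess (G q Q)) w.
Proof.
move=> Mq fQ w1; rewrite /put sK; split=> [[h1 [q' [_ h2]]]|[h1 h2]]; split => //.
  exact: (hi_critical_local _ Mq fQ w1).1 h2.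
have [q' hq'] := nearest_exists (q + w *m Q) cM (ex_intro _ q Mq).
by exists q'; split=> //; exact: (hi_critical_local _ Mq fQ w1).2.
Qed.

Lemma nearest_coord x q Q : nearest M x q -> tangent_frame M q Q ->
  exists2 y : 'rV[R]_m, x = q + row_mx 0 y *m Q & enorm y = mdist M x.
Proof.
move=> hq fQ; have [QQ _] := fQ; have [Mq _] := hq.
have t0 : tc Q (x - q) = 0.
  apply: edot_orth => u; have Tu : tangent M q (row_mx u 0 *m Q) by rewrite (tangentP _ fQ) nc_row_mx.
  have := nearest_normal gM hq Tu; rewrite edotC edot_mulmx -[_ *m Q^T]hsubmxK edot_row_mx.
  by rewrite edot0l addr0 edotC.
exists (nc Q (x - q)); first by rewrite -t0 tcnc_row_mx // addrC subrK.
by rewrite (mdist_nearest hq) -(enorm_row_0mx d) -t0 -(enorm_orthmx QQ) tcnc_row_mx.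
Qed.

Lemma normal_lt1 (y : 'rV[R]_m) : enorm y <= r0 -> enorm (row_mx (0 : 'rV[R]_d) y) < 1.
Proof.
by move=> yr; apply: hlr; rewrite /eball /= ?enorm0 //; exact: le_lt_trans yr r03.
Qed.

Lemma put_normal z q Q : put z -> nearest M (s^-1 *: z) q -> tangent_frame M q Q ->
  exists2 y : 'rV[R]_m, s^-1 *: z = q + row_mx 0 y *m Q & enorm y <= C * eps /\ enorm y = mdist M (s^-1 *: z).
Proof.
move=> pz hq fQ; have [y E ny] := nearest_coord hq fQ; exists y => //; have [Mq _] := hq.
split=> //; have [mz _] := pz; rewrite -ny in mz.
have := pz; rewrite -[z]sVK E (put_local Mq fQ (normal_lt1 mz)) => -[_ cw].
have := critical_small C0 eps0 (hsm Mq fQ) (normal_lt1 mz) cw.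
by rewrite row_mxKr.
Qed.

(** The graph hypothesis at tangential coordinate 0 yields a critical point in the normal fibre;
    [C * eps <= r0 / 2] keeps it in the tube. *)
Lemma put_over q Q : M q -> tangent_frame M q Q -> exists y : 'rV[R]_m,
  [/\ put (s *: (q + row_mx 0 y *m Q)), pi_critical (grad (G q Q)) (hess (G q Q)) (row_mx 0 y),
     enorm y <= C * eps & mdist M (q + row_mx 0 y *m Q) <= enorm y].
Proof.
move=> Mq fQ; have [QQ _] := fQ; have [psi [_ h1 h2]] := hgr Mq fQ.
have b0 : eball c4 (0 : 'rV[R]_d) by rewrite /eball /= enorm0.
have w1 := hlr b0 (h1 _ b0).
have cw : pi_critical (grad (G q Q)) (hess (G q Q)) (row_mx 0 (psi 0)).
  by rewrite -(hi_critical_pi Mq fQ w1) (h2 _ _ b0 (h1 _ b0)).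
have := critical_small C0 eps0 (hsm Mq fQ) w1 cw; rewrite row_mxKr => ny.
have md : mdist M (q + row_mx 0 (psi 0) *m Q) <= enorm (psi 0).
  by rewrite (le_trans (mdist_le _ cM Mq)) // [q + _]addrC addrK (enorm_orthmx QQ) enorm_row_0mx.
exists (psi 0); split=> //; rewrite (put_local Mq fQ w1); split=> //.
by rewrite (le_trans md) // (le_trans ny) // (le_trans eta) // ler_pdivrMr // ler_peMr ?ltW // ltr1n.
Qed.

Let E1 : 'M[R]_(d + m, d) := col_mx 1%:M 0.
Let F2 : 'M[R]_(d + m, m) := col_mx 0 1%:M.
Let E2 : 'M[R]_(m, d + m) := row_mx 0 1%:M.

Let lsubE (v : 'rV[R]_(d + m)) : v *m E1 = lsubmx v.
Proof. by rewrite -{1}[v]hsubmxK mul_row_col mulmx1 mulmx0 addr0. Qed.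
Let rsubE (v : 'rV[R]_(d + m)) : v *m F2 = rsubmx v.
Proof. by rewrite -{1}[v]hsubmxK mul_row_col mulmx1 mulmx0 add0r. Qed.
Let mulE2 (y : 'rV[R]_m) : y *m E2 = row_mx 0 y.
Proof. by rewrite mul_mx_row mulmx0 mulmx1. Qed.

Lemma open_affine_preimage n p (A : 'M[R]_(n, p)) a c : open [set v : 'rV[R]_n | eball c (v *m A + a)].
Proof.
have h v : {for v, continuous (fun v : 'rV[R]_n => v *m A + a)}.
  by apply: continuousD; [exact: continuous_mulmxr|exact: cst_continuous].
apply: (@open_comp _ _ (fun v : 'rV[R]_n => v *m A + a) (eball c)); last exact: open_eball0.
by move=> v _; exact: h.
Qed.

Lemma Ck_cont n (W : normedModType R) j (U : set 'rV[R]_n) (g : 'rV[R]_n -> W) x : Ck j U g -> U x -> {for x, continuous g}.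
Proof. by case: j => [|j] [h _]; exact: h. Qed.

(** Straighten the graph: [T] gives the coordinates in the frame at the foot [q], and [Phi]
    subtracts [psi] of the tangential part from the normal part. The statement concerns all points
    of the tube, because [put_closed] needs the chart at a limit point. *)
Lemma put_chart z : M !=set0 -> mdist M (s^-1 *: z) <= r0 ->
  exists (U W : set 'rV[R]_(d + m)) (Phi Psi : 'rV[R]_(d + m) -> 'rV[R]_(d + m)),
    [/\ open U, open W & U z] /\
    [/\ forall x, U x -> W (Phi x) /\ Psi (Phi x) = x,
        forall y, W y -> U (Psi y) /\ Phi (Psi y) = y,
        Ck (k - 2) U Phi, Ck (k - 2) W Psi &
        forall x, U x -> (put x <-> rsubmx (Phi x) = 0)].
Proof.
move=> M0 mz; have [q hq] := nearest_exists (s^-1 *: z) cM M0; have [Mq _] := hq.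
have [Q fQ] := frame Mq; have [QQ _] := fQ; have [psi [psiC psi3 psiP]] := hgr Mq fQ.
pose A := s^-1 *: Q^T; pose a := - (q *m Q^T); pose T (z : 'rV[R]_(d + m)) := z *m A + a.
pose S (v : 'rV[R]_(d + m)) := v *m (s *: Q) + s *: q.
have SE v : S v = s *: (q + v *m Q) by rewrite /S -scalemxAr -scalerDr addrC.
have TS v : T (S v) = v.
  by rewrite SE /T /A -scalemxAr scalemxAl sK mulmxDl mulmx_orthK // addrC addKr.
have ST x : S (T x) = x.
  rewrite SE /T /A /a mulmxDl mulNmx -scalemxAr -scalemxAl !mulmx_orthVK // addrC subrK; exact: sVK.
pose U := [set x | eball c4 (x *m (A *m E1) + a *m E1)] `&` [set x | eball c3 (x *m (A *m F2) + a *m F2)].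
have lT x : x *m (A *m E1) + a *m E1 = lsubmx (T x) by rewrite -lsubE mulmxDl mulmxA.
have rT x : x *m (A *m F2) + a *m F2 = rsubmx (T x) by rewrite -rsubE mulmxDl mulmxA.
pose W1 := [set v : 'rV[R]_(d + m) | eball c4 (v *m E1 + 0)].
pose g (v : 'rV[R]_(d + m)) := v *m F2 + psi (v *m E1 + 0) *m 1%:M.
have gE v : g v = rsubmx v + psi (lsubmx v) by rewrite /g mulmx1 addr0 lsubE rsubE.
have oW1 : open W1 by exact: open_affine_preimage.
have oU : open U by apply: openI; exact: open_affine_preimage.
pose W := W1 `&` [set v | eball c3 (g v)].
have lin n p (B : 'M[R]_(n, p)) b j (V : set 'rV[R]_n) : open V -> Ck j V (fun v => v *m B + b).
  move=> oV; have := @Ck_affine_comp R n p p p j V setT (fun x => x) B b 1%:M oV.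
  have -> : (fun v => v *m B + b) = (fun v => (v *m B + b) *m 1%:M) by apply/funext => v; rewrite mulmx1.
  by apply => //; exact: Ck_id.
have cg : Ck (k - 2) W1 g.
  apply: Ck_add => //; last exact: (@Ck_affine_comp R (d + m) d m m (k - 2) W1 (eball c4) psi E1 0 1%:M oW1 (fun v h => h) psiC).
  have -> : (fun v : 'rV[R]_(d + m) => v *m F2) = (fun v => v *m F2 + 0) by apply/funext => v; rewrite addr0.
  exact: lin.
have oW : open W.
  rewrite openE => v [v1 v2]; apply: filterI; first exact: open_nbhs_nbhs.
  by apply: (Ck_cont cg v1); apply: open_nbhs_nbhs; split => //; exact: open_eball0.
pose Phi x := T x + psi (x *m (A *m E1) + a *m E1) *m (- E2).
pose Psi v := S v + psi (v *m E1 + 0) *m (E2 *m (s *: Q)).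
have lPhi x : lsubmx (Phi x) = lsubmx (T x).
  by rewrite /Phi mulmxN mulE2 linearB /= row_mxKl subr0.
have rPhi x : rsubmx (Phi x) = rsubmx (T x) - psi (lsubmx (T x)).
  by rewrite /Phi mulmxN mulE2 linearB /= row_mxKr lT.
have PsiE v : Psi v = S (v + row_mx 0 (psi (lsubmx v))).
  by rewrite /Psi /S addr0 lsubE mulmxA mulE2 mulmxDl addrAC.
have TPsi v : T (Psi v) = v + row_mx 0 (psi (lsubmx v)) by rewrite PsiE TS.
exists U, W, Phi, Psi; split; first split => //.
  have [y E ny] := nearest_coord hq fQ.
  have -> : z = S (row_mx 0 y) by rewrite SE -E sVK.
  rewrite /U /= lT rT TS row_mxKl row_mxKr /eball /= enorm0; split=> //.
  by rewrite ny (le_lt_trans mz).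
split.
- move=> x [/= xl xr]; rewrite lT in xl; rewrite rT in xr; split.
    split; first by rewrite /W1 /= addr0 lsubE lPhi.
    by rewrite /= gE lPhi rPhi subrK.
  rewrite PsiE lPhi /Phi lT mulmxN mulE2 subrK; exact: ST.
- move=> v [/= vl vr]; rewrite /W1 /= addr0 lsubE in vl; rewrite gE in vr.
  have lP : lsubmx (T (Psi v)) = lsubmx v by rewrite TPsi linearD /= row_mxKl addr0.
  split; first by rewrite /U /= lT rT lP; split=> //; rewrite TPsi linearD /= row_mxKr.
  by rewrite /Phi lT lP mulmxN mulE2 TPsi addrK.
- apply: Ck_add => //; first exact: lin.
  exact: (@Ck_affine_comp R (d + m) d m (d + m) (k - 2) U (eball c4) psi (A *m E1) (a *m E1) (- E2) oU (fun x h => h.1) psiC).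
- apply: Ck_add => //; first exact: lin.
  exact: (@Ck_affine_comp R (d + m) d m (d + m) (k - 2) W (eball c4) psi E1 0 (E2 *m (s *: Q)) oW (fun x h => h.1) psiC).
move=> x [/= xl xr]; rewrite lT in xl; rewrite rT in xr.
have w1 : enorm (T x) < 1 by rewrite -[T x]hsubmxK; exact: hlr.
have xE : x = s *: (q + T x *m Q) by rewrite -SE ST.
have key : pi_critical (grad (G q Q)) (hess (G q Q)) (T x) <-> rsubmx (T x) = psi (lsubmx (T x)).
  by rewrite -(hi_critical_pi Mq fQ w1) -(psiP _ _ xl xr) hsubmxK.
rewrite {1}xE (put_local Mq fQ w1) rPhi; split=> [[_ /key ->]|/eqP]; first by rewrite subrr.
rewrite subr_eq0 => /eqP/key cw; split; last exact: cw.
(* A critical point of the chart domain lies in the tube: half of [r0] pays for its normal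
   coordinates, the other half for the curvature of [M]. *)
apply: (le_trans (frame_dist_le gM _ Mq fQ)); have [tau0 _ _ _] := gM.
have h1 := le_trans (critical_small C0 eps0 (hsm Mq fQ) w1 cw) eta.
have h2 : 3 * enorm (lsubmx (T x)) ^+ 2 / tau <= r0 / 2.
  apply: le_trans flat; rewrite ler_wpM2r ?invr_ge0 ?(ltW tau0) // ler_piMr // exprn_ile1 ?enorm_ge0 //.
  by rewrite (le_trans (enorm_lsubmx _)) // ltW.
by rewrite [r0]splitr lerD.
Qed.

Lemma put_closed : closed put.
Proof.
move=> z cz; have M0 : M !=set0.
  by have [z' [[_ [q [[Mq _] _]]] _]] := cz _ (@filterT _ (nbhs z) _); exists q.
have mz : mdist M (s^-1 *: z) <= r0.
  have cm : {for z, continuous (fun z : 'rV[R]_(d + m) => mdist M (s^-1 *: z))}.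
    by apply: (@continuous_comp _ _ _ (fun z : 'rV[R]_(d + m) => s^-1 *: z)); [exact: scaler_continuous|exact: continuous_mdist].
  rewrite leNgt; apply/negP => lt; have n0 : nbhs (mdist M (s^-1 *: z)) [set t | r0 < t].
    by apply: open_nbhs_nbhs; split; [exact: open_gt|].
  have := cm _ n0; by move=> /cz[z' [[h _] /=]]; rewrite ltNge h.
have [U [W [Phi [Psi [[oU oW Uz] [_ _ cP _ hP]]]]]] := put_chart M0 mz.
apply/(hP _ Uz)/eqP/negPn/negP => ne.
have cr : {for z, continuous (fun x => enorm (rsubmx (Phi x)))}.
  have -> : (fun x => enorm (rsubmx (Phi x))) = (fun x => enorm (Phi x *m F2)) by apply/funext => x; rewrite rsubE.
  have c1 := @continuous_comp _ _ _ Phi (fun v => v *m F2) z (Ck_cont cP Uz) (@continuous_mulmxr R _ _ F2 _).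
  by apply: (continuous_comp c1); exact: continuous_enorm.
have n0 : nbhs (enorm (rsubmx (Phi z))) [set t : R | 0 < t].
  by apply: open_nbhs_nbhs; split; [exact: open_gt|exact: enorm_gt0].
have n1 : nbhs z [set x | 0 < enorm (rsubmx (Phi x))] := cr _ n0.
have n2 : nbhs z U by exact: open_nbhs_nbhs.
have [z' [pz [/= h Uz']]] := cz _ (filterI n1 n2).
by move: h; rewrite ((hP _ Uz').1 pz) enorm0 ltxx.
Qed.

(** In the frame at the foot [p] of their midpoint, the two points become [w + h] and [w - h] with
    [w] in the normal fibre. [midpoint_residual] makes the projected gradient at [w] of order
    [|h| ^ 2], and [fiber_lower] converts this into the distance from [w] to the critical point over
    [p]. *)
Lemma put_midpoint rho z1 z2 : 0 <= rho -> rho + 2 * (C * eps) <= 1 / 3 -> C * (rho + 2 * (C * eps)) <= 1 / 10 ->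
  C * (C * eps) <= 1 / 100 -> eps <= 1 ->
  put z1 -> put z2 -> enorm (s^-1 *: z1 - s^-1 *: z2) <= 2 * rho ->
  exists2 z, put z & enorm (s^-1 *: z - 2^-1 *: (s^-1 *: z1 + s^-1 *: z2)) <=
    ((C + 8) * (400 * C ^+ 2 + 4 * C) + C + 8 * C * (C + 9)) * enorm (2^-1 *: (s^-1 *: z1 - s^-1 *: z2)) ^+ 2.
Proof.
move=> rho0 rc Crc CCe e1 p1 p2.
set x1 := s^-1 *: z1; set x2 := s^-1 *: z2 => x12; set x := 2^-1 *: (x1 + x2).
have M0 : M !=set0 by have [_ [q [[Mq _] _]]] := p1; exists q.
have [q1 hq1] := nearest_exists x1 cM M0; have [Q1 fQ1] := frame hq1.1.
have [y1 _ [ny1 my1]] := put_normal p1 hq1 fQ1; rewrite -/x1 in my1.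
have [p hp] := nearest_exists x cM M0; have [Mp _] := hp; have [Q fQ] := frame Mp; have [QQ _] := fQ.
have [y Ex ny] := nearest_coord hp fQ.
pose h := (2^-1 *: (x1 - x2)) *m Q^T; pose w : 'rV[R]_(d + m) := row_mx 0 y.
have nh : enorm h = enorm (2^-1 *: (x1 - x2)) by exact: enorm_orthmxV.
have nhr : enorm h <= rho by rewrite nh enormZ ger0_norm ?invr_ge0 // ler_pdivrMl.
have Eh : h *m Q = 2^-1 *: (x1 - x2) by exact: mulmx_orthVK.
have mid (u v : 'rV[R]_(d + m)) : u = 2^-1 *: (u + v) + 2^-1 *: (u - v) /\ v = 2^-1 *: (u + v) - 2^-1 *: (u - v).
  by split; apply/rowP => i; rewrite !mxE; field.
have ex1 : x1 = p + (w + h) *m Q.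
  by rewrite mulmxDl Eh addrA -Ex; exact: (mid x1 x2).1.
have ex2 : x2 = p + (w - h) *m Q.
  by rewrite mulmxBl Eh addrA -Ex; exact: (mid x1 x2).2.
have yb : enorm y <= rho + C * eps.
  rewrite ny (le_trans (mdist_lip x x1 cM M0)) // addrC lerD // -?my1 // enormBC.
  have -> : x1 - x = 2^-1 *: (x1 - x2) by rewrite {1}(mid x1 x2).1 -/x addrC addKr.
  by rewrite -nh.
have Ce0 : 0 <= C * eps by rewrite mulr_ge0.
have nw : enorm w = enorm y by exact: enorm_row_0mx.
have [k1 k2 k3 k4 k5] := midpoint_sizes rho0 Ce0 rc.
have w1 : enorm w < 1 by rewrite nw (le_lt_trans yb).
have h1 : enorm h < 1 by exact: le_lt_trans k2.
have wpm : enorm w + enorm h < 1.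
  by rewrite nw; apply: le_lt_trans k3; rewrite lerD.
have wp : enorm (w + h) < 1 by exact: le_lt_trans (enormD_le _ _) wpm.
have wm : enorm (w - h) < 1 by exact: le_lt_trans (enormB_le _ _) wpm.
have cp : pi_critical (grad (G p Q)) (hess (G p Q)) (w + h).
  by have := p1; rewrite -[z1]sVK -/x1 ex1 (put_local Mp fQ wp) => -[].
have cm : pi_critical (grad (G p Q)) (hess (G p Q)) (w - h).
  by have := p2; rewrite -[z2]sVK -/x2 ex2 (put_local Mp fQ wm) => -[].
have [Hs _ _] := (hsm Mp fQ).1 w w1; have [P hP] := Pi_hi_exists Hs.
have res := midpoint_residual C0 eps0 (hsm Mp fQ) w1 h1 wp wm e1 cp cm hP.
have [ys [pz cs nys _]] := put_over Mp fQ.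
have yys : enorm (y - ys) <= rho + 2 * (C * eps).
  by rewrite (le_trans (enormB_le _ _)) // mulr_natl mulr2n addrA lerD.
exists (s *: (p + row_mx 0 ys *m Q)) => //; rewrite sK Ex opprD addrACA subrr add0r -mulmxBl opp_row_mx add_row_mx subr0.
rewrite (enorm_orthmx QQ) enorm_row_0mx enormBC -nh; apply: le_trans res.
apply: (fiber_lower C0 eps0 (hsm Mp fQ)) => //.
- by rewrite (le_trans (ler_wpM2l C0 yys)).
- exact: le_lt_trans k4.
- by rewrite -nw.
exact: le_lt_trans k5.
Qed.

End Put.

(** * Assembly of the three claims *)

Lemma two_pi_gt1 (R : realType) : 1 < 2 * pi :> R.
Proof. by have := pi_ge2 R; lra. Qed.

Lemma le_scale (R : realType) (sigma : R) : 0 < sigma -> sigma <= scale sigma.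
Proof.
move=> s0; rewrite /scale ler_peMr ?(ltW s0) // -[leLHS]sqrtr1 ler_sqrt ?mulr_ge0 ?pi_ge0 //.
exact: ltW (two_pi_gt1 R).
Qed.

Lemma local_radius_lt1 (R : realType) : local_radius R < 1.
Proof.
rewrite /local_radius invf_lt1 ?sqrtr_gt0 ?mulr_gt0 ?pi_gt0 // -[X in X < _]sqrtr1 ltr_sqrt ?mulr_gt0 ?pi_gt0 //.
exact: two_pi_gt1.
Qed.

(** The term [rho ^ 2] on both sides of (iii) absorbs the C^0 error as soon as [eps <= rho ^ 2 / 2];
    the threshold for the bandwidth therefore depends on [rho], but the constants do not. *)
Lemma local_model_asdf (R : realType) d m k kk (K eps rho : R) (F : 'rV[R]_(d + m) -> R) : (k <= kk)%N -> 0 < rho ->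
  eps <= rho ^+ 2 / 2 -> local_model kk K eps F -> asdf k (K + 1) (1 / 2) (pi + 1) rho F.
Proof.
move=> kk0 rho0 er [bF hF].
have sub : eball (local_radius R) `<=` @eball R (d + m) 2.
  by move=> w /lt_trans; apply; apply: lt_trans (local_radius_lt1 R) _; rewrite ltr1n.
have b := Bk_leq kk0 (Bk_sub sub bF); split; first exact: Bk_Ck b.
  move=> vs w vk v1 wl; have := Bk_iter_derive vk b.
  have -> : \prod_(v <- vs) enorm v = 1 by rewrite big1_seq // => v /andP[_ /v1].
  rewrite mulr1; case: (k - size vs)%N => [|j] [/(_ w wl)[_]]; rewrite ler_norml => /andP[_ h] _; lra.
move=> w /sub /hF; rewrite ler_norml => /andP[]; set y := enorm (rsubmx w) ^+ 2.
have p2 := pi_ge2 R; have y0 : 0 <= y by exact: sqr_ge0.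
have py := ler_wpM2r y0 p2; have r0 : 0 <= rho ^+ 2 by exact: sqr_ge0.
have pr := ler_wpM2r r0 p2.
have -> : (pi + 1) * (y + rho ^+ 2) = pi * y + pi * rho ^+ 2 + y + rho ^+ 2 by ring.
move: y (rho ^+ 2) (pi * y) (pi * rho ^+ 2) y0 er r0 pr py; clear => y r z u y0 er r0 pr py h1 h2.
by split; lra.
Qed.

Lemma root6_lt (R : realType) (sigma b : R) : 0 < sigma -> 0 < b -> sigma < b ^+ 6 -> root6 sigma < b.
Proof.
move=> s0 b0; by rewrite -{1}(root6X s0) ltr_pXn2r ?nnegrE ?(ltW b0) ?(ltW (root6_gt0 s0)).
Qed.

Lemma sqrt_root6 (R : realType) (sigma c : R) : 0 < sigma -> 0 <= c ->
  sigma * Num.sqrt (c * root6 sigma ^+ 3) = Num.sqrt c * sigma `^ (5 / 4).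
Proof.
move=> s0 c0; rewrite sqrtrM // mulrCA; congr (_ * _).
rewrite -powR12_sqrt ?exprn_ge0 ?(ltW (root6_gt0 s0)) // /root6 -powR_mulrn ?powR_ge0 // -!powRrM.
have -> : 1 / 6 * (3 / 2) = 1 / 4 :> R by field.
have -> : 5 / 4 = 1 + 1 / 4 :> R by field.
by rewrite powRD ?powRr1 ?(ltW s0) // (gt_eqF s0) implybT.
Qed.

(** The factor [sqrt (2 * pi)] enters twice, in the tube radius and in [scale sigma]; hence the
    radius [Num.min c3 c4 / (2 * pi)] in rescaled coordinates. *)
Lemma M_put_eq (R : realType) d m (c3 c4 sigma tau : R) (M0 : set 'rV[R]_(d + m)) N (X : 'I_N -> 'rV[R]_(d + m)) z : 0 < sigma ->
  good_mfd (tau / scale sigma) (rescale_set sigma M0) ->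
  M_put c3 c4 sigma M0 X z <-> put (scale sigma) (Num.min c3 c4 / (2 * pi)) (rescale_set sigma M0)
    (fun x => - ln (kde (fun i => (scale sigma)^-1 *: X i) x))
    (fun q => ln (normalization d (rescale_set sigma M0) (sigma `^ (5 / 6) / scale sigma) q)) z.
Proof.
move=> s0 gM; have sc := scale_gt0 s0; set s := scale sigma in sc *.
suff key q : nearest (rescale_set sigma M0) (s^-1 *: z) q ->
    tube M0 (Num.min c3 c4 * sigma / Num.sqrt (2 * pi)) z <-> mdist (rescale_set sigma M0) (s^-1 *: z) <= Num.min c3 c4 / (2 * pi).
  by split=> -[h1 [q [hq h2]]]; split; try (by exists q); apply/(key q hq).
move=> hq; rewrite (mdist_nearest hq) /tube /=.
have hq' : nearest M0 z (s *: q).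
  split=> [|a Ma]; first exact/(rescale_setP _ _ s0)/(proj1 hq).
  have sz u : z - s *: u = s *: (s^-1 *: z - u) by rewrite scalerBr scalerA mulfV ?gt_eqF // scale1r.
  have -> : a = s *: (s^-1 *: a) by rewrite scalerA mulfV ?gt_eqF // scale1r.
  by rewrite !sz !enormZ ler_wpM2l //; apply: (proj2 hq); exists a.
rewrite (edist_nearest hq') lee_fin.
have -> : z - s *: q = s *: (s^-1 *: z - q) by rewrite scalerBr scalerA mulfV ?gt_eqF // scale1r.
rewrite enormZ gtr0_norm //.
have p0 : 0 < 2 * pi :> R by rewrite mulr_gt0 ?pi_gt0.
have -> : Num.min c3 c4 * sigma / Num.sqrt (2 * pi) = s * (Num.min c3 c4 / (2 * pi)).
  rewrite -[X in _ = s * (_ / X)](sqr_sqrtr (ltW p0)) /s /scale; field.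
  by rewrite gt_eqF // sqrtr_gt0.
by rewrite ler_pM2l.
Qed.

Lemma hausdorff_le (R : realType) n (A B : set 'rV[R]_n) (e : R) :
  (forall a, A a -> exists2 b, B b & enorm (a - b) <= e) -> (forall b, B b -> exists2 a, A a & enorm (b - a) <= e) ->
  (hausdorff_dist A B <= e%:E)%E.
Proof.
move=> h1 h2; rewrite /hausdorff_dist ge_max; apply/andP; split; apply: ge_ereal_sup => _ [x hx <-].
  by have [b Bb hb] := h1 x hx; apply: (le_trans (edist_le _ Bb)); rewrite lee_fin.
by have [a Aa ha] := h2 x hx; apply: (le_trans (edist_le _ Aa)); rewrite lee_fin.
Qed.

Lemma small_eps (R : realType) (C r t : R) : 0 <= C -> 0 < r -> 0 <= t -> t <= r / (2 * (C + 1)) -> t <= 1 / (100 * (C + 1) ^+ 2) ->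
  [/\ C * t <= r / 2, t <= 1, C * (C * t) <= 1 / 100 & 2 * (C * t) <= 1 / 50].
Proof.
move=> C0 r0 t0; have C1 : 0 < C + 1 by rewrite ltr_wpDl.
rewrite !ler_pdivlMr ?mulr_gt0 ?exprn_gt0 // => h1 h2.
have h3 : 0 <= C * t by exact: mulr_ge0. have h4 : 0 <= C * (C * t) by exact: mulr_ge0.
have e2 : t * (100 * (C + 1) ^+ 2) = 100 * (C * (C * t)) + 200 * (C * t) + 100 * t by ring.
rewrite e2 in h2; split; lra.
Qed.

Lemma small_rho (R : realType) (C D r : R) : 0 <= C -> 0 <= D -> r = 1 / (20 * (C + 1) + 4 * D) ->
  [/\ 0 < r, r <= 1 / 20, C * r <= 1 / 20 & 2 * (r * D) < 1].
Proof.
move=> C0 D0 ->; have q0 : 0 < 20 * (C + 1) + 4 * D by lra.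
split; first by rewrite divr_gt0.
- by rewrite ler_pdivrMr //; lra.
- by rewrite mulrA mulr1 ler_pdivrMr //; lra.
by rewrite mul1r [_^-1 * D]mulrC mulrA ltr_pdivrMr //; lra.
Qed.
Theorem theorem16 (R : realType) (d m k : nat) (hk : (2 <= k)%N) :
  exists C0 c1 C1 creach : R,
    [/\ 0 < C0, 0 < c1, 0 < C1 & 0 < creach] /\
    forall c c3 c4 Vmax tau_min : R, 0 < tau_min ->
    exists CH : R, forall rho : R, 0 < rho < c ->
    exists sigma0 : R, 0 < sigma0 /\
    forall sigma : R, 0 < sigma < sigma0 ->
    forall delta : R, 0 < delta ->
    exists N0 : nat, forall N : nat, (N0 <= N)%N ->
    forall M0 : set 'rV[R]_(d + m), manifold_class Vmax tau_min M0 ->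
    forall (disp : measure_display) (T : measurableType disp)
      (P : probability T R) (X : 'I_N -> T -> 'rV[R]_(d + m)),
      iid_uniform d M0 P X ->
    exists E : set T,
      [/\ measurable E, ((1 - delta)%:E <= P E)%E &
        forall w, E w ->
          kde_is_asdf k C0 c1 C1 rho sigma M0 (fun i => X i w) /\
          (graph_constants d m k C0 c1 C1 c c3 c4 ->
           [/\ submanifold (k - 2) (M_put c3 c4 sigma M0 (fun i => X i w)),
               ((creach * sigma)%:E <=
                 reach (M_put c3 c4 sigma M0 (fun i => X i w)))%E &
               (hausdorff_dist M0 (M_put c3 c4 sigma M0 (fun i => X i w))
                 <= (CH * sigma `^ (5 / 4))%:E)%E])].
Proof.
(* Order [k] serves conditions (i)-(iii), order 4 the spectral estimates. *)
have [K [C2 [K0 C20 hloc]]] := @kde_local_model R d m (maxn k 4).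
have [C [e0 [C0 e00 hsm]]] := @smooth_model_of_local R d m K K0.
(* The constant of [midpoint_residual]. *)
pose D := (C + 8) * (400 * C ^+ 2 + 4 * C) + C + 8 * C * (C + 9).
have D0 : 0 <= D.
  by repeat first [exact: C0|exact: ler0n|exact: exprn_ge0|apply: addr_ge0|apply: mulr_ge0].
(* Two demands on [creach]: smallness of [C * creach] for [put_midpoint] and [2 * (creach * D) < 1]
   for [midpoint_reach]. *)
have [rho0_gt0 rho0_le Crho0 Drho0] := small_rho C0 D0 erefl.
move: (1 / (20 * (C + 1) + 4 * D)) rho0_gt0 rho0_le Crho0 Drho0 => creach cr0 cr20 Ccr Dcr.
exists (K + 1), (1 / 2), (pi + 1), creach; split.
  by split=> //; [rewrite ltr_wpDl|rewrite ltr_wpDl // pi_ge0].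
move=> c c3 c4 Vmax tau tau0; exists (3 * C * Num.sqrt (C2 + 1)) => rho /andP[rho0 rhoc].
(* At this point [c3] and [c4] may still be nonpositive; the value 1 is a placeholder until
   [graph_constants] is assumed. *)
pose r0 : R := if 0 < Num.min c3 c4 then Num.min c3 c4 / (2 * pi) else 1.
have p0 : 0 < 2 * pi :> R by rewrite mulr_gt0 ?pi_gt0.
have r00 : 0 < r0 by rewrite /r0; case: ifP => // h; rewrite divr_gt0.
have C1 : 0 < C + 1 by rewrite ltr_wpDl.
pose tt := Num.min (r0 / (2 * (C + 1))) (1 / (100 * (C + 1) ^+ 2)).
have tt0 : 0 < tt by rewrite lt_min !divr_gt0 // mulr_gt0 // exprn_gt0.
(* Three demands on the C^0 error: [e0] for the smooth model, [rho ^+ 2 / 2] for condition (iii),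
   and [tt ^+ 2] to get [Num.sqrt eps <= tt] in the study of the output set. *)
pose emin := Num.min e0 (Num.min (rho ^+ 2 / 2) (tt ^+ 2)).
have emin0 : 0 < emin by rewrite !lt_min e00 ?divr_gt0 ?exprn_gt0.
have C21 : 0 < C2 + 1 by rewrite ltr_wpDl.
have DD0 : 0 <= (d + m)%:R + 2 :> R by rewrite addr_ge0.
have [b0 b00 hkde] := @kde_estimate R d m _ Vmax tau DD0 tau0.
have [b1 b10 hmodel] := hloc tau tau0.
(* The last two entries give [eps <= emin] and the bound [flat] on the curvature of the rescaled
   manifold. *)
pose bm := Num.min 1 (Num.min b0 (Num.min b1 (Num.min (emin / (C2 + 1)) (tau * r0 / 18)))).
have bm0 : 0 < bm by rewrite !lt_min ltr01 b00 b10 !divr_gt0 ?mulr_gt0.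
exists (bm ^+ 6); split; first exact: exprn_gt0.
move=> sigma /andP[s0 ss]; have := root6_lt s0 bm0 ss; rewrite !lt_min.
set b := root6 sigma => /and5P[lb1 lb0 lbm lbe lbt] delta delta0.
have bb0 : 0 < b by exact: root6_gt0.
have [N0 hN0] := hkde sigma s0 lb0 delta delta0; exists N0 => N hN M0 hM0 disp T P X hX.
have [Npos {}hN0] := hN0 N hN; have [E [mE PE hE]] := hN0 M0 hM0 disp T P X hX.
exists E; split=> // w /hE[MX hest].
set M := rescale_set sigma M0 in hest; set s := scale sigma in hest *.
have sc := scale_gt0 s0; rewrite -/s in sc; have [_ s6] := scale_root6 s0; rewrite -/s -/b in s6.
have gM : good_mfd (tau / s) M by apply: good_rescale => //; exact: good_mfd_of_class hM0.
have b3 : b ^+ 3 <= b by rewrite -[leRHS]expr1 ler_wiXn2l // ltW.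
have b6 : b ^+ 6 <= b by rewrite -[leRHS]expr1 ler_wiXn2l // ltW.
pose eps := (C2 + 1) * b ^+ 3; have eps0 : 0 < eps by rewrite mulr_gt0 ?exprn_gt0.
have epsm : eps <= emin.
  rewrite (le_trans (ler_wpM2l (ltW C21) b3)) // mulrC; move: lbe; rewrite ltr_pdivlMr //; exact: ltW.
move: epsm; rewrite !le_min => /and3P[ee0 erho ett].
pose t := sigma `^ (5 / 6) / s.
pose f x := - ln (kde (fun i => s^-1 *: X i w) x); pose cst q := ln (normalization d M t q).
have model q Q z : M q -> tangent_frame M q Q -> M z -> local_model (maxn k 4) K eps (fun w => f (q + w *m Q) + cst z).
  move=> Mq fQ Mz; have [h1 h2] := hmodel sigma s0 lbm M N (fun i => s^-1 *: X i w) t gM hest q Q z Mq fQ Mz.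
  split=> // v v2; apply: (le_trans (h2 v v2)); rewrite /eps -/b ler_wpM2r ?exprn_ge0 ?(ltW bb0) //.
  by rewrite lerDl.
have hasdf q Q z : M q -> tangent_frame M q Q -> M z ->
    asdf k (K + 1) (1 / 2) (pi + 1) rho (fun v => kde_asdf d sigma M0 (fun i => X i w) z (q + v *m Q)).
  by move=> Mq fQ Mz; apply: (@local_model_asdf R d m k (maxn k 4) K eps) => //; [exact: leq_maxl|exact: model].
split=> [q Q x z Mq fQ _ [Mz _]|[_ c30 c40 hlr hpsi]]; first exact: hasdf.
have mc : 0 < Num.min c3 c4 by rewrite lt_min c30.
have r0E : r0 = Num.min c3 c4 / (2 * pi) by rewrite /r0 mc.
have r0m : r0 < Num.min c3 c4.
  by rewrite r0E ltr_pdivrMr // ltr_pMr // two_pi_gt1.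
have [r03 r04] : r0 < c3 /\ r0 < c4 by move: r0m; rewrite lt_min => /andP[].
have st : Num.sqrt eps <= tt by rewrite -(ger0_norm (ltW tt0)) -sqrtr_sqr ler_sqrt // exprn_ge0 // ltW.
move: st; rewrite le_min => /andP[st1 st2].
have [eta sq1 CCs Cs] := small_eps C0 r00 (sqrtr_ge0 eps) st1 st2.
have flat : 3 / (tau / s) <= r0 / 2.
  rewrite invf_div mulrA ler_pdivrMr //; move: lbt; rewrite ltr_pdivlMr // => lbt.
  apply: (@le_trans _ _ (9 * b)); last by move: lbt; clear; lra.
  by have := le_trans s6 (ler_wpM2l (ler0n _ 3) b6); clear; lra.
have hlr1 (x : 'rV[R]_d) (y : 'rV[R]_m) : eball c4 x -> eball c3 y -> eball 1 (row_mx x y).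
  by move=> hx hy; apply: lt_trans (hlr _ _ hx hy) (local_radius_lt1 R).
have hB q Q : M q -> tangent_frame M q Q -> exists K, Bk 4 (eball 2) K (fun w => f (q + w *m Q) + cst q).
  by move=> Mq fQ; exists K; have [h _] := model q Q q Mq fQ Mq; apply: Bk_leq h; exact: leq_maxr.
have hS q Q : M q -> tangent_frame M q Q ->
    smooth_model C (Num.sqrt eps) (grad (fun w => f (q + w *m Q) + cst q)) (hess (fun w => f (q + w *m Q) + cst q)).
  move=> Mq fQ; apply: hsm => //; have [h1 h2] := model q Q q Mq fQ Mq; split=> //.
  by apply: Bk_leq h1; exact: leq_maxr.
have hg q Q : M q -> tangent_frame M q Q -> exists psi : 'rV[R]_d -> 'rV[R]_m,
  [/\ Ck (k - 2) (eball c4) psi, (forall x, eball c4 x -> eball c3 (psi x)) &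
   forall x y, eball c4 x -> eball c3 y -> (hi_critical m (fun w => f (q + w *m Q) + cst q) (row_mx x y) <-> y = psi x)].
  by move=> Mq fQ; apply: (hpsi rho) (hasdf q Q q Mq fQ Mq); rewrite rho0.
pose pt := put s r0 M f cst.
have putE : M_put c3 c4 sigma M0 (fun i => X i w) = pt.
  by apply/seteqP; split=> z; rewrite (M_put_eq c3 c4 (fun i => X i w) z s0 gM) /pt r0E.
rewrite putE {putE}.
have sq0 := sqrtr_ge0 eps.
have cP : closed pt by apply: (put_closed sc C0 sq0 r00 r03 r04 gM eta flat hlr1 hB hS hg).
have near_pt z : pt z -> exists2 q, nearest M (s^-1 *: z) q & enorm (s^-1 *: z - q) <= C * Num.sqrt eps.
  move=> pz; have [_ [q [hq _]]] := pz; have [Mq _] := hq.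
  have [Q fQ] : exists Q, tangent_frame M q Q by case: gM => _ _ h _; exact: h.
  have [y _ [h1 h2]] := put_normal sc C0 sq0 r00 r03 r04 gM hlr1 hB hS pz hq fQ.
  by exists q => //; rewrite -(mdist_nearest hq) -h2.
have ss' : sigma <= s := le_scale s0.
have sCs : s * (C * Num.sqrt eps) <= 3 * C * Num.sqrt (C2 + 1) * sigma `^ (5 / 4).
  have s3 : s <= 3 * sigma by rewrite -[X in 3 * X](root6X s0).
  rewrite -mulrA -sqrt_root6 ?(ltW C21) // -/b -/eps.
  have -> : 3 * C * (sigma * Num.sqrt eps) = (3 * sigma) * (C * Num.sqrt eps) by ring.
  by rewrite ler_wpM2r // mulr_ge0.
split.
- move=> z pz; have [_ [q [[Mq _] _]]] := pz; have [mz _] := pz.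
  exact: (put_chart sc C0 sq0 r00 r03 r04 gM eta flat hlr1 hB hS hg (ex_intro _ q Mq) mz).
(* With [h] half the rescaled difference, [D * |h| ^ 2] is [D / 4] times [|z1 - z2| ^ 2 / s ^ 2];
   undoing one rescaling on the left leaves [D / (4 * s)]. *)
- apply: (@midpoint_reach R _ pt (creach * sigma) (D / (4 * s)) cP).
  + by rewrite mulr_ge0 // ltW.
  + by rewrite divr_ge0 // mulr_ge0 // ltW.
  + have -> : 8 * (creach * sigma * (D / (4 * s))) = 2 * (creach * D) * (sigma / s) by field; rewrite gt_eqF.
    have sr : sigma / s <= 1 by rewrite ler_pdivrMr // mul1r.
    have cD : 0 <= 2 * (creach * D) by exact: mulr_ge0 (ler0n _ 2) (mulr_ge0 (ltW cr0) D0).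
    by apply: le_lt_trans Dcr; exact: ler_piMr.
  move=> z1 z2 p1 p2 z12.
  have x12 : enorm (s^-1 *: z1 - s^-1 *: z2) <= 2 * creach.
    rewrite -scalerBr enormZ gtr0_norm ?invr_gt0 // ler_pdivrMl // (le_trans z12) //.
    by rewrite mulrA mulrC ler_wpM2r // mulr_ge0 // ltW.
  have a1 : creach + 2 * (C * Num.sqrt eps) <= 1 / 3 by clear -cr20 Cs; lra.
  have a2 : C * (creach + 2 * (C * Num.sqrt eps)) <= 1 / 10 by clear -Ccr CCs; lra.
  have [z pz hz] := put_midpoint sc C0 sq0 r00 r03 r04 gM eta hlr1 hB hS hg (ltW cr0) a1 a2 CCs sq1 p1 p2 x12.
  exists z => //; rewrite -/D in hz; move: hz.
  have -> : s^-1 *: z - 2^-1 *: (s^-1 *: z1 + s^-1 *: z2) = s^-1 *: (z - 2^-1 *: (z1 + z2)).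
    by rewrite -scalerDr scalerBr !scalerA [2^-1 * _]mulrC.
  rewrite -scalerBr scalerA !enormZ !gtr0_norm ?mulr_gt0 ?invr_gt0 // ler_pdivrMl // => hz.
  apply: (le_trans hz); rewrite le_eqVlt; apply/orP; left; apply/eqP; field.
  by rewrite gt_eqF.
apply: hausdorff_le => [a Ma|z pz].
  have Mq : M (s^-1 *: a) by exists a.
  have [Q fQ] : exists Q, tangent_frame M (s^-1 *: a) Q by case: gM => _ _ h _; exact: h.
  have [QQ _] := fQ.
  have [y [py _ hy _]] := put_over sc C0 sq0 r00 r04 gM eta hlr1 hB hS hg Mq fQ.
  exists (s *: (s^-1 *: a + row_mx 0 y *m Q)) => //.
  have -> : a - s *: (s^-1 *: a + row_mx 0 y *m Q) = - (s *: (row_mx 0 y *m Q)).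
    by rewrite scalerDr scalerA mulfV ?gt_eqF // scale1r opprD addrA subrr add0r.
  rewrite enormN enormZ gtr0_norm // (enorm_orthmx QQ) enorm_row_0mx (le_trans _ sCs) //.
  by rewrite ler_wpM2l // ltW.
have [q [Mq _] hq] := near_pt z pz.
exists (s *: q); first exact/(rescale_setP _ _ s0).
have -> : z - s *: q = s *: (s^-1 *: z - q) by rewrite scalerBr scalerA mulfV ?gt_eqF // scale1r.
by rewrite enormZ gtr0_norm // (le_trans _ sCs) // ler_wpM2l // ltW.
Qed.
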